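(* Let $G$ be a second-countable locally compact Hausdorff groupoid with a left Haar system, let $\Gamma$ be a discrete group, and let $c\colon G\to\Gamma$ be a continuous homomorphism. Let $L\colon C^*(G)\to\mathcal L(X)$ and $\widetilde L\colon C^*_{\mathrm r}(G)\to\mathcal L(Y)$ be the homomorphisms extending left multiplication by $C_c(G)$, and let $\mathcal A=\{A_\gamma:\gamma\in\Gamma\}$ and $\mathcal B=\{B_\gamma:\gamma\in\Gamma\}$ be the associated Fell bundles over $\Gamma$ (all as defined in the context). Then $C^*_{\mathrm r}(\mathcal A)$ is isomorphic to the range of $\widetilde L$, $C^*_{\mathrm r}(\mathcal B)$ is isomorphic to the range of $L$, and $C^*(\mathcal B)$ is isomorphic to $C^*(G)$.
   Context: Write $\lambda=\{\lambda^u:u\in G^{(0)}\}$ for the Haar system of $G$, $e$ for the identity of $\Gamma$, and $G_\gamma:=c^{-1}(\{\gamma\})$ (open and closed). The subgroupoid $G_e$ carries the Haar system $\{\lambda^u|_{G_e}\}$. $C_c(G)$ is a $*$-algebra under $(a*b)(x)=\int_G a(y)\,b(y^{-1}x)\,d\lambda^{r(x)}(y)$ and $a^*(x)=\overline{a(x^{-1})}$. Let $\lambda_u$ be the push-forward of $\lambda^u$ under inversion, and $\|a\|_I=\max\{\sup_u\int|a|\,d\lambda^u,\ \sup_u\int|a|\,d\lambda_u\}$. $C^*(G)$ is the completion of $C_c(G)$ in the norm given by the supremum of $\|\pi(a)\|$ over $I$-norm-decreasing $*$-representations $\pi$ on Hilbert spaces; $C^*_{\mathrm r}(G)$ is the completion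 in the norm $\|a\|_{\mathrm r}=\sup_{u}\|\pi_u(a)\|$, where $\pi_u$ is the regular representation on $L^2(Gu,\lambda_u)$, $Gu=\{x: s(x)=u\}$, $\pi_u(a)h=a*h$. The same definitions apply to $G_e$. The modules $X$ and $Y$: for $a\in C_c(G)$ let $a_\gamma:=a|_{G_\gamma}$ (nonzero for only finitely many $\gamma$), identified with its extension by zero to $G$. $C_c(G)$ is an inner-product right $C_c(G_e)$-module with $a\cdot g=a*i(g)$, where $i(g)$ is the extension of $g\in C_c(G_e)$ by zero, and $\langle a,b\rangle=\sum_{\gamma\in\Gamma}(a_\gamma^* * b_\gamma)|_{G_e}\in C_c(G_e)$. $X$ (respectively $Y$) is the right Hilbert $C^*(G_e)$-module (respectively $C^*_{\mathrm r}(G_e)$-module) obtained by completing $C_c(G)$ in the norm $\|\langle a,a\rangle\|^{1/2}$ computed in $C^*(G_e)$ (respectively $C^*_{\mathrm r}(G_e)$). $\mathcal L(\cdot)$ denotes the $C^*$-algebra of adjointable operators. $L\colon C^*(G)\to\mathcal L(X)$ and $\widetilde L\colon C^*_{\mathrm r}(G)\to\mathcal L(Y)$ are the (existing, unique) $*$-homomorphisms with $L_a(b)=a*b$ and $\widetilde L_a(b)=a*b$ for $a,b\in C_c(G)$. The bundles: $A_\gamma$ (respectively $B_\gamma$) is the closure of $\{f\in C_c(G):\operatorname{supp}f\subset G_\gamma\}$ in $C^*_{\mathrm r}(G)$ (respectively $C^*(G)$). With the norm, multiplication and involution inherited from the ambient $C^*$-algebra, $\mathcal A$ and $\mathcal B$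 are Fell bundles over the discrete group $\Gamma$. For a Fell bundle $\mathcal C=\{C_\gamma\}_{\gamma\in\Gamma}$: a representation of $\mathcal C$ in a $C^*$-algebra $D$ is a family of linear maps $\pi_\gamma\colon C_\gamma\to D$ with $\pi_\beta(b)\pi_\gamma(c)=\pi_{\beta\gamma}(bc)$ and $\pi_\gamma(c)^*=\pi_{\gamma^{-1}}(c^* )$; $C^*(\mathcal C)$ is the $C^*$-algebra generated by a universal representation. $\ell^2(\mathcal C)$ is the right Hilbert $C_e$-module completion of the algebraic direct sum $\bigoplus_\gamma C_\gamma$ under $\langle x,y\rangle=\sum_\gamma x_\gamma^*y_\gamma$, and the reduced $C^*$-algebra $C^*_{\mathrm r}(\mathcal C)$ is the range of the regular representation $\Lambda\colon C^*(\mathcal C)\to\mathcal L(\ell^2(\mathcal C))$ induced by left multiplication (an element $b\in C_\beta$ sends $c\in C_\gamma$ to $bc\in C_{\beta\gamma}$). *)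

(* Defs.v *)
(* The complex numbers are [R[i]] for an abstract [R : realType]; [R[i]^o] is the
   same type with its topology and normed-module structure. *)
From HB Require Import structures.
From mathcomp Require Import all_boot all_order all_algebra.
From mathcomp Require Import all_classical all_reals all_analysis.
From mathcomp Require Import complex.

Set Implicit Arguments.
Unset Strict Implicit.
Unset Printing Implicit Defensive.

Import numFieldNormedType.Exports.
Import Order.TTheory GRing.Theory Num.Theory.

Local Open Scope classical_set_scope.
Local Open Scope complex_scope.
Local Open Scope ring_scope.

(* In a normed module over [R[i]] the library norm takes values in [R[i]];
   [nrm] is the same norm with values in [R]. *)
Definition nrm (R : realType) (V : normedModType R[i]) (x : V) : R :=
  complex.Re `|x|.

Definition linear_on (K : pzRingType) (V W : lmodType K) (D : set V)
    (f : V -> W) : Prop :=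
  forall k x y, D x -> D y -> f (k *: x + y) = k *: f x + f y.

(* Not assumed unital. *)

HB.mixin Record Lmodule_isStarAlgebra (R : realType) A & GRing.Lmodule R[i] A := {
  smul : A -> A -> A;
  sstar : A -> A;
  smulA : forall a b d, smul a (smul b d) = smul (smul a b) d;
  smul_linear_r : forall a, linear (smul a);
  smul_linear_l : forall b, linear (fun a => smul a b);
  sstarK : forall a, sstar (sstar a) = a;
  sstarM : forall a b, sstar (smul a b) = smul (sstar b) (sstar a);
  sstar_conj_linear : forall (k : R[i]) a b,
    sstar (k *: a + b) = conjc k *: sstar a + sstar b
}.

#[short(type="starAlgType")]
HB.structure Definition StarAlgebra (R : realType) :=
  {A of Lmodule_isStarAlgebra R A & GRing.Lmodule R[i] A}.

HB.mixin Record StarAlgebra_isCstar (R : realType) A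
    & StarAlgebra R A & CompleteNormedModule R[i] A := {
  normrM_le : forall a b : A, `|smul a b| <= `|a| * `|b|;
  cstar_identity : forall a : A, `|smul (sstar a) a| = `|a| ^+ 2
}.

#[short(type="cstarAlgType")]
HB.structure Definition CstarAlgebra (R : realType) :=
  {A of StarAlgebra_isCstar R A & StarAlgebra R A & CompleteNormedModule R[i] A}.

Definition star_hom (R : realType) (A B : starAlgType R) (f : A -> B) : Prop :=
  [/\ linear f,
      forall a b, f (smul a b) = smul (f a) (f b) &
      forall a, f (sstar a) = sstar (f a)].

Definition star_subalgebra (R : realType) (A : starAlgType R) (S : set A) : Prop :=
  [/\ S 0,
      forall (k : R[i]) a b, S a -> S b -> S (k *: a + b),
      forall a b, S a -> S b -> S (smul a b) &
      forall a, S a -> S (sstar a)].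

(* *-isomorphism between *-subalgebras [S] and [T].  Between C*-algebras such a
   map is automatically isometric. *)
Definition star_isomorphic (R : realType) (A B : starAlgType R)
    (S : set A) (T : set B) : Prop :=
  exists phi : A -> B,
    [/\ set_bij S T phi,
        linear_on S phi,
        forall a b, S a -> S b -> phi (smul a b) = smul (phi a) (phi b) &
        forall a, S a -> phi (sstar a) = sstar (phi a)].

(* A C*-algebra obtained by completing the *-algebra [D] (a subset of [V] closed
   under the operations [mulV] and [starV]) in the C*-norm [N]. *)
Record cstarCompletion (R : realType) (V : lmodType R[i]) (D : set V)
    (mulV : V -> V -> V) (starV : V -> V) (N : V -> R) := CstarCompletion {
  cc_alg :> cstarAlgType R;
  cc_inc : V -> cc_alg;
  cc_linear : linear_on D cc_inc;
  cc_mul : forall a b, D a -> D b -> cc_inc (mulV a b) = smul (cc_inc a) (cc_inc b);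
  cc_star : forall a, D a -> cc_inc (starV a) = sstar (cc_inc a);
  cc_norm : forall a, D a -> nrm (cc_inc a) = N a;
  cc_dense : closure (cc_inc @` D) = setT
}.
Arguments cc_inc {R V D mulV starV N} _ _.

Lemma sstar0 (R : realType) (A : starAlgType R) : sstar (0 : A) = 0.
Proof.
have := sstar_conj_linear (-1) (0 : A) 0.
by rewrite scaler0 addr0 rmorphN1 scaleN1r addNr.
Qed.

(* Inner products are linear in the second variable. *)

Record hilbertSpace (R : realType) := HilbertSpace {
  hs_car :> completeNormedModType R[i];
  hs_ip : hs_car -> hs_car -> R[i]^o;
  hs_ip_linear : forall x, linear (hs_ip x);
  hs_ip_conj : forall x y, conjc (hs_ip x y) = hs_ip y x;
  hs_ip_norm : forall x, `|x| ^+ 2 = hs_ip x x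
}.

Definition opnorm (R : realType) (V : normedModType R[i]) (T : V -> V) : R :=
  sup [set nrm (T x) | x in [set x | nrm x <= 1]].

(* Right Hilbert modules over a C*-subalgebra [B] of [M]; [hact x b] is only
   meaningful for [b] in [B]. *)
Record hilbertModule (R : realType) (M : cstarAlgType R) (B : set M) :=
    HilbertModule {
  hm_car :> completeNormedModType R[i];
  hact : hm_car -> M -> hm_car;
  hip : hm_car -> hm_car -> M;
  hact_linear_l : forall b, B b -> linear (fun x => hact x b);
  hact_linear_r : forall x, linear_on B (hact x);
  hactA : forall x a b, B a -> B b -> hact (hact x a) b = hact x (smul a b);
  hip_in : forall x y, B (hip x y);
  hip_linear : forall x, linear (hip x);
  hip_star : forall x y, sstar (hip x y) = hip y x;
  hip_act : forall x y b, B b -> hip x (hact y b) = smul (hip x y) b;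
  hip_pos : forall x, exists2 b, B b & hip x x = smul (sstar b) b;
  hip_norm : forall x, `|x| ^+ 2 = `|hip x x|
}.

(* [E] is the completion of the inner-product module [DV] over the *-algebra
   [DW], where [iota] sends [DW] into the coefficient algebra. *)
Record moduleCompletion (R : realType) (M : cstarAlgType R) (B : set M)
    (V W : lmodType R[i]) (DV : set V) (DW : set W) (iota : W -> M)
    (ip : V -> V -> W) (act : V -> W -> V) := ModuleCompletion {
  mc_mod :> hilbertModule B;
  mc_inc : V -> mc_mod;
  mc_linear : linear_on DV mc_inc;
  mc_ip : forall x y, DV x -> DV y ->
    hip (mc_inc x) (mc_inc y) = iota (ip x y);
  mc_act : forall x w, DV x -> DW w ->
    mc_inc (act x w) = hact (mc_inc x) (iota w);
  mc_dense : closure (mc_inc @` DV) = setT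
}.
Arguments mc_inc {R M B V W DV DW iota ip act} _ _.

Section Adjointable.
Context (R : realType) (M : cstarAlgType R) (B : set M) (E : hilbertModule B).
Implicit Types S T U : E -> E.

Definition is_adjoint T S : Prop := forall x y, hip (T x) y = hip x (S y).

Definition adjointable : {pred (E -> E)} :=
  fun T => `[< exists S, is_adjoint T S >].

Lemma hip0r (x : E) : hip x 0 = 0.
Proof.
have := hip_linear x 1 0 0; rewrite !scale1r addr0 => /eqP.
by rewrite -subr_eq0 opprD addNKr oppr_eq0 => /eqP.
Qed.

Lemma hipDr (x y z : E) : hip x (y + z) = hip x y + hip x z.
Proof. by have := hip_linear x 1 y z; rewrite !scale1r. Qed.

Lemma hipZr (x y : E) k : hip x (k *: y) = k *: hip x y.
Proof. by have := hip_linear x k y 0; rewrite hip0r !addr0. Qed.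

Lemma hipBr (x y z : E) : hip x (y - z) = hip x y - hip x z.
Proof. by rewrite hipDr -scaleN1r hipZr scaleN1r. Qed.

Lemma hip_comb_l (x y z : E) k :
  hip (k *: y + z) x = conjc k *: hip y x + hip z x.
Proof.
by rewrite -hip_star hipDr hipZr sstar_conj_linear !hip_star.
Qed.

Lemma hip_eq (y z : E) : (forall x, hip x y = hip x z) -> y = z.
Proof.
move=> h; apply/eqP; rewrite -subr_eq0 -normr_eq0.
have := hip_norm (y - z); rewrite hipBr h subrr normr0 => /eqP.
by rewrite expf_eq0.
Qed.

Lemma is_adjoint_sym T S : is_adjoint T S -> is_adjoint S T.
Proof. by move=> h x y; rewrite -hip_star -h hip_star. Qed.

Lemma is_adjoint_inj T S S' : is_adjoint T S -> is_adjoint T S' -> S = S'.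
Proof. by move=> h h'; apply/funext => y; apply: hip_eq => x; rewrite -h -h'. Qed.

Lemma is_adjoint_comb T S T' S' k : is_adjoint T S -> is_adjoint T' S' ->
  is_adjoint (k *: T + T') (conjc k *: S + S').
Proof.
move=> h h' x y.
rewrite -[LHS]/(hip (k *: T x + T' x) y) -[RHS]/(hip x (conjc k *: S y + S' y)).
by rewrite hip_comb_l hipDr hipZr h h'.
Qed.

Lemma is_adjoint_comp T S T' S' : is_adjoint T S -> is_adjoint T' S' ->
  is_adjoint (T \o T') (S' \o S).
Proof. by move=> h h' x y /=; rewrite h h'. Qed.

Lemma is_adjoint_linear T S : is_adjoint T S -> linear T.
Proof.
move=> /is_adjoint_sym h k x y; apply: hip_eq => z.
by rewrite -h !hipDr !hipZr !h.
Qed.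

Lemma adjointable_submod : submod_closed adjointable.
Proof.
split.
  apply/asboolP; exists 0 => x y.
  by rewrite -[LHS]hip_star -[RHS]/(hip x 0) -[X in hip _ X]/(0 : E) !hip0r sstar0.
move=> k T T' /asboolP[S h] /asboolP[S' h']; apply/asboolP.
by exists (conjc k *: S + S'); exact: is_adjoint_comb.
Qed.

HB.instance Definition _ :=
  GRing.isSubmodClosed.Build R[i] (E -> E) adjointable adjointable_submod.

Record adjop := Adjop { aop :> E -> E; aop_adjointable : aop \in adjointable }.

HB.instance Definition _ := [isSub for aop].
HB.instance Definition _ := [Choice of adjop by <:].
HB.instance Definition _ := [SubChoice_isSubLmodule of adjop by <:].

Lemma aop_inj : injective aop. Proof. exact: val_inj. Qed.

Lemma adjointableP (T : adjop) : exists S, is_adjoint (aop T) S.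
Proof. exact/asboolP/aop_adjointable. Qed.

Lemma adjop_mul_subproof (T S : adjop) : (aop T \o aop S) \in adjointable.
Proof.
have [T' hT] := adjointableP T; have [S' hS] := adjointableP S.
by apply/asboolP; exists (S' \o T'); exact: is_adjoint_comp.
Qed.

Definition adjop_mul (T S : adjop) : adjop := Adjop (adjop_mul_subproof T S).

Lemma adjop_star_subproof (T : adjop) :
  projT1 (cid (adjointableP T)) \in adjointable.
Proof.
by case: cid => S h /=; apply/asboolP; exists (aop T); exact: is_adjoint_sym.
Qed.

Definition adjop_star (T : adjop) : adjop := Adjop (adjop_star_subproof T).

Lemma adjop_starP (T : adjop) : is_adjoint (aop T) (aop (adjop_star T)).
Proof. by rewrite /=; case: cid. Qed.

Lemma adjop_linear (T : adjop) : linear (aop T).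
Proof. by have [S] := adjointableP T; exact: is_adjoint_linear. Qed.

Lemma adjop_mulA (T S U : adjop) : adjop_mul T (adjop_mul S U) = adjop_mul (adjop_mul T S) U.
Proof. exact: aop_inj. Qed.

Lemma adjop_mul_linear_r (T : adjop) : linear (adjop_mul T).
Proof.
by move=> k S U; apply: aop_inj; apply/funext => x; rewrite /= adjop_linear.
Qed.

Lemma adjop_mul_linear_l (S : adjop) : linear (fun T : adjop => adjop_mul T S).
Proof. by move=> k T U; apply: aop_inj; apply/funext => x. Qed.

Lemma adjop_starK (T : adjop) : adjop_star (adjop_star T) = T.
Proof.
apply: aop_inj; apply: is_adjoint_inj (adjop_starP _) _.
exact/is_adjoint_sym/adjop_starP.
Qed.

Lemma adjop_starM (T S : adjop) :
  adjop_star (adjop_mul T S) = adjop_mul (adjop_star S) (adjop_star T).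
Proof.
apply: aop_inj; apply: is_adjoint_inj (adjop_starP _) _.
by apply: is_adjoint_comp; exact: adjop_starP.
Qed.

Lemma adjop_star_conj_linear (k : R[i]) (T S : adjop) :
  adjop_star (k *: T + S) = conjc k *: adjop_star T + adjop_star S.
Proof.
apply: aop_inj; apply: is_adjoint_inj (adjop_starP _) _.
by apply: is_adjoint_comb; exact: adjop_starP.
Qed.

HB.instance Definition _ := Lmodule_isStarAlgebra.Build R adjop
  adjop_mulA adjop_mul_linear_r adjop_mul_linear_l
  adjop_starK adjop_starM adjop_star_conj_linear.
End Adjointable.

(* Arrows only; the unit space is the set of fixed points of [grng].
   [gmul x y] is only meaningful when [gsrc x = grng y]. *)
HB.mixin Record isGroupoid G := {
  gmul : G -> G -> G;
  ginv : G -> G;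
  grng : G -> G;
  gsrc : G -> G;
  grng_rng : forall x, grng (grng x) = grng x;
  gsrc_rng : forall x, gsrc (grng x) = grng x;
  grng_src : forall x, grng (gsrc x) = gsrc x;
  gsrc_src : forall x, gsrc (gsrc x) = gsrc x;
  grng_mul : forall x y, gsrc x = grng y -> grng (gmul x y) = grng x;
  gsrc_mul : forall x y, gsrc x = grng y -> gsrc (gmul x y) = gsrc y;
  gmulA : forall x y z, gsrc x = grng y -> gsrc y = grng z ->
    gmul x (gmul y z) = gmul (gmul x y) z;
  gmul_rng : forall x, gmul (grng x) x = x;
  gmul_src : forall x, gmul x (gsrc x) = x;
  grng_inv : forall x, grng (ginv x) = gsrc x;
  gsrc_inv : forall x, gsrc (ginv x) = grng x;
  gmul_inv : forall x, gmul x (ginv x) = grng x;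
  ginv_mul : forall x, gmul (ginv x) x = gsrc x
}.

#[short(type="groupoidType")]
HB.structure Definition Groupoid := {G of isGroupoid G}.

HB.mixin Record Groupoid_isTopological G & Groupoid G & PointedTopological G := {
  ginv_continuous : continuous (@ginv G : G -> G);
  gmul_continuous : {within [set p : G * G | gsrc p.1 = grng p.2],
    continuous (fun p : G * G => gmul p.1 p.2 : G)}
}.

#[short(type="topGroupoidType")]
HB.structure Definition TopGroupoid :=
  {G of Groupoid_isTopological G & Groupoid G & PointedTopological G}.

Definition gunits (G : groupoidType) : set G := [set u | grng u = u].
Arguments gunits : clear implicits.

Record cocycle (G : topGroupoidType) (Gamma : groupType) := Cocycle {
  coc :> G -> Gamma;
  cocM : forall x y, gsrc x = grng y -> coc (gmul x y) = (coc x * coc y)%g;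
  coc_continuous : continuous (coc : G -> discrete_topology Gamma)
}.

Section Kernel.
Context (G : topGroupoidType) (Gamma : groupType) (c : cocycle G Gamma).

Record kernel := Kernel { kval :> G; kvalP : c kval == 1%g }.

HB.instance Definition _ := [isSub for kval].
HB.instance Definition _ := [Choice of kernel by <:].

Lemma coc_rng x : c (grng x) = 1%g.
Proof.
have e : gmul (grng x) (grng x) = grng x by rewrite -{1}(grng_rng x) gmul_rng.
have := @cocM _ _ c (grng x) (grng x); rewrite gsrc_rng grng_rng e => /(_ erefl).
by rewrite -{1}[c _]mulg1 => /mulgI.
Qed.

Lemma coc_inv x : c (ginv x) = (c x)^-1%g.
Proof.
apply: (mulgI (c x)); rewrite mulgV -cocM ?grng_inv//.
by rewrite gmul_inv coc_rng.
Qed.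

Lemma coc_src x : c (gsrc x) = 1%g.
Proof. by rewrite -grng_inv coc_rng. Qed.

Lemma kernel_inv_subproof (x : kernel) : c (ginv (kval x)) == 1%g.
Proof. by rewrite coc_inv (eqP (kvalP x)) invg1. Qed.

Lemma kernel_rng_subproof x : c (grng x) == 1%g.
Proof. exact/eqP/coc_rng. Qed.

Lemma kernel_src_subproof x : c (gsrc x) == 1%g.
Proof. exact/eqP/coc_src. Qed.

(* The default value [x] is only taken on non-composable pairs. *)
Definition kmul (x y : kernel) : kernel := insubd x (gmul (kval x) (kval y)).
Definition kinv (x : kernel) : kernel := Kernel (kernel_inv_subproof x).
Definition krng (x : kernel) : kernel := Kernel (kernel_rng_subproof (kval x)).
Definition ksrc (x : kernel) : kernel := Kernel (kernel_src_subproof (kval x)).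

Lemma kval_inj : injective kval. Proof. exact: val_inj. Qed.

Lemma kval_mul x y : ksrc x = krng y -> kval (kmul x y) = gmul (kval x) (kval y).
Proof.
move=> /(congr1 kval)/= xy; rewrite /kmul [kval _]val_insubd cocM//.
by rewrite (eqP (kvalP x)) (eqP (kvalP y)) mulg1 eqxx.
Qed.

Lemma krng_rng x : krng (krng x) = krng x.
Proof. by apply: kval_inj; rewrite /= grng_rng. Qed.
Lemma ksrc_rng x : ksrc (krng x) = krng x.
Proof. by apply: kval_inj; rewrite /= gsrc_rng. Qed.
Lemma krng_src x : krng (ksrc x) = ksrc x.
Proof. by apply: kval_inj; rewrite /= grng_src. Qed.
Lemma ksrc_src x : ksrc (ksrc x) = ksrc x.
Proof. by apply: kval_inj; rewrite /= gsrc_src. Qed.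
Lemma krng_mul x y : ksrc x = krng y -> krng (kmul x y) = krng x.
Proof.
move=> xy; apply: kval_inj; rewrite /= kval_mul// grng_mul//.
exact: (congr1 kval xy).
Qed.
Lemma ksrc_mul x y : ksrc x = krng y -> ksrc (kmul x y) = ksrc y.
Proof.
move=> xy; apply: kval_inj; rewrite /= kval_mul// gsrc_mul//.
exact: (congr1 kval xy).
Qed.
Lemma kmulA x y z : ksrc x = krng y -> ksrc y = krng z ->
  kmul x (kmul y z) = kmul (kmul x y) z.
Proof.
move=> xy yz; apply: kval_inj; rewrite !kval_mul ?ksrc_mul ?krng_mul//.
by apply: gmulA; [exact: (congr1 kval xy)|exact: (congr1 kval yz)].
Qed.
Lemma kmul_rng x : kmul (krng x) x = x.
Proof. by apply: kval_inj; rewrite kval_mul ?ksrc_rng//= gmul_rng. Qed.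
Lemma kmul_src x : kmul x (ksrc x) = x.
Proof. by apply: kval_inj; rewrite kval_mul ?krng_src//= gmul_src. Qed.
Lemma krng_inv x : krng (kinv x) = ksrc x.
Proof. by apply: kval_inj; rewrite /= grng_inv. Qed.
Lemma ksrc_inv x : ksrc (kinv x) = krng x.
Proof. by apply: kval_inj; rewrite /= gsrc_inv. Qed.
Lemma kmul_inv x : kmul x (kinv x) = krng x.
Proof. by apply: kval_inj; rewrite kval_mul ?krng_inv//= gmul_inv. Qed.
Lemma kinv_mul x : kmul (kinv x) x = ksrc x.
Proof. by apply: kval_inj; rewrite kval_mul ?ksrc_inv//= ginv_mul. Qed.

HB.instance Definition _ := isGroupoid.Build kernel
  krng_rng ksrc_rng krng_src ksrc_src krng_mul ksrc_mul kmulA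
  kmul_rng kmul_src krng_inv ksrc_inv kmul_inv kinv_mul.

HB.instance Definition _ := isPointed.Build kernel (Kernel (kernel_rng_subproof point)).
HB.instance Definition _ := Topological.copy kernel (initial_topology kval).

Lemma kval_continuous : continuous (kval : kernel -> G).
Proof. exact: (@initial_continuous kernel G kval). Qed.

Lemma kernel_nbhsP (x : kernel) (A : set kernel) :
  nbhs x A <-> exists2 U, nbhs (kval x) U & kval @^-1` U `<=` A.
Proof.
split=> [|[U xU UA]]; last by apply: filterS UA _; exact: kval_continuous.
rewrite nbhsE => -[_ [[U oU <-] Ux] UA]; exists U => //.
exact: open_nbhs_nbhs.
Qed.

Lemma kinv_continuous : continuous (@ginv kernel : kernel -> kernel).
Proof.
move=> x A /= /kernel_nbhsP[U xU UA].
have h : nbhs x (kval @^-1` (@ginv G @^-1` U)).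
  by apply: kval_continuous; exact: ginv_continuous.
by apply: filterS h => y yU; exact: UA.
Qed.

Lemma kmul_continuous :
  {within [set p : kernel * kernel | gsrc p.1 = grng p.2],
    continuous (fun p : kernel * kernel => gmul p.1 p.2 : kernel)}.
Proof.
apply/subspace_continuousP => -[x y] /= xy A /kernel_nbhsP[U].
rewrite [kval _]kval_mul// => xyU UA.
have /subspace_continuousP/(_ (kval x, kval y)) := @gmul_continuous G.
move=> /(_ (congr1 kval xy) U xyU); rewrite /within /= => -[[P Q] /= [xP yQ] PQ].
exists (kval @^-1` P, kval @^-1` Q) => /=.
  by split; exact: kval_continuous.
move=> [x' y'] /= [Px' Qy'] x'y'; apply: UA.
rewrite /= [kval _]kval_mul//.
by apply: (PQ (kval x', kval y')) => //=; exact: (congr1 kval x'y').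
Qed.

HB.instance Definition _ :=
  Groupoid_isTopological.Build kernel kinv_continuous kmul_continuous.
End Kernel.

Definition borel (T : ptopologicalType) := g_sigma_algebraType (@open T).

Definition bintegral (R : realType) (T : ptopologicalType)
    (mu : set (borel T) -> \bar R) (D : set T) (f : T -> R) : \bar R :=
  (\int[mu]_(x in (D : set (borel T))) (f x)%:E)%E.

Definition cintegral (R : realType) (T : ptopologicalType)
    (mu : set (borel T) -> \bar R) (D : set T) (f : T -> R[i]^o) : R[i]^o :=
  fine (bintegral mu D (fun x => complex.Re (f x))) +i*
  fine (bintegral mu D (fun x => complex.Im (f x))).

Definition fsupp (R : realType) (G : topologicalType) (f : G -> R[i]^o) : set G :=
  closure [set x | f x != 0].

Definition Cc (R : realType) (G : topologicalType) : set (G -> R[i]^o) :=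
  [set f | continuous f /\ compact (fsupp f)].
Arguments Cc : clear implicits.

(* [haar u] is only constrained for units [u].  On a second countable locally
   compact Hausdorff space, Radon measures are the Borel measures that are
   finite on compact sets. *)
Record haarSystem (R : realType) (G : topGroupoidType) := HaarSystem {
  haar : G -> {measure set (borel G) -> \bar R};
  haar_compact : forall u (K : set G), gunits G u -> compact K ->
    (haar u K < +oo)%E;
  haar_supp : forall u, gunits G u ->
    [set x | forall U : set G, open U -> U x -> (0 < haar u U)%E] =
    [set x | grng x = u];
  haar_continuous : forall f, Cc R G f ->
    {within gunits G, continuous (fun u => cintegral (haar u) setT f)};
  haar_left_invariant : forall f x, Cc R G f ->
    cintegral (haar (gsrc x)) [set y | grng y = gsrc x] (fun y => f (gmul x y)) =
    cintegral (haar (grng x)) setT f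
}.

Definition haar_fun (R : realType) (G : topGroupoidType) (lam : haarSystem R G)
  (u : G) : set (borel G) -> \bar R := haar lam u.
Coercion haar_fun : haarSystem >-> Funclass.

Section Convolution.
Context (R : realType) (G : topGroupoidType) (lam : G -> set (borel G) -> \bar R).
Implicit Types (a b h : G -> R[i]^o) (u : G).

(* [lam u] lives on the arrows with range [u]; the integrand is meaningful
   only there. *)
Definition conv a b : G -> R[i]^o := fun x =>
  cintegral (lam (grng x)) [set y | grng y = grng x]
    (fun y => a y * b (gmul (ginv y) x)).

Definition adj a : G -> R[i]^o := fun x => conjc (a (ginv x)).

Definition lam_inv u : set (borel G) -> \bar R :=
  pushforward (lam u) (@ginv G : borel G -> borel G).

Definition Inorm a : R :=
  Num.max
    (sup [set fine (bintegral (lam u) setT (fun x => nrm (a x))) | u in gunits G])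
    (sup [set fine (bintegral (lam_inv u) setT (fun x => nrm (a x))) | u in gunits G]).

Record star_rep (H : hilbertSpace R) (pi : (G -> R[i]^o) -> H -> H) : Prop := {
  sr_linear : forall a, Cc R G a -> linear (pi a);
  sr_bounded : forall a, Cc R G a -> continuous (pi a);
  sr_add : forall k a b x, Cc R G a -> Cc R G b ->
    pi (k *: a + b) x = k *: pi a x + pi b x;
  sr_mul : forall a b x, Cc R G a -> Cc R G b -> pi (conv a b) x = pi a (pi b x);
  sr_star : forall a x y, Cc R G a -> hs_ip (pi a x) y = hs_ip x (pi (adj a) y)
}.

Definition full_norm a : R :=
  sup [set t | exists (H : hilbertSpace R) (pi : (G -> R[i]^o) -> H -> H),
    [/\ star_rep pi,
        forall b, Cc R G b -> opnorm (pi b) <= Inorm b &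
        t = opnorm (pi a)]].

(* Square-integrable functions on [Gu = s^-1(u)] for [lam_inv u]; elements of
   L^2(Gu) are represented by functions on [G], of which only the restriction to
   [Gu] matters. *)
Definition gfiber u : set (borel G) := [set x | gsrc x = u].

Definition L2int u h : \bar R :=
  bintegral (lam_inv u) (gfiber u) (fun x => nrm (h x) ^+ 2).

Definition L2fun u : set (G -> R[i]^o) := [set h |
  [/\ measurable_fun (gfiber u) (fun x : borel G => complex.Re (h x)),
      measurable_fun (gfiber u) (fun x : borel G => complex.Im (h x)) &
      (L2int u h < +oo)%E]].

Definition L2norm u h : R := Num.sqrt (fine (L2int u h)).

(* The operator norm of [h |-> a * h] on L^2(Gu, lam_inv u). *)
Definition regular_norm u a : R :=
  sup [set L2norm u (conv a h) | h in [set h | L2fun u h /\ L2norm u h <= 1]].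

Definition reduced_norm a : R := sup [set regular_norm u a | u in gunits G].

Definition fullCstar := cstarCompletion (Cc R G) conv adj full_norm.
Definition reducedCstar := cstarCompletion (Cc R G) conv adj reduced_norm.
End Convolution.

Section CocycleModule.
Context (R : realType) (G : topGroupoidType) (lam : G -> set (borel G) -> \bar R).
Context (Gamma : groupType) (c : cocycle G Gamma).

Definition kernel_haar (u : kernel c) (A : set (borel (kernel c))) : \bar R :=
  lam (kval u) (@kval _ _ c @` A).

Definition fibre_part (gamma : Gamma) (a : G -> R[i]^o) : G -> R[i]^o :=
  fun x => if c x == gamma then a x else 0.

Definition ext0 (g : kernel c -> R[i]^o) : G -> R[i]^o :=
  fun x => oapp g 0 (insub x).

Definition Cc_ip (a b : G -> R[i]^o) : kernel c -> R[i]^o := fun x =>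
  \sum_(gamma \in [set: Gamma])
    conv lam (adj (fibre_part gamma a)) (fibre_part gamma b) (kval x).

Definition Cc_act (a : G -> R[i]^o) (g : kernel c -> R[i]^o) : G -> R[i]^o :=
  conv lam a (ext0 g).

(* For [N] the full (reduced) norm of the kernel this is the module X (Y). *)
Definition cocycleModule (N : (kernel c -> R[i]^o) -> R)
    (CGe : cstarCompletion (Cc R (kernel c)) (conv kernel_haar)
             (@adj R (kernel c)) N) :=
  moduleCompletion [set: CGe] (Cc R G) (Cc R (kernel c)) (cc_inc CGe)
    Cc_ip Cc_act.

Definition left_mult_hom (NG : (G -> R[i]^o) -> R)
    (CG : cstarCompletion (Cc R G) (conv lam) (@adj R G) NG)
    (N : (kernel c -> R[i]^o) -> R)
    (CGe : cstarCompletion (Cc R (kernel c)) (conv kernel_haar)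
             (@adj R (kernel c)) N)
    (X : cocycleModule CGe) (L : CG -> adjop X) : Prop :=
  star_hom L /\
  forall a b, Cc R G a -> Cc R G b ->
    aop (L (cc_inc CG a)) (mc_inc X b) = mc_inc X (conv lam a b).

Definition cocycle_bundle (NG : (G -> R[i]^o) -> R)
    (CG : cstarCompletion (Cc R G) (conv lam) (@adj R G) NG)
    (gamma : Gamma) : set CG :=
  closure (cc_inc CG @`
    [set f | Cc R G f /\ fsupp f `<=` [set x | c x = gamma]]).
End CocycleModule.
Arguments kernel_haar {R G} lam {Gamma} c u A.
Arguments cocycle_bundle {R G lam Gamma} c {NG} CG gamma.

(* A Fell bundle is given as a family [F] of closed subspaces of a C*-algebra
   [M] with [F beta F gamma] contained in [F (beta gamma)] and [(F gamma)^*] in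
   [F gamma^-1]; norm, product and involution are those of [M]. *)
Section FellBundle.
Context (R : realType) (Gamma : groupType) (M : cstarAlgType R).
Variable F : Gamma -> set M.

Record fell_rep (D : starAlgType R) (pi : Gamma -> M -> D) : Prop := {
  fr_linear : forall gamma, linear_on (F gamma) (pi gamma);
  fr_mul : forall beta gamma b d, F beta b -> F gamma d ->
    smul (pi beta b) (pi gamma d) = pi (beta * gamma)%g (smul b d);
  fr_star : forall gamma b, F gamma b ->
    sstar (pi gamma b) = pi gamma^-1%g (sstar b)
}.

Record fellCstar := FellCstar {
  fc_alg :> cstarAlgType R;
  fc_inc : Gamma -> M -> fc_alg;
  fc_rep : fell_rep fc_inc;
  fc_generated : forall S : set fc_alg, star_subalgebra S -> closed S ->
    (forall gamma b, F gamma b -> S (fc_inc gamma b)) -> S = setT;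
  fc_universal : forall (D : cstarAlgType R) (pi : Gamma -> M -> D),
    fell_rep pi -> exists2 phi : fc_alg -> D, star_hom phi &
      forall gamma b, F gamma b -> phi (fc_inc gamma b) = pi gamma b
}.

Definition finite_sections : set (Gamma -> M) :=
  [set xi | (forall gamma, F gamma (xi gamma)) /\
            finite_set [set gamma | xi gamma != 0]].

Definition section_ip (xi eta : Gamma -> M) : M :=
  \sum_(gamma \in [set: Gamma]) smul (sstar (xi gamma)) (eta gamma).

Definition section_act (xi : Gamma -> M) (b : M) : Gamma -> M :=
  fun gamma => smul (xi gamma) b.

Definition section_delta (gamma : Gamma) (b : M) : Gamma -> M :=
  fun gamma' => if gamma' == gamma then b else 0.

Definition ell2 :=
  moduleCompletion (F 1%g) finite_sections (F 1%g) (@id M)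
    section_ip section_act.

Definition regular_representation (CF : fellCstar) (E : ell2)
    (Lambda : CF -> adjop E) : Prop :=
  star_hom Lambda /\
  forall beta gamma b d, F beta b -> F gamma d ->
    aop (Lambda (fc_inc CF beta b)) (mc_inc E (section_delta gamma d)) =
    mc_inc E (section_delta (beta * gamma)%g (smul b d)).
End FellBundle.

(* Main.v *)
(** Let [F] be the bundle over [Gamma] whose fibre at [gamma] is the closure of the
    functions supported in [G_gamma], inside [C^*(G)] or [C^*_r(G)].  Sending [a] to its
    section [gamma |-> a_gamma] is a unitary [U] from [X] (or [Y]) onto [l^2(F)], because
    the norm of [g] in the completion for [G_e] equals the norm of its extension by zero
    [ext0 g] in the completion for [G].  One inequality comes from restricting
    representations (for the reduced norms: from cutting [L^2(Gu)] into translates of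
    [L^2]-spaces of [G_e]); the other from the action of [ext0 g] on the module.  If
    [phi : C^*(F) -> C^*(G)] extends the inclusions of the fibres, then [U] intertwines
    the regular representation with [L \o phi], and [phi] is onto since star-homomorphisms
    have closed range.

    For the full norm [phi] is also injective.  Put [T b = sum_gamma b_gamma] in [C^*(F)].
    If [|T b| <= |b|_I], then [T] followed by a faithful representation is one of those
    that define the full norm of [C_c(G)], so [phi] is isometric on the dense range of [T].
    To prove the bound, let [P_gamma] and [Q_gamma] be the fibrewise integrals of
    [|b_gamma|] and [|b_gamma^*|].  By Schur's test
    [P_gamma(r)^(-1/2) b_gamma Q_gamma(s)^(-1/2)] has norm at most one in the fibre, while
    [sum_gamma P_gamma] and [sum_gamma Q_gamma] are at most [|b|_I]; Cauchy-Schwarz over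
    [gamma] then bounds [T b].

    Norms in C*-algebras are controlled without spectral theory, through the unitaries
    [sqrt (1 - x^2) + i x] of self-adjoint contractions [x]. *)
From HB Require Import structures.
From mathcomp Require Import all_boot all_order all_algebra.
From mathcomp Require Import all_classical all_reals all_analysis.
From mathcomp Require Import complex measurable_realfun.
From mathcomp Require Import ring lra.
Require Import Defs.

Set Implicit Arguments.
Unset Strict Implicit.
Unset Printing Implicit Defensive.

Import numFieldNormedType.Exports.
Import Order.TTheory GRing.Theory Num.Theory.

Local Open Scope classical_set_scope.
Local Open Scope complex_scope.
Local Open Scope ring_scope.

(** * Star algebras and norms *)

(** The completions, modules and bundle algebras are arbitrary objects with the defining properties,
    so maps between them come from extending isometries off dense subspaces or from universality.
    [full_norm] is a supremum over Hilbert space representations, while [T] takes values in an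
    abstract C*-algebra; this is why Gelfand-Naimark is proved, in the form of one representation
    for each element. Unitizations and operators on modules are only star-algebras here, so
    C*-arguments are made for an abstract norm with sequential completeness, or for abstract actions
    on vectors. Weights such as [P_gamma(r)] are multipliers and not elements of [C_c(G)]: they are
    applied to functions before these are represented, and the final estimate is made on vectors
    [pi (bundle_map h) xi]. Since [P_gamma] and [Q_gamma] may vanish, a small [eps] is added before
    dividing. Schur's test is proved in the C*-norm itself by repeated squaring: the powers of
    [b^* b] keep bounded I-norms, which forces [b] to have norm at most one. *)

Section SquareZero.
Context (R : realType) (V : lmodType R[i]).
Local Notation K := R[i].

Definition sqzero : Type := (K * V)%type.
HB.instance Definition _ := GRing.Zmodule.on sqzero.

Definition sqz_mul (p q : sqzero) : sqzero :=
  (p.1 * q.1, p.1 *: q.2 + q.1 *: p.2).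

Lemma sqz_mulA : associative sqz_mul.
Proof.
move=> [a x] [b y] [d z]; rewrite /sqz_mul /= mulrA; congr (_, _).
rewrite !scalerDr !scalerA -addrA; congr (_ + _).
by rewrite (mulrC d a) (mulrC d b).
Qed.

Lemma sqz_mulC : commutative sqz_mul.
Proof. by move=> [a x] [b y]; rewrite /sqz_mul /= mulrC addrC. Qed.

Lemma sqz_mul1 : left_id ((1, 0) : sqzero) sqz_mul.
Proof. by move=> [a x]; rewrite /sqz_mul /= mul1r scale1r scaler0 addr0. Qed.

Lemma sqz_mulDl : left_distributive sqz_mul +%R.
Proof.
move=> [a x] [b y] [d z]; rewrite /sqz_mul /=; congr (_, _); first by rewrite mulrDl.
by rewrite scalerDl scalerDr addrACA.
Qed.

Lemma sqz_1neq0 : ((1, 0) : sqzero) != 0.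
Proof. by apply/eqP => -[] /eqP; rewrite oner_eq0. Qed.

HB.instance Definition _ := GRing.Zmodule_isComNzRing.Build sqzero
  sqz_mulA sqz_mulC sqz_mul1 sqz_mulDl sqz_1neq0.

Definition sqz_sc (k : K) : sqzero := (k, 0).
Definition sqz_in (v : V) : sqzero := (0, v).

Lemma sqz_sc_zmod : zmod_morphism sqz_sc.
Proof. by move=> a b; rewrite /sqz_sc; congr (_, _); rewrite subr0. Qed.
HB.instance Definition _ := GRing.isZmodMorphism.Build K sqzero sqz_sc sqz_sc_zmod.
Lemma sqz_sc_monoid : monoid_morphism sqz_sc.
Proof. by split=> // a b; congr (_, _); rewrite /= !scaler0 addr0. Qed.
HB.instance Definition _ := GRing.isMonoidMorphism.Build K sqzero sqz_sc sqz_sc_monoid.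

Lemma sqz_in_zmod : zmod_morphism sqz_in.
Proof. by move=> a b; rewrite /sqz_in; congr (_, _); rewrite subr0. Qed.
HB.instance Definition _ := GRing.isZmodMorphism.Build V sqzero sqz_in sqz_in_zmod.

Lemma sqz_inZ k v : sqz_in (k *: v) = sqz_sc k * sqz_in v.
Proof. by congr (_, _); rewrite /= ?mulr0// scale0r addr0. Qed.

Lemma sqz_inD v w : sqz_in (v + w) = sqz_in v + sqz_in w.
Proof. exact: raddfD. Qed.
Lemma sqz_inN v : sqz_in (- v) = - sqz_in v.
Proof. exact: raddfN. Qed.
Lemma sqz_in0 : sqz_in 0 = 0. Proof. by []. Qed.

Lemma sqz_in_inj (v w : V) : sqz_in v = sqz_in w -> v = w.
Proof. by case. Qed.
End SquareZero.

(* In the square-zero extension [K + V] a linear identity in [V] is an identity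
   in a commutative ring, hence within the scope of [ring]. *)
Ltac lin := apply: sqz_in_inj; rewrite !(sqz_inZ, sqz_inD, sqz_inN, sqz_in0); ring.

Notation "a ** b" := (smul a b) (at level 40, left associativity).

Section StarAlgebraTheory.
Context (R : realType) (A : starAlgType R).
Implicit Types (a b d x y : A) (k : R[i]).

Lemma smulDr a x y : a ** (x + y) = a ** x + a ** y.
Proof. by have := smul_linear_r a 1 x y; rewrite !scale1r. Qed.
Lemma smulDl a x y : (x + y) ** a = x ** a + y ** a.
Proof. by have := smul_linear_l a 1 x y; rewrite !scale1r. Qed.
Lemma smul0r a : a ** 0 = 0.
Proof. by apply: (addrI (a ** 0)); rewrite -smulDr !addr0. Qed.
Lemma smul0l a : 0 ** a = 0.
Proof. by apply: (addrI (0 ** a)); rewrite -smulDl !addr0. Qed.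
Lemma smulZr a k x : a ** (k *: x) = k *: (a ** x).
Proof. by have := smul_linear_r a k x 0; rewrite smul0r !addr0. Qed.
Lemma smulZl a k x : (k *: x) ** a = k *: (x ** a).
Proof. by have := smul_linear_l a k x 0; rewrite smul0l !addr0. Qed.
Lemma smulNr a x : a ** (- x) = - (a ** x).
Proof. by rewrite -scaleN1r smulZr scaleN1r. Qed.
Lemma smulNl a x : (- x) ** a = - (x ** a).
Proof. by rewrite -scaleN1r smulZl scaleN1r. Qed.

Lemma sstarD a b : sstar (a + b) = sstar a + sstar b.
Proof. by have := sstar_conj_linear 1 a b; rewrite !scale1r conjc1 scale1r. Qed.
Lemma sstarZ k a : sstar (k *: a) = conjc k *: sstar a.
Proof. by have := sstar_conj_linear k a 0; rewrite !sstar0 !addr0. Qed.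
Lemma sstarN a : sstar (- a) = - sstar a.
Proof. by rewrite -scaleN1r sstarZ rmorphN1 scaleN1r. Qed.
Lemma sstarB a b : sstar (a - b) = sstar a - sstar b.
Proof. by rewrite sstarD sstarN. Qed.

Definition selfadj a := sstar a = a.

Lemma selfadj_mulV a : selfadj (sstar a ** a).
Proof. by rewrite /selfadj sstarM sstarK. Qed.

Lemma selfadj_sqr a : selfadj a -> selfadj (a ** a).
Proof. by move=> h; rewrite /selfadj sstarM h. Qed.

Lemma conjc_real (t : R) : conjc t%:C = t%:C :> R[i].
Proof. by rewrite /= oppr0. Qed.

Lemma selfadjZ (t : R) a : selfadj a -> selfadj (t%:C *: a).
Proof. by move=> h; rewrite /selfadj sstarZ h conjc_real. Qed.

Lemma selfadjD a b : selfadj a -> selfadj b -> selfadj (a + b).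
Proof. by rewrite /selfadj sstarD => -> ->. Qed.

Lemma selfadjN a : selfadj a -> selfadj (- a).
Proof. by rewrite /selfadj sstarN => ->. Qed.

Lemma selfadjB a b : selfadj a -> selfadj b -> selfadj (a - b).
Proof. by move=> ha hb; apply/selfadjD/selfadjN. Qed.

Section Subalgebra.
Variable S : set A.
Hypothesis Ssub : star_subalgebra S.

Lemma ssub0 : S 0. Proof. by case: Ssub. Qed.
Lemma ssubM a b : S a -> S b -> S (a ** b). Proof. by case: Ssub => _ _ + _; apply. Qed.
Lemma ssubV a : S a -> S (sstar a). Proof. by case: Ssub => _ _ _; apply. Qed.
Lemma ssubZ k a : S a -> S (k *: a).
Proof. by move=> Sa; rewrite -[_ *: _]addr0; case: Ssub => S0 + _ _; apply. Qed.
Lemma ssubD a b : S a -> S b -> S (a + b).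
Proof. by move=> Sa Sb; rewrite -[a]scale1r; case: Ssub => _ + _ _; apply. Qed.
Lemma ssubN a : S a -> S (- a).
Proof. by move=> Sa; rewrite -scaleN1r; exact: ssubZ. Qed.
Lemma ssubB a b : S a -> S b -> S (a - b).
Proof. by move=> Sa Sb; apply/ssubD/ssubN. Qed.
End Subalgebra.

Lemma star_subalgebraT : star_subalgebra [set: A].
Proof. by []. Qed.

(** Self-adjointness of [b] is what makes the commutant stable under the star. Since [sqrt_exists]
    places the square root in every closed star-subalgebra containing [c], taking a commutant for
    that subalgebra shows what the root commutes with. *)
Lemma commutant_subalgebra b : selfadj b -> star_subalgebra [set a | a ** b = b ** a].
Proof.
move=> hb; split=> /=; first by rewrite smul0r smul0l.
- by move=> k x y hx hy; rewrite smulDl smulDr smulZl smulZr hx hy.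
- by move=> x y hx hy; rewrite -smulA hy smulA hx smulA.
- by move=> x hx; rewrite -{1}hb -sstarM -hx sstarM hb.
Qed.
End StarAlgebraTheory.

Ltac alg := rewrite ?(smulDl, smulDr, smulNl, smulNr, smulZl, smulZr, smul0l, smul0r, smulA); lin.

Section NrmTheory.
Context (R : realType) (V : normedModType R[i]).
Implicit Types (x y : V) (k : R[i]).

Lemma nrmE x : `|x| = (nrm x)%:C :> R[i].
Proof.
rewrite /nrm; have : 0 <= `|x| :> R[i] by exact: normr_ge0.
by case: (`|x|) => a b; rewrite lecE /= => /andP[/eqP-> _].
Qed.

Lemma nrm_ge0 x : 0 <= nrm x.
Proof. by have := normr_ge0 x; rewrite nrmE lecR. Qed.

Lemma ler_nrmD x y : nrm (x + y) <= nrm x + nrm y.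
Proof. by rewrite -lecR rmorphD /= -!nrmE ler_normD. Qed.

Lemma nrmZ k x : nrm (k *: x) = nrm (k : R[i]^o) * nrm x.
Proof. by apply: complexI; rewrite rmorphM /= -!nrmE normrZ. Qed.

Lemma nrm0_eq0 x : nrm x = 0 -> x = 0.
Proof. by move=> h; apply/eqP; rewrite -normr_eq0 nrmE h. Qed.

Lemma nrm_lt x (e : R) : (`|x| < e%:C) = (nrm x < e).
Proof. by rewrite nrmE ltcR. Qed.

Lemma nrm0 : nrm (0 : V) = 0.
Proof. by rewrite /nrm normr0. Qed.

Lemma nrmN x : nrm (- x) = nrm x.
Proof. by rewrite /nrm normrN. Qed.

Lemma posC_real (e : R[i]) : 0 < e -> exists2 r : R, 0 < r & e = r%:C.
Proof.
case: e => a b; rewrite ltcE /= => /andP[/eqP h a0]; exists a => //.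
by rewrite h.
Qed.

Lemma closureP (S : set V) x :
  closure S x <-> forall e : R, 0 < e -> exists2 y, S y & nrm (x - y) < e.
Proof.
split=> [clS e e0|h U].
  have e0' : 0 < e%:C :> R[i] by rewrite ltcR.
  have [y [Sy]] := clS _ (nbhsx_ballx x _ e0').
  by rewrite -ball_normE /= nrm_lt => ?; exists y.
move=> /nbhs_ballP[e /= /posC_real[r r0 ->]] xU.
by have [y Sy xy] := h _ r0; exists y; split => //; apply: xU; rewrite -ball_normE /= nrm_lt.
Qed.
End NrmTheory.

Section ComplexNorm.
Context (R : realType).
Implicit Types (k : R[i]) (t : R).

Lemma nrmCE k : nrm (k : R[i]^o) = Num.sqrt (complex.Re k ^+ 2 + complex.Im k ^+ 2).
Proof. by rewrite /nrm normc_def. Qed.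

Lemma nrm_real t : nrm (t%:C : R[i]^o) = `|t|.
Proof. by rewrite nrmCE /= expr0n addr0 sqrtr_sqr. Qed.

Lemma nrm_i : nrm ('i : R[i]^o) = 1.
Proof. by rewrite nrmCE /= expr0n add0r expr1n sqrtr1. Qed.

Lemma nrmM k1 k2 : nrm (k1 * k2 : R[i]^o) = nrm (k1 : R[i]^o) * nrm (k2 : R[i]^o).
Proof. exact: (@nrmZ R R[i]^o k1 k2). Qed.

Lemma nrm_conj k : nrm (conjc k : R[i]^o) = nrm (k : R[i]^o).
Proof. by rewrite !nrmCE; case: k => a b /=; rewrite sqrrN. Qed.

Lemma conjcM k1 k2 : conjc (k1 * k2) = conjc k1 * conjc k2 :> R[i].
Proof. exact: rmorphM. Qed.
Lemma conjcD k1 k2 : conjc (k1 + k2) = conjc k1 + conjc k2 :> R[i].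
Proof. exact: rmorphD. Qed.
Lemma conjcB k1 k2 : conjc (k1 - k2) = conjc k1 - conjc k2 :> R[i].
Proof. exact: rmorphB. Qed.

Lemma conjM_nrm k : conjc k * k = (nrm (k : R[i]^o) ^+ 2)%:C.
Proof. by rewrite mulrC -sqr_normc rmorphXn /= -nrmE. Qed.
End ComplexNorm.

(** * Complete C*-norms and square roots *)

Section CNorm.
Context (R : realType) (A : starAlgType R).
Implicit Types (N : A -> R) (u v : nat -> A) (S : set A).

Definition lims N u (l : A) :=
  forall e, 0 < e -> exists n0, forall n, (n0 <= n)%N -> N (u n - l) < e.

Definition cauchys N u := forall e, 0 < e ->
  exists n0, forall m n, (n0 <= m)%N -> (n0 <= n)%N -> N (u m - u n) < e.

(* A complete C*-norm, with completeness expressed by sequences; the carrier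
   needs no topology. *)
Record cnorm N : Prop := {
  cn_D : forall x y, N (x + y) <= N x + N y;
  cn_Z : forall (k : R[i]) x, N (k *: x) = nrm (k : R[i]^o) * N x;
  cn_eq0 : forall x, N x = 0 -> x = 0;
  cn_M : forall x y, N (x ** y) <= N x * N y;
  cn_star : forall x, N (sstar x ** x) = N x ^+ 2;
  cn_complete : forall u, cauchys N u -> exists l, lims N u l
}.

Definition sclosed N S := forall u l, (forall n, S (u n)) -> lims N u l -> S l.
End CNorm.

Section CNormTheory.
Context (R : realType) (A : starAlgType R) (N : A -> R) (cn : cnorm N).
Implicit Types (x y z c : A) (u v : nat -> A).

Lemma cn_0 : N 0 = 0.
Proof. by rewrite -(scale0r (0 : A)) (cn_Z cn) nrm0 mul0r. Qed.
Lemma cn_N x : N (- x) = N x.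
Proof. by rewrite -scaleN1r (cn_Z cn) nrmN -[1]/(1%:C) nrm_real normr1 mul1r. Qed.
Lemma cn_ge0 x : 0 <= N x.
Proof.
have := cn_D cn x (- x); rewrite subrr cn_0 cn_N => h.
by have -> : N x = (N x + N x) / 2; [field | rewrite divr_ge0].
Qed.
Lemma cn_R (t : R) x : N (t%:C *: x) = `|t| * N x.
Proof. by rewrite (cn_Z cn) nrm_real. Qed.
Lemma cn_C x y : N (x - y) = N (y - x).
Proof. by rewrite -cn_N opprB. Qed.
Lemma cn_tri x y z : N (x - z) <= N (x - y) + N (y - z).
Proof. by have := cn_D cn (x - y) (y - z); rewrite addrA subrK. Qed.

(** Star-invariance of the norm follows from the C*-identity: [|x|^2 = |x^* x| <= |x^*| |x|], and
    [|x|] cancels. *)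
Lemma cn_le_star x : N x <= N (sstar x).
Proof.
have [->|x0] := eqVneq (N x) 0; first exact: cn_ge0.
have p : 0 < N x by rewrite lt_neqAle eq_sym x0 cn_ge0.
by rewrite -(ler_pM2r p) -expr2 -(cn_star cn) (cn_M cn).
Qed.
Lemma cn_V x : N (sstar x) = N x.
Proof. by apply/le_anti; rewrite cn_le_star -{2}(sstarK x) cn_le_star. Qed.

Lemma cn_sa2 x : selfadj x -> N (x ** x) = N x ^+ 2.
Proof. by move=> h; rewrite -(cn_star cn) h. Qed.

Lemma lims_cst x : lims N (fun=> x) x.
Proof. by move=> e e0; exists 0%N => n _; rewrite subrr cn_0. Qed.

Lemma lims_uniq u x y : lims N u x -> lims N u y -> x = y.
Proof.
move=> h1 h2; apply/eqP; rewrite -subr_eq0; apply/eqP/(cn_eq0 cn).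
apply/le_anti; rewrite cn_ge0 andbT; apply/ler_addgt0Pr => e e0.
have e20 : 0 < e / 2 by rewrite divr_gt0.
have [n1 H1] := h1 _ e20; have [n2 H2] := h2 _ e20.
have := cn_tri x (u (n1 + n2)%N) y.
rewrite (cn_C x (u _)); have := H1 _ (leq_addr n2 n1); have := H2 _ (leq_addl n1 n2); lra.
Qed.

Lemma limsD u v x y : lims N u x -> lims N v y -> lims N (fun n => u n + v n) (x + y).
Proof.
move=> h1 h2 e e0; have e20 : 0 < e / 2 by rewrite divr_gt0.
have [n1 H1] := h1 _ e20; have [n2 H2] := h2 _ e20; exists (n1 + n2)%N => n nn.
have := H1 _ (leq_trans (leq_addr _ _) nn); have := H2 _ (leq_trans (leq_addl _ _) nn).
have -> : u n + v n - (x + y) = (u n - x) + (v n - y) by lin.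
have := cn_D cn (u n - x) (v n - y); lra.
Qed.

Lemma lims_le u v x y (K : R) : lims N u x ->
  (forall n, N (v n - y) <= K * N (u n - x)) -> lims N v y.
Proof.
move=> h H e e0; have K0 : 0 < `|K| + 1 by rewrite ltr_wpDl.
have [n0 Hn] := h _ (divr_gt0 e0 K0); exists n0 => n /Hn h1.
apply: le_lt_trans (H n) _; apply: le_lt_trans (_ : _ <= (`|K| + 1) * N (u n - x)) _.
  by rewrite ler_wpM2r ?cn_ge0// ler_wpDr// ler_norm.
by rewrite mulrC -ltr_pdivlMr.
Qed.

Lemma limsZ (k : R[i]) u x : lims N u x -> lims N (fun n => k *: u n) (k *: x).
Proof. by move=> h; apply: lims_le h _ => n; rewrite -scalerBr (cn_Z cn). Qed.

Lemma limsV u x : lims N u x -> lims N (fun n => sstar (u n)) (sstar x).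
Proof. by move=> h; apply: (lims_le (K := 1)) h _ => n; rewrite -sstarB cn_V mul1r. Qed.

Lemma lims_mulr y u x : lims N u x -> lims N (fun n => u n ** y) (x ** y).
Proof.
move=> h; apply: (lims_le (K := N y)) h _ => n.
by rewrite mulrC -smulNl -smulDl (cn_M cn).
Qed.
Lemma lims_mull y u x : lims N u x -> lims N (fun n => y ** u n) (y ** x).
Proof.
move=> h; apply: (lims_le (K := N y)) h _ => n.
by rewrite -smulNr -smulDr (cn_M cn).
Qed.

Lemma lims_bound u x K : lims N u x -> (forall n, N (u n) <= K) -> N x <= K.
Proof.
move=> h b; apply/ler_addgt0Pr => e e0; have [n0 H] := h _ e0.
have := H _ (leqnn n0); have := b n0; have := cn_tri x (u n0) 0.
rewrite !subr0 (cn_C x); lra.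
Qed.

Lemma limsM u v x y : lims N u x -> lims N v y ->
  (exists K, forall n, N (v n) <= K) -> lims N (fun n => u n ** v n) (x ** y).
Proof.
move=> h1 h2 [K bK].
have h : lims N (fun n => (u n - x) ** v n) 0.
  apply: (lims_le (K := K)) h1 _ => n; rewrite subr0 mulrC.
  by apply: le_trans (cn_M cn _ _) _; rewrite ler_wpM2l ?cn_ge0.
have := limsD h (lims_mull x h2); rewrite add0r; congr lims.
by apply/funext => n; alg.
Qed.

Lemma limsS u x : lims N u x -> lims N (fun n => u n.+1) x.
Proof.
by move=> h e /h[n0 H]; exists n0 => n nn; apply: H; rewrite (leq_trans nn).
Qed.

Lemma sclosedT : sclosed N [set: A]. Proof. by []. Qed.

Lemma commutant_sclosed y : sclosed N [set x | x ** y = y ** x].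
Proof.
move=> u l h ul; apply: lims_uniq (lims_mulr y ul) _.
rewrite (_ : (fun n => _) = fun n => y ** u n); last exact/funext.
exact: lims_mull.
Qed.

(** A majorant argument: the increments of [u] are dominated by those of a bounded increasing real
    sequence. It gives convergence without a rate, as needed for the square root when [N c = 1],
    where the iteration may converge more slowly than any geometric series. *)
Lemma monotone_cauchys u (r : nat -> R) (K : R) :
  (forall n, N (u n.+1 - u n) <= r n.+1 - r n) -> (forall n, r n <= K) -> cauchys N u.
Proof.
move=> h b e e0.
have rm n : r n <= r n.+1 by have := h n; have := cn_ge0 (u n.+1 - u n); lra.
have hr n k : N (u (n + k)%N - u n) <= r (n + k)%N - r n.
  elim: k => [|k IH]; first by rewrite addn0 !subrr cn_0.
  rewrite addnS; have := cn_tri (u (n + k).+1) (u (n + k)%N) (u n).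
  have := h (n + k)%N; lra.
have hs : has_sup (range r) by split; [exists (r 0%N); exists 0%N | exists K => _ [n _ <-]].
have [_ [n0 _ <-] hn] := sup_adherent (divr_gt0 e0 (ltr0n _ 2)) hs.
have ub n : r n <= sup (range r) by apply: ub_le_sup; [case: hs | exists n].
exists n0 => m n m0 n0'.
have H k : (n0 <= k)%N -> N (u k - u n0) < e / 2.
  by move=> /subnKC <-; apply: le_lt_trans (hr _ _) _; have := ub (n0 + (k - n0))%N; lra.
by have := H _ m0; have := H _ n0'; have := cn_tri (u m) (u n0) (u n); rewrite (cn_C (u n0)); lra.
Qed.

Lemma geometric_cauchys u (K q : R) : 0 <= K -> 0 <= q < 1 ->
  (forall n, N (u n.+1 - u n) <= K * q ^+ n) -> cauchys N u.
Proof.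
move=> K0 /andP[q0 q1] h.
(* The majorant consists of the partial sums of the geometric series. *)
apply: (@monotone_cauchys _ (fun n => K * ((1 - q ^+ n) / (1 - q))) (K / (1 - q))).
  move=> n; apply: le_trans (h n) _; rewrite -mulrBr le_eqVlt; apply/orP; left; apply/eqP.
  by rewrite exprS; field; lra.
move=> n; rewrite ler_wpM2l// ler_pdivrMr; last by lra.
by rewrite mulVf; [have := exprn_ge0 n q0; lra | lra].
Qed.

(** A fixed point of [z |-> (c + z^2) / 2] satisfies [(1 - z)^2 = 1 - c]. The real sequence
    [sqrt_recR] is the same iteration at [c = 1]; it increases, stays below one and majorizes this
    one when [N c <= 1]. *)
Fixpoint sqrt_rec c n := if n is n'.+1 then (2^-1)%:C *: (c + sqrt_rec c n' ** sqrt_rec c n') else 0.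
Fixpoint sqrt_recR n : R := if n is n'.+1 then (1 + sqrt_recR n' ^+ 2) / 2 else 0.

Lemma sqrt_recRP n : 0 <= sqrt_recR n /\ sqrt_recR n <= 1.
Proof. by elim: n => [|n [h0 h1]] /=; split; nra. Qed.

(* [1 - z] is the square root of [1 - c]. *)
Lemma sqrt_exists c : selfadj c -> N c <= 1 ->
  exists z, [/\ selfadj z, N z <= 1, z + z = c + z ** z &
    forall S, star_subalgebra S -> sclosed N S -> S c -> S z].
Proof.
move=> hc c1; pose z := sqrt_rec c; pose r := sqrt_recR.
have hz n : selfadj (z n).
  elim: n => [|n IH] /=; first exact: sstar0.
  exact/selfadjZ/selfadjD/selfadj_sqr.
have zr n : N (z n) <= r n.
  elim: n => [|n IH] /=; first by rewrite cn_0.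
  rewrite cn_R gtr0_norm ?invr_gt0// mulrC ler_wpM2r ?invr_ge0//.
  apply: le_trans (cn_D cn _ _) _; rewrite lerD//.
  by apply: le_trans (cn_M cn _ _) _; rewrite -expr2 lerXn2r ?nnegrE ?cn_ge0//; case: (sqrt_recRP n).
have dz n : N (z n.+1 - z n) <= r n.+1 - r n.
  elim: n => [|n IH].
    by rewrite /z /= smul0l addr0 subr0 cn_R gtr0_norm ?invr_gt0//; rewrite /r /=; lra.
  (* The difference of two squares is factored without commutativity. The real iteration satisfies
     the same identity, so the majorization passes from one increment to the next. *)
  have -> : z n.+2 - z n.+1 =
      (2^-1)%:C *: ((z n.+1 - z n) ** z n.+1 + z n ** (z n.+1 - z n)).
    rewrite -[z n.+2]/((2^-1)%:C *: (c + z n.+1 ** z n.+1)).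
    by rewrite -{3}[z n.+1]/((2^-1)%:C *: (c + z n ** z n)); alg.
  have -> : r n.+2 - r n.+1 = 2^-1 * ((r n.+1 - r n) * r n.+1 + r n * (r n.+1 - r n)).
    rewrite -[r n.+2]/((1 + r n.+1 ^+ 2) / 2).
    by rewrite -{2}[r n.+1]/((1 + r n ^+ 2) / 2); field.
  rewrite cn_R gtr0_norm ?invr_gt0// ler_wpM2l ?invr_ge0//.
  apply: le_trans (cn_D cn _ _) _; apply: lerD.
    by apply: le_trans (cn_M cn _ _) _; rewrite ler_pM ?cn_ge0.
  by apply: le_trans (cn_M cn _ _) _; rewrite ler_pM ?cn_ge0.
have [l zl] := cn_complete cn (monotone_cauchys dz (fun n => (sqrt_recRP n).2)).
have zb n : N (z n) <= 1 := le_trans (zr n) (sqrt_recRP n).2.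
exists l; split.
- by apply: lims_uniq (limsV zl) _; move: zl; congr lims; apply/funext => n; rewrite hz.
- exact: lims_bound zl zb.
- have h1 : lims N (fun n => 2%:C *: z n.+1) (l + l).
    rewrite (_ : l + l = 2%:C *: l); last by rewrite -[LHS]/(l *+ 2) -scaler_nat rmorphMn.
    exact/limsZ/limsS.
  apply: lims_uniq h1 _.
  have h2 := limsD (lims_cst c) (limsM zl zl (ex_intro _ 1 zb)).
  move: h2; congr lims; apply/funext => n /=.
  by rewrite scalerA -rmorphM /= mulfV// scale1r.
- move=> S Ss Sc cS; apply: Sc zl => n.
  elim: n => [|n IH] /=; first exact: ssub0.
  exact: (ssubZ Ss _ (ssubD Ss cS (ssubM Ss IH IH))).
Qed.
End CNormTheory.

(** * Contractivity and closed range of star-homomorphisms *)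

Lemma half2C (R : realType) : 2^-1%:C * 2 = 1 :> R[i].
Proof. by rewrite -(rmorph_nat (real_complex R)) -rmorphM /= mulVf. Qed.

Section StarAction.
Context (R : realType) (A : starAlgType R) (W : lmodType R[i]) (Z : zmodType).
Implicit Types (a b x z : A) (u w : W).

(* Covers both a *-homomorphism into a C*-algebra, acting by left multiplication
   with [I u w = u^* w], and one into the adjointable operators of a Hilbert module. *)
Record star_action (S : set A) (p : A -> W -> W) (I : W -> W -> Z) (M : Z -> R)
    (q : W -> R) : Prop := {
  act_ge0 : forall u, 0 <= q u;
  act_D : forall u w, q (u + w) <= q u + q w;
  act_Z : forall (k : R[i]) u, q (k *: u) = nrm (k : R[i]^o) * q u;
  act_q : forall u, q u ^+ 2 = M (I u u);
  act_Il : forall u u' w, I (u + u') w = I u w + I u' w;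
  act_Ir : forall u w w', I u (w + w') = I u w + I u w';
  act_lin : forall k a b u, S a -> S b -> p (k *: a + b) u = k *: p a u + p b u;
  act_add : forall a u w, S a -> p a (u + w) = p a u + p a w;
  act_mul : forall a b u, S a -> S b -> p (a ** b) u = p a (p b u);
  act_adj : forall a u w, S a -> I (p a u) w = I u (p (sstar a) w)
}.

Context (S : set A) (p : A -> W -> W) (I : W -> W -> Z) (M : Z -> R) (q : W -> R).
Hypotheses (act : star_action S p I M q) (Ss : star_subalgebra S).

Lemma act_pD a b u : S a -> S b -> p (a + b) u = p a u + p b u.
Proof. by move=> Sa Sb; have := act_lin act 1 u Sa Sb; rewrite !scale1r. Qed.

Lemma act_p0 u : p 0 u = 0.
Proof.
have := act_pD u (ssub0 Ss) (ssub0 Ss); rewrite addr0 => /eqP.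
by rewrite -subr_eq0 opprD addNKr oppr_eq0 => /eqP.
Qed.

Lemma act_pZ k a u : S a -> p (k *: a) u = k *: p a u.
Proof. by move=> Sa; have := act_lin act k u Sa (ssub0 Ss); rewrite act_p0 !addr0. Qed.

Lemma act_pN a u : S a -> p (- a) u = - p a u.
Proof. by move=> Sa; rewrite -(scaleN1r a) act_pZ// scaleN1r. Qed.

Lemma act_pB a b u : S a -> S b -> p (a - b) u = p a u - p b u.
Proof. by move=> Sa Sb; rewrite act_pD ?act_pN//; exact: ssubN. Qed.

(** In a unitization the hypothesis on [a] reads [(1 + a)^* (1 + a) = 1]; expanding [I] at
    [u + p a u] collects exactly these terms. *)
Lemma quasi_unitary_isometric a u : S a -> a + sstar a + sstar a ** a = 0 ->
  q (u + p a u) = q u.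
Proof.
move=> Sa ha; have Sa' := ssubV Ss Sa.
have e : q (u + p a u) ^+ 2 = q u ^+ 2.
  rewrite !(act_q act) (act_Il act) (act_adj act)// -(act_Ir act).
  rewrite (act_add act)// -(act_mul act)// -addrA (addrA (p a u)).
  rewrite -!act_pD// ?ha ?act_p0 ?addr0//; first by apply: (ssubD Ss).
  exact: ssubM.
by apply/eqP; rewrite -(@eqrXn2 _ 2) ?(act_ge0 act)//; apply/eqP.
Qed.

(* [1 - z + i x] is unitary. *)
Lemma cayley_contractive x z u : S x -> S z -> selfadj x -> selfadj z ->
  x ** z = z ** x -> z + z = x ** x + z ** z ->
  q (p x u) <= q u /\ q (u - p z u) <= q u.
Proof.
move=> Sx Sz hx hz xz zz.
(* Here [k] is ['i] or [- 'i]. The mixed terms cancel because [x] and [z] commute, and what remains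
   is [x^2 + z^2 - 2 z = 0]. *)
have key (k : R[i]) : conjc k = - k -> conjc k * k = 1 ->
    q (u + p (k *: x - z) u) = q u.
  move=> k1 k2; apply: quasi_unitary_isometric; first by apply: ssubB => //; exact: ssubZ.
  rewrite sstarB sstarZ hx hz k1.
  transitivity (((- k) * k) *: (x ** x) + z ** z - (z + z)
    + (k *: (x ** z) - k *: (z ** x))); first by alg.
  by rewrite -k1 k2 zz xz scale1r !subrr addr0.
have h1 := key 'i ltac:(by apply/eqP; rewrite eq_complex /= oppr0 !eqxx)
  ltac:(by apply/eqP; rewrite eq_complex /= !(mul0r,mulr0,mulN1r,mulr1,addr0,subr0,add0r,opprK,oppr0) ?eqxx).
have h2 := key (- 'i) ltac:(by apply/eqP; rewrite eq_complex /= ?oppr0 ?opprK !eqxx)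
  ltac:(by apply/eqP; rewrite eq_complex /= !(mul0r,mulr0,mulN1r,mulrN1,mulr1,addr0,subr0,add0r,opprK,oppr0) ?eqxx).
have Sk k : S (k *: x) by exact: ssubZ.
have hh : nrm (2^-1%:C : R[i]^o) = 2^-1 by rewrite nrm_real gtr0_norm ?invr_gt0.
split.
  (* [x] is the half-difference of the isometries [1 - z + i x] and [1 - z - i x], divided by [i].
     Their half-sum is [1 - z], which gives the second bound. *)
  have -> : p x u = (2^-1%:C * - 'i) *: ((u + p ('i *: x - z) u) - (u + p (- 'i *: x - z) u)).
    rewrite !act_pB// !act_pZ//.
    transitivity ((2^-1%:C * - 'i * ('i + 'i)) *: p x u); last by lin.
    rewrite [X in X *: _](_ : _ = 1) ?scale1r//.
    rewrite -mulrA mulNr mulrDr -expr2 sqr_i opprD opprK.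
    exact: half2C.
  rewrite (act_Z act) nrmM hh nrmN nrm_i mulr1.
  have := act_D act (u + p ('i *: x - z) u) (- (u + p (- 'i *: x - z) u)).
  rewrite -[in X in X -> _]scaleN1r (act_Z act) scaleN1r nrmN -[1]/(1%:C) nrm_real normr1 mul1r h1 h2; lra.
have -> : u - p z u = (2^-1%:C) *: ((u + p ('i *: x - z) u) + (u + p (- 'i *: x - z) u)).
  rewrite !act_pB// !act_pZ//.
  transitivity ((2^-1%:C * 2) *: (u - p z u)); last by lin.
  rewrite [X in X *: _](_ : _ = 1) ?scale1r//.
  exact: half2C.
rewrite (act_Z act) hh.
have := act_D act (u + p ('i *: x - z) u) (u + p (- 'i *: x - z) u).
rewrite h1 h2; lra.
Qed.

Section Contraction.
Variables (N : A -> R).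
Hypotheses (cn : cnorm N) (Sc : sclosed N S).

Lemma selfadj_act1 x u : S x -> selfadj x -> N x <= 1 ->
  q (p x u) <= q u /\ q (u - p (x ** x) u) <= q u.
Proof.
move=> Sx hx x1.
have [z [hz z1 zz zS]] := sqrt_exists cn (selfadj_sqr hx)
  (le_trans (cn_M cn _ _) (mulr_ile1 (cn_ge0 cn x) (cn_ge0 cn x) x1 x1)).
have Sz : S z by apply: zS => //; exact: ssubM.
have xz : x ** z = z ** x.
  apply/esym; have := zS _ (commutant_subalgebra hx) (commutant_sclosed cn (y := x)).
  by apply; rewrite /= smulA.
have H w := cayley_contractive w Sx Sz hx hz xz zz.
split; first exact: (H u).1.
(* [1 - x^2 = (1 - z)^2], so the contraction [1 - z] is applied twice. *)
have -> : u - p (x ** x) u = (u - p z u) - p z (u - p z u).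
  have pzN w : p z (- w) = - p z w.
    apply/eqP; rewrite -subr_eq0 opprK -(act_add act)// addrC subrr.
    apply/eqP; have := act_add act 0 0 Sz; rewrite addr0 => /eqP.
    by rewrite -subr_eq0 opprD addNKr oppr_eq0 => /eqP.
  have -> : x ** x = z + z - z ** z by rewrite zz addrK.
  rewrite act_pB ?act_pD//; [|exact: ssubD|exact: ssubM].
  by rewrite (act_mul act)// (act_add act)// pzN; lin.
exact: le_trans (H _).2 (H _).2.
Qed.

Lemma selfadj_act x u : S x -> selfadj x -> q (p x u) <= N x * q u.
Proof.
move=> Sx hx; have [/(cn_eq0 cn) ->|x0] := eqVneq (N x) 0.
  rewrite act_p0 -(scale0r (0 : W)) (act_Z act) nrm0 mul0r.
  by rewrite mulr_ge0 ?(cn_ge0 cn) ?(act_ge0 act).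
have p0 : 0 < N x by rewrite lt_neqAle eq_sym x0 (cn_ge0 cn).
have e : x = (N x)%:C *: ((N x)^-1%:C *: x) by rewrite scalerA -rmorphM /= mulfV// scale1r.
have S' : S ((N x)^-1%:C *: x) by exact: ssubZ.
rewrite {1}e act_pZ// (act_Z act) nrm_real gtr0_norm// ler_wpM2l ?(ltW p0)//.
apply: (selfadj_act1 u S' (selfadjZ _ hx) _).1.
by rewrite (cn_R cn) gtr0_norm ?invr_gt0// mulVf.
Qed.
End Contraction.
End StarAction.

Section Homomorphisms.
Context (R : realType) (A B : starAlgType R) (NA : A -> R) (NB : B -> R).
Hypotheses (cA : cnorm NA) (cB : cnorm NB).
Implicit Types (a x : A) (y : B).

Lemma hom_action (S : set A) (f : A -> B) : star_subalgebra S -> linear_on S f ->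
  (forall a b, S a -> S b -> f (a ** b) = f a ** f b) ->
  (forall a, S a -> f (sstar a) = sstar (f a)) ->
  star_action S (fun a y => f a ** y) (fun x y : B => sstar x ** y) NB NB.
Proof.
move=> Ss fl fm fs; split.
- exact: cn_ge0.
- exact: cn_D.
- exact: cn_Z.
- by move=> u; rewrite (cn_star cB).
- by move=> *; rewrite sstarD smulDl.
- by move=> *; rewrite smulDr.
- by move=> k a b u Sa Sb; rewrite fl// smulDl smulZl.
- by move=> *; rewrite smulDr.
- by move=> a b u Sa Sb; rewrite fm// smulA.
- by move=> a u w Sa; rewrite sstarM fs// smulA.
Qed.

(** For self-adjoint [h] the estimate for actions is used at the vector [f h] itself:
    [|f h|^2 <= |h| |f h|]. The C*-identity reduces the general case to [h = a^* a]. A proper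
    subalgebra [S] occurs later as the unit fibre of a bundle. *)
Lemma hom_contractive (S : set A) (f : A -> B) : star_subalgebra S -> sclosed NA S ->
  linear_on S f ->
  (forall a b, S a -> S b -> f (a ** b) = f a ** f b) ->
  (forall a, S a -> f (sstar a) = sstar (f a)) ->
  forall a, S a -> NB (f a) <= NA a.
Proof.
move=> Ss Sc fl fm fs a Sa; have act := hom_action Ss fl fm fs.
have Sh : S (sstar a ** a) by apply: ssubM => //; exact: ssubV.
have h := selfadj_act act Ss cA Sc (f (sstar a ** a)) Sh (selfadj_mulV a).
have hsa : selfadj (f (sstar a ** a)) by rewrite /selfadj -fs// selfadj_mulV.
rewrite /= (cn_sa2 cB hsa) expr2 in h.
rewrite -(@ler_pXn2r _ 2) ?nnegrE ?(cn_ge0 cA) ?(cn_ge0 cB)//.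
rewrite -(cn_star cA) -(cn_star cB) -fs// -fm//; last exact: ssubV.
have [->|n0] := eqVneq (NB (f (sstar a ** a))) 0; first exact: cn_ge0.
by rewrite -(ler_pM2r (_ : 0 < NB (f (sstar a ** a)))) // lt_neqAle eq_sym n0 (cn_ge0 cB).
Qed.
End Homomorphisms.

Section ClosedRange.
Context (R : realType) (A : starAlgType R) (NA : A -> R) (cA : cnorm NA).

Lemma self_action : star_action [set: A] smul (fun x y : A => sstar x ** y) NA NA.
Proof. by apply: (@hom_action _ A A NA cA [set: A] id). Qed.

(** The solution is [g^2 / (1 + g^2)], found without a unit as the limit of
    [w |-> t (g^2 + m^2 w - g^2 w)] with [t = 1 / (1 + m^2)]. Multiplication by [m^2 - g^2] has norm
    at most [m^2], so the iteration contracts by the factor [t m^2 < 1]. *)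
Lemma resolvent_exists (g : A) : selfadj g ->
  exists w, [/\ selfadj w, w ** g = g ** w & w + g ** g ** w = g ** g].
Proof.
move=> hg; pose m := NA g + 1; have m0 : 0 < m by rewrite ltr_wpDl ?(cn_ge0 cA).
(* [m^2 - g^2 = m^2 (1 - x^2)] for the self-adjoint contraction [x = g / m]. Adding one to the norm
   keeps [m] invertible when [g = 0]. *)
have bnd y : NA ((m ^+ 2)%:C *: y - g ** g ** y) <= m ^+ 2 * NA y.
  pose x := m^-1%:C *: g.
  have x1 : NA x <= 1.
    by rewrite (cn_R cA) gtr0_norm ?invr_gt0// mulrC ler_pdivrMr// mul1r lerDl.
  have [_] := selfadj_act1 self_action (star_subalgebraT A) cA (@sclosedT _ _ _) y I (selfadjZ _ hg) x1.
  move=> h; have -> : (m ^+ 2)%:C *: y - g ** g ** y = (m ^+ 2)%:C *: (y - x ** x ** y).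
    rewrite /x scalerBr !(smulZl, smulZr) !scalerA -!rmorphM /=.
    by rewrite expr2 mulrA mulfK ?gt_eqF// mulfV ?gt_eqF// scale1r.
  by rewrite (cn_R cA) ger0_norm ?sqr_ge0// ler_wpM2l ?sqr_ge0.
pose t := (1 + m ^+ 2)^-1; have d0 : 0 < 1 + m ^+ 2 by rewrite ltr_wpDr ?sqr_ge0.
have t0 : 0 < t by rewrite invr_gt0.
pose F w := t%:C *: (g ** g + ((m ^+ 2)%:C *: w - g ** g ** w)).
pose w n := iter n F 0.
have wg n : w n ** g = g ** w n.
  elim: n => [|n IH] /=; first by rewrite smul0l smul0r.
  rewrite /F smulZl smulZr; congr (_ *: _).
  rewrite smulDr smulDl smulA; congr (_ + _).
  rewrite smulDr smulDl smulZl smulZr IH smulNl smulNr; congr (_ - _).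
  by rewrite -!smulA IH.
have wgg n : w n ** (g ** g) = g ** g ** w n by rewrite smulA wg -smulA wg smulA.
have wsa n : selfadj (w n).
  elim: n => [|n IH] /=; first exact: sstar0.
  apply/selfadjZ/selfadjD; first exact: selfadj_sqr.
  apply/selfadjB; first exact: selfadjZ.
  by rewrite /selfadj sstarM IH (selfadj_sqr hg) -/(w n) wgg.
have dw n : NA (w n.+1 - w n) <= (t * NA (g ** g)) * (t * m ^+ 2) ^+ n.
  elim: n => [|n IH].
    rewrite /= /F scaler0 smul0r !subr0 addr0 (cn_R cA) gtr0_norm// expr0 mulr1//.
  have -> : w n.+2 - w n.+1 = t%:C *: ((m ^+ 2)%:C *: (w n.+1 - w n) - g ** g ** (w n.+1 - w n)).
    by rewrite -[w n.+2]/(F (w n.+1)) -{2}[w n.+1]/(F (w n)) /F; alg.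
  rewrite (cn_R cA) gtr0_norm//.
  apply: le_trans (_ : t * (m ^+ 2 * NA (w n.+1 - w n)) <= _).
    by rewrite ler_wpM2l ?(ltW t0).
  rewrite [_ ^+ n.+1]exprS [leRHS]mulrCA [leLHS]mulrA ler_wpM2l//.
  by rewrite mulr_ge0 ?sqr_ge0// ltW.
have q01 : 0 <= t * m ^+ 2 < 1.
  rewrite mulr_ge0 ?sqr_ge0 ?(ltW t0)//= mulrC ltr_pdivrMr// mul1r; lra.
have K0 : 0 <= t * NA (g ** g) by rewrite mulr_ge0 ?(ltW t0) ?(cn_ge0 cA).
have [l wl] := cn_complete cA (geometric_cauchys cA K0 q01 dw).
exists l; split.
- by apply: (lims_uniq cA) (limsV cA wl) _; move: wl; congr lims; apply/funext => n; rewrite wsa.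
- exact: (commutant_sclosed cA (y := g) wg wl).
- have h1 := limsS wl.
  have h2 : lims NA (fun n => F (w n)) (F l).
    apply/(limsZ cA)/(limsD cA); first exact: lims_cst.
    apply: (limsD cA); first exact: (limsZ cA).
    rewrite -scaleN1r (_ : (fun n => _) = fun n => -1 *: (g ** g ** w n)).
      exact/(limsZ cA)/(lims_mull cA).
    by apply/funext => n; rewrite scaleN1r.
  have e := lims_uniq cA h1 h2.
  have : (1 + m ^+ 2)%:C *: l = g ** g + ((m ^+ 2)%:C *: l - g ** g ** l).
    by rewrite {1}e /F scalerA -rmorphM /= mulfV ?gt_eqF// scale1r.
  rewrite rmorphD /= scalerDl scale1r => /(congr1 (fun y => y - (m ^+ 2)%:C *: l)).
  rewrite addrK => e'; rewrite {1}e'; lin.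
Qed.

Section ResolventBounds.
Context (W : lmodType R[i]) (Z : zmodType) (p : A -> W -> W) (I : W -> W -> Z) (M : Z -> R)
  (q : W -> R).
Hypothesis act : star_action [set: A] p I M q.
Let T := star_subalgebraT A.

(** The rational parametrization of the circle: [x = 2 g / (1 + g^2)] and
    [1 - z = (1 - g^2) / (1 + g^2)] satisfy [x^2 + (1 - z)^2 = 1], so [cayley_contractive] applies.
    Half of [x] is [g - g w], and [1 - w] is the mean of [1] and [1 - z]. *)
Lemma resolvent_bounds (g w : A) u : selfadj g -> selfadj w -> w ** g = g ** w ->
  w + g ** g ** w = g ** g ->
  q (u - p w u) <= q u /\ q (p (g - g ** w) u) <= q u / 2.
Proof.
move=> hg hw wg ww.
pose x := 2%:C *: (g - g ** w); pose z : A := 2%:C *: w.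
have hx : selfadj x.
  by apply/selfadjZ/selfadjB => //; rewrite /selfadj sstarM hg hw wg.
have hz : selfadj z by exact: selfadjZ.
have xz : x ** z = z ** x.
  rewrite /x /z !smulZl !smulZr; congr (_ *: (_ *: _)).
  by rewrite smulDl smulDr smulNl smulNr smulA wg.
have zz : z + z = x ** x + z ** z.
  have gw : g ** w ** g = g ** g ** w by rewrite -smulA wg smulA.
  have -> : x ** x = 4%:C *: (w - w ** w).
    have -> : w - w ** w = (g ** g - g ** g ** w) - (g ** g - g ** g ** w) ** w.
      have we : w = g ** g - g ** g ** w by rewrite -[X in X - _]ww addrK.
      by rewrite -we.
    rewrite /x smulZl smulZr scalerA -rmorphM /= (_ : 2 * 2 = 4 :> R); last by ring.
    congr (_ *: _); rewrite smulDl !smulDr !smulNl !smulNr !smulA gw.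
    by rewrite smulDl smulNl; lin.
  rewrite /z smulZl smulZr scalerA -rmorphM /= (_ : 2 * 2 = 4 :> R); last by ring.
  rewrite -scalerDl -rmorphD /= (_ : 2 + 2 = 4 :> R); last by ring.
  by rewrite -scalerDr subrK.
have [h1 h2] := cayley_contractive act T u Logic.I Logic.I hx hz xz zz.
have q2 : nrm (2%:C : R[i]^o) = 2 by rewrite nrm_real ger0_norm.
split.
  have -> : u - p w u = 2^-1%:C *: (u + (u - p z u)).
    rewrite /z (act_pZ act T)//; transitivity ((2^-1%:C * 2%:C) *: (u - p w u)); last first.
      by rewrite (_ : 2%:C = 1 + 1) ?rmorphD ?rmorph1//; lin.
    by rewrite -rmorphM /= mulVf// scale1r.
  rewrite (act_Z act) nrm_real gtr0_norm ?invr_gt0//.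
  by have := act_D act u (u - p z u); lra.
by move: h1; rewrite /x (act_pZ act T)// (act_Z act) q2; lra.
Qed.
End ResolventBounds.

Context (B : starAlgType R) (NB : B -> R) (cB : cnorm NB) (f : A -> B) (fh : star_hom f).

Let fl : linear f. Proof. by case: fh. Qed.
Let fm a b : f (a ** b) = f a ** f b. Proof. by case: fh. Qed.
Let fs a : f (sstar a) = sstar (f a). Proof. by case: fh. Qed.
Let fact : star_action [set: A] (fun a y => f a ** y) (fun x y : B => sstar x ** y) NB NB.
Proof. by apply: hom_action => // k x y _ _; exact: fl. Qed.

Lemma star_hom_contractive a : NB (f a) <= NA a.
Proof.
by apply: (hom_contractive cA cB (star_subalgebraT A) (@sclosedT _ _ _)) => // k x y _ _; exact: fl.
Qed.

Lemma star_hom0 : f 0 = 0.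
Proof. by have := fl (-1) 0 0; rewrite scaler0 addr0 scaleN1r addNr. Qed.
Lemma star_homZ k a : f (k *: a) = k *: f a.
Proof. by have := fl k a 0; rewrite star_hom0 !addr0. Qed.
Lemma star_homD a b : f (a + b) = f a + f b.
Proof. by have := fl 1 a b; rewrite !scale1r. Qed.
Lemma star_homB a b : f (a - b) = f a - f b.
Proof. by rewrite star_homD -scaleN1r star_homZ scaleN1r. Qed.

(* With [h = a^* a] and [g = h / (2 |f a|^2)], truncate [a] to [a (1 + g^2)^-1]. *)
Lemma range_truncate a : 0 < NB (f a) -> exists x,
  NA x <= NB (f a) /\ NB (f a - f x) <= NB (f a) / 4.
Proof.
set dl := NB (f a) => d0; pose t := (2 * dl ^+ 2)^-1.
have dl2 : 0 < dl ^+ 2 by rewrite exprn_gt0.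
have t0 : 0 < t by rewrite invr_gt0 mulr_gt0.
pose h := sstar a ** a; pose g := t%:C *: h.
have hg : selfadj g by exact/selfadjZ/selfadj_mulV.
have [w [hw wg ww]] := resolvent_exists hg.
exists (a - a ** w); split.
  have [_ b1] := resolvent_bounds self_action (g - g ** w) hg hw wg ww.
  have [b2 _] := resolvent_bounds self_action (h - h ** w) hg hw wg ww.
  have gs : selfadj (g - g ** w).
    by apply/selfadjB => //; rewrite /selfadj sstarM hg hw wg.
  (* With [y] the norm of [g / (1 + g^2)], the bound applied to that element itself reads
     [y^2 <= y / 2]. *)
  have n12 : NA (g - g ** w) <= 1 / 2.
    rewrite (cn_sa2 cA gs) in b1.
    by have := cn_ge0 cA (g - g ** w); set y := NA _ in b1 *; nra.
  have e : h - h ** w = (2 * dl ^+ 2)%:C *: (g - g ** w).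
    rewrite /g smulZl -scalerBr scalerA -rmorphM /= /t mulfV ?scale1r//.
    by rewrite gt_eqF ?mulr_gt0.
  have n2 : NA (h - h ** w) <= dl ^+ 2.
    rewrite e (cn_R cA) gtr0_norm ?mulr_gt0//; nra.
  (* [x^* x = (1 - w) (h - h w)] for [x = a - a w], and [b2] says that the left factor does not
     increase the norm. *)
  rewrite -(@ler_pXn2r _ 2) ?nnegrE ?(cn_ge0 cA) ?(ltW d0)// -(cn_star cA).
  apply: le_trans n2; apply: le_trans b2; rewrite sstarB sstarM hw /h.
  by rewrite le_eqVlt; apply/orP; left; apply/eqP; congr NA; alg.
have -> : f a - f (a - a ** w) = f a ** f w by rewrite star_homB fm; lin.
apply: le_trans (cn_M cB _ _) _; rewrite -/dl ler_wpM2l ?(ltW d0)//.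
have [b1 _] := resolvent_bounds fact (f (g ** g)) hg hw wg ww.
(* [f w] arises from [f (g^2)] by the contraction [1 - f w], and [f (g^2)] has norm
   [(t dl^2)^2 = 1 / 4] by the choice of [t]. *)
have e : f w = f (g ** g) - f w ** f (g ** g).
  rewrite -fm -star_homB; congr f; rewrite smulA wg -smulA wg smulA.
  by rewrite -[X in X - _]ww addrK.
rewrite e; apply: le_trans b1 _; rewrite fm.
have fgs : selfadj (f g) by rewrite /selfadj -fs hg.
rewrite (cn_sa2 cB fgs) /g star_homZ (cn_R cB) gtr0_norm// /h fm fs (cn_star cB) -/dl.
rewrite /t invfM mulfVK ?gt_eqF//; lra.
Qed.

(** The estimate behind an open mapping argument. An approximant within [K / 8] has an image of norm
    at most [9 K / 8], but its own norm is uncontrolled; truncation bounds it and costs a quarter of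
    [9 K / 8], for a total error of [13 K / 32]. *)
Lemma range_lift (y : B) (K : R) : 0 < K -> NB y <= K ->
  (forall e, 0 < e -> exists a, NB (y - f a) < e) ->
  exists x, NA x <= 2 * K /\ NB (y - f x) <= K / 2.
Proof.
move=> K0 yK H; have [a ya] := H (K / 8) ltac:(by rewrite divr_gt0).
have hfa : NB (f a) <= 9 * K / 8.
  have := cn_tri cB (f a) y 0; rewrite !subr0 (cn_C cB (f a)); lra.
have [d0|d0] := eqVneq (NB (f a)) 0.
  exists 0; rewrite (cn_0 cA) star_hom0 subr0; split; first by rewrite mulr_ge0// ltW.
  have := cn_tri cB y (f a) 0; rewrite !subr0 d0; lra.
have p0 : 0 < NB (f a) by rewrite lt_neqAle eq_sym d0 (cn_ge0 cB).
have [x [x1 x2]] := range_truncate p0.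
exists x; split; first lra.
have := cn_tri cB y (f a) (f x); lra.
Qed.

(** As in the open mapping theorem, lifts of the successive errors form a geometric series, whose
    sum exists by completeness of [A] and is mapped to [y]. *)
Lemma star_hom_closed_range (y : B) :
  (forall e, 0 < e -> exists a, NB (y - f a) < e) -> exists a, f a = y.
Proof.
move=> H; pose K := NB y + 1; have K0 : 0 < K by rewrite ltr_wpDl ?(cn_ge0 cB).
(* [st] takes a partial sum with a bound on its error and returns the next summand; nothing is
   required of it when the bound fails. *)
have [st Hst] : exists st : A * R -> A, forall sr : A * R, 0 < sr.2 ->
    NB (y - f sr.1) <= sr.2 -> NA (st sr) <= 2 * sr.2 /\ NB (y - f (sr.1 + st sr)) <= sr.2 / 2.
  suff /choice[st Hst] : forall sr : A * R, exists x, 0 < sr.2 ->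
    NB (y - f sr.1) <= sr.2 -> NA x <= 2 * sr.2 /\ NB (y - f (sr.1 + x)) <= sr.2 / 2.
    by exists st.
  move=> [s r] /=; have [r0|] := ltP 0 r; last by exists 0.
  have [yr|] := leP (NB (y - f s)) r; last by exists 0.
  have [e e0|x [x1 x2]] := range_lift r0 yr.
    by have [a ha] := H e e0; exists (a - s); rewrite star_homB opprB addrA subrK.
  by exists x => _ _; split => //; rewrite star_homD opprD addrA.
pose r n := K * 2^-1 ^+ n.
have r0 n : 0 < r n by rewrite mulr_gt0// exprn_gt0// invr_gt0.
pose s := fix s n := if n is n'.+1 then s n' + st (s n', r n') else 0.
have hs n : NB (y - f (s n)) <= r n.
  elim: n => [|n IH]; first by rewrite /= star_hom0 subr0 /r expr0 mulr1 lerDl.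
  rewrite (le_trans (Hst (s n, r n) (r0 n) IH).2)//= /r exprS; lra.
have ds n : NA (s n.+1 - s n) <= 2 * K * 2^-1 ^+ n.
  by rewrite /= addrC addKr -mulrA; exact: (Hst (s n, r n) (r0 n) (hs n)).1.
have h2 : 0 <= (2^-1 : R) < 1 by apply/andP; split; lra.
have [l sl] := cn_complete cA (geometric_cauchys cA (mulr_ge0 (ler0n _ 2) (ltW K0)) h2 ds).
exists l; apply: (lims_uniq cB (u := fun n => f (s n))).
  move=> e /sl[n0 h]; exists n0 => n /h; apply: le_lt_trans.
  by rewrite -star_homB star_hom_contractive.
move=> e e0.
have [n0 hn] : exists n0, forall n, (n0 <= n)%N -> r n < e.
  have /cvgrPdist_lt /(_ e e0) : r n @[n --> \oo] --> 0.
    rewrite -(mulr0 K); apply: cvgMr; apply: cvg_expr.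
    by rewrite gtr0_norm ?invr_gt0//; lra.
  move=> [n0 _ hn0]; exists n0 => n /hn0 /=.
  by rewrite sub0r normrN gtr0_norm.
by exists n0 => n /hn; apply: le_lt_trans; rewrite (cn_C cB).
Qed.
End ClosedRange.

(** * States *)

Section HahnBanach.
Context (R : realType) (V : lmodType R[i]).
Implicit Types (p q : V -> R) (x y : V).

Record sublinear p : Prop := {
  sl_D : forall x y, p (x + y) <= p x + p y;
  sl_Z : forall (t : R) x, 0 < t -> p (t%:C *: x) <= t * p x
}.

Lemma sl_0 p : sublinear p -> p 0 = 0.
Proof.
move=> h; apply/le_anti/andP; split.
  by have := sl_Z h 0 (_ : 0 < 2^-1); rewrite scaler0 invr_gt0 ltr0n => /(_ isT); lra.
by have := sl_D h 0 0; rewrite addr0; lra.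
Qed.

Lemma sl_eqZ p (t : R) x : sublinear p -> 0 <= t -> p (t%:C *: x) = t * p x.
Proof.
move=> h; rewrite le_eqVlt => /predU1P[<-|t0].
  by rewrite rmorph0 scale0r sl_0// mul0r.
apply/le_anti/andP; split; first exact: sl_Z.
have ti : 0 < t^-1 by rewrite invr_gt0.
have := sl_Z h (t%:C *: x) ti; rewrite scalerA -rmorphM /= mulVf ?gt_eqF// scale1r.
by rewrite mulrC ler_pdivlMr// mulrC.
Qed.

Lemma sl_opp p x : sublinear p -> - p (- x) <= p x.
Proof. by move=> h; have := sl_D h x (- x); rewrite subrr sl_0//; lra. Qed.

(** The classical modification of a sublinear functional in the direction [y]: it stays sublinear
    and below [p], and at [- y] it drops to at most [- p y]. Only real [t] occur, so the theory is
    that of the underlying real space. *)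
Definition sl_shift p y x := inf [set p (x + t%:C *: y) - t * p y | t in [set t | 0 <= t]].

Section Shift.
Variables (p : V -> R) (y : V).
Hypothesis h : sublinear p.

Let lbd x : lbound [set p (x + t%:C *: y) - t * p y | t in [set t | 0 <= t]] (- p (- x)).
Proof.
move=> _ [t /= t0 <-]; rewrite -(sl_eqZ y h t0).
by have := sl_D h (x + t%:C *: y) (- x); rewrite addrAC subrr add0r; lra.
Qed.

Lemma sl_shift_le x t : 0 <= t -> sl_shift p y x <= p (x + t%:C *: y) - t * p y.
Proof.
by move=> t0; apply: ge_inf; [exists (- p (- x)); exact: lbd | exists t].
Qed.

Lemma le_sl_shift x (c : R) : (forall t, 0 <= t -> c <= p (x + t%:C *: y) - t * p y) ->
  c <= sl_shift p y x.
Proof.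
move=> H; apply: lb_le_inf; first by exists (p (x + 0%:C *: y) - 0 * p y); exists 0 => /=.
by move=> _ [t /= t0 <-]; exact: H.
Qed.

Lemma sl_shift_sublinear : sublinear (sl_shift p y).
Proof.
split=> [x x'|s x s0].
  rewrite -lerBlDr; apply: le_sl_shift => t t0; rewrite lerBlDr -lerBlDl.
  apply: le_sl_shift => t' t0'; rewrite lerBlDl.
  apply: le_trans (sl_shift_le _ (addr_ge0 t0 t0')) _.
  have := sl_D h (x + t%:C *: y) (x' + t'%:C *: y); rewrite addrACA -scalerDl -rmorphD /=; lra.
rewrite mulrC -ler_pdivrMr//; apply: le_sl_shift => t t0; rewrite ler_pdivrMr//.
apply: le_trans (sl_shift_le _ (mulr_ge0 (ltW s0) t0)) _.
have := sl_Z h (x + t%:C *: y) s0; rewrite scalerDr scalerA -rmorphM /=; lra.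
Qed.

Lemma sl_shift_lep x : sl_shift p y x <= p x.
Proof. by have := sl_shift_le x (lexx 0); rewrite rmorph0 scale0r addr0 mul0r subr0. Qed.

Lemma sl_shift_opp : sl_shift p y (- y) <= - p y.
Proof. by have := sl_shift_le (- y) ler01; rewrite rmorph1 scale1r addNr sl_0// mul1r sub0r. Qed.
End Shift.

(* A minimal sublinear functional is linear, since it equals all its shifts. *)
Lemma sl_minimal p : sublinear p -> exists f, [/\ sublinear f, forall x, f x <= p x &
  forall x, f (- x) = - f x].
Proof.
move=> hp; pose T := {q : V -> R | sublinear q /\ forall x, q x <= p x}.
(* The order is reversed, so that a maximal element for [le] is a minimal functional. *)
pose le (q q' : T) := `[< forall x, sval q' x <= sval q x >].
have [||||[f [hf fp]] fmin] := @Zorn T le.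
- by move=> q; apply/asboolP.
- by move=> a b d /asboolP ab /asboolP bd; apply/asboolP => x; exact: le_trans (bd x) (ab x).
- move=> [q hq] [q' hq'] /asboolP /= h1 /asboolP /= h2; apply: eq_exist.
  by apply/funext => x; apply/le_anti; rewrite h1 h2.
- move=> C tot; have [[q0 Cq0]|C0] := pselect (exists q : T, C q); last first.
    by exists (exist _ p (conj hp (fun=> lexx _))) => s Cs; case: C0; exists s.
  pose im x := [set sval q x | q in C].
  have lb x : has_lbound (im x).
    exists (- p (- x)) => _ [[q [hq qp]] Cq <-] /=.
    by have := sl_opp x hq; have := qp (- x); lra.
  (* The infimum over a nonempty chain is finite because every member lies above
     [x |-> - p (- x)]. *)
  pose g x := inf (im x).
  have gle x (q : T) : C q -> g x <= sval q x by move=> Cq; apply: ge_inf => //; exists q.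
  have leg x (c : R) : (forall q : T, C q -> c <= sval q x) -> c <= g x.
    by move=> H; apply: lb_le_inf; [exists (sval q0 x); exists q0 | move=> _ [q Cq <-]; exact: H].
  have hg : sublinear g.
    split=> [x y|t x t0].
      rewrite -lerBlDr; apply: (leg) => q Cq; rewrite lerBlDr -lerBlDl; apply: (leg) => q' Cq'.
      rewrite lerBlDl; have [/asboolP H|/asboolP H] := tot _ _ Cq Cq'.
        apply: le_trans (gle _ _ Cq') _; apply: le_trans (sl_D (svalP q').1 _ _) _.
        by have := H x; lra.
      apply: le_trans (gle _ _ Cq) _; apply: le_trans (sl_D (svalP q).1 _ _) _.
      by have := H y; lra.
    rewrite mulrC -ler_pdivrMr//; apply: (leg) => q Cq; rewrite ler_pdivrMr// mulrC.
    exact: le_trans (gle _ _ Cq) (sl_Z (svalP q).1 x t0).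
  have gp x : g x <= p x by apply: le_trans (gle x _ Cq0) _; exact: (svalP q0).2.
  by exists (exist _ g (conj hg gp)) => s Cs; apply/asboolP => x /=; exact: gle.
exists f; split => // x.
have sp z : sl_shift f x z <= p z by apply: le_trans (sl_shift_lep x hf z) (fp z).
have e : sl_shift f x = f.
  pose s : T := exist _ (sl_shift f x) (conj (sl_shift_sublinear x hf) sp).
  have H : le (exist _ f (conj hf fp)) s by apply/asboolP => z /=; exact: sl_shift_lep.
  by have /(congr1 sval) := fmin _ H.
apply/le_anti/andP; split; last by have := sl_opp x hf; lra.
by have := sl_shift_opp x hf; rewrite e.
Qed.

(** Minimizing below the shift by [k] forces [f (- k) <= - p k], hence [f k = p k]. The functional
    is real-linear, although [V] is a complex space. *)
Lemma hahn_banach p k : sublinear p -> exists f : V -> R,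
  [/\ forall x y, f (x + y) = f x + f y, forall (t : R) x, f (t%:C *: x) = t * f x,
      forall x, f x <= p x & f k = p k].
Proof.
move=> hp; have [f [hf fp fN]] := sl_minimal (sl_shift_sublinear k hp).
have fD x y : f (x + y) = f x + f y.
  apply/le_anti/andP; split; first exact: sl_D.
  by have := sl_D hf (- x) (- y); rewrite -opprD !fN; lra.
have fp' x : f x <= p x := le_trans (fp x) (sl_shift_lep k hp x).
exists f; split => //.
- move=> t x; have [t0|t0] := leP 0 t; first exact: sl_eqZ.
  have -> : t%:C *: x = - ((- t)%:C *: x) by rewrite rmorphN scaleNr opprK.
  by rewrite fN sl_eqZ// ?oppr_ge0 ?ltW//; lra.
- apply/le_anti; rewrite fp' /=.
  by have := fp (- k); have := sl_shift_opp k hp; rewrite fN; lra.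
Qed.
End HahnBanach.

(** * Positive elements in a unital algebra *)

Section Positivity.
Context (R : realType) (U : starAlgType R) (N : U -> R) (cn : cnorm N).
Variable e : U.
Hypotheses (el : forall x, e ** x = x) (er : forall x, x ** e = x) (e1 : N e = 1).
Implicit Types (a b h k x y z : U).

Lemma selfadj_unit : selfadj e.
Proof. by have := selfadj_mulV e; rewrite er /selfadj sstarK => /esym. Qed.

Lemma selfadjRe (t : R) : selfadj (t%:C *: e).
Proof. exact/selfadjZ/selfadj_unit. Qed.

(* [h] is positive: its spectrum lies in the disc of centre [S] and radius [S]. *)
Definition pos h := selfadj h /\ exists2 S : R, 0 <= S & N (S%:C *: e - h) <= S.

(** The contraction estimate is applied to the unit with [z = e - b], for which [z + z = a^2 + z^2]
    is the last hypothesis. *)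
Lemma sqr_sum_le a b : selfadj a -> selfadj b -> a ** b = b ** a ->
  a ** a + b ** b = e -> N a <= 1.
Proof.
move=> ha hb ab h; have T := star_subalgebraT U.
have [] := @cayley_contractive _ _ _ _ _ _ _ _ _ (self_action cn) T a (e - b) e I I ha.
- by apply/selfadjB => //; exact: selfadj_unit.
- by rewrite smulDr smulDl smulNr smulNl el er ab.
- rewrite -[in X in X + _ = _]h !(smulDl, smulDr, smulNl, smulNr) !el !er.
  by rewrite (_ : e = a ** a + b ** b)//; lin.
- by rewrite er e1.
Qed.

(** Write [h = S (1 - c)] with [|c| <= 1] and take [sqrt S (1 - z)], with [z] from the iteration.
    The root lies in the commutant of every self-adjoint element commuting with [h], and [|z| <= 1]
    makes it positive. *)
Lemma pos_sqrt h : pos h -> exists y, [/\ selfadj y, pos y, y ** y = h &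
  forall x, selfadj x -> x ** h = h ** x -> x ** y = y ** x].
Proof.
move=> [hh [S S0 hS]].
have [S00|Sn] := eqVneq S 0.
  have h0 : h = 0.
    by apply: (cn_eq0 cn); apply/le_anti; rewrite (cn_ge0 cn) andbT -(cn_N cn) -[- h]add0r -(scale0r e) -[0 in X in _ <= X]S00 -(rmorph0 (real_complex R)) -S00.
  exists 0; rewrite h0; split.
  - exact: sstar0.
  - by split; [exact: sstar0 | exists 0 => //; rewrite scale0r subr0 (cn_0 cn)].
  - exact: smul0l.
  - by move=> x _ _; rewrite smul0l smul0r.
have Sp : 0 < S by rewrite lt_neqAle eq_sym Sn.
pose c := e - S^-1%:C *: h.
have hc : selfadj c by apply/selfadjB; [exact: selfadj_unit | exact: selfadjZ].
have cE : c = S^-1%:C *: (S%:C *: e - h).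
  by rewrite scalerBr scalerA -rmorphM /= mulVf// scale1r.
have c1 : N c <= 1 by rewrite cE (cn_R cn) gtr0_norm ?invr_gt0// mulrC ler_pdivrMr// mul1r.
have [z [hz z1 zz zS]] := sqrt_exists cn hc c1.
pose r := Num.sqrt S; have r2 : r * r = S by rewrite -expr2 sqr_sqrtr.
have r0 : 0 < r by rewrite sqrtr_gt0.
have hy : selfadj (r%:C *: (e - z)) by apply/selfadjZ/selfadjB => //; exact: selfadj_unit.
exists (r%:C *: (e - z)); split => //.
- split => //; exists r; first exact: ltW.
  rewrite (_ : _ - _ = r%:C *: z); last by lin.
  by rewrite (cn_R cn) gtr0_norm// ler_piMr// ltW.
- rewrite smulZl smulZr scalerA -rmorphM /= r2.
  transitivity (S%:C *: (e - (z + z) + z ** z)).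
    by congr (_ *: _); rewrite !(smulDl, smulDr, smulNl, smulNr) !el !er; lin.
  rewrite zz /c; transitivity (S%:C *: (S^-1%:C *: h)); first by congr (_ *: _); lin.
  by rewrite scalerA -rmorphM /= mulfV// scale1r.
- move=> x hx xh; rewrite smulZl smulZr smulDl smulDr smulNl smulNr el er.
  congr (_ *: (_ - _)).
  apply/esym; have := zS _ (commutant_subalgebra hx) (commutant_sclosed cn (y := x)).
  by apply; rewrite /= /c smulDl smulDr smulNl smulNr smulZl smulZr el er xh.
Qed.

(** [m^2 - y^2 = m^2 (1 - x^2)] for the contraction [x = y / m], so [m^2] serves as centre and
    radius. *)
Lemma pos_sqr y : selfadj y -> pos (y ** y).
Proof.
move=> hy; split; first exact: selfadj_sqr.
pose m := N y + 1; have m0 : 0 < m by rewrite ltr_wpDl ?(cn_ge0 cn).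
have x1 : N (m^-1%:C *: y) <= 1.
  by rewrite (cn_R cn) gtr0_norm ?invr_gt0// mulrC ler_pdivrMr// mul1r lerDl.
have [_] := selfadj_act1 (self_action cn) (star_subalgebraT U) cn (@sclosedT _ _ _) e I
  (selfadjZ _ hy) x1.
rewrite er e1 => h; exists (m ^+ 2); first exact: sqr_ge0.
have -> : (m ^+ 2)%:C *: e - y ** y = (m ^+ 2)%:C *: (e - m^-1%:C *: y ** (m^-1%:C *: y)).
  rewrite scalerBr !(smulZl, smulZr) !scalerA -!rmorphM /=.
  by rewrite expr2 mulrA mulfK ?gt_eqF// mulfV ?gt_eqF// scale1r.
by rewrite (cn_R cn) ger0_norm ?sqr_ge0// ler_piMr// sqr_ge0.
Qed.

Lemma posD h k : pos h -> pos k -> pos (h + k).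
Proof.
move=> [hh [S S0 hS]] [hk [T T0 hT]]; split; first exact: selfadjD.
exists (S + T); first exact: addr_ge0.
have -> : (S + T)%:C *: e - (h + k) = (S%:C *: e - h) + (T%:C *: e - k).
  by rewrite rmorphD; lin.
by apply: le_trans (cn_D cn _ _) _; exact: lerD.
Qed.

Lemma pos0 : pos 0.
Proof. by split; [exact: sstar0 | exists 0 => //; rewrite scale0r subr0 (cn_0 cn)]. Qed.

Lemma posZ (t : R) h : 0 <= t -> pos h -> pos (t%:C *: h).
Proof.
move=> t0 [hh [S S0 hS]]; split; first exact: selfadjZ.
exists (t * S); first exact: mulr_ge0.
by rewrite rmorphM -scalerA -scalerBr (cn_R cn) ger0_norm// ler_wpM2l.
Qed.

Lemma pos_norm h (t : R) : selfadj h -> N h <= t -> pos (t%:C *: e - h).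
Proof.
move=> hh ht; split; first by apply: selfadjB => //; exact: selfadjRe.
exists t; first exact: le_trans (cn_ge0 cn _) ht.
by rewrite opprB addrCA subrr addr0.
Qed.

Lemma pos_scalar (t : R) : pos (t%:C *: e) -> 0 <= t.
Proof.
move=> [_ [S S0]]; rewrite -scalerBl -rmorphB (cn_R cn) e1 mulr1.
by rewrite ler_norml => /andP[_]; lra.
Qed.

(** For [s > t] the commuting elements [sqrt h / sqrt s] and [sqrt (s - h) / sqrt s] have squares
    with sum one, so [sqr_sum_le] gives [|sqrt h|^2 <= s]. *)
Lemma pos_le h (t : R) : pos h -> pos (t%:C *: e - h) -> N h <= t.
Proof.
move=> ph pt; have hh := ph.1.
have t0 : 0 <= t by have := posD ph pt; rewrite addrC subrK; exact: pos_scalar.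
have [y [hy _ yy yc]] := pos_sqrt ph; have [w [hw _ ww wc]] := pos_sqrt pt.
have yh : y ** h = h ** y by rewrite -yy smulA.
have yw : y ** w = w ** y.
  by apply: wc => //; rewrite smulDl smulDr smulNl smulNr smulZl smulZr el er yh.
suff : N y ^+ 2 <= t by rewrite -(cn_sa2 cn hy) yy.
(* The strict inequality makes [s] positive, so that dividing by [sqrt s] is legitimate; [s] then
   tends to [t]. *)
have H (s : R) : t < s -> N y ^+ 2 <= s.
  move=> ts; have s0 : 0 < s by exact: le_lt_trans ts.
  have ps : pos (s%:C *: e - h).
    have -> : s%:C *: e - h = (s - t)%:C *: (e ** e) + (t%:C *: e - h).
      by rewrite el rmorphB; lin.
    by apply: posD => //; apply: posZ; [rewrite subr_ge0 ltW | apply/pos_sqr/selfadj_unit].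
  have [v [hv _ vv vc]] := pos_sqrt ps.
  have yv : y ** v = v ** y.
    by apply: vc => //; rewrite smulDl smulDr smulNl smulNr smulZl smulZr el er yh.
  pose r := (Num.sqrt s)^-1; have r2 : r * r = s^-1 by rewrite -invfM -expr2 sqr_sqrtr// ltW.
  have r0 : 0 < r by rewrite invr_gt0 sqrtr_gt0.
  have := @sqr_sum_le (r%:C *: y) (r%:C *: v).
  rewrite (cn_R cn) gtr0_norm// => /(_ (selfadjZ _ hy) (selfadjZ _ hv)).
  rewrite !(smulZl, smulZr) yv !scalerA -!rmorphM /= r2 => /(_ erefl).
  have -> : s^-1%:C *: (y ** y) + s^-1%:C *: (v ** v) = e.
    rewrite yy vv; transitivity (s^-1%:C *: (s%:C *: e)); first by lin.
    by rewrite scalerA -rmorphM /= mulVf ?gt_eqF// scale1r.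
  move=> /(_ erefl); rewrite mulrC ler_pdivrMr ?sqrtr_gt0// mul1r => ys.
  by rewrite -(sqr_sqrtr (ltW s0)) lerXn2r// nnegrE ?(cn_ge0 cn) ?sqrtr_ge0.
by apply/ler_addgt0Pr => d d0; apply: H; rewrite ltrDl.
Qed.

Lemma pos_antisym h : pos h -> pos (- h) -> h = 0.
Proof.
move=> h1 h2; apply: (cn_eq0 cn); apply/le_anti; rewrite (cn_ge0 cn) andbT.
by apply: pos_le => //; rewrite scale0r sub0r.
Qed.

Lemma sqr_eq0 y : selfadj y -> y ** y = 0 -> y = 0.
Proof.
move=> hy yy; apply: (cn_eq0 cn); apply/eqP; rewrite -sqrf_eq0.
by rewrite -(cn_sa2 cn hy) yy (cn_0 cn).
Qed.

(** For the real and imaginary parts [a] and [b] of [y] the commutators cancel, and the sum is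
    [2 (a^2 + b^2)]. *)
Lemma pos_mulVD y : pos (sstar y ** y + y ** sstar y).
Proof.
pose a := 2^-1%:C *: (y + sstar y); pose b := (2^-1%:C * 'i) *: (sstar y - y).
have i2 : 'i * 'i = -1 :> R[i] by rewrite -expr2 sqr_i.
have ha : selfadj a by apply/selfadjZ; rewrite /selfadj sstarD sstarK addrC.
have hb : selfadj b.
  have hc : conjc (2^-1%:C * 'i) = - (2^-1%:C * 'i) :> R[i].
    by apply/eqP; rewrite eq_complex /= mulr0 mul0r subrr oppr0 !eqxx.
  by rewrite /selfadj sstarZ sstarB sstarK hc -[y - _]opprB scalerN scaleNr opprK.
have -> : sstar y ** y + y ** sstar y = 2%:C *: (a ** a + b ** b).
  rewrite /a /b !(smulZl, smulZr) !scalerA -!rmorphM /=.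
  have -> : 2^-1%:C * 'i * (2^-1%:C * 'i) = - (2^-1%:C * 2^-1%:C) :> R[i].
    by rewrite mulrACA i2 mulrN1.
  rewrite rmorphM.
  transitivity ((2%:C * (2^-1%:C * 2^-1%:C) * 2) *: (sstar y ** y + y ** sstar y)); last by alg.
  rewrite [X in X *: _](_ : _ = 1) ?scale1r//.
  have -> : 2 = 2%:C :> R[i] by rewrite -(rmorph_nat (real_complex R)).
  by rewrite -!rmorphM -(rmorph1 (real_complex R)) /=; congr (_%:C); field.
by apply: posZ => //; apply: posD; exact: pos_sqr.
Qed.

(* Kaplansky's trick without spectra: for [x = g y^*] both [x^* x = - (y y^* )^2]
   and [x x^* = - g^4] are negative, whereas their sum is positive. *)
Lemma mulV_neg_eq0 y g : selfadj g -> sstar y ** y = - (g ** g) -> y = 0.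
Proof.
move=> hg yg; pose x := g ** sstar y; pose m := y ** sstar y; pose n := g ** g.
have hm : selfadj m by rewrite /selfadj sstarM sstarK.
have hn : selfadj n by exact: selfadj_sqr.
have e1' : sstar x ** x = - (m ** m).
  have -> : sstar x ** x = y ** (g ** g) ** sstar y by rewrite /x sstarM sstarK hg !smulA.
  by rewrite -[g ** g]opprK -yg smulNr smulNl /m !smulA.
have e2' : x ** sstar x = - (n ** n).
  have -> : x ** sstar x = g ** (sstar y ** y) ** g by rewrite /x sstarM sstarK hg !smulA.
  by rewrite yg smulNr smulNl /n !smulA.
have p1 := pos_mulVD x; rewrite e1' e2' -opprD in p1.
have pm := pos_sqr hm; have pn := pos_sqr hn.
have s0 := pos_antisym (posD pm pn) p1.
have n0 : n ** n = 0.
  apply: pos_antisym => //; suff -> : - (n ** n) = m ** m by [].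
  by apply/eqP; rewrite eq_sym -addr_eq0 s0.
have g0 := sqr_eq0 hg (sqr_eq0 hn n0).
apply: (cn_eq0 cn); apply/eqP; rewrite -sqrf_eq0 -(cn_star cn) yg g0 smul0l oppr0.
by rewrite (cn_0 cn).
Qed.

Lemma pos_mulV z : pos (sstar z ** z).
Proof.
pose h := sstar z ** z; have hh : selfadj h := selfadj_mulV z.
have [a [ha pa aa ac]] := pos_sqrt (pos_sqr hh).
have ha_h : h ** a = a ** h by apply: ac => //; rewrite smulA.
have [r [hr _ rr rc]] := pos_sqrt pa.
have hr_h : h ** r = r ** h by exact: rc.
have ra : r ** a = a ** r by rewrite -rr smulA.
(* As [a] is the absolute value of [h], this is twice the negative part of [h]. For [y = z n] one
   has [y^* y = n h n = - (r n)^2], so [z n = 0]; then [n^2 = 0], and [h] equals its absolute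
   value. *)
pose n := a - h; have hn : selfadj n by exact: selfadjB.
have rn : r ** n = n ** r by rewrite smulDr smulDl smulNr smulNl ra hr_h.
have an : a ** n = n ** a by rewrite smulDr smulDl smulNr smulNl ha_h.
have hn_n : h ** n = - (a ** n).
  by rewrite !smulDr !smulNr ha_h aa; lin.
have : z ** n = 0.
  apply: (@mulV_neg_eq0 _ (r ** n)); first by rewrite /selfadj sstarM hr hn rn.
  rewrite sstarM hn smulA -(smulA n) -/h -smulA hn_n smulNr; congr (- _).
  by rewrite -rr {1}rn -!smulA.
move=> zn; have hn0 : h ** n = 0 by rewrite /h -smulA zn smul0r.
have an0 : a ** n = 0 by apply/eqP; rewrite -oppr_eq0 -hn_n hn0.
have nn : n ** n = 0 by rewrite {1}/n smulDl smulNl an0 hn0 subr0.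
have /eqP := sqr_eq0 hn nn; rewrite subr_eq0 => /eqP ah.
by rewrite -/h -ah.
Qed.

Definition re x := 2^-1%:C *: (x + sstar x).

Lemma re_selfadj x : selfadj (re x).
Proof. by apply/selfadjZ; rewrite /selfadj sstarD sstarK addrC. Qed.
Lemma re_id x : selfadj x -> re x = x.
Proof.
move=> hx; rewrite /re hx; transitivity ((2^-1%:C * 2) *: x); first by lin.
by rewrite half2C scale1r.
Qed.
Lemma reD x y : re (x + y) = re x + re y.
Proof. by rewrite /re sstarD; lin. Qed.
Lemma reZ (t : R) x : re (t%:C *: x) = t%:C *: re x.
Proof. by rewrite /re sstarZ conjc_real; lin. Qed.
Lemma re_skew x : sstar x = - x -> re x = 0.
Proof. by move=> h; rewrite /re h subrr scaler0. Qed.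

(** The largest spectral value of the real part of [x]. A real-linear functional dominated by it is
    nonnegative on positive elements and at most one at the unit, which is how Hahn-Banach produces
    a state. *)
Definition upper x := inf [set t : R | pos (t%:C *: e - re x)].

Let upper_lb x : lbound [set t : R | pos (t%:C *: e - re x)] (- N (re x)).
Proof.
move=> t /= pt; suff : 0 <= t + N (re x) by lra.
apply: pos_scalar; have := posD pt (pos_norm (selfadjN (re_selfadj x)) (_ : _ <= N (re x))).
by rewrite (cn_N cn) rmorphD opprK scalerDl addrACA addNr addr0; apply.
Qed.

Lemma upper_le x t : pos (t%:C *: e - re x) -> upper x <= t.
Proof. by move=> h; apply: ge_inf => //; exists (- N (re x)); exact: upper_lb. Qed.

Lemma le_upper x (c : R) : (forall t, pos (t%:C *: e - re x) -> c <= t) -> c <= upper x.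
Proof.
move=> H; apply: lb_le_inf; last by move=> t /=; exact: H.
by exists (N (re x)); exact: pos_norm (re_selfadj x) _.
Qed.

Lemma upper_sublinear : sublinear upper.
Proof.
split=> [x y|t x t0].
  rewrite -lerBlDr; apply: le_upper => t pt; rewrite lerBlDr -lerBlDl.
  apply: le_upper => t' pt'; rewrite lerBlDl; apply: upper_le.
  have := posD pt pt'; congr pos; rewrite reD rmorphD; lin.
rewrite mulrC -ler_pdivrMr//; apply: le_upper => s ps; rewrite ler_pdivrMr// mulrC.
by apply: upper_le; rewrite reZ rmorphM -scalerA -scalerBr; exact: posZ (ltW t0) ps.
Qed.

Lemma exists_state d : exists f : U -> R,
  [/\ forall x y, f (x + y) = f x + f y, forall (t : R) x, f (t%:C *: x) = t * f x,
      forall x, 0 <= f (sstar x ** x), forall x, f (sstar x) = f x &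
      f e <= 1 /\ f (sstar d ** d) = N d ^+ 2].
Proof.
have [f [fD fZ fle fd]] := hahn_banach (sstar d ** d) upper_sublinear.
have fN x : f (- x) = - f x.
  by have := fZ (-1) x; rewrite rmorphN1 scaleN1r mulN1r.
exists f; split => //; last split.
- move=> x; have : f (- (sstar x ** x)) <= 0.
    apply: le_trans (fle _) _; apply: upper_le; rewrite scale0r sub0r re_id ?opprK.
      exact: pos_mulV.
    exact/selfadjN/selfadj_mulV.
  by rewrite fN; lra.
(* A skew element and its negative both have real part zero, so [f] vanishes on it; hence [f] is the
   real part of a Hermitian functional. *)
- move=> x; have sk y : sstar y = - y -> f y = 0.
    have H z : sstar z = - z -> f z <= 0.
      move=> hz; apply: le_trans (fle _) _; apply: upper_le.
      by rewrite re_skew// subr0 scale0r; exact: pos0.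
    move=> hy; apply/le_anti; rewrite H//= -oppr_le0 -fN; apply: H.
    by rewrite sstarN hy.
  have := sk (x - sstar x); rewrite sstarB sstarK opprB fD fN => /(_ erefl); lra.
- apply: le_trans (fle _) _; apply: upper_le.
  by rewrite re_id ?rmorph1 ?scale1r ?subrr; [exact: pos0 | exact: selfadj_unit].
- rewrite fd; apply/le_anti/andP; split.
    apply: upper_le; rewrite re_id; last exact: selfadj_mulV.
    by apply: pos_norm; [exact: selfadj_mulV | rewrite (cn_star cn)].
  apply: le_upper => t; rewrite re_id; last exact: selfadj_mulV.
  by move=> pt; rewrite -(cn_star cn); apply: pos_le => //; exact: pos_mulV.
Qed.

(** The square root of [|a|^2 - a^* a] turns the operator inequality for [a^* a] into an identity,
    to which a positive real-linear functional can be applied directly. *)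
Lemma norm_dominates a x : exists y,
  sstar (a ** x) ** (a ** x) + sstar y ** y = (N a ^+ 2)%:C *: (sstar x ** x).
Proof.
have := pos_norm (selfadj_mulV a) (lexx _); rewrite (cn_star cn).
move=> /pos_sqrt[b [hb _ bb _]]; exists (b ** x).
rewrite !sstarM hb -!smulA (smulA b) bb (smulA (sstar a)).
rewrite -smulDr -smulDl addrC subrK smulZl el smulZr//.
Qed.
End Positivity.

(** * Completeness and operator norms *)

Section Completeness.
Context (R : realType).

Lemma seq_cvg_eps (V : normedModType R[i]) (u : nat -> V) (l : V) : u n @[n --> \oo] --> l ->
  forall e, 0 < e -> exists n0, forall n, (n0 <= n)%N -> nrm (u n - l) < e.
Proof.
move=> /cvgrPdist_lt ul e e0.
have e0' : 0 < e%:C :> R[i] by rewrite ltcR.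
have [n0 _ H] := ul _ e0'; exists n0 => n /H /=.
by rewrite distrC nrm_lt.
Qed.

Lemma nrm_complete (V : completeNormedModType R[i]) (u : nat -> V) :
  (forall e, 0 < e -> exists n0, forall m n, (n0 <= m)%N -> (n0 <= n)%N -> nrm (u m - u n) < e) ->
  exists l, forall e, 0 < e -> exists n0, forall n, (n0 <= n)%N -> nrm (u n - l) < e.
Proof.
move=> h; suff /cvg_ex[l ul] : cvg (u n @[n --> \oo]) by exists l; exact: seq_cvg_eps ul.
apply: cauchy_cvg; apply: cauchy_exP => _ /posC_real[r r0 ->].
have [n0 H] := h _ r0; exists (u n0), n0 => // n /= n0n.
by rewrite -ball_normE /= nrm_lt; exact: H.
Qed.

(** A Cauchy filter contains a ball of radius [1 / (n + 1)] for every [n]. The centres form a Cauchy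
    sequence, and its limit is a limit of the filter. *)
Lemma cauchy_filter_cvg (V : normedModType R[i]) :
  (forall u : nat -> V,
    (forall e, 0 < e -> exists n0, forall m n, (n0 <= m)%N -> (n0 <= n)%N -> nrm (u m - u n) < e) ->
    exists l, forall e, 0 < e -> exists n0, forall n, (n0 <= n)%N -> nrm (u n - l) < e) ->
  forall F : set_system V, ProperFilter F -> cauchy F -> cvg F.
Proof.
move=> sc F PF cF.
have [r0 rpos small] : exists2 r : nat -> R, forall n, 0 < r n &
    forall e, 0 < e -> exists n0, forall n, (n0 <= n)%N -> r n < e.
  exists (fun n => n.+1%:R^-1) => [n|e e0]; first by rewrite invr_gt0.
  exists (Num.truncn e^-1) => n hn; rewrite -ltf_pV2 ?posrE ?invr_gt0// invrK.
  by apply: lt_le_trans (truncnS_gt _) _; rewrite ler_nat ltnS.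
have /choice[u hu] : forall n : nat, exists x : V, F (ball x (r0 n)%:C).
  by move=> n; have [|x Fx] := (cauchyP F).1 cF (r0 n)%:C _; [rewrite ltcR | exists x].
have uP m n : nrm (u m - u n) < r0 m + r0 n.
  have [x []] := filter_ex (filterI (hu m) (hu n)).
  rewrite -!ball_normE /= !nrm_lt => h1 h2.
  have := ler_nrmD (u m - x) (x - u n); rewrite addrA subrK -(nrmN (x - u n)) opprB; lra.
have [e e0|l hl] := sc u.
  have [n0 H] := small _ (divr_gt0 e0 (ltr0n R 2)); exists n0 => m n hm hn.
  by have := uP m n; have := H _ hm; have := H _ hn; lra.
apply/cvg_ex; exists l; apply/cvgrPdist_lt => _ /posC_real[r rp ->].
have r2 := divr_gt0 rp (ltr0n R 2).
have [n1 H1] := small _ r2; have [n2 H2] := hl _ r2.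
apply: filterS (hu (n1 + n2)%N) => x; rewrite -ball_normE /= !nrm_lt => h.
have := H1 _ (leq_addr n2 n1); have := H2 _ (leq_addl n1 n2).
have := ler_nrmD (l - u (n1 + n2)%N) (u (n1 + n2)%N - x).
rewrite addrA subrK -(nrmN (l - _)) opprB; lra.
Qed.

Lemma real_complete (u : nat -> R) :
  (forall e, 0 < e -> exists n0, forall m n, (n0 <= m)%N -> (n0 <= n)%N -> `|u m - u n| < e) ->
  exists l, forall e, 0 < e -> exists n0, forall n, (n0 <= n)%N -> `|u n - l| < e.
Proof.
move=> h; suff /cvg_ex[l ul] : cvg (u n @[n --> \oo]).
  exists l => e e0; move/cvgrPdist_lt : ul => /(_ e e0)[n0 _ H].
  by exists n0 => n /H /=; rewrite distrC.
apply: cauchy_cvg; apply: cauchy_exP => r r0.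
have [n0 H] := h _ r0; exists (u n0), n0 => // n /= n0n.
by rewrite -ball_normE /=; exact: H.
Qed.

Lemma nrm1C : nrm (1 : R[i]^o) = 1.
Proof. by rewrite -[X in nrm X]/(1%:C) nrm_real normr1. Qed.

Lemma Re_le_nrm (k : R[i]) : `|complex.Re k| <= nrm (k : R[i]^o).
Proof.
by rewrite nrmCE -sqrtr_sqr ler_sqrt ?addr_ge0 ?sqr_ge0// lerDl sqr_ge0.
Qed.
Lemma Im_le_nrm (k : R[i]) : `|complex.Im k| <= nrm (k : R[i]^o).
Proof.
by rewrite nrmCE -sqrtr_sqr ler_sqrt ?addr_ge0 ?sqr_ge0// lerDr sqr_ge0.
Qed.
Lemma nrm_le_ReIm (k : R[i]) : nrm (k : R[i]^o) <= `|complex.Re k| + `|complex.Im k|.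
Proof.
rewrite nrmCE -(@ler_pXn2r _ 2) ?nnegrE ?sqrtr_ge0 ?addr_ge0//.
rewrite sqr_sqrtr ?addr_ge0 ?sqr_ge0// sqrrD !real_normK ?num_real//.
by have := normr_ge0 (complex.Re k); have := normr_ge0 (complex.Im k); nra.
Qed.

Lemma complex_complete (u : nat -> R[i]) :
  (forall e, 0 < e -> exists n0, forall m n, (n0 <= m)%N -> (n0 <= n)%N ->
     nrm (u m - u n : R[i]^o) < e) ->
  exists l, forall e, 0 < e -> exists n0, forall n, (n0 <= n)%N -> nrm (u n - l : R[i]^o) < e.
Proof.
move=> h.
have [a ha] : exists l, forall e, 0 < e -> exists n0, forall n, (n0 <= n)%N ->
    `|complex.Re (u n) - l| < e.
  apply: real_complete => e /h[n0 H]; exists n0 => m n hm hn.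
  by rewrite -raddfB; exact: le_lt_trans (Re_le_nrm _) (H _ _ hm hn).
have [b hb] : exists l, forall e, 0 < e -> exists n0, forall n, (n0 <= n)%N ->
    `|complex.Im (u n) - l| < e.
  apply: real_complete => e /h[n0 H]; exists n0 => m n hm hn.
  by rewrite -raddfB; exact: le_lt_trans (Im_le_nrm _) (H _ _ hm hn).
exists (a +i* b) => e e0; have e2 := divr_gt0 e0 (ltr0n R 2).
have [n1 H1] := ha _ e2; have [n2 H2] := hb _ e2; exists (n1 + n2)%N => n hn.
have := H1 _ (leq_trans (leq_addr n2 n1) hn); have := H2 _ (leq_trans (leq_addl n1 n2) hn).
by have := nrm_le_ReIm (u n - (a +i* b)); rewrite !raddfB /=; lra.
Qed.

Lemma cstar_cnorm (A : cstarAlgType R) : cnorm (@nrm R A).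
Proof.
split.
- exact: ler_nrmD.
- exact: nrmZ.
- exact: nrm0_eq0.
- by move=> x y; rewrite -lecR rmorphM /= -!nrmE normrM_le.
- by move=> x; apply: complexI; rewrite rmorphXn /= -!nrmE cstar_identity.
- by move=> u hu; exact: nrm_complete.
Qed.
End Completeness.

Section OperatorNorm.
Context (R : realType) (V : normedModType R[i]) (T : V -> V).

Lemma opnorm_le (K : R) : 0 <= K -> (forall x, nrm (T x) <= K * nrm x) -> opnorm T <= K.
Proof.
move=> K0 H; apply: ge_sup; first by exists (nrm (T 0)), 0; rewrite //= nrm0.
by move=> _ [x /= x1 <-]; apply: le_trans (H x) _; rewrite ler_piMr.
Qed.

Lemma opnorm_ge0 : 0 <= opnorm T.
Proof.
have [hs|hs] := pselect (has_sup [set nrm (T x) | x in [set x | nrm x <= 1]]); last first.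
  by rewrite /opnorm sup_out.
apply: le_trans (nrm_ge0 (T 0)) _; apply: ub_le_sup; first by case: hs.
by exists 0; rewrite //= nrm0.
Qed.

(** Some bound has to be given because [sup] takes a default value on an unbounded set. *)
Lemma le_opnorm x : (forall (k : R[i]) x, T (k *: x) = k *: T x) ->
  (exists K, forall x, nrm (T x) <= K * nrm x) -> nrm (T x) <= opnorm T * nrm x.
Proof.
move=> TZ [K HK]; have [x0|x0] := eqVneq (nrm x) 0.
  by have := HK x; rewrite x0 !mulr0.
have p : 0 < nrm x by rewrite lt_neqAle eq_sym x0 nrm_ge0.
rewrite -ler_pdivrMr// mulrC.
have h r y : 0 < r -> nrm (r%:C *: y : V) = r * nrm y by move=> r0; rewrite nrmZ nrm_real gtr0_norm.
have pi : 0 < (nrm x)^-1 by rewrite invr_gt0.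
rewrite -h// -TZ; apply: ub_le_sup.
  exists `|K| => _ [y /= y1 <-]; apply: le_trans (HK y) _.
  apply: le_trans (ler_wpM2r (nrm_ge0 y) (ler_norm K)) _.
  by rewrite ler_piMr.
by exists ((nrm x)^-1%:C *: x) => //=; rewrite h// mulVf.
Qed.
End OperatorNorm.

(** * The unitization of a C*-algebra *)

Section Unitization.
Context (R : realType) (A : cstarAlgType R).
Let cn := cstar_cnorm A.

Definition unitz : Type := (A * R[i]^o)%type.
HB.instance Definition _ := GRing.Lmodule.on unitz.
Implicit Types z w : unitz.

Definition uz_mul z w : unitz := (z.1 ** w.1 + z.2 *: w.1 + w.2 *: z.1, z.2 * w.2).
Definition uz_star z : unitz := (sstar z.1, conjc z.2).

Lemma uz_mulA z1 z2 z3 : uz_mul z1 (uz_mul z2 z3) = uz_mul (uz_mul z1 z2) z3.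
Proof.
case: z1 z2 z3 => [a k] [b l] [d m]; rewrite /uz_mul /=; congr (_, _); last by rewrite mulrA.
by rewrite !scalerDr !scalerA; rewrite ?(smulDl, smulDr, smulZl, smulZr, smulA) (mulrC m l) (mulrC m k); lin.
Qed.
Lemma uz_mul_linear_r z : linear (uz_mul z).
Proof.
case: z => a k r [b l] [d m]; congr (_, _); rewrite /=; last first.
  by rewrite -[_ *: l]/(r * l) -[_ *: (k * l)]/(r * (k * l)); ring.
rewrite -[_ *: l]/(r * l); rewrite !smulDr !smulZr; lin.
Qed.
Lemma uz_mul_linear_l w : linear (fun z => uz_mul z w).
Proof.
case: w => a k r [b l] [d m]; congr (_, _); rewrite /=; last first.
  by rewrite -[_ *: l]/(r * l) -[_ *: (l * k)]/(r * (l * k)); ring.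
rewrite -[_ *: l]/(r * l); rewrite !smulDl !smulZl; lin.
Qed.
Lemma uz_starK z : uz_star (uz_star z) = z.
Proof. by case: z => a k; rewrite /uz_star /= sstarK conjcK. Qed.
Lemma uz_starM z w : uz_star (uz_mul z w) = uz_mul (uz_star w) (uz_star z).
Proof.
case: z w => a k [b l]; rewrite /uz_star /uz_mul /=; congr (_, _).
  by rewrite !sstarD !sstarZ sstarM addrAC.
by rewrite rmorphM mulrC.
Qed.
Lemma uz_star_conj_linear (k : R[i]) z w :
  uz_star (k *: z + w) = conjc k *: uz_star z + uz_star w.
Proof.
case: z w => a l [b m]; rewrite /uz_star /=; congr (_, _); first by rewrite sstarD sstarZ.
by rewrite -[_ *: l]/(k * l) rmorphD rmorphM.
Qed.
HB.instance Definition _ := Lmodule_isStarAlgebra.Build R unitz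
  uz_mulA uz_mul_linear_r uz_mul_linear_l uz_starK uz_starM uz_star_conj_linear.

Definition uz_e : unitz := (0, 1).
Lemma uz_el z : uz_e ** z = z.
Proof.
case: z => a k; rewrite -[LHS]/(uz_mul _ _) /uz_mul /=; congr (_, _); last by rewrite mul1r.
by rewrite smul0l scale1r scaler0 add0r addr0.
Qed.
Lemma uz_er z : z ** uz_e = z.
Proof.
case: z => a k; rewrite -[LHS]/(uz_mul _ _) /uz_mul /=; congr (_, _); last by rewrite mulr1.
by rewrite smul0r scale1r scaler0 !add0r.
Qed.

Definition uz_op z (x : A) := z.1 ** x + z.2 *: x.
Definition uz_seminorm z := opnorm (uz_op z).
(* The second term makes this a norm even when [A] is already unital. *)
Definition uz_norm z := Num.max (uz_seminorm z) (nrm z.2).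

Lemma uz_op_bound z : exists K, forall x, nrm (uz_op z x) <= K * nrm x.
Proof.
exists (nrm z.1 + nrm z.2) => x; apply: le_trans (ler_nrmD _ _) _.
by rewrite mulrDl lerD// ?nrmZ// (cn_M cn).
Qed.
Lemma uz_opZ z (k : R[i]) x : uz_op z (k *: x) = k *: uz_op z x.
Proof. by rewrite /uz_op smulZr; lin. Qed.
Lemma uz_opP z x : nrm (uz_op z x) <= uz_seminorm z * nrm x.
Proof. apply: le_opnorm; [exact: uz_opZ | exact: uz_op_bound]. Qed.
Lemma uz_seminorm_le z K : 0 <= K -> (forall x, nrm (uz_op z x) <= K * nrm x) ->
  uz_seminorm z <= K.
Proof. exact: opnorm_le. Qed.
Lemma uz_seminorm_ge0 z : 0 <= uz_seminorm z. Proof. exact: opnorm_ge0. Qed.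

Lemma uz_opM z w x : uz_op (z ** w) x = uz_op z (uz_op w x).
Proof.
rewrite -[z ** w]/(uz_mul z w) /uz_op /uz_mul /=.
by rewrite !smulDl !smulDr !smulZl !smulZr smulA; lin.
Qed.

Lemma uz_op_star z x : sstar (uz_op z x) ** uz_op z x = sstar x ** uz_op (sstar z ** z) x.
Proof.
rewrite uz_opM; move: {2 3}(uz_op z x) => y.
rewrite /uz_op sstarD sstarM sstarZ -[sstar z]/(uz_star z) /uz_star /=.
by rewrite !smulDl !smulDr !smulZl !smulZr smulA.
Qed.

(** [|z x|^2 = |x^* (z^* z x)| <= |x|^2 |z^* z|], where all vectors lie in the ideal [A] and its own
    C*-identity is used. *)
Lemma uz_seminorm_star z : uz_seminorm z ^+ 2 <= uz_seminorm (sstar z ** z).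
Proof.
set K := uz_seminorm (_ ** _); have K0 : 0 <= K by exact: uz_seminorm_ge0.
rewrite -(sqr_sqrtr K0) lerXn2r// ?nnegrE ?sqrtr_ge0 ?uz_seminorm_ge0//.
apply: uz_seminorm_le; first exact: sqrtr_ge0.
move=> x; rewrite -(@ler_pXn2r _ 2) ?nnegrE ?mulr_ge0 ?nrm_ge0 ?sqrtr_ge0//.
rewrite -(cn_star cn) uz_op_star exprMn sqr_sqrtr//.
apply: le_trans (cn_M cn _ _) _; rewrite (cn_V cn) expr2 mulrCA ler_wpM2l ?nrm_ge0//.
exact: uz_opP.
Qed.

Lemma uz_seminormM z w : uz_seminorm (z ** w) <= uz_seminorm z * uz_seminorm w.
Proof.
apply: uz_seminorm_le => [|x]; first by rewrite mulr_ge0 ?uz_seminorm_ge0.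
rewrite uz_opM; apply: le_trans (uz_opP _ _) _.
by rewrite -mulrA ler_wpM2l ?uz_seminorm_ge0// uz_opP.
Qed.

Lemma uz_seminorm_le_star z : uz_seminorm z <= uz_seminorm (sstar z).
Proof.
have [->|x0] := eqVneq (uz_seminorm z) 0; first exact: uz_seminorm_ge0.
have p : 0 < uz_seminorm z by rewrite lt_neqAle eq_sym x0 uz_seminorm_ge0.
rewrite -(ler_pM2r p) -expr2; apply: le_trans (uz_seminorm_star z) _.
exact: uz_seminormM.
Qed.

Lemma uz_seminorm_inc (a : A) : nrm a <= uz_seminorm (a, 0).
Proof.
have [->|x0] := eqVneq (nrm a) 0; first exact: uz_seminorm_ge0.
have p : 0 < nrm a by rewrite lt_neqAle eq_sym x0 nrm_ge0.
have := uz_opP (a, 0) (sstar a); rewrite /uz_op /= scale0r addr0.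
by rewrite -{1}(sstarK a) (cn_star cn) (cn_V cn) expr2 ler_pM2r.
Qed.

Lemma uz_norm_inc (a : A) : uz_norm (a, 0) = nrm a.
Proof.
rewrite /uz_norm /= (@nrm0 R R[i]^o) max_l ?uz_seminorm_ge0//; apply/le_anti.
rewrite uz_seminorm_inc andbT; apply: uz_seminorm_le; first exact: nrm_ge0.
by move=> x; rewrite /uz_op /= scale0r addr0; exact: (cn_M cn).
Qed.

Lemma uz_norm1 : uz_norm uz_e = 1.
Proof.
rewrite /uz_norm /uz_e /= nrm1C max_r//.
apply: uz_seminorm_le => // x; rewrite /uz_op /= smul0l add0r scale1r mul1r//.
Qed.

Lemma uz_cnorm : cnorm uz_norm.
Proof.
split.
- move=> z w; rewrite ge_max; apply/andP; split; last first.
    by apply: le_trans (ler_nrmD _ _) _; rewrite lerD// le_max lexx orbT.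
  apply: le_trans (_ : uz_seminorm z + uz_seminorm w <= _).
    apply: uz_seminorm_le => [|x]; first by rewrite addr_ge0 ?uz_seminorm_ge0.
    have -> : uz_op (z + w) x = uz_op z x + uz_op w x.
      by rewrite /uz_op /= smulDl; lin.
    by apply: le_trans (ler_nrmD _ _) _; rewrite mulrDl lerD// uz_opP.
  by rewrite lerD// le_max lexx.
- have le k z : uz_seminorm (k *: z) <= nrm (k : R[i]^o) * uz_seminorm z.
    apply: uz_seminorm_le => [|x]; first by rewrite mulr_ge0 ?nrm_ge0 ?uz_seminorm_ge0.
    have -> : uz_op (k *: z) x = k *: uz_op z x.
      by rewrite /uz_op /= smulZl -[k *: z.2]/(k * z.2); lin.
    by rewrite nrmZ -mulrA ler_wpM2l ?nrm_ge0// uz_opP.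
  have eq k z : uz_seminorm (k *: z) = nrm (k : R[i]^o) * uz_seminorm z.
    have [->|k0] := eqVneq k 0.
      rewrite (@nrm0 R R[i]^o) mul0r; apply/le_anti; rewrite uz_seminorm_ge0 andbT.
      by have := le 0 z; rewrite (@nrm0 R R[i]^o) mul0r.
    apply/le_anti; rewrite le /=.
    have n0 : 0 < nrm (k : R[i]^o).
      rewrite lt_neqAle nrm_ge0 andbT eq_sym; apply/eqP => /nrm0_eq0 /eqP.
      by rewrite (negPf k0).
    have := le k^-1 (k *: z); rewrite scalerA mulVf// scale1r.
    rewrite -(ler_pM2l n0) mulrA -nrmM mulfV//.
    by rewrite nrm1C mul1r.
  move=> k z; rewrite /uz_norm eq -[(k *: z).2]/(k * z.2) nrmM maxr_pMr//.
  exact: nrm_ge0.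
- move=> [a k] h; have k0 : nrm k <= 0 by rewrite -h le_max lexx orbT.
  have {}k0 : k = 0 by apply: nrm0_eq0; apply/le_anti; rewrite k0 nrm_ge0.
  by move: h; rewrite k0 uz_norm_inc => /nrm0_eq0 ->.
- move=> z w; rewrite ge_max; apply/andP; split.
    apply: le_trans (uz_seminormM _ _) _; rewrite ler_pM ?uz_seminorm_ge0// le_max lexx//.
  rewrite -[z ** w]/(uz_mul z w) /= nrmM ler_pM ?nrm_ge0// le_max lexx orbT//.
- move=> z; have hm : uz_seminorm (sstar z ** z) = uz_seminorm z ^+ 2.
    apply/le_anti; rewrite uz_seminorm_star andbT.
    apply: le_trans (uz_seminormM _ _) _; rewrite expr2 ler_wpM2r ?uz_seminorm_ge0//.
    by rewrite -{2}(sstarK z) uz_seminorm_le_star.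
  rewrite /uz_norm hm -[sstar z ** z]/(uz_mul (uz_star z) z) /= nrmM nrm_conj -expr2.
  have h1 := uz_seminorm_ge0 z; have h2 := nrm_ge0 z.2.
  by case: (leP (uz_seminorm z) (nrm z.2)) => h;
    case: (leP (uz_seminorm z ^+ 2) (nrm z.2 ^+ 2)) => // h'; apply/le_anti; apply/andP; split => //; nra.
- move=> u hu.
  have [k hk] : exists l, forall e, 0 < e -> exists n0, forall n, (n0 <= n)%N ->
      nrm ((u n).2 - l : R[i]^o) < e.
    apply: complex_complete => e /hu[n0 H]; exists n0 => m n hm hn.
    by apply: le_lt_trans (H _ _ hm hn); rewrite /uz_norm le_max lexx orbT.
  (* The scalar part is controlled by the second term of the norm; subtracting it from the action
     leaves multiplication by the component in [A]. *)
  have bnd m n : nrm ((u m).1 - (u n).1) <= 2 * uz_norm (u m - u n).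
    apply: le_trans (uz_seminorm_inc _) _; apply: uz_seminorm_le.
      by rewrite mulr_ge0// le_max uz_seminorm_ge0.
    move=> x; have -> : uz_op ((u m).1 - (u n).1, 0) x =
        uz_op (u m - u n) x - (u m - u n).2 *: x by rewrite /uz_op /=; lin.
    apply: le_trans (ler_nrmD _ _) _; rewrite nrmN nrmZ.
    have h1 : uz_seminorm (u m - u n) <= uz_norm (u m - u n) by rewrite le_max lexx.
    have h2 : nrm (u m - u n).2 <= uz_norm (u m - u n) by rewrite le_max lexx orbT.
    have := uz_opP (u m - u n) x; have := nrm_ge0 x; nra.
  have [a ha] : exists l, forall e, 0 < e -> exists n0, forall n, (n0 <= n)%N ->
      nrm ((u n).1 - l) < e.
    apply: nrm_complete => e e0; have [n0 H] := hu _ (divr_gt0 e0 (ltr0n R 2)).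
    by exists n0 => m n hm hn; have := bnd m n; have := H _ _ hm hn; lra.
  exists (a, k) => e e0; have e2 := divr_gt0 e0 (ltr0n R 2).
  have [n1 H1] := ha _ e2; have [n2 H2] := hk _ e2; exists (n1 + n2)%N => n hn.
  have h1 := H1 _ (leq_trans (leq_addr n2 n1) hn).
  have h2 := H2 _ (leq_trans (leq_addl n1 n2) hn).
  rewrite /uz_norm gt_max /=; apply/andP; split; last by rewrite (lt_trans h2)//; lra.
  apply: le_lt_trans (_ : nrm ((u n).1 - a) + nrm ((u n).2 - k) < _); last by lra.
  apply: uz_seminorm_le => [|x]; first by rewrite addr_ge0 ?nrm_ge0.
  apply: le_trans (ler_nrmD _ _) _; rewrite mulrDl lerD// ?nrmZ//.
  exact: (cn_M cn).
Qed.
End Unitization.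

(** * The Gelfand-Naimark theorem *)

Section PreHilbert.
Context (R : realType) (V : lmodType R[i]).

Record semi_ip (s : V -> V -> R[i]) (n2 : V -> R) : Prop := {
  ip_linear : forall x k y z, s x (k *: y + z) = k * s x y + s x z;
  ip_conj : forall x y, conjc (s x y) = s y x;
  ip_diag : forall x, s x x = (n2 x)%:C;
  ip_ge0 : forall x, 0 <= n2 x
}.

Context (s : V -> V -> R[i]) (n2 : V -> R) (H : semi_ip s n2).
Implicit Types (x y z v w : V) (k : R[i]) (F : V -> R[i]).

Lemma ipDr x y z : s x (y + z) = s x y + s x z.
Proof. by have := ip_linear H x 1 y z; rewrite scale1r mul1r. Qed.
Lemma ip0r x : s x 0 = 0.
Proof. by apply: (addrI (s x 0)); rewrite -ipDr !addr0. Qed.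
Lemma ipZr x k y : s x (k *: y) = k * s x y.
Proof. by have := ip_linear H x k y 0; rewrite ip0r !addr0. Qed.
Lemma ipBr x y z : s x (y - z) = s x y - s x z.
Proof. by rewrite ipDr -scaleN1r ipZr mulN1r. Qed.
Lemma ipZl x k y : s (k *: x) y = conjc k * s x y.
Proof. by rewrite -(ip_conj H) ipZr conjcM (ip_conj H). Qed.
Lemma ipDl x y z : s (x + y) z = s x z + s y z.
Proof. by rewrite -(ip_conj H) ipDr conjcD !(ip_conj H). Qed.
Lemma ipBl x y z : s (x - y) z = s x z - s y z.
Proof. by rewrite -(ip_conj H) ipBr conjcB !(ip_conj H). Qed.

Local Notation N k := (nrm (k : R[i]^o)).
Definition sn x := Num.sqrt (n2 x).

Lemma sn_ge0 x : 0 <= sn x. Proof. exact: sqrtr_ge0. Qed.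
Lemma sn_sq x : sn x ^+ 2 = n2 x. Proof. by rewrite sqr_sqrtr ?(ip_ge0 H). Qed.

Lemma n2Z k x : n2 (k *: x) = N k ^+ 2 * n2 x.
Proof.
by apply: complexI; rewrite rmorphM /= -!(ip_diag H) ipZr ipZl mulrA (mulrC k) conjM_nrm.
Qed.

Lemma snZ k x : sn (k *: x) = N k * sn x.
Proof. by rewrite /sn n2Z sqrtrM ?sqr_ge0// sqrtr_sqr ger0_norm ?nrm_ge0. Qed.

Lemma ip_cs x y : N (s x y) <= sn x * sn y.
Proof.
set C := N (s x y) ^+ 2.
have key (t : R) : 0 <= n2 x - 2 * t * C + t ^+ 2 * C * n2 y.
  pose l := t%:C * conjc (s x y).
  have e : (n2 (x - l *: y))%:C = (n2 x - 2 * t * C + t ^+ 2 * C * n2 y)%:C.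
    rewrite -(ip_diag H) ipBr !ipBl !ipZr !ipZl (ip_diag H) -(ip_conj H x y) /l.
    rewrite conjcM conjcK conjc_real (ip_diag H).
    have -> : (n2 x - 2 * t * C + t ^+ 2 * C * n2 y)%:C =
        (n2 x)%:C - 2 * t%:C * C%:C + t%:C ^+ 2 * C%:C * (n2 y)%:C by ring.
    by rewrite -conjM_nrm; ring.
  by have := ip_ge0 H (x - l *: y); move: e => /complexI ->.
suff : C <= n2 x * n2 y.
  move=> h; rewrite -(@ler_pXn2r _ 2) ?nnegrE ?nrm_ge0 ?mulr_ge0 ?sn_ge0//.
  by rewrite exprMn !sn_sq.
have C0 : 0 <= C by exact: sqr_ge0.
have x0 := ip_ge0 H x; have y0 := ip_ge0 H y.
(* For a degenerate [y] the polynomial in [t] is affine, and a large [t] makes it negative unless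
   [C = 0]. Otherwise it is evaluated at its minimum. *)
have [y00|yn] := eqVneq (n2 y) 0.
  rewrite y00 mulr0 leNgt; apply/negP => Cp.
  have := key ((n2 x + 1) / (2 * C)); rewrite y00 mulr0 addr0.
  have -> : 2 * ((n2 x + 1) / (2 * C)) * C = n2 x + 1 by field; lra.
  lra.
have yp : 0 < n2 y by rewrite lt_neqAle eq_sym yn.
have := key (n2 y)^-1.
have -> : n2 x - 2 * (n2 y)^-1 * C + (n2 y)^-1 ^+ 2 * C * n2 y = n2 x - C / n2 y by field.
by rewrite subr_ge0 ler_pdivrMr.
Qed.

(* [F] is within [d] of the functional [s _ v], uniformly on the unit ball; the
   completion consists of the conjugate-linear functionals that can be approximated. *)
Definition approx F v (d : R) := forall w, N (F w - s w v) <= d * sn w.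

Definition approximable : {pred (V -> R[i])} :=
  fun F => `[< forall d, 0 < d -> exists v, approx F v d >].

Lemma approx_comb F F' v v' d d' k : approx F v d -> approx F' v' d' ->
  approx (k *: F + F') (k *: v + v') (N k * d + d').
Proof.
move=> h h' w; rewrite (ip_linear H).
have -> : (k *: F + F') w - (k * s w v + s w v') = k * (F w - s w v) + (F' w - s w v').
  by rewrite -[(k *: F + F') w]/(k * F w + F' w); ring.
apply: le_trans (ler_nrmD _ _) _; by rewrite nrmM mulrDl lerD// -mulrA ler_wpM2l ?nrm_ge0.
Qed.

Lemma approximable_submod : submod_closed approximable.
Proof.
split; first by apply/asboolP => d d0; exists 0 => w; rewrite ip0r subr0 (@nrm0 R R[i]^o) mulr_ge0 ?sn_ge0 ?ltW.
move=> k F F' /asboolP h /asboolP h'; apply/asboolP => d d0.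
pose a := d / 2 / (N k + 1).
have k1 : 0 < N k + 1 by rewrite ltr_wpDl ?nrm_ge0.
have a0 : 0 < a by rewrite !divr_gt0.
have [v hv] := h _ a0; have [v' hv'] := h' _ (divr_gt0 d0 (ltr0n R 2)).
exists (k *: v + v') => w; apply: le_trans (approx_comb k hv hv' w) _.
rewrite ler_wpM2r ?sn_ge0//.
have : N k * a <= d / 2.
  by rewrite /a mulrC mulrAC ler_pdivrMr// ler_wpM2l ?lerDl// ltW// divr_gt0.
lra.
Qed.

HB.instance Definition _ :=
  GRing.isSubmodClosed.Build R[i] (V -> R[i]) approximable approximable_submod.

(** A vector of seminorm zero gives the zero functional, so passing to functionals performs the
    quotient and the completion at once. *)
Record hcompl := HCompl { hfun :> V -> R[i]; hfunP : hfun \in approximable }.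
HB.instance Definition _ := [isSub for hfun].
HB.instance Definition _ := [Choice of hcompl by <:].
HB.instance Definition _ := [SubChoice_isSubLmodule of hcompl by <:].
Implicit Types f g : hcompl.

Lemma hfun_inj f g : hfun f = hfun g -> f = g. Proof. exact: val_inj. Qed.
Lemma hfunZ k f w : (k *: f) w = k * f w. Proof. by []. Qed.

Lemma hcomplP f d : 0 < d -> exists v, approx f v d.
Proof. by move=> d0; have /asboolP := hfunP f; apply. Qed.

Lemma hemb_subproof v : (fun w => s w v) \in approximable.
Proof.
by apply/asboolP => d d0; exists v => w; rewrite subrr (@nrm0 R R[i]^o) mulr_ge0 ?sn_ge0 ?ltW.
Qed.
Definition hemb v : hcompl := HCompl (hemb_subproof v).

Lemma approx_bound F v d w : approx F v d -> N (F w) <= (sn v + d) * sn w.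
Proof.
move=> h; have := ler_nrmD (F w - s w v : R[i]^o) (s w v); rewrite subrK.
by have := h w; have := ip_cs w v; have := sn_ge0 w; nra.
Qed.

Lemma eps_eq0 (t : R) : (forall d, 0 < d -> t <= d) -> t <= 0.
Proof. by move=> h; apply/ler_addgt0Pr => d d0; rewrite add0r; exact: h. Qed.

Lemma scale_eps (a K : R) : 0 <= K -> (forall d, 0 < d -> a <= d * K) -> a <= 0.
Proof.
move=> K0 h; apply: eps_eq0 => d d0; have K1 : 0 < K + 1 by rewrite ltr_wpDl.
apply: le_trans (h _ (divr_gt0 d0 K1)) _; rewrite mulrAC ler_pdivrMr//.
by rewrite ler_wpM2l ?lerDl ?ltW.
Qed.

Lemma hfun_conjZ f k w : f (k *: w) = conjc k * f w.
Proof.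
apply/eqP; rewrite -subr_eq0; apply/eqP/(@nrm0_eq0 R R[i]^o)/le_anti; rewrite nrm_ge0 andbT.
apply: (@scale_eps _ (2 * N k * sn w)) => [|d d0]; first by rewrite !mulr_ge0 ?nrm_ge0 ?sn_ge0.
have [v hv] := hcomplP f d0.
have -> : f (k *: w) - conjc k * f w =
    (f (k *: w) - s (k *: w) v) - conjc k * (f w - s w v) by rewrite ipZl; ring.
apply: le_trans (ler_nrmD _ _) _; rewrite nrmN nrmM nrm_conj.
have := hv (k *: w); have := hv w; rewrite snZ; have := nrm_ge0 (k : R[i]^o); nra.
Qed.

Lemma hfun_D f w w' : f (w + w') = f w + f w'.
Proof.
apply/eqP; rewrite -subr_eq0; apply/eqP/(@nrm0_eq0 R R[i]^o)/le_anti; rewrite nrm_ge0 andbT.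
apply: (@scale_eps _ (sn (w + w') + sn w + sn w')) => [|d d0]; first by rewrite !addr_ge0 ?sn_ge0.
have [v hv] := hcomplP f d0.
have -> : f (w + w') - (f w + f w') =
    (f (w + w') - s (w + w') v) - ((f w - s w v) + (f w' - s w' v)) by rewrite ipDl; ring.
apply: le_trans (ler_nrmD _ _) _; rewrite nrmN.
have := ler_nrmD (f w - s w v : R[i]^o) (f w' - s w' v).
have := hv (w + w'); have := hv w; have := hv w'; lra.
Qed.

Definition hnorm f : R := sup [set N (f w) | w in [set w | sn w <= 1]].

Lemma hnorm_le f K : 0 <= K -> (forall w, N (f w) <= K * sn w) -> hnorm f <= K.
Proof.
move=> K0 h; apply: ge_sup.
  by exists (N (f 0)), 0; rewrite //= -(scale0r (0 : V)) snZ (@nrm0 R R[i]^o) mul0r.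
by move=> _ [w /= w1 <-]; apply: le_trans (h w) _; rewrite ler_piMr.
Qed.

Lemma hfun_bound f : exists2 K, 0 <= K & forall w, N (f w) <= K * sn w.
Proof.
have [v hv] := hcomplP f ltr01; exists (sn v + 1); first by rewrite addr_ge0 ?sn_ge0.
by move=> w; exact: approx_bound.
Qed.

Lemma hnorm_ge0 f : 0 <= hnorm f.
Proof.
have [K K0 hK] := hfun_bound f; apply: le_trans (nrm_ge0 (f 0 : R[i]^o)) _; apply: ub_le_sup.
  by exists K => _ [w /= w1 <-]; apply: le_trans (hK w) _; rewrite ler_piMr.
by exists 0; rewrite //= -(scale0r (0 : V)) snZ (@nrm0 R R[i]^o) mul0r.
Qed.

Lemma hnormP f w : N (f w) <= hnorm f * sn w.
Proof.
have [K K0 hK] := hfun_bound f.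
have [x0|x0] := eqVneq (sn w) 0; first by have := hK w; rewrite x0 !mulr0.
have p : 0 < sn w by rewrite lt_neqAle eq_sym x0 sn_ge0.
have pi : 0 < (sn w)^-1 by rewrite invr_gt0.
rewrite -ler_pdivrMr// mulrC.
have -> : (sn w)^-1 * N (f w) = N (f ((sn w)^-1%:C *: w)).
  by rewrite hfun_conjZ nrmM nrm_conj nrm_real gtr0_norm.
apply: ub_le_sup.
  by exists K => _ [y /= y1 <-]; apply: le_trans (hK y) _; rewrite ler_piMr.
by exists ((sn w)^-1%:C *: w) => //=; rewrite snZ nrm_real gtr0_norm// mulVf.
Qed.

Lemma hnorm_emb v : hnorm (hemb v) = sn v.
Proof.
apply/le_anti/andP; split.
  by apply: hnorm_le => [|w]; [exact: sn_ge0 | rewrite mulrC; exact: ip_cs].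
have [->|x0] := eqVneq (sn v) 0; first exact: hnorm_ge0.
have p : 0 < sn v by rewrite lt_neqAle eq_sym x0 sn_ge0.
have := hnormP (hemb v) v; rewrite /= (ip_diag H) nrm_real ger0_norm ?(ip_ge0 H)//.
by rewrite -sn_sq expr2 ler_pM2r.
Qed.

Lemma hnormD f g : hnorm (f + g) <= hnorm f + hnorm g.
Proof.
apply: hnorm_le => [|w]; first by rewrite addr_ge0 ?hnorm_ge0.
by apply: le_trans (ler_nrmD _ _) _; rewrite mulrDl lerD// hnormP.
Qed.

Lemma hnormZ k f : hnorm (k *: f) = N k * hnorm f.
Proof.
have le l g : hnorm (l *: g) <= N l * hnorm g.
  apply: hnorm_le => [|w]; first by rewrite mulr_ge0 ?nrm_ge0 ?hnorm_ge0.
  by rewrite hfunZ nrmM -mulrA ler_wpM2l ?nrm_ge0// hnormP.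
have [->|k0] := eqVneq k 0.
  rewrite (@nrm0 R R[i]^o) mul0r; apply/le_anti; rewrite hnorm_ge0 andbT.
  by have := le 0 f; rewrite (@nrm0 R R[i]^o) mul0r.
apply/le_anti; rewrite le /=.
have n0 : 0 < N k.
  by rewrite lt_neqAle nrm_ge0 andbT eq_sym; apply/eqP => /nrm0_eq0 /eqP; rewrite (negPf k0).
have := le k^-1 (k *: f); rewrite scalerA mulVf// scale1r.
by rewrite -(ler_pM2l n0) mulrA -nrmM mulfV// nrm1C mul1r.
Qed.

Lemma hnorm_eq0 f : hnorm f = 0 -> f = 0.
Proof.
move=> h; apply: hfun_inj; apply/funext => w; apply: (@nrm0_eq0 R R[i]^o).
by apply/le_anti; rewrite nrm_ge0 andbT; have := hnormP f w; rewrite h mul0r.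
Qed.

Let normC f : R[i] := (hnorm f)%:C.
Let normC_D f g : normC (f + g) <= normC f + normC g.
Proof. by rewrite -rmorphD lecR hnormD. Qed.
Let normC_Z (k : R[i]) f : normC (k *: f) = `|k| * normC f.
Proof. by rewrite /normC hnormZ rmorphM; congr (_ * _); rewrite -(@nrmE R R[i]^o). Qed.
Let normC_eq0 f : normC f = 0 -> f = 0.
Proof. by move=> /complexI; exact: hnorm_eq0. Qed.
HB.instance Definition _ :=
  Lmodule_isNormed.Build R[i] hcompl normC_D normC_Z normC_eq0.

Lemma nrm_hcompl f : nrm f = hnorm f.
Proof. by []. Qed.

Lemma hcompl_seq_complete (u : nat -> hcompl) :
  (forall e, 0 < e -> exists n0, forall m n, (n0 <= m)%N -> (n0 <= n)%N -> nrm (u m - u n) < e) ->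
  exists l, forall e, 0 < e -> exists n0, forall n, (n0 <= n)%N -> nrm (u n - l) < e.
Proof.
move=> hu; have /choice[l hl] : forall w : V, exists l, forall e, 0 < e ->
    exists n0, forall n, (n0 <= n)%N -> N (u n w - l) < e.
  move=> w; apply: complex_complete => e e0.
  have w1 : 0 < sn w + 1 by rewrite ltr_wpDl ?sn_ge0.
  have [n0 h] := hu _ (divr_gt0 e0 w1); exists n0 => m n hm hn.
  apply: le_lt_trans (hnormP (u m - u n) w) _.
  apply: le_lt_trans (_ : nrm (u m - u n) * (sn w + 1) < _).
    by rewrite ler_wpM2l ?hnorm_ge0// lerDl.
  by rewrite -ltr_pdivlMr//; exact: h.
have key e : 0 < e -> exists n0, forall n, (n0 <= n)%N -> forall w, N (u n w - l w) <= e * sn w.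
  move=> e0; have [n0 h] := hu _ e0; exists n0 => n hn w.
  apply/ler_addgt0Pr => d d0; have [n1 h1] := hl w _ d0.
  have h2 := h1 _ (leq_addl n0 n1); have h3 := h _ _ hn (leq_addr n1 n0).
  have -> : u n w - l w = (u n w - u (n0 + n1)%N w) + (u (n0 + n1)%N w - l w) by ring.
  apply: le_trans (ler_nrmD _ _) _; apply: lerD; last exact: ltW.
  apply: le_trans (hnormP (u n - u (n0 + n1)%N) w) _.
  by rewrite ler_wpM2r ?sn_ge0// ltW.
have lP : l \in approximable.
  apply/asboolP => d d0; have d2 := divr_gt0 d0 (ltr0n R 2).
  have [n0 h] := key _ d2; have [v hv] := hcomplP (u n0) d2; exists v => w.
  have -> : l w - s w v = (u n0 w - s w v) - (u n0 w - l w) by ring.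
  apply: le_trans (ler_nrmD _ _) _; rewrite nrmN.
  by have := h _ (leqnn n0) w; have := hv w; lra.
exists (HCompl lP) => e e0; have [n0 h] := key _ (divr_gt0 e0 (ltr0n R 2)).
exists n0 => n hn; apply: le_lt_trans (_ : e / 2 < e); last by lra.
by rewrite nrm_hcompl; apply: hnorm_le; [rewrite ltW// divr_gt0 | exact: h].
Qed.

HB.instance Definition _ := Uniform_isComplete.Build hcompl
  (cauchy_filter_cvg hcompl_seq_complete).

(** Under [hemb] the value [g v] stands for the inner product of [v] with [g]; hence the inner
    product of [f] with [g] is the limit of [g v] as [v] approximates [f]. *)
Definition ip_limit f g (c : R[i]) := forall e, 0 < e -> exists2 d, 0 < d &
  forall v, approx f v d -> N (c - g v) <= e.

(** Both approximations are tested at [w = v - v'], where [s w v - s w v'] is the square of the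
    seminorm. *)
Lemma approx_dist F v v' d d' : 0 < d -> 0 < d' ->
  approx F v d -> approx F v' d' -> sn (v - v') <= d + d'.
Proof.
move=> d0 d0' h h'; set w := v - v'.
have [->|x0] := eqVneq (sn w) 0; first by rewrite addr_ge0 ?ltW.
have p : 0 < sn w by rewrite lt_neqAle eq_sym x0 sn_ge0.
rewrite -(ler_pM2r p) -expr2 sn_sq -[n2 w]ger0_norm ?(ip_ge0 H)// -nrm_real -(ip_diag H).
rewrite {2}/w ipBr.
have -> : s w v - s w v' = (F w - s w v') - (F w - s w v) by ring.
apply: le_trans (ler_nrmD _ _) _; rewrite nrmN.
by have := h w; have := h' w; lra.
Qed.

Lemma ip_limit_exists f g : exists c, ip_limit f g c.
Proof.
have [r0 rpos small] : exists2 r : nat -> R, forall n, 0 < r n &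
    forall e, 0 < e -> exists n0, forall n, (n0 <= n)%N -> r n < e.
  exists (fun n => n.+1%:R^-1) => [n|e e0]; first by rewrite invr_gt0.
  exists (Num.truncn e^-1) => n hn; rewrite -ltf_pV2 ?posrE ?invr_gt0// invrK.
  by apply: lt_le_trans (truncnS_gt _) _; rewrite ler_nat ltnS.
have /choice[v hv] : forall n, exists v, approx f v (r0 n) by move=> n; exact: hcomplP.
have gB x y : g x - g y = g (x - y).
  by rewrite hfun_D -scaleN1r hfun_conjZ rmorphN1 mulN1r.
have g1 : 0 < hnorm g + 1 by rewrite ltr_wpDl ?hnorm_ge0.
have bnd x y (d : R) : sn (x - y) <= d -> N (g x - g y) <= d * (hnorm g + 1).
  move=> hd; rewrite gB; apply: le_trans (hnormP _ _) _; rewrite mulrC.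
  by rewrite ler_pM ?sn_ge0 ?hnorm_ge0// lerDl.
have [c hc] : exists c, forall e, 0 < e -> exists n0, forall n, (n0 <= n)%N -> N (g (v n) - c) < e.
  apply: complex_complete => e e0.
  have e2 : 0 < e / (hnorm g + 1) / 2 by rewrite !divr_gt0.
  have [n0 h] := small _ e2; exists n0 => m n hm hn.
  apply: le_lt_trans (bnd _ _ _ (approx_dist (rpos m) (rpos n) (hv m) (hv n))) _.
  by rewrite -ltr_pdivlMr//; have := h _ hm; have := h _ hn; lra.
exists c => e e0; have e3 : 0 < e / (hnorm g + 1) / 4 by rewrite !divr_gt0.
exists (e / (hnorm g + 1) / 4) => // x hx.
have [n1 h1] := small _ e3; have [n2' h2] := hc _ (divr_gt0 e0 (ltr0n R 2)).
have a := h1 _ (leq_addr n2' n1); have b := h2 _ (leq_addl n1 n2').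
have := bnd _ _ _ (approx_dist (rpos _) e3 (hv (n1 + n2')%N) hx).
have -> : c - g x = (g (v (n1 + n2')%N) - g x) - (g (v (n1 + n2')%N) - c) by ring.
have : (r0 (n1 + n2')%N + e / (hnorm g + 1) / 4) * (hnorm g + 1) <= e / 2.
  rewrite -ler_pdivlMr//; lra.
by have := ler_nrmD (g (v (n1 + n2')%N) - g x : R[i]^o) (- (g (v (n1 + n2')%N) - c)); rewrite nrmN; lra.
Qed.

Lemma ip_limit_uniq f g c c' : ip_limit f g c -> ip_limit f g c' -> c = c'.
Proof.
move=> h h'; apply/eqP; rewrite -subr_eq0; apply/eqP/(@nrm0_eq0 R R[i]^o)/le_anti.
rewrite nrm_ge0 andbT; apply: eps_eq0 => e e0; have e2 := divr_gt0 e0 (ltr0n R 2).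
have [d d0 hd] := h _ e2; have [d' d0' hd'] := h' _ e2.
have m0 : 0 < Num.min d d' by rewrite lt_min d0.
have [v hv] := hcomplP f m0.
have hm (b : R) : Num.min d d' <= b -> approx f v b.
  by move=> mb w; apply: le_trans (hv w) _; rewrite ler_wpM2r ?sn_ge0.
have -> : c - c' = (c - g v) - (c' - g v) by ring.
apply: le_trans (ler_nrmD _ _) _; rewrite nrmN.
have := hd v (hm _ _); rewrite ge_min lexx => /(_ isT).
have := hd' v (hm _ _); rewrite ge_min lexx orbT => /(_ isT); lra.
Qed.

Definition hcip f g : R[i]^o := projT1 (cid (ip_limit_exists f g)).
Lemma hcipP f g : ip_limit f g (hcip f g).
Proof. by rewrite /hcip; case: cid. Qed.

Lemma hcip_lin f : linear (hcip f).
Proof.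
move=> k g g'; apply: (ip_limit_uniq (hcipP _ _)) => e e0.
have k1 : 0 < N k + 1 by rewrite ltr_wpDl ?nrm_ge0.
have a0 : 0 < e / 2 / (N k + 1) by rewrite !divr_gt0.
have [d d0 hd] := hcipP f g a0; have [d' d0' hd'] := hcipP f g' (divr_gt0 e0 (ltr0n R 2)).
have m0 : 0 < Num.min d d' by rewrite lt_min d0.
exists (Num.min d d') => // v hv.
have hm (b : R) : Num.min d d' <= b -> approx f v b.
  by move=> mb w; apply: le_trans (hv w) _; rewrite ler_wpM2r ?sn_ge0.
have -> : k *: hcip f g + hcip f g' - (k *: g + g') v = k * (hcip f g - g v) + (hcip f g' - g' v).
  by rewrite -[(k *: g + g') v]/(k * g v + g' v) -[k *: hcip f g]/(k * hcip f g); ring.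
apply: le_trans (ler_nrmD _ _) _; rewrite nrmM.
have h1 := hd v (hm _ _); have h2 := hd' v (hm _ _).
have {}h1 : N (hcip f g - g v) <= e / 2 / (N k + 1) by apply: h1; rewrite ge_min lexx.
have {}h2 : N (hcip f g' - g' v) <= e / 2 by apply: h2; rewrite ge_min lexx orbT.
have : N k * N (hcip f g - g v) <= e / 2.
  apply: le_trans (_ : (N k + 1) * (e / 2 / (N k + 1)) <= _).
    by rewrite ler_pM ?nrm_ge0// lerDl.
  by rewrite mulrC divfK// gt_eqF.
lra.
Qed.

Lemma hcip_conjugate f g : conjc (hcip f g) = hcip g f.
Proof.
apply: (ip_limit_uniq _ (hcipP g f)) => e e0.
have e3 : 0 < e / 3 by rewrite divr_gt0.
have [d d0 hd] := hcipP f g e3.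
have f2 : 0 < hnorm f + 1 by rewrite ltr_wpDl ?hnorm_ge0.
pose a := e / 3 / (hnorm f + 1); have a0 : 0 < a by rewrite !divr_gt0.
exists a => // v hv.
have v1 : 0 < sn v + 1 by rewrite ltr_wpDl ?sn_ge0.
(* The approximant [w] of [f] is chosen after [v], since the error of [s v w] scales with [sn v].
   The bound by one keeps [sn w] below [hnorm f + 1], the size against which [a] was chosen. *)
pose b := Num.min d (Num.min 1 (e / 3 / (sn v + 1))).
have b0 : 0 < b by rewrite !lt_min d0 ltr01 !divr_gt0.
have [w hw] := hcomplP f b0.
have hm (r : R) : b <= r -> approx f w r.
  by move=> mb z; apply: le_trans (hw z) _; rewrite ler_wpM2r ?sn_ge0.
have h1 : N (hcip f g - g w) <= e / 3 by apply: hd; apply: hm; rewrite ge_min lexx.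
have nw : sn w <= hnorm f + 1.
  have [->|x0] := eqVneq (sn w) 0; first exact: ltW.
  have p : 0 < sn w by rewrite lt_neqAle eq_sym x0 sn_ge0.
  rewrite -(ler_pM2r p) -expr2 sn_sq -[n2 w]ger0_norm ?(ip_ge0 H)// -nrm_real -(ip_diag H).
  have -> : s w w = f w - (f w - s w w) by ring.
  apply: le_trans (ler_nrmD _ _) _; rewrite nrmN.
  have := hm 1 _ w; rewrite !ge_min lexx orbT => /(_ isT); have := hnormP f w; lra.
have h2 : N (g w - s w v) <= e / 3.
  apply: le_trans (hv w) _; rewrite /a mulrAC ler_pdivrMr// ler_wpM2l// ltW//.
have h3 : N (f v - s v w) <= e / 3.
  have h := hm (e / 3 / (sn v + 1)) _ v; apply: le_trans (h _) _.
    by rewrite !ge_min lexx !orbT.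
  by rewrite mulrAC ler_pdivrMr// ler_wpM2l ?lerDl// ltW.
have -> : conjc (hcip f g) - f v = conjc ((hcip f g - g w) + (g w - s w v)) - (f v - s v w).
  by rewrite addrA subrK conjcB (ip_conj H); ring.
apply: le_trans (ler_nrmD _ _) _; rewrite nrmN nrm_conj.
have := ler_nrmD (hcip f g - g w) (g w - s w v : R[i]^o); lra.
Qed.

Lemma approx_norm f v d : 0 <= d -> approx f v d ->
  hnorm f <= sn v + d /\ sn v <= hnorm f + d.
Proof.
move=> d0 h; have hd : hnorm (f - hemb v) <= d by apply: hnorm_le => // w; exact: h.
split.
  have := hnormD (f - hemb v) (hemb v); rewrite subrK hnorm_emb; lra.
have := hnormD f (- (f - hemb v)); rewrite opprB addrC subrK hnorm_emb.
by rewrite -opprB -scaleN1r hnormZ nrmN nrm1C mul1r; lra.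
Qed.

Lemma hcip_diag f : `|f| ^+ 2 = hcip f f.
Proof.
rewrite -[`|f|]/((hnorm f)%:C) -rmorphXn; apply: ip_limit_uniq (hcipP f f) => e e0.
set t := hnorm f; have t0 : 0 <= t := hnorm_ge0 f.
(* The errors are at most [d (2 t + d)] for the squared norm and [d (t + d)] for [f v]; with
   [d <= 1] their sum stays below [d (3 t + 4)]. *)
pose d := Num.min 1 (e / (3 * t + 4)).
have q0 : 0 < 3 * t + 4 by lra.
have d0 : 0 < d by rewrite lt_min ltr01 divr_gt0.
exists d => // v hv; have [h1 h2] := approx_norm (ltW d0) hv; rewrite -/t in h1 h2.
have d1 : d <= 1 by rewrite ge_min lexx.
have de : d * (3 * t + 4) <= e by rewrite -ler_pdivlMr// ge_min lexx orbT.
rewrite rmorphXn -rmorphXn /=.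
have -> : (t ^+ 2)%:C - f v = (t ^+ 2 - n2 v)%:C - (f v - s v v).
  by rewrite (ip_diag H) rmorphB; ring.
apply: le_trans (ler_nrmD _ _) _; rewrite nrmN nrm_real.
have := hv v; have v0 := sn_ge0 v.
have : `|t ^+ 2 - n2 v| <= d * (2 * t + d).
  rewrite -sn_sq ler_norml; apply/andP; split; nra.
nra.
Qed.

Definition gns_space : hilbertSpace R := HilbertSpace hcip_lin hcip_conjugate hcip_diag.

Section Operators.
Variables (a a' : V -> V).
Hypothesis aa' : forall x y, s (a' x) y = s x (a y).
Variable K : R.
Hypotheses (K0 : 0 <= K) (aK' : forall x, sn (a' x) <= K * sn x).

Lemma hop_approx f v d : 0 < d -> approx f v (d / (K + 1)) ->
  approx (fun w => f (a' w)) (a v) d.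
Proof.
have K1 : 0 < K + 1 by rewrite ltr_wpDl.
move=> d0 hv w; rewrite -aa'; apply: le_trans (hv _) _; rewrite mulrAC ler_pdivrMr//.
rewrite -mulrA ler_wpM2l ?(ltW d0)//; apply: le_trans (aK' w) _.
by rewrite mulrC ler_wpM2l ?sn_ge0// lerDl.
Qed.
Lemma hop_subproof f : (fun w => f (a' w)) \in approximable.
Proof.
have K1 : 0 < K + 1 by rewrite ltr_wpDl.
apply/asboolP => d d0; have [v hv] := hcomplP f (divr_gt0 d0 K1).
by exists (a v); exact: hop_approx.
Qed.
(** Precomposition with the adjoint [a']: as [f w] stands for the inner product of [w] with [f], the
    functional of the image of [f] under [a] sends [w] to [f (a' w)]. *)
Definition hop f : hcompl := HCompl (hop_subproof f).

Lemma hop_linear : linear hop.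
Proof. by move=> k f g; apply: hfun_inj; apply/funext. Qed.

Lemma hop_bound f : nrm (hop f) <= K * nrm f.
Proof.
rewrite !nrm_hcompl; apply: hnorm_le => [|w]; first by rewrite mulr_ge0 ?hnorm_ge0.
apply: le_trans (hnormP f _) _; rewrite -mulrA mulrCA.
by rewrite ler_wpM2l ?hnorm_ge0.
Qed.

Lemma hop_emb v : hop (hemb v) = hemb (a v).
Proof. by apply: hfun_inj; apply/funext => w; rewrite /= aa'. Qed.
End Operators.

Lemma hcip_hop a a' K (K0 : 0 <= K) (aa : forall x y, s (a x) y = s x (a' y))
  (aa' : forall x y, s (a' x) y = s x (a y))
  (aK : forall x, sn (a x) <= K * sn x) (aK' : forall x, sn (a' x) <= K * sn x) f g :
  hcip (hop aa' K0 aK' f) g = hcip f (hop aa K0 aK g).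
Proof.
apply/esym/(ip_limit_uniq (hcipP _ _)) => e e0.
have K1 : 0 < K + 1 by rewrite ltr_wpDl.
have [d d0 hd] := hcipP (hop aa' K0 aK' f) g e0.
exists (d / (K + 1)); first by rewrite divr_gt0.
by move=> v hv; apply: hd; exact: (hop_approx aa' K0 aK' d0 hv).
Qed.
End PreHilbert.

(** * Representations from states *)

Section GelfandNaimark.
Context (R : realType) (D : cstarAlgType R).

Record cstar_rep (H : hilbertSpace R) (pi : D -> H -> H) : Prop := {
  cr_linear : forall a, linear (pi a);
  cr_comb : forall k a b x, pi (k *: a + b) x = k *: pi a x + pi b x;
  cr_mul : forall a b x, pi (a ** b) x = pi a (pi b x);
  cr_adj : forall a x y, hs_ip (pi a x) y = hs_ip x (pi (sstar a) y);
  cr_bound : forall a x, nrm (pi a x) <= nrm a * nrm x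
}.

Section StateSpace.
Variable f : unitz D -> R.
Hypotheses (fD : forall x y, f (x + y) = f x + f y)
  (fZ : forall (t : R) x, f (t%:C *: x) = t * f x)
  (fpos : forall x, 0 <= f (sstar x ** x)) (fstar : forall x, f (sstar x) = f x).
Implicit Types x y : unitz D.

(* The complex-linear functional with real part [f]. *)
Definition cfun x : R[i] := f x +i* (- f ('i *: x)).

Let fN x : f (- x) = - f x.
Proof. by have := fZ (-1) x; rewrite rmorphN1 scaleN1r mulN1r. Qed.

Lemma cfunD x y : cfun (x + y) = cfun x + cfun y.
Proof. by apply/eqP; rewrite eq_complex /cfun /= scalerDr !fD opprD !eqxx. Qed.

Lemma cfunZ (k : R[i]) x : cfun (k *: x) = k * cfun x.
Proof.
case: k => a b.
have e : (a +i* b) *: x = a%:C *: x + b%:C *: ('i *: x).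
  rewrite scalerA -scalerDl; congr (_ *: _).
  by apply/eqP; rewrite eq_complex /= !(mul0r, mulr0, mulr1, addr0, add0r, subr0) !eqxx.
have i2 : 'i *: ('i *: x) = - x by rewrite scalerA -expr2 sqr_i scaleN1r.
have e' : 'i *: ((a +i* b) *: x) = a%:C *: ('i *: x) + b%:C *: (- x).
  by rewrite e -i2; lin.
apply/eqP; rewrite eq_complex /cfun /= e' e !fD !fZ fN; apply/andP; split; apply/eqP; ring.
Qed.

Lemma cfun_star x : cfun (sstar x) = conjc (cfun x).
Proof.
rewrite /cfun /= fstar; congr (_ +i* _); rewrite opprK.
have -> : 'i *: sstar x = - sstar ('i *: x).
  rewrite sstarZ -scaleNr; congr (_ *: _).
  by apply/eqP; rewrite eq_complex /= oppr0 opprK !eqxx.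
by rewrite fN opprK fstar.
Qed.

Definition state_ip x y := cfun (sstar x ** y).

Lemma state_semi_ip : semi_ip state_ip (fun x => f (sstar x ** x)).
Proof.
split.
- by move=> x k y z; rewrite /state_ip smulDr smulZr cfunD cfunZ.
- by move=> x y; rewrite /state_ip -cfun_star sstarM sstarK.
- move=> x; have : conjc (state_ip x x) = state_ip x x by rewrite /state_ip -cfun_star selfadj_mulV.
  rewrite /state_ip /cfun => /eqP; rewrite eq_complex /= => /andP[_ /eqP h].
  by congr (_ +i* _); lra.
- exact: fpos.
Qed.

Definition uz_inc (a : D) : unitz D := (a, 0).
Lemma uz_incM a b : uz_inc (a ** b) = uz_inc a ** uz_inc b.
Proof. by rewrite -[RHS]/(uz_mul _ _) /uz_mul /= !scale0r !addr0 mulr0. Qed.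
Lemma uz_incV a : uz_inc (sstar a) = sstar (uz_inc a).
Proof.
rewrite -[RHS]/(uz_star _) /uz_star /= /uz_inc; congr (_, _).
by apply/eqP; rewrite eq_complex /= oppr0 !eqxx.
Qed.
Lemma uz_inc_comb (k : R[i]) a b : uz_inc (k *: a + b) = k *: uz_inc a + uz_inc b.
Proof. by congr (_, _); rewrite /= addr0 -[k *: 0]/(k * 0) mulr0. Qed.

Let S := state_semi_ip.

Lemma state_adj (a x y : unitz D) : state_ip (a ** x) y = state_ip x (sstar a ** y).
Proof. by rewrite /state_ip sstarM smulA. Qed.

Lemma state_adjV (a x y : unitz D) : state_ip (sstar a ** x) y = state_ip x (a ** y).
Proof. by rewrite /state_ip sstarM sstarK smulA. Qed.

Let sq x := sn (fun x => f (sstar x ** x)) x.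

Lemma state_bound (a x : unitz D) : sq (a ** x) <= uz_norm a * sq x.
Proof.
have cn := uz_cnorm D; have a0 := cn_ge0 cn a.
have [y hy] := norm_dominates cn (@uz_el _ D) (@uz_er _ D) a x.
rewrite -(@ler_pXn2r _ 2) ?nnegrE ?mulr_ge0 ?sn_ge0//.
rewrite exprMn !(sn_sq S); move/(congr1 f): hy; rewrite fD fZ => <-.
by rewrite lerDl.
Qed.

Lemma state_boundV (a x : unitz D) : sq (sstar a ** x) <= uz_norm a * sq x.
Proof. by rewrite -(cn_V (uz_cnorm D)); exact: state_bound. Qed.

Definition gns_op (a : D) : gns_space S -> gns_space S :=
  hop (state_adjV (uz_inc a)) (cn_ge0 (uz_cnorm D) (uz_inc a)) (state_boundV (uz_inc a)).

Definition gns_vec (x : unitz D) : gns_space S := hemb state_ip _ x.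

Lemma gns_op_vec a x : gns_op a (gns_vec x) = gns_vec (uz_inc a ** x).
Proof. exact: hop_emb. Qed.

Lemma gns_rep : cstar_rep gns_op.
Proof.
split.
- by move=> a; exact: hop_linear.
- move=> k a b x; apply: hfun_inj; apply/funext => w.
  rewrite -[RHS]/(k * x (sstar (uz_inc a) ** w) + x (sstar (uz_inc b) ** w)).
  rewrite -[LHS]/(x (sstar (uz_inc (k *: a + b)) ** w)).
  by rewrite uz_inc_comb sstarD sstarZ smulDl smulZl (hfun_D S x) (hfun_conjZ S x) conjcK.
- move=> a b x; apply: hfun_inj; apply/funext => w.
  rewrite -[LHS]/(x (sstar (uz_inc (a ** b)) ** w)).
  rewrite -[RHS]/(x (sstar (uz_inc b) ** (sstar (uz_inc a) ** w))).
  by rewrite uz_incM sstarM smulA.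
- move=> a x y; rewrite /gns_op /=.
  rewrite (hcip_hop S _ (state_adj (uz_inc a)) _ (state_bound (uz_inc a))).
  congr (hcip _ _); apply: hfun_inj; apply/funext => w /=.
  by rewrite uz_incV sstarK.
- move=> a x; rewrite -(uz_norm_inc a); exact: hop_bound.
Qed.
End StateSpace.

(** The state attains [|d|^2] at [d^* d], so the vector of the unit attains the norm of [d]. The
    representation depends on [d]; every later use concerns the norm of one element. *)
Theorem gelfand_naimark (d : D) : exists (H : hilbertSpace R) (pi : D -> H -> H),
  cstar_rep pi /\ exists2 xi, nrm xi <= 1 & nrm (pi d xi) = nrm d.
Proof.
have cn := uz_cnorm D.
have [f [fD fZ fp fs [f1 fd]]] :=
  exists_state cn (@uz_el _ D) (@uz_er _ D) (uz_norm1 D) (uz_inc d).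
exists (gns_space (state_semi_ip fD fZ fp fs)), (@gns_op f fD fZ fp fs); split; first exact: gns_rep.
have e1 : sstar (uz_e D) ** uz_e D = uz_e D by rewrite uz_er (selfadj_unit (@uz_er _ D)).
exists (@gns_vec f fD fZ fp fs (uz_e D)).
  rewrite nrm_hcompl (hnorm_emb (state_semi_ip fD fZ fp fs)) /sn; cbv beta.
  by rewrite e1 -sqrtr1 ler_sqrt.
transitivity (nrm (@gns_vec f fD fZ fp fs (uz_inc d ** uz_e D))).
  by congr nrm; exact: gns_op_vec.
rewrite nrm_hcompl (hnorm_emb (state_semi_ip fD fZ fp fs)) /sn; cbv beta.
by rewrite uz_er fd uz_norm_inc sqrtr_sqr ger0_norm ?nrm_ge0.
Qed.
End GelfandNaimark.

(** * Topological groupoids *)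

(** Multiplication is continuous only within the composable pairs, so continuity is taken relative
    to a set throughout. *)
Definition cont_on (T U : topologicalType) (D : set T) (f : T -> U) :=
  forall x, D x -> f @ within D (nbhs x) --> f x.

Section ContOn.
Context (T U V : topologicalType).

Lemma cont_onT (f : T -> U) : continuous f -> forall D, cont_on D f.
Proof. by move=> cf D x _; apply: cvg_trans (cf x); apply: cvg_app; exact: cvg_within. Qed.

Lemma cont_on_comp (D : set T) (E : set U) (f : T -> U) (g : U -> V) :
  cont_on D f -> cont_on E g -> (forall x, D x -> E (f x)) -> cont_on D (g \o f).
Proof.
move=> cf cg DE x Dx A /(cg _ (DE _ Dx)); rewrite /within /= !nbhs_simpl /= => h.
have := cf _ Dx _ h; rewrite /within /= !nbhs_simpl /=.
by apply: filterS => y hy Dy; apply: hy => //; exact: DE.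
Qed.

Lemma cont_on_pair (D : set T) (f : T -> U) (g : T -> V) :
  cont_on D f -> cont_on D g -> cont_on D (fun x => (f x, g x)).
Proof. by move=> cf cg x Dx; apply: cvg_pair; [exact: cf | exact: cg]. Qed.

Lemma cont_on_open (D : set T) (f : T -> U) : cont_on D f -> forall A, open A ->
  exists2 W, open W & D `&` f @^-1` A = D `&` W.
Proof.
move=> cf A oA; exists [set x | nbhs x [set y | D y -> A (f y)]].
  by rewrite openE => x /= /nbhs_interior.
apply/seteqP; split => x [Dx /= h]; split => //.
  have := cf _ Dx A; rewrite /within /= !nbhs_simpl /=; apply.
  exact: open_nbhs_nbhs.
by have /= := nbhs_singleton h; apply.
Qed.
End ContOn.

Section Groupoid.
Context (G : topGroupoidType).
Implicit Types (x y z : G).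

Lemma cont_on_gmul (T : topologicalType) (D : set T) (f g : T -> G) :
  cont_on D f -> cont_on D g -> (forall t, D t -> gsrc (f t) = grng (g t)) ->
  cont_on D (fun t => gmul (f t) (g t)).
Proof.
move=> cf cg fg; apply: (@cont_on_comp _ _ _ D [set p : G * G | gsrc p.1 = grng p.2]
  (fun t => (f t, g t)) (fun p => gmul p.1 p.2)) => //; first exact: cont_on_pair.
by have /subspace_continuousP := @gmul_continuous G.
Qed.

Lemma cont_on_ginv (T : topologicalType) (D : set T) (f : T -> G) :
  cont_on D f -> cont_on D (fun t => ginv (f t)).
Proof.
move=> cf; apply: (@cont_on_comp _ _ _ D setT f (@ginv G)) => //.
by apply: cont_onT; exact: ginv_continuous.
Qed.

Lemma cont_on_setT (T U : topologicalType) (f : T -> U) : cont_on setT f -> continuous f.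
Proof.
move=> cf x A /(cf x I); rewrite /within /= !nbhs_simpl /=.
by apply: filterS => y; apply.
Qed.

Lemma cont_id (T : topologicalType) (D : set T) : cont_on D (@id T).
Proof. by apply: cont_onT => x A. Qed.

Lemma grng_continuous : continuous (@grng G : G -> G).
Proof.
apply: cont_on_setT.
rewrite (_ : @grng G = fun x => gmul x (ginv x)); last by apply/funext => x; rewrite gmul_inv.
apply: cont_on_gmul; [exact: cont_id | exact/cont_on_ginv/cont_id | by move=> x _; rewrite grng_inv].
Qed.

Lemma gsrc_continuous : continuous (@gsrc G : G -> G).
Proof.
apply: cont_on_setT.
rewrite (_ : @gsrc G = fun x => gmul (ginv x) x); last by apply/funext => x; rewrite ginv_mul.
apply: cont_on_gmul; [exact/cont_on_ginv/cont_id | exact: cont_id | by move=> x _; rewrite gsrc_inv].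
Qed.

Lemma ginv_uniq x y : gsrc x = grng y -> gmul x y = grng x -> y = ginv x.
Proof.
move=> xy h; have := congr1 (gmul (ginv x)) h.
rewrite gmulA ?gsrc_inv// ginv_mul xy gmul_rng => ->.
by rewrite -{1}gsrc_inv gmul_src.
Qed.

Lemma ginvK x : ginv (ginv x) = x.
Proof. by apply/esym/ginv_uniq; rewrite ?gsrc_inv// ginv_mul grng_inv. Qed.

Lemma gmulKV x y : grng x = grng y -> gmul x (gmul (ginv x) y) = y.
Proof. by move=> xy; rewrite gmulA ?grng_inv ?gsrc_inv// gmul_inv xy gmul_rng. Qed.

Lemma gmulVK x y : gsrc x = grng y -> gmul (ginv x) (gmul x y) = y.
Proof. by move=> xy; rewrite gmulA ?gsrc_inv// ginv_mul xy gmul_rng. Qed.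

Lemma ginv_gmul x y : gsrc x = grng y -> ginv (gmul x y) = gmul (ginv y) (ginv x).
Proof.
move=> xy; have yx : gsrc (ginv y) = grng (ginv x) by rewrite gsrc_inv grng_inv.
apply/esym/ginv_uniq; first by rewrite gsrc_mul// grng_mul// grng_inv.
have ry : grng y = grng (ginv x) by rewrite grng_inv.
have h : gsrc y = grng (gmul (ginv y) (ginv x)) by rewrite grng_mul// grng_inv.
by rewrite -(@gmulA _ _ _ _ xy h) gmulKV// gmul_inv grng_mul.
Qed.

Lemma grng_unit x : gunits G (grng x).
Proof. by rewrite /gunits /= grng_rng. Qed.
Lemma gsrc_unit x : gunits G (gsrc x).
Proof. by rewrite /gunits /= grng_src. Qed.
End Groupoid.

(** * Borel sets, bump functions and countable bases *)

Section SecondCountable.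
Context (G : ptopologicalType).
Hypotheses (Gsc : @second_countable G).

Lemma countable_base : exists b : nat -> set G, (forall n, open (b n)) /\
  forall x U, open U -> U x -> exists n, b n x /\ b n `<=` U.
Proof.
have [B Bc [Bo Bb]] := Gsc.
have /pcard_surjP[g gs] := Bc.
exists (fun n => if `[< B (g n) >] then g n else set0); split.
  by move=> n; case: asboolP => [/Bo//|_]; exact: open0.
move=> x U oU Ux; have : nbhs x U by exact: open_nbhs_nbhs.
move=> /(Bb x)[V /= [BV Vx] VU]; have [n _ gn] := gs _ BV.
by exists n; rewrite gn; case: asboolP.
Qed.

Lemma open_borel (A : set G) : open A -> measurable (A : set (borel G)).
Proof. by move=> oA; apply: sub_sigma_algebra. Qed.

Lemma closed_borel (A : set G) : closed A -> measurable (A : set (borel G)).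
Proof.
move=> cA; rewrite -[A]setCK; apply: measurableC; apply: open_borel.
by rewrite openC.
Qed.

Lemma cont_on_measurable (R : realType) (D : set G) (f : G -> R) :
  measurable (D : set (borel G)) -> cont_on D f ->
  measurable_fun (D : set (borel G)) (f : borel G -> R).
Proof.
move=> mD cf; apply: (measurability _ (measurable_realfun.RGenOpens.measurableE R)).
move=> _ [_ [a [b ->] <-]].
have [W oW ->] := cont_on_open cf (@interval_open R (BRight a) (BLeft b) isT isT).
by apply: measurableI => //; exact: open_borel.
Qed.

Lemma continuous_borel (R : realType) (f : G -> R) : continuous f ->
  measurable_fun [set: borel G] (f : borel G -> R).
Proof. by move=> cf; apply: cont_on_measurable => //; exact: cont_onT. Qed.

Lemma cont_on_borel_map (H : ptopologicalType) (D : set G) (f : G -> H) :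
  measurable (D : set (borel G)) -> cont_on D f ->
  measurable_fun (D : set (borel G)) (f : borel G -> borel H).
Proof.
move=> mD cf; apply: (@measurability _ _ (borel G) (borel H) D f (@open H)) => //.
move=> _ [A oA <-]; have [W oW ->] := cont_on_open cf oA.
by apply: measurableI => //; exact: open_borel.
Qed.

(** A countable base writes an open set as a countable union of open rectangles. Tonelli's theorem
    uses the sigma-algebra generated by rectangles, so continuous integrands on pairs become
    measurable only through this. *)
Lemma open_prod_measurable (A : set (G * G)) : open A ->
  measurable (A : set (borel G * borel G)).
Proof.
move=> oA; have [b [bo bb]] := countable_base.
pose F (p : nat * nat) : set (borel G * borel G) :=
  if `[< b p.1 `*` b p.2 `<=` A >] then b p.1 `*` b p.2 else set0.
have -> : A = \bigcup_p F p.
  apply/seteqP; split => [[x y] Axy|p [q _]]; last first.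
    by rewrite /F; case: asboolP => // h; exact: h.
  have : nbhs (x, y) A by exact: open_nbhs_nbhs.
  move=> [[P Q] /= [xP yQ] PQ].
  move: xP yQ; rewrite !nbhsE => -[P' [oP' P'x] PP'] [Q' [oQ' Q'y] QQ'].
  have [n [bnx bnP]] := bb x P' oP' P'x; have [m [bmy bmQ]] := bb y Q' oQ' Q'y.
  exists (n, m) => //; rewrite /F; case: asboolP => // h; exfalso; apply: h.
  by move=> [x' y'] /= [h1 h2]; apply: PQ; split; [exact/PP'/bnP | exact/QQ'/bmQ].
apply: countable_bigcupT_measurable => // p; rewrite /F; case: asboolP => // _.
by apply: measurableX; exact: open_borel.
Qed.

Lemma cont_on_prod_measurable (R : realType) (D : set (G * G)) (f : G * G -> R) :
  measurable (D : set (borel G * borel G)) -> cont_on D f ->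
  measurable_fun (D : set (borel G * borel G)) (f : borel G * borel G -> R).
Proof.
move=> mD cf; apply: (measurability _ (measurable_realfun.RGenOpens.measurableE R)).
move=> _ [_ [a [b ->] <-]].
have [W oW ->] := cont_on_open cf (@interval_open R (BRight a) (BLeft b) isT isT).
by apply: measurableI => //; exact: open_prod_measurable.
Qed.
End SecondCountable.

Section LocallyCompact.
Context (R : realType) (G : ptopologicalType).
Hypotheses (Gh : hausdorff_space G) (Glc : locally_compact [set: G]).

Lemma bump x (U : set G) : open U -> U x -> exists f : G -> R,
  [/\ continuous f, forall y, 0 <= f y <= 1, f x = 1 & forall y, f y != 0 -> U y].
Proof.
move=> oU Ux; have cU : closed (~` U) by rewrite closedC.
have h : ~ (~` U) x by [].
have /uniform_separatorP := @locally_compact_completely_regular G R Glc Gh x (~` U) cU h.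
move=> /(_ R)[f [cf f01 f0 f1]].
exists (fun y => 1 - f y); split.
- by move=> y; apply: cvgB; [exact: cvg_cst | exact: cf].
- move=> y; have /f01 : range f (f y) by exists y.
  by rewrite /= in_itv /= => /andP[a b]; apply/andP; split; lra.
- by have /f0 /= -> : (f @` [set x]) (f x) by [exists x]; rewrite subr0.
- move=> y fy; apply: contrapT => Uy; move/eqP: fy; apply.
  by have /f1 /= -> : (f @` (~` U)) (f y) by [exists y]; rewrite subrr.
Qed.

Lemma compact_nbhd x : exists2 K : set G, compact K & exists2 U, open U & U x /\ U `<=` K.
Proof.
have [K] := @Glc x I; rewrite withinET => xK [cK _]; exists K => //.
by move: xK; rewrite nbhsE => -[U [oU Ux] UK]; exists U.
Qed.

Hypothesis Gsc : @second_countable G.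

(** By local compactness the members of a countable base that lie in some compact set still form a
    base; the others are replaced by the empty set. *)
Lemma exhaustion : exists O : nat -> set G,
  [/\ forall n, open (O n), forall n, exists2 K, compact K & O n `<=` K &
      forall x U, open U -> U x -> exists n, O n x /\ O n `<=` U].
Proof.
have [b [bo bb]] := countable_base Gsc.
exists (fun n => if `[< exists2 K, compact K & b n `<=` K >] then b n else set0); split.
- by move=> n; case: asboolP => // _; exact: open0.
- by move=> n; case: asboolP => // _; exists set0 => //; exact: compact0.
- move=> x U oU Ux; have [K cK [V oV [Vx VK]]] := compact_nbhd x.
  have [n [bnx bnU]] := bb x (U `&` V) (openI oU oV) (conj Ux Vx).
  exists n; case: asboolP => [_|h]; first by split => // y /bnU[].
  by exfalso; apply: h; exists K => // y /bnU[_ /VK].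
Qed.
End LocallyCompact.

(** * Haar systems *)

Section ComplexIntegral.
Context (R : realType) (T : ptopologicalType) (mu : {measure set (borel T) -> \bar R}).
Variable D : set T.
Hypothesis mD : measurable (D : set (borel T)).
Implicit Types (f g : T -> R[i]^o) (k : R[i]) (h : T -> R).
Local Notation N k := (nrm (k : R[i]^o)).

Definition rint h : R := fine (bintegral mu D h).
Definition rintegrable h := mu.-integrable (D : set (borel T)) (EFin \o (h : borel T -> R)).
Definition cintegrable f :=
  rintegrable (fun x => complex.Re (f x)) /\ rintegrable (fun x => complex.Im (f x)).

Lemma rintE h : rintegrable h -> bintegral mu D h = (rint h)%:E.
Proof. by move=> h1; rewrite /rint fineK// integrable_fin_num. Qed.

Lemma rintegrableD h1 h2 : rintegrable h1 -> rintegrable h2 -> rintegrable (fun x => h1 x + h2 x).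
Proof.
move=> i1 i2; have := integrableD mD i1 i2.
by apply: eq_integrable => // x _; rewrite /= EFinD.
Qed.
Lemma rintegrableZ (t : R) h : rintegrable h -> rintegrable (fun x => t * h x).
Proof.
move=> i1; have := integrableZl mD t i1.
by apply: eq_integrable => // x _; rewrite /= EFinM.
Qed.

Lemma rintD h1 h2 : rintegrable h1 -> rintegrable h2 ->
  rint (fun x => h1 x + h2 x) = rint h1 + rint h2.
Proof. by move=> i1 i2; exact: (RintegralD mD i1 i2). Qed.
Lemma rintZ (t : R) h : rintegrable h -> rint (fun x => t * h x) = t * rint h.
Proof. by move=> i1; exact: (@RintegralZl _ _ _ mu D h t mD i1). Qed.
Lemma le_rint h1 h2 : rintegrable h1 -> rintegrable h2 ->
  (forall x, D x -> h1 x <= h2 x) -> rint h1 <= rint h2.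
Proof. by move=> i1 i2; exact: (le_Rintegral mD i1 i2). Qed.

Lemma cintegralE f : cintegral mu D f =
  (rint (fun x => complex.Re (f x)) +i* rint (fun x => complex.Im (f x)))%C.
Proof. by []. Qed.

Lemma cintegrable_comb k f g : cintegrable f -> cintegrable g ->
  cintegrable (fun x => k * f x + g x).
Proof.
case: k => a b [f1 f2] [g1 g2]; split.
  have := rintegrableD (rintegrableD (rintegrableZ a f1) (rintegrableZ (- b) f2)) g1.
  apply: eq_integrable => // x _ /=; congr _%:E.
  by case: (f x) => c d /=; case: (g x) => c' d' /=; ring.
have := rintegrableD (rintegrableD (rintegrableZ a f2) (rintegrableZ b f1)) g2.
apply: eq_integrable => // x _ /=; congr _%:E.
by case: (f x) => c d /=; case: (g x) => c' d' /=; ring.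
Qed.

Lemma cintegral_comb k f g : cintegrable f -> cintegrable g ->
  cintegral mu D (fun x => k * f x + g x) = k * cintegral mu D f + cintegral mu D g.
Proof.
case: k => a b [f1 f2] [g1 g2]; rewrite !cintegralE.
have e1 : rint (fun x => complex.Re ((a +i* b)%C * f x + g x)) =
    rint (fun x => a * complex.Re (f x) + (- b) * complex.Im (f x) + complex.Re (g x)).
  by congr rint; apply/funext => x; case: (f x) => c d; case: (g x) => c' d' /=; ring.
have e2 : rint (fun x => complex.Im ((a +i* b)%C * f x + g x)) =
    rint (fun x => a * complex.Im (f x) + b * complex.Re (f x) + complex.Im (g x)).
  by congr rint; apply/funext => x; case: (f x) => c d; case: (g x) => c' d' /=; ring.
rewrite e1 e2 !rintD ?rintZ//; do ?[exact: rintegrableZ | exact: rintegrableD];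
  try by apply: rintegrableD; exact: rintegrableZ.
by apply/eqP; rewrite eq_complex /=; apply/andP; split; apply/eqP; ring.
Qed.

Lemma cintegrable0 : cintegrable (fun=> 0).
Proof.
have h : rintegrable (fun=> 0).
  by have := @integrable0 _ _ _ mu (D : set (borel T)); apply: eq_integrable.
by split.
Qed.

Lemma cintegral0 : cintegral mu D (fun=> 0) = 0.
Proof.
rewrite cintegralE /rint /bintegral.
by apply/eqP; rewrite eq_complex /= integral0 /= eqxx.
Qed.

Lemma cintegrableZ k f : cintegrable f -> cintegrable (fun x => k * f x).
Proof.
move=> h; have := cintegrable_comb k h cintegrable0.
by congr cintegrable; apply/funext => x; rewrite addr0.
Qed.

Lemma cintegralZ k f : cintegrable f -> cintegral mu D (fun x => k * f x) = k * cintegral mu D f.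
Proof.
move=> h; have := cintegral_comb k h cintegrable0; rewrite cintegral0 addr0 => <-.
by congr cintegral; apply/funext => x; rewrite addr0.
Qed.

Lemma cintegral_conj f : cintegrable f ->
  cintegral mu D (fun x => conjc (f x)) = conjc (cintegral mu D f).
Proof.
move=> [f1 f2]; rewrite !cintegralE /=; congr (_ +i* _)%C.
  by congr rint; apply/funext => x; case: (f x).
rewrite -mulN1r -rintZ//; congr rint; apply/funext => x; rewrite mulN1r.
by case: (f x).
Qed.

Definition cmeasurable f :=
  measurable_fun (D : set (borel T)) (fun x : borel T => complex.Re (f x)) /\
  measurable_fun (D : set (borel T)) (fun x : borel T => complex.Im (f x)).

Lemma nrm_measurable f : cmeasurable f ->
  measurable_fun (D : set (borel T)) (fun x : borel T => N (f x)).
Proof.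
move=> [h1 h2].
have -> : (fun x : borel T => N (f x)) =
    Num.sqrt \o (fun x : borel T => complex.Re (f x) ^+ 2 + complex.Im (f x) ^+ 2).
  by apply/funext => x; rewrite /= nrmCE.
apply: measurableT_comp; first by apply: continuous_measurable_fun; exact: sqrt_continuous.
by apply: measurable_funD; exact: measurable_funX.
Qed.

Lemma cintegrable_le f h : cmeasurable f -> rintegrable h ->
  (forall x, D x -> N (f x) <= h x) -> cintegrable f.
Proof.
move=> [h1 h2] ih H; split.
  apply: (le_integrable mD) ih; first exact/measurable_EFinP.
  move=> x Dx; rewrite /= lee_fin; apply: le_trans (Re_le_nrm _) _.
  by apply: le_trans (H x Dx) _; exact: ler_norm.
apply: (le_integrable mD) ih; first exact/measurable_EFinP.
move=> x Dx; rewrite /= lee_fin; apply: le_trans (Im_le_nrm _) _.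
by apply: le_trans (H x Dx) _; exact: ler_norm.
Qed.

Lemma cintegrable_nrm f : cintegrable f -> rintegrable (fun x => N (f x)).
Proof.
move=> [i1 i2].
have m1 : measurable_fun (D : set (borel T)) (fun x : borel T => complex.Re (f x)).
  by apply/measurable_EFinP; case/integrableP: i1.
have m2 : measurable_fun (D : set (borel T)) (fun x : borel T => complex.Im (f x)).
  by apply/measurable_EFinP; case/integrableP: i2.
have n1 : rintegrable (fun x => `|complex.Re (f x)|).
  by have := integrable_abse i1; apply: eq_integrable.
have n2 : rintegrable (fun x => `|complex.Im (f x)|).
  by have := integrable_abse i2; apply: eq_integrable.
have := rintegrableD n1 n2; apply: (le_integrable mD).
  by apply/measurable_EFinP; exact: nrm_measurable.
move=> x _; rewrite /= lee_fin ger0_norm ?nrm_ge0//.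
by apply: le_trans (nrm_le_ReIm _) _; exact: ler_norm.
Qed.

Lemma cintegral_norm f : cintegrable f ->
  N (cintegral mu D f) <= rint (fun x => N (f x)).
Proof.
move=> i; set c := cintegral mu D f.
have in0 := cintegrable_nrm i.
have [c0|c0] := eqVneq (N c) 0.
  rewrite c0 /rint; apply: fine_ge0; apply: integral_ge0 => x _.
  by rewrite lee_fin nrm_ge0.
have cp : 0 < N c by rewrite lt_neqAle eq_sym c0 nrm_ge0.
(* A phase of modulus one that rotates the integral to its absolute value, so that only a real part
   has to be estimated. *)
pose k : R[i] := (N c)^-1%:C * conjc c.
have kN : N k = 1 by rewrite nrmM nrm_real nrm_conj gtr0_norm ?invr_gt0// mulVf.
have kc : k * c = (N c)%:C.
  by rewrite /k -mulrA conjM_nrm -rmorphM /= expr2 mulrA mulVf// mul1r.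
have : complex.Re (k * c) = N c by rewrite kc.
rewrite -(cintegralZ k i) cintegralE /= => <-.
apply: le_rint => //; first by case: (cintegrableZ k i).
move=> x _; apply: le_trans (ler_norm _) _; apply: le_trans (Re_le_nrm _) _.
by rewrite nrmM kN mul1r.
Qed.

Lemma rint_ge0 h : (forall x, D x -> 0 <= h x) -> 0 <= rint h.
Proof.
by move=> h0; apply: fine_ge0; apply: integral_ge0 => x Dx; rewrite lee_fin; exact: h0.
Qed.
End ComplexIntegral.

Section SigmaFinite.
Context d (T : measurableType d) (R : realType) (m : {measure set T -> \bar R}).
Hypothesis s : sigma_finite setT m.
(** A copy of [m] that has the proof of sigma-finiteness as an argument, so that the corresponding
    structure can be attached to it. *)
Definition sfm (_ : sigma_finite setT m) : set T -> \bar R := m.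
HB.instance Definition _ := isMeasure.Build _ _ _ (sfm s)
  (measure0 m) (measure_ge0 m) (@measure_semi_sigma_additive _ _ _ m).
HB.instance Definition _ := @Measure_isSigmaFinite.Build _ _ _ (sfm s) s.
End SigmaFinite.

Lemma sf_tonelli d1 d2 (T1 : measurableType d1) (T2 : measurableType d2) (R : realType)
  (m1 : {measure set T1 -> \bar R}) (m2 : {measure set T2 -> \bar R})
  (f : T1 * T2 -> \bar R) : sigma_finite setT m1 -> sigma_finite setT m2 ->
  measurable_fun [set: (T1 * T2)%type] f -> (forall x, (0 <= f x)%E) ->
  (\int[m1]_x \int[m2]_y f (x, y) = \int[m2]_y \int[m1]_x f (x, y))%E.
Proof. by move=> s1 s2 mf f0; exact: (@fubini_tonelli _ _ _ _ _ (sfm s1) (sfm s2) f mf f0). Qed.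

Lemma sf_measurable d1 d2 (T1 : measurableType d1) (T2 : measurableType d2) (R : realType)
  (m2 : {measure set T2 -> \bar R})
  (f : T1 * T2 -> \bar R) : sigma_finite setT m2 ->
  measurable_fun [set: (T1 * T2)%type] f -> (forall x, (0 <= f x)%E) ->
  measurable_fun setT (fun x => \int[m2]_y f (x, y))%E.
Proof. by move=> s2 mf f0; exact: (@measurable_fun_fubini_tonelli_F _ _ _ _ _ (sfm s2) f mf f0). Qed.

Section ComplexContinuity.
Context (R : realType) (T : topologicalType).
Implicit Types (f g : T -> R[i]^o).
Local Notation N k := (nrm (k : R[i]^o)).

Lemma cont_onC (D : set T) f : cont_on D f <->
  forall x, D x -> forall e : R, 0 < e -> nbhs x [set y | D y -> N (f x - f y) < e].
Proof.
split=> [cf x Dx e e0|h x Dx].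
  have /cvgrPdist_lt := cf x Dx.
  have e0' : 0 < e%:C :> R[i] by rewrite ltcR.
  move=> /(_ _ e0') H.
  have {}H : nbhs x [set y | D y -> `|f x - f y| < e%:C] by exact: H.
  by apply: filterS H => y hy Dy; rewrite -nrm_lt; exact: hy.
apply/cvgrPdist_lt => _ /posC_real[r r0 ->].
by have := h x Dx r r0; apply: filterS => y hy Dy; rewrite nrm_lt; exact: hy.
Qed.

Lemma cont_onR (D : set T) (f : T -> R) : cont_on D f <->
  forall x, D x -> forall e : R, 0 < e -> nbhs x [set y | D y -> `|f x - f y| < e].
Proof.
split=> [cf x Dx e e0|h x Dx].
  by have /cvgrPdist_lt := cf x Dx; apply.
by apply/cvgrPdist_lt => e e0; exact: h.
Qed.

Lemma cont_on_nrm (D : set T) f : cont_on D f -> cont_on D (fun x => N (f x)).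
Proof.
move=> /cont_onC cf; apply/cont_onR => x Dx e e0.
apply: filterS (cf x Dx e e0) => y hy Dy; apply: le_lt_trans (hy Dy).
rewrite ler_norml; apply/andP; split.
  by have := ler_nrmD (f x : R[i]^o) (f y - f x); rewrite addrC subrK -(nrmN (f y - f x)) opprB; lra.
by have := ler_nrmD (f x - f y : R[i]^o) (f y); rewrite subrK; lra.
Qed.

Lemma cont_on_Re (D : set T) f : cont_on D f -> cont_on D (fun x => complex.Re (f x)).
Proof.
move=> /cont_onC cf; apply/cont_onR => x Dx e e0.
apply: filterS (cf x Dx e e0) => y hy Dy; apply: le_lt_trans (hy Dy).
by rewrite -raddfB; exact: Re_le_nrm.
Qed.

Lemma cont_on_Im (D : set T) f : cont_on D f -> cont_on D (fun x => complex.Im (f x)).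
Proof.
move=> /cont_onC cf; apply/cont_onR => x Dx e e0.
apply: filterS (cf x Dx e e0) => y hy Dy; apply: le_lt_trans (hy Dy).
by rewrite -raddfB; exact: Im_le_nrm.
Qed.

Lemma cont_on_RC (D : set T) (f : T -> R) : cont_on D f -> cont_on D (fun x => (f x)%:C : R[i]^o).
Proof.
move=> /cont_onR cf; apply/cont_onC => x Dx e e0.
apply: filterS (cf x Dx e e0) => y hy Dy; apply: le_lt_trans (hy Dy).
by rewrite -rmorphB nrm_real.
Qed.

Lemma cont_on_conj (D : set T) f : cont_on D f -> cont_on D (fun x => conjc (f x) : R[i]^o).
Proof.
move=> /cont_onC cf; apply/cont_onC => x Dx e e0.
apply: filterS (cf x Dx e e0) => y hy Dy; apply: le_lt_trans (hy Dy).
by rewrite -conjcB nrm_conj.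
Qed.

Lemma cont_onM (K : numFieldType) (D : set T) (f g : T -> K^o) :
  cont_on D f -> cont_on D g -> cont_on D (fun x => f x * g x).
Proof. by move=> cf cg x Dx; apply: cvgM; [exact: cf | exact: cg]. Qed.

Lemma cont_onD (K : numFieldType) (D : set T) (f g : T -> K^o) :
  cont_on D f -> cont_on D g -> cont_on D (fun x => f x + g x).
Proof. by move=> cf cg x Dx; apply: cvgD; [exact: cf | exact: cg]. Qed.

Lemma cont_on_cst (U : topologicalType) (D : set T) (k : U) : cont_on D (fun=> k : U).
Proof. by move=> x Dx; exact: cvg_cst. Qed.
End ComplexContinuity.

Definition CcR (R : realType) (G : topologicalType) (f : G -> R) :=
  continuous f /\ exists2 K : set G, compact K & forall x, f x != 0 -> K x.

Section CcReal.
Context (R : realType) (G : ptopologicalType).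
Hypotheses (Gh : hausdorff_space G) (Glc : locally_compact [set: G])
  (Gsc : @second_countable G).
Implicit Types (f g : G -> R).

Lemma CcR0 : CcR (fun _ : G => 0 : R).
Proof.
split; first by move=> x; exact: cvg_cst.
by exists set0; [exact: compact0 | move=> x; rewrite eqxx].
Qed.

Lemma compact_union (K L : set G) : compact K -> compact L -> compact (K `|` L).
Proof. exact: compactU. Qed.

Lemma CcR_bounded f : CcR f -> exists2 M, 0 <= M & forall x, `|f x| <= M.
Proof.
move=> [cf [K cK fK]].
have cfK : compact (f @` K) by apply: continuous_compact => //; exact: continuous_subspaceT.
have [M [_ hM]] := compact_bounded cfK.
have M1 : M < `|M| + 1 by rewrite ltr_pwDr// ler_norm.
exists (`|M| + 1); first by rewrite addr_ge0.
move=> x; have [fx|fx] := eqVneq (f x) 0; first by rewrite fx normr0 addr_ge0.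
by apply: (hM _ M1); exists x => //; exact: fK.
Qed.

(* [1 - (1 - f) (1 - g)] stays in [0, 1] and equals [1] where [f] or [g] does. *)
Lemma CcR_join f g : CcR f -> CcR g -> CcR (fun x => f x + g x - f x * g x).
Proof.
move=> [cf [K cK fK]] [cg [L cL gL]]; split.
  move=> x; apply: cvgB; first by apply: cvgD; [exact: cf | exact: cg].
  by apply: cvgM; [exact: cf | exact: cg].
exists (K `|` L); first exact: compact_union.
move=> x; apply: contraNP => /not_orP[h1 h2].
have -> : f x = 0 by apply/eqP; apply: contrapT => /negP /fK.
have -> : g x = 0 by apply/eqP; apply: contrapT => /negP /gL.
by rewrite mul0r addr0 subr0.
Qed.

Lemma plateau (U : set G) x : open U -> U x -> exists g : G -> R,
  [/\ CcR g, forall y, 0 <= g y <= 1, forall y, g y != 0 -> U y &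
      exists V, [/\ open V, V x & forall y, V y -> g y = 1]].
Proof.
move=> oU Ux; have [K cK [V oV [Vx VK]]] := compact_nbhd Glc x.
have [f [cf f01 fx fUV]] := bump R Gh Glc (openI oU oV) (conj Ux Vx).
pose g y := Num.min 1 (2 * f y); exists g.
have gn y : g y != 0 -> (U `&` V) y.
  move=> gy; apply: fUV; apply: contraNneq gy => fy.
  by rewrite /g fy mulr0; apply/eqP/min_idPr.
split.
- split; last by exists K => // y /gn[_ /VK].
  move=> y; apply: (@continuous_min R G (fun=> 1) (fun z => 2 * f z)); first exact: cvg_cst.
  by apply: cvgM; [exact: cvg_cst | exact: cf].
- move=> y; have /andP[a b] := f01 y; rewrite /g le_min ler01 ge_min lexx andbT /=; lra.
- by move=> y /gn[].
- exists (f @^-1` [set t | t > 2^-1]); split.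
  + by apply: open_comp; [move=> y _; exact: cf | exact: open_gt].
  + by rewrite /= fx; lra.
  + by move=> y /= h; apply/min_idPl; lra.
Qed.

(** The uniqueness half of the Riesz theorem. The indicator of an open set is an increasing limit of
    functions in [C_c], so the measures agree on open sets; these are stable under intersection and
    contain a countable cover by sets of finite measure. *)
Lemma measure_eq_Cc (m1 m2 : {measure set (borel G) -> \bar R}) :
  (forall K : set G, compact K -> (m1 K < +oo)%E) ->
  (forall f, CcR f -> (forall x, 0 <= f x) ->
    (\int[m1]_x (f x)%:E = \int[m2]_x (f x)%:E)%E) ->
  forall A, measurable A -> m1 A = m2 A.
Proof.
move=> fin eqC.
have [V_ [oO OK Ob]] := exhaustion Glc Gsc.
have OO n : (m1 (V_ n) < +oo)%E.
  have [K cK OnK] := OK n; apply: le_lt_trans (fin K cK); apply: le_measure => //.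
    by rewrite inE; exact: open_borel.
  by rewrite inE; apply: closed_borel; exact: compact_closed.
have eqO (U : set G) : open U -> m1 U = m2 U.
  move=> oU.
  (* [g n] equals one on [V_ n] whenever some admissible function supported in [U] does; by
     [plateau] such sets [V_ n] cover [U]. *)
  have /choice[g hg] : forall n, exists g : G -> R, [/\ CcR g, forall y, 0 <= g y <= 1,
      forall y, g y != 0 -> U y & (exists h : G -> R, [/\ CcR h, forall y, 0 <= h y <= 1,
        forall y, h y != 0 -> U y & forall y, V_ n y -> h y = 1]) -> forall y, V_ n y -> g y = 1].
    move=> n; have [[h [h1 h2 h3 h4]]|nh] := pselect (exists h : G -> R, [/\ CcR h,
        forall y, 0 <= h y <= 1, forall y, h y != 0 -> U y & forall y, V_ n y -> h y = 1]).
      by exists h; split.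
    exists (fun=> 0); split => //; first exact: CcR0.
    + by move=> y; rewrite lexx ler01.
    + by move=> y; rewrite eqxx.
  (* The recursion makes [1 - F n] the product of the functions [1 - g m] for [m < n], so [F]
     increases and equals one as soon as some [g m] does. *)
  pose F := fix F n : G -> R := if n is m.+1 then fun x => F m x + g m x - F m x * g m x else fun=> 0.
  have F01 n x : 0 <= F n x <= 1.
    elim: n => [|n IH] /=; first by rewrite lexx ler01.
    by have [_ /(_ x)/andP[a b] _ _] := hg n; move: IH => /andP[c d]; apply/andP; split; nra.
  have FC n : CcR (F n).
    by elim: n => [|n IH] /=; [exact: CcR0 | apply: CcR_join => //; case: (hg n)].
  have Fmono x n m : (n <= m)%N -> F n x <= F m x.
    move=> /subnKC <-; elim: (m - n)%N => [|k IH]; first by rewrite addn0.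
    rewrite addnS /=; have [_ /(_ x)/andP[a b] _ _] := hg (n + k)%N.
    by have /andP[c d] := F01 (n + k)%N x; nra.
  have Flim x : limn (fun n => (F n x)%:E) = (\1_U x)%:E :> \bar R.
    apply: cvg_lim => //; have [Ux|Ux] := pselect (U x); last first.
      rewrite indicE memNset//.
      rewrite (_ : (fun n => _) = fun=> 0%E); first exact: cvg_cst.
      apply/funext => n; congr _%:E; elim: n => [//|n IH] /=.
      have [_ _ /(_ x) h _] := hg n.
      have -> : g n x = 0 by apply/eqP; apply: contrapT => /negP /h.
      by rewrite IH mul0r addr0 subr0.
    rewrite indicE mem_set//.
    have [h [h1 h2 h3 [V [oV Vx hV]]]] := plateau oU Ux.
    have [n [Onx OnV]] := Ob x V oV Vx.
    have gn : g n x = 1.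
      have [_ _ _ H] := hg n; apply: H => //; exists h; split => // y /OnV; exact: hV.
    have Fn k : F (n.+1 + k)%N x = 1.
      apply/le_anti; have /andP[_ ->] /= := F01 (n.+1 + k)%N x.
      by apply: le_trans (Fmono x n.+1 _ (leq_addr _ _)); rewrite /= gn mulr1; lra.
    rewrite -(cvg_shiftn n.+1); rewrite (_ : (fun k => _) = fun=> 1%:E); first exact: cvg_cst.
    by apply/funext => k; rewrite addnC Fn.
  have key (m : {measure set (borel G) -> \bar R}) :
      m U = limn (fun n => \int[m]_x (F n x)%:E)%E.
    rewrite -monotone_convergence//.
    - under eq_integral do rewrite Flim.
      by rewrite integral_indic ?setIT//; exact: open_borel.
    - by move=> n; apply/measurable_EFinP; apply: continuous_borel; case: (FC n).
    - by move=> n x _; rewrite lee_fin; case/andP: (F01 n x).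
    - by move=> x _ i j ij; rewrite lee_fin; exact: Fmono.
  rewrite !key; congr (limn _); apply/funext => n; apply: eqC => // x.
  by case/andP: (F01 n x).
move=> A mA; apply: (@g_sigma_algebra_measure_unique _ _ (borel G) (@open G) _ V_) => //.
- by move=> B oB; exact: open_borel.
- by apply/seteqP; split => // x _; have [n [Onx _]] := Ob x setT openT I; exists n.
- exact: openI.
Qed.
End CcReal.

Section Haar.
Context (R : realType) (G : topGroupoidType).
Hypotheses (Gh : hausdorff_space G) (Glc : locally_compact [set: G])
  (Gsc : @second_countable G).
Variable lam : haarSystem R G.
Implicit Types (u x y : G).

Definition rfib u : set G := [set y | grng y = u].

Lemma rfib_closed u : closed (rfib u).
Proof.
apply: (@preimage_closed _ _ (@grng G : G -> G) [set u]).
  by move=> x _; exact: grng_continuous.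
apply: accessible_closed_set1; exact: hausdorff_accessible.
Qed.

Lemma rfib_measurable u : measurable (rfib u : set (borel G)).
Proof. by apply: closed_borel; exact: rfib_closed. Qed.

(** A point off the fibre is off the support and so has a null neighbourhood; countably many basic
    ones cover the complement. *)
Lemma haar_null u : gunits G u -> haar lam u (~` rfib u : set (borel G)) = 0%E.
Proof.
move=> hu; have mN : measurable (~` rfib u : set (borel G)) by apply: measurableC; exact: rfib_measurable.
have [b [bo bb]] := countable_base Gsc.
pose F n : set (borel G) := if `[< haar lam u (b n) = 0%E >] then b n else set0.
have FN n : (haar lam u).-negligible (F n).
  rewrite /F; case: asboolP => [h|_]; last exact: negligible_set0.
  by exists (b n); split => //; exact: open_borel.
have : (haar lam u).-negligible (~` rfib u : set (borel G)).
  apply: negligibleS (negligible_bigcup FN) => y /= ny.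
  have : ~ [set x | forall U : set G, open U -> U x -> (0 < haar lam u U)%E] y.
    by rewrite (haar_supp lam hu).
  move=> /existsNP[U /not_implyP[oU /not_implyP[Uy hU]]].
  have [n [bny bnU]] := bb y U oU Uy.
  exists n => //; rewrite /F; case: asboolP => // h; exfalso; apply: h.
  apply/eqP; rewrite eq_le measure_ge0 andbT.
  move/negP: hU; rewrite -leNgt; apply: le_trans; apply: le_measure => //.
    by rewrite inE; exact: open_borel.
  by rewrite inE; exact: open_borel.
move=> [B [mB B0 NB]]; apply/eqP; rewrite eq_le measure_ge0 andbT -B0.
by apply: le_measure => //; rewrite inE.
Qed.

Lemma haar_sf u : gunits G u -> sigma_finite [set: borel G] (haar lam u).
Proof.
move=> hu; have [V_ [oO OK Ob]] := exhaustion Glc Gsc; exists V_.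
  by apply/esym/seteqP; split => // x _; have [n [Onx _]] := Ob x setT openT I; exists n.
move=> n; split; first exact: open_borel.
have [K cK OnK] := OK n; apply: le_lt_trans (haar_compact lam hu cK); apply: le_measure => //.
  by rewrite inE; exact: open_borel.
by rewrite inE; apply: closed_borel; exact: compact_closed.
Qed.

Lemma bdd_rintegrable u (f : G -> R) (K : set G) (M : R) : gunits G u ->
  measurable_fun [set: borel G] (f : borel G -> R) -> (forall x, `|f x| <= M) ->
  compact K -> (forall x, f x != 0 -> K x) -> rintegrable (haar lam u) setT f.
Proof.
move=> hu mf fM cK fK.
have mK : measurable (K : set (borel G)) by apply: closed_borel; exact: compact_closed.
have iK : (haar lam u).-integrable (K : set (borel G)) (EFin \o (f : borel G -> R)).
  apply: measurable_bounded_integrable => //; first exact: haar_compact.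
    exact: measurable_funTS.
  exists M; split; first exact: num_real.
  by move=> t Mt x _ /=; apply: le_trans (fM x) (ltW Mt).
have := (integrable_mkcond _ mK).1 iK; apply: eq_integrable => // x _.
rewrite patchE; case: ifPn => // /negP xK; rewrite /=.
have [->//|/fK Kx] := eqVneq (f x) 0.
by exfalso; apply: xK; rewrite inE.
Qed.

Lemma CcR_rintegrable u (f : G -> R) : gunits G u -> CcR f -> rintegrable (haar lam u) setT f.
Proof.
move=> hu Cf; have [M M0 fM] := CcR_bounded Cf; case: Cf => cf [K cK fK].
by apply: (bdd_rintegrable (K := K) (M := M)) => //; exact: continuous_borel.
Qed.

Lemma rintegrable_fib u D (f : G -> R) : measurable (D : set (borel G)) ->
  rintegrable (haar lam u) setT f -> rintegrable (haar lam u) D f.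
Proof. by move=> mD; apply: integrableS. Qed.

Lemma setTDN u : [set: G] `\` (~` rfib u) = rfib u.
Proof. by rewrite setTD setCK. Qed.

Lemma ge0_integral_rfib u (f : borel G -> \bar R) : gunits G u -> measurable_fun setT f ->
  (forall x, 0 <= f x)%E ->
  (\int[haar lam u]_x f x = \int[haar lam u]_(x in (rfib u : set (borel G))) f x)%E.
Proof.
move=> hu mf f0; have mN : measurable (~` rfib u : set (borel G)).
  by apply: measurableC; exact: rfib_measurable.
have := @ge0_negligible_integral _ _ _ (haar lam u) setT (~` rfib u) f mN measurableT mf
  (fun x _ => f0 x) (haar_null hu).
by rewrite setTDN.
Qed.

Lemma bintegral_rfib u (f : G -> R) : gunits G u -> rintegrable (haar lam u) setT f ->
  bintegral (haar lam u) setT f = bintegral (haar lam u) (rfib u) f.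
Proof.
move=> hu rf; have mN : measurable (~` rfib u : set (borel G)).
  by apply: measurableC; exact: rfib_measurable.
have := @negligible_integral _ _ _ (haar lam u) setT (~` rfib u) _ mN measurableT rf
  (haar_null hu).
by rewrite setTDN.
Qed.

(** Left translation as a map on all of [G]: off the fibre where [gmul x] is meaningful it takes a
    constant default value, and that set is null for the measure at [gsrc x] by [haar_null]. *)
Definition ltrans x : borel G -> borel G := (gmul x : borel G -> borel G) \_ (rfib (gsrc x)).

Lemma ltransE x y : gsrc x = grng y -> ltrans x y = gmul x y.
Proof. by move=> xy; rewrite /ltrans patchE mem_set//= /rfib /= xy. Qed.

Lemma cont_on_ltrans x : cont_on (rfib (gsrc x)) (gmul x).
Proof.
apply: (@cont_on_gmul _ G (rfib (gsrc x)) (fun=> x) id).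
- exact: cont_on_cst.
- exact: cont_id.
- by move=> t ->.
Qed.

Lemma ltrans_measurable x : measurable_fun [set: borel G] (ltrans x).
Proof.
apply/measurable_restrict => //; first exact: rfib_measurable.
rewrite setTI; apply: (cont_on_borel_map (rfib_measurable _)).
exact: cont_on_ltrans.
Qed.

(** Left invariance is given for integrals of [C_c] functions. The uniqueness of a measure with
    prescribed integrals extends it to Borel sets, and so to the merely measurable integrands of the
    regular representation. *)
Lemma haar_ltrans x (A : set (borel G)) : measurable A ->
  haar lam (grng x) A = pushforward (haar lam (gsrc x)) (ltrans x) A.
Proof.
have mphi := ltrans_measurable x.
pose mphi_mixin := isMeasurableFun.Build _ _ _ _ _ mphi.
pose phi : {mfun borel G >-> borel G} := HB.pack (ltrans x) mphi_mixin.
have hr := grng_unit x; have hs := gsrc_unit x.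
apply: (@measure_eq_Cc R G Gh Glc Gsc (haar lam (grng x)) (pushforward (haar lam (gsrc x)) phi)).
  by move=> K; exact: haar_compact.
move=> f Cf f0.
have mf : measurable_fun [set: borel G] (f : borel G -> R) by apply: continuous_borel; case: Cf.
have mfE : measurable_fun [set: borel G] (fun y : borel G => (f y)%:E) by exact/measurable_EFinP.
have -> : (\int[pushforward (haar lam (gsrc x)) phi]_y (f y)%:E =
    \int[haar lam (gsrc x)]_y (f (ltrans x y))%:E)%E.
  rewrite (ge0_integral_pushforward mphi (haar lam (gsrc x)) measurableT mfE) ?preimage_setT//.
  by move=> y _; rewrite lee_fin.
pose fC : G -> R[i]^o := fun y => (f y)%:C.
have CfC : Cc R G fC.
  case: Cf => cf [K cK fK]; split.
    by apply: cont_on_setT; apply: cont_on_RC; exact: cont_onT.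
  apply: (subclosed_compact _ cK); first exact: closed_closure.
  have cK' := compact_closed Gh cK; move/closure_id : (cK') => ->; apply: closureS => y /=.
  by rewrite /fC => h; apply: fK; apply: contraNneq h => ->.
have := haar_left_invariant lam x CfC; rewrite /cintegral => -[h _].
(* The indicator cancels the default value of [ltrans]. What is left is supported in the compact set
   [K'], the translate by [ginv x] of the part of [K] in the fibre. *)
have gf : rintegrable (haar lam (gsrc x)) setT (fun y => f (ltrans x y) * \1_(rfib (gsrc x)) y).
  have [M M0 fM] := CcR_bounded Cf; case: (Cf) => cf [K cK fK].
  pose K' := gmul (ginv x) @` (K `&` rfib (grng x)).
  apply: (bdd_rintegrable (K := K') (M := M)) => //.
  - apply: measurable_funM; first exact: measurableT_comp mf mphi.
    exact: measurable_indic (rfib_measurable _).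
  - move=> y; rewrite indicE; case: (_ \in _); rewrite ?mulr1 ?mulr0 ?normr0//.
  - apply: continuous_compact.
      apply/subspace_continuousP => z [_ zx]; have := @cont_on_ltrans (ginv x) z.
      rewrite gsrc_inv => /(_ zx) hz B /hz; rewrite /within /= !nbhs_simpl /=.
      by apply: filterS => w hw [_ /hw].
    apply: (subclosed_compact _ cK); last by move=> ? [].
    by apply: closedI; [exact: compact_closed | exact: rfib_closed].
  - move=> y; rewrite indicE; case: (boolP (y \in _)); rewrite ?mulr0 ?eqxx// mulr1 inE => yx.
    have yx' : gsrc x = grng y by rewrite yx.
    rewrite ltransE// => /fK Ky; exists (gmul x y); last by rewrite gmulVK.
    by split => //; rewrite /rfib /= grng_mul.
have e1 : bintegral (haar lam (gsrc x)) [set y | grng y = gsrc x] (fun y => f (gmul x y)) =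
    (\int[haar lam (gsrc x)]_y (f (ltrans x y))%:E)%E.
  rewrite [RHS](ge0_integral_rfib hs); last 2 first.
  - by apply/measurable_EFinP; exact: measurableT_comp mf mphi.
  - by move=> y; rewrite lee_fin.
  apply: eq_integral => y; rewrite inE => yx; rewrite ltransE//; exact/esym.
have i1 := rintE (rfib_measurable (gsrc x)) (rintegrable_fib (rfib_measurable (gsrc x)) gf).
have i2 := rintE measurableT (CcR_rintegrable hr Cf).
rewrite -[LHS]/(bintegral (haar lam (grng x)) setT f) i2.
rewrite -e1.
have e2 : bintegral (haar lam (gsrc x)) [set y | grng y = gsrc x] (fun y => f (gmul x y)) =
    bintegral (haar lam (gsrc x)) (rfib (gsrc x)) (fun y => f (ltrans x y) * \1_(rfib (gsrc x)) y).
  apply: eq_integral => y yx; rewrite indicE yx mulr1; congr _%:E; congr f.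
  by rewrite ltransE//; move: yx; rewrite inE => /esym.
rewrite e2 i1; congr _%:E; rewrite /rint -h; congr fine.
by rewrite -e2.
Qed.

Lemma ge0_integral_ltrans x (f : borel G -> \bar R) :
  measurable_fun (rfib (grng x) : set (borel G)) f -> (forall y, 0 <= f y)%E ->
  (\int[haar lam (gsrc x)]_(y in (rfib (gsrc x) : set (borel G))) f (gmul x y) =
   \int[haar lam (grng x)]_(y in (rfib (grng x) : set (borel G))) f y)%E.
Proof.
move=> mf f0; have mphi := ltrans_measurable x.
pose mphi_mixin := isMeasurableFun.Build _ _ _ _ _ mphi.
pose phi : {mfun borel G >-> borel G} := HB.pack (ltrans x) mphi_mixin.
rewrite [RHS](@eq_measure_integral _ _ _ _ (pushforward (haar lam (gsrc x)) phi)); last first.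
  by move=> A mA _; exact: haar_ltrans.
have mD : measurable (rfib (grng x) : set (borel G)) by exact: rfib_measurable.
rewrite (ge0_integral_pushforward mphi (haar lam (gsrc x)) mD mf); last by move=> y _.
have mP : measurable (ltrans x @^-1` rfib (grng x)) by rewrite -[X in measurable X]setTI; exact: (ltrans_measurable x).
have mN : measurable (~` rfib (gsrc x) : set (borel G)).
  by apply: measurableC; exact: rfib_measurable.
have mc : measurable_fun (ltrans x @^-1` rfib (grng x)) (f \o ltrans x).
  apply: (measurable_comp mD _ mf); first by move=> _ [y hy <-].
  by apply: measurable_funTS; exact: ltrans_measurable.
rewrite (@ge0_negligible_integral _ _ _ _ _ _ _ mN mP mc (fun y _ => f0 _) (haar_null (gsrc_unit x))).
rewrite setDE setCK (_ : _ `&` _ = rfib (gsrc x)); last first.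
  apply/seteqP; split => [y []//|y yx]; split => //; rewrite /rfib /=.
  by rewrite ltransE ?grng_mul//; exact/esym.
by apply: eq_integral => y; rewrite inE => yx; rewrite /= ltransE//; exact/esym.
Qed.

Lemma bintegral_ltrans x (h : G -> R) :
  measurable_fun (rfib (grng x) : set (borel G)) (h : borel G -> R) ->
  bintegral (haar lam (gsrc x)) (rfib (gsrc x)) (fun y => h (gmul x y)) =
  bintegral (haar lam (grng x)) (rfib (grng x)) h.
Proof.
move=> mh; rewrite /bintegral [LHS]integralE [RHS]integralE.
have mE : measurable_fun (rfib (grng x) : set (borel G)) (fun y : borel G => (h y)%:E).
  exact/measurable_EFinP.
rewrite -(ge0_integral_ltrans (measurable_funepos mE))//.
rewrite -(ge0_integral_ltrans (measurable_funeneg mE))//.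
by congr (_ - _)%E; apply: eq_integral => y _; rewrite ?funeposE ?funenegE.
Qed.

Lemma cintegral_ltrans x (f : G -> R[i]^o) : cmeasurable (rfib (grng x)) f ->
  cintegral (haar lam (gsrc x)) (rfib (gsrc x)) (fun y => f (gmul x y)) =
  cintegral (haar lam (grng x)) (rfib (grng x)) f.
Proof.
move=> [m1 m2]; rewrite /cintegral.
by rewrite (bintegral_ltrans m1) (bintegral_ltrans m2).
Qed.
End Haar.

(** * The convolution algebra *)

Section CompactSupport.
Context (R : realType) (G : ptopologicalType).
Hypotheses (Gh : hausdorff_space G).
Implicit Types (a b f : G -> R[i]^o) (h : G -> R).
Local Notation N k := (nrm (k : R[i]^o)).

Lemma CcP f : Cc R G f <-> continuous f /\ exists2 K : set G, compact K & forall x, f x != 0 -> K x.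
Proof.
split=> [[cf cK]|[cf [K cK fK]]].
  by split => //; exists (fsupp f) => // x fx; exact: subset_closure.
split => //; apply: (subclosed_compact _ cK); first exact: closed_closure.
by have /closure_id -> := compact_closed Gh cK; exact: closureS.
Qed.

Lemma Cc_comb (k : R[i]) a b : Cc R G a -> Cc R G b -> Cc R G (k *: a + b).
Proof.
move=> /CcP[ca [K cK aK]] /CcP[cb [L cL bL]]; apply/CcP; split.
  apply: cont_on_setT; apply: (@cont_onD _ R[i] setT (fun x => k * a x) b); last exact: (cont_onT cb).
  by apply: (@cont_onM _ R[i] setT (fun=> k) a); [exact: cont_on_cst | exact: (cont_onT ca)].
exists (K `|` L); first exact: compactU.
move=> x; apply: contraNP => /not_orP[h1 h2].
rewrite -[(k *: a + b) x]/(k * a x + b x).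
have -> : a x = 0 by apply/eqP; apply: contrapT => /negP /aK.
have -> : b x = 0 by apply/eqP; apply: contrapT => /negP /bL.
by rewrite mulr0 addr0.
Qed.

Lemma Cc0 : Cc R G 0.
Proof.
apply/CcP; split; first by move=> x; exact: cvg_cst.
by exists set0; [exact: compact0 | move=> x; rewrite eqxx].
Qed.

Lemma CcD a b : Cc R G a -> Cc R G b -> Cc R G (a + b).
Proof. by move=> ca cb; rewrite -[a]scale1r; exact: Cc_comb. Qed.

Lemma Cc_mulf (p : G -> R[i]^o) a : continuous p -> Cc R G a -> Cc R G (fun x => p x * a x).
Proof.
move=> cp /CcP[ca [K cK aK]]; apply/CcP; split.
  by apply: cont_on_setT; apply: (@cont_onM _ R[i] setT p a); [exact: (cont_onT cp) | exact: (cont_onT ca)].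
by exists K => // x; apply: contraNP => h; apply/eqP;
  have -> : a x = 0 by [apply/eqP; apply: contrapT => /negP /aK]; rewrite mulr0.
Qed.

Lemma Cc_nrm f : Cc R G f -> CcR (fun x => N (f x)).
Proof.
move=> /CcP[cf [K cK fK]]; split.
  by apply: cont_on_setT; apply: cont_on_nrm; exact: cont_onT.
by exists K => // x h; apply: fK; apply: contraNneq h => ->; rewrite (@nrm0 R R[i]^o).
Qed.

Lemma CcR_mulf (p : G -> R) h : continuous p -> CcR h -> CcR (fun x => h x * p x).
Proof.
move=> cp [ch [K cK hK]]; split.
  by apply: cont_on_setT; apply: (@cont_onM _ R setT h p); [exact: (cont_onT ch) | exact: (cont_onT cp)].
by exists K => // x hx; apply: hK; apply: contraNneq hx => ->; rewrite mul0r.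
Qed.

Lemma Cc_cmeasurable f : Cc R G f -> cmeasurable setT f.
Proof.
by move=> [cf _]; split; apply: continuous_borel; apply: cont_on_setT;
  [apply: cont_on_Re | apply: cont_on_Im]; exact: cont_onT.
Qed.

Lemma cont_on_cmeasurable (D : set G) f : measurable (D : set (borel G)) ->
  cont_on D f -> cmeasurable D f.
Proof.
by move=> mD cf; split; apply: cont_on_measurable => //; [apply: cont_on_Re | apply: cont_on_Im].
Qed.
End CompactSupport.

Section Convolution.
Context (R : realType) (G : topGroupoidType).
Hypotheses (Gh : hausdorff_space G) (Glc : locally_compact [set: G])
  (Gsc : @second_countable G).
Variable lam : haarSystem R G.
Implicit Types (u x y : G) (a b f : G -> R[i]^o).
Local Notation N k := (nrm (k : R[i]^o)).

Lemma cont_on_quot x : cont_on (rfib (grng x)) (fun y => gmul (ginv y) x).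
Proof.
apply: cont_on_gmul; [exact/cont_on_ginv/cont_id | exact: cont_on_cst | ].
by move=> y yx; rewrite gsrc_inv.
Qed.

Lemma nrm_rintegrable u a : gunits G u -> Cc R G a -> rintegrable (haar lam u) setT (fun x => N (a x)).
Proof. by move=> hu ca; apply: (CcR_rintegrable Gh lam hu); exact: Cc_nrm. Qed.

Lemma Cc_bounded a : Cc R G a -> exists2 M, 0 <= M & forall x, N (a x) <= M.
Proof.
move=> ca; have [M M0 h] := CcR_bounded (Cc_nrm Gh ca).
by exists M => // x; have := h x; rewrite ger0_norm ?nrm_ge0.
Qed.

Lemma Cc_cintegrable u D a : gunits G u -> measurable (D : set (borel G)) -> Cc R G a ->
  cintegrable (haar lam u) D a.
Proof.
move=> hu mD ca; apply: (@cintegrable_le _ _ _ _ mD a (fun x => N (a x))) => //.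
- by have [m1 m2] := Cc_cmeasurable ca; split; exact: measurable_funTS.
- by apply: (rintegrable_fib mD); exact: nrm_rintegrable.
Qed.

Lemma conv_cintegrable a b x : Cc R G a -> Cc R G b ->
  cintegrable (haar lam (grng x)) (rfib (grng x)) (fun y => a y * b (gmul (ginv y) x)).
Proof.
move=> ca cb; have [M M0 bM] := Cc_bounded cb; have mD := rfib_measurable Gh (grng x).
apply: (@cintegrable_le _ _ _ _ mD _ (fun y => M * N (a y))) => //.
- apply: cont_on_cmeasurable => //; apply: (@cont_onM _ R[i]).
    by apply: cont_onT; case: ca.
  apply: (@cont_on_comp _ _ _ _ setT (fun y => gmul (ginv y) x) b) => //.
    exact: cont_on_quot.
  by apply: cont_onT; case: cb.
- apply: (rintegrableZ mD); apply: (rintegrable_fib mD).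
  by apply: nrm_rintegrable => //; exact: grng_unit.
- by move=> y _; rewrite nrmM mulrC ler_wpM2r ?nrm_ge0.
Qed.

Lemma conv_comb_l k a a' b : Cc R G a -> Cc R G a' -> Cc R G b ->
  conv lam (k *: a + a') b = k *: conv lam a b + conv lam a' b.
Proof.
move=> ca ca' cb; apply/funext => x; have mD := rfib_measurable Gh (grng x).
rewrite -[RHS]/(k * conv lam a b x + conv lam a' b x) /conv.
rewrite -(cintegral_comb mD k (conv_cintegrable x ca cb) (conv_cintegrable x ca' cb)).
congr cintegral; apply/funext => y.
by rewrite -[(k *: a + a') y]/(k * a y + a' y) mulrDl mulrA.
Qed.

Lemma conv_comb_r k a b b' : Cc R G a -> Cc R G b -> Cc R G b' ->
  conv lam a (k *: b + b') = k *: conv lam a b + conv lam a b'.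
Proof.
move=> ca cb cb'; apply/funext => x; have mD := rfib_measurable Gh (grng x).
rewrite -[RHS]/(k * conv lam a b x + conv lam a b' x) /conv.
rewrite -(cintegral_comb mD k (conv_cintegrable x ca cb) (conv_cintegrable x ca cb')).
congr cintegral; apply/funext => y.
by rewrite -[(k *: b + b') _]/(k * b _ + b' _); ring.
Qed.

Lemma Cc_adj a : Cc R G a -> Cc R G (adj a).
Proof.
move=> /(CcP Gh)[ca [K cK aK]]; apply/(CcP Gh); split.
  apply: cont_on_setT; apply: cont_on_conj.
  apply: (@cont_on_comp _ _ _ setT setT (@ginv G) a) => //; last exact: cont_onT.
  by apply: cont_onT; exact: ginv_continuous.
exists (@ginv G @` K).
  by apply: continuous_compact => //; apply: continuous_subspaceT; exact: ginv_continuous.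
move=> x h; exists (ginv x); last exact: ginvK.
by apply: aK; apply: contraNneq h => h; rewrite /adj h rmorph0.
Qed.

Lemma adjK a : adj (adj a) = a.
Proof. by apply/funext => x; rewrite /adj ginvK conjcK. Qed.

Lemma adj_conv a b : Cc R G a -> Cc R G b -> adj (conv lam a b) = conv lam (adj b) (adj a).
Proof.
move=> ca cb; apply/funext => x; rewrite /adj /conv grng_inv.
have mD := rfib_measurable Gh (grng x).
(* The integrand after the substitution [z = x y], which moves the integral from the fibre over
   [gsrc x] to the one over [grng x]. *)
pose f (z : G) : R[i]^o := a (gmul (ginv x) z) * b (ginv z).
have qc : cont_on (rfib (grng x)) (gmul (ginv x)).
  by have := @cont_on_ltrans _ (ginv x); rewrite gsrc_inv.
have mf : cmeasurable (rfib (grng x)) f.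
  apply: cont_on_cmeasurable => //; apply: (@cont_onM _ R[i]).
    by apply: (@cont_on_comp _ _ _ _ setT _ a) => //; apply: cont_onT; case: ca.
  apply: (@cont_on_comp _ _ _ _ setT (@ginv G) b) => //; last by apply: cont_onT; case: cb.
  by apply: cont_onT; exact: ginv_continuous.
have -> : cintegral (lam (gsrc x)) [set y | grng y = gsrc x]
    (fun y => a y * b (gmul (ginv y) (ginv x))) =
    cintegral (haar lam (gsrc x)) (rfib (gsrc x)) (fun y => f (gmul x y)).
  rewrite /cintegral; congr (fine _ +i* fine _)%C; apply: eq_integral => y;
    by rewrite inE => /esym yx; rewrite /f gmulVK// ginv_gmul.
rewrite (cintegral_ltrans Gh Glc Gsc lam mf) -cintegral_conj//; last first.
  have [M M0 aM] := Cc_bounded ca.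
  apply: (@cintegrable_le _ _ _ _ mD _ (fun z => M * N (adj b z))) => //.
  - apply: (rintegrableZ mD); apply: (rintegrable_fib mD).
    by apply: nrm_rintegrable; [exact: grng_unit | exact: Cc_adj].
  - by move=> y _; rewrite /f nrmM /adj nrm_conj ler_wpM2r ?nrm_ge0.
rewrite /cintegral; congr (fine _ +i* fine _)%C; apply: eq_integral => y; rewrite inE => yx;
  by rewrite /f conjcM mulrC ginv_gmul ?gsrc_inv// ginvK.
Qed.

Lemma cont_cintegral A : Cc R G A ->
  continuous (fun x => cintegral (haar lam (grng x)) setT A : R[i]^o).
Proof.
move=> cA; apply: cont_on_setT.
apply: (@cont_on_comp _ _ _ setT (gunits G) (@grng G)
  (fun u => cintegral (haar lam u) setT A)).
- by apply: cont_onT; exact: grng_continuous.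
- by have /subspace_continuousP := (@haar_continuous _ _ lam _ cA).
- by move=> x _; exact: grng_unit.
Qed.

Lemma cont_rint (f : G -> R) : CcR f -> continuous (fun x => rint (haar lam (grng x)) setT f).
Proof.
move=> Cf; have cA : Cc R G (fun x => (f x)%:C).
  case: Cf => cf [K cK fK]; apply/(CcP Gh); split.
    by apply: cont_on_setT; apply: cont_on_RC; exact: cont_onT.
  by exists K => // x h; apply: fK; apply: contraNneq h => ->.
have h := cont_on_setT (cont_on_Re (cont_onT (cont_cintegral cA) (D:=setT))).
by move=> x; have := h x.
Qed.

Lemma rint_rfib u (f : G -> R) : gunits G u -> CcR f ->
  rint (haar lam u) (rfib u) f = rint (haar lam u) setT f.
Proof.
move=> hu Cf; rewrite /rint; congr fine; apply/esym.
by apply: (bintegral_rfib Gh Gsc) => //; exact: CcR_rintegrable.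
Qed.

(** The integral is continuous in the unit and vanishes unless the fibre meets the support, so only
    the image of a compact set matters. The bound makes the suprema in [Inorm] genuine. *)
Lemma rint_bounded (f : G -> R) : CcR f ->
  exists2 M, 0 <= M & forall u, gunits G u -> `|rint (haar lam u) setT f| <= M.
Proof.
move=> Cf; have [cf [K cK fK]] := Cf.
pose P x := rint (haar lam (grng x)) setT f.
have cPK : compact (P @` K).
  by apply: continuous_compact => //; apply: continuous_subspaceT; exact: cont_rint.
have [M [_ hM]] := compact_bounded cPK.
have M1 : M < `|M| + 1 by rewrite ltr_pwDr// ler_norm.
exists (`|M| + 1); first by rewrite addr_ge0.
move=> u hu; have [[y [Ky yu]]|h] := pselect (exists y, K y /\ grng y = u).
  by apply: (hM _ M1); exists y => //; rewrite /P yu.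
rewrite -rint_rfib//.
have -> : rint (haar lam u) (rfib u) f = 0.
  rewrite /rint /bintegral (eq_integral (fun=> 0%E)) ?integral0// => y; rewrite inE => yu.
  congr _%:E; apply/eqP; apply: contrapT => /negP fy.
  by apply: h; exists y; split => //; exact: fK.
by rewrite normr0 addr_ge0.
Qed.

Lemma conv_neq0 a b x : conv lam a b x != 0 ->
  exists y, [/\ grng y = grng x, a y != 0 & b (gmul (ginv y) x) != 0].
Proof.
move=> h; apply: contrapT => ne; move/eqP: h; apply.
rewrite /conv /cintegral /bintegral.
have H y : y \in (rfib (grng x) : set (borel G)) -> a y * b (gmul (ginv y) x) = 0.
  rewrite inE => yx; apply/eqP; apply: contrapT => /negP; rewrite mulf_eq0 negb_or => /andP[h1 h2].
  by apply: ne; exists y.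
rewrite (eq_integral (fun=> 0%E)); last by move=> y /H ->.
rewrite [X in _ +i* (fine X)](eq_integral (fun=> 0%E)); last by move=> y /H ->.
by rewrite !integral0.
Qed.

Lemma composable_closed : closed [set p : G * G | gsrc p.1 = grng p.2].
Proof.
rewrite -openC openE => -[x y] /= /eqP xy.
have [[U V] /= [sU rV] [oU oV /eqP UV]] := eq_ind _ id Gh _ (@open_hausdorff G) _ _ xy.
exists (@gsrc G @^-1` U, @grng G @^-1` V) => /=.
  split; [apply: gsrc_continuous | apply: grng_continuous]; apply: open_nbhs_nbhs; split => //.
  - by rewrite inE in sU.
  - by rewrite inE in rV.
move=> [x' y'] /= [hx hy] e; have : (U `&` V) (gsrc x') by split => //; rewrite e.
by rewrite UV.
Qed.
End Convolution.

(** Compactness as an induction principle on sets. It builds a partition of unity in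
    [conv_integrand_approx] and yields finitely many values of a cocycle on a compact set. *)
Lemma compact_ind (T : ptopologicalType) (K : set T) (P : set T -> Prop) : compact K ->
  P set0 -> (forall A B, P A -> P B -> P (A `|` B)) -> (forall A B, A `<=` B -> P B -> P A) ->
  (forall x, K x -> exists V, [/\ open V, V x & P V]) -> P K.
Proof.
rewrite compact_cover => cK P0 PU PS loc.
have /choice[V hV] : forall x, exists V, K x -> [/\ open V, V x & P V].
  move=> x; have [Kx|nKx] := pselect (K x); last by exists set0 => /nKx.
  by have [V h] := loc _ Kx; exists V.
have [|x Kx|D' sD cD] := cK _ K V; first by move=> x /hV[].
  by exists x => //; case: (hV _ Kx).
apply: (PS) cD _; rewrite /cover.
have {sD}sD : forall x, x \in finmap.enum_fset D' -> K x by move=> x /sD; rewrite inE.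
suff H : forall s : seq T, (forall x, x \in s -> K x) -> P (\bigcup_(x in [set` s]) V x).
  by apply: (PS) (H _ sD) => x [y Dy Vy]; exists y.
elim=> [|x s IH] h.
  by apply: (PS) P0 => y [z].
apply: (PS _ (V x `|` \bigcup_(y in [set` s]) V y)).
  move=> y [z /=]; rewrite inE => /orP[/eqP->|zs] Vz; [by left | right; by exists z].
apply: PU; first by case: (hV x (h x (mem_head _ _))).
by apply: IH => y ys; apply: h; rewrite inE ys orbT.
Qed.

(** * Continuity and compact support of convolutions *)

Section ConvCc.
Context (R : realType) (G : topGroupoidType).
Hypotheses (Gh : hausdorff_space G) (Glc : locally_compact [set: G])
  (Gsc : @second_countable G).
Variable lam : haarSystem R G.
Implicit Types (u x y : G) (a b f : G -> R[i]^o).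
Local Notation N k := (nrm (k : R[i]^o)).

(** If the ranges of [y0] and [x0] differ, open sets separate them and the conclusion is vacuous
    nearby. Otherwise it is continuity of [y^-1 x] on pairs with equal range. *)
Lemma conv_integrand_near a b x0 y0 (d : R) : Cc R G b -> 0 < d ->
  exists V, [/\ open V, V y0 & exists beta : R[i], \forall x \near x0,
    forall y, V y -> grng y = grng x -> N (b (gmul (ginv y) x) - beta) <= d].
Proof.
move=> [cb _] d0.
have [e|/eqP ne] := pselect (grng y0 = grng x0); last first.
  have [[U V] /= [sU rV] [oU oV /eqP UV]] := eq_ind _ id Gh _ (@open_hausdorff G) _ _ ne.
  exists (@grng G @^-1` U); split.
  - by apply: open_comp => // x _; exact: grng_continuous.
  - by rewrite inE in sU.
  - exists 0; have : nbhs x0 (@grng G @^-1` V).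
      by apply: grng_continuous; apply: open_nbhs_nbhs; split => //; rewrite inE in rV.
    apply: filterS => x hx y hy e; have : (U `&` V) (grng x) by split => //; rewrite -e.
    by rewrite UV.
pose D := [set p : G * G | grng p.1 = grng p.2].
have cq : cont_on D (fun p => b (gmul (ginv p.1) p.2)).
  apply: (@cont_on_comp _ _ _ D setT (fun p => gmul (ginv p.1) p.2) b) => //; last exact: cont_onT.
  apply: cont_on_gmul.
  - by apply: cont_on_ginv; apply: cont_onT => p; exact: cvg_fst.
  - by apply: cont_onT => p; exact: cvg_snd.
  - by move=> p; rewrite gsrc_inv.
have /cont_onC/(_ (y0, x0) e d d0)[[V W] /= [nV nW] VW] := cq.
move: nV; rewrite nbhsE => -[V' [oV' V'y] V'V].
exists V'; split => //; exists (b (gmul (ginv y0) x0)).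
apply: filterS nW => x Wx y V'y1 e1; rewrite -nrmN opprB; apply: ltW.
by apply: (VW (y, x)) => //; split => //; exact: V'V.
Qed.

(** The integrand lives on pairs of equal range and changes with [x], whereas [haar_continuous]
    integrates one fixed function. A partition of unity replaces [b (y^-1 x)] by constants, so that
    a single [A] serves for all [x] near [x0]. *)
Lemma conv_integrand_approx a b x0 (d : R) : Cc R G a -> Cc R G b -> 0 < d ->
  exists2 A, Cc R G A & \forall x \near x0, forall y, grng y = grng x ->
    N (a y * b (gmul (ginv y) x) - A y) <= d * N (a y).
Proof.
move=> ca cb d0.
(* [h] is a partial sum of a partition of unity, and [A] approximates [h] times the integrand. Two
   pieces are joined by [h + (1 - h) h'], which is one on both sets. *)
pose good (S : set G) := exists (h : G -> R) A,
  [/\ continuous h, forall y, 0 <= h y <= 1, forall y, S y -> h y = 1, Cc R G A &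
    \forall x \near x0, forall y, grng y = grng x ->
    N ((h y)%:C * (a y * b (gmul (ginv y) x)) - A y) <= d * (h y * N (a y))].
have [K cK aK] : exists2 K : set G, compact K & forall x, a x != 0 -> K x.
  by move/(CcP Gh): ca => [_].
have : good K.
  apply: (@compact_ind _ K good cK).
  - exists (fun=> 0), 0; split => //; [by move=> x; exact: cvg_cst | by move=> x; rewrite lexx ler01 | exact: Cc0 |].
    by apply: nearW => x y _; rewrite mul0r subr0 (@nrm0 R R[i]^o) mul0r mulr0.
  - move=> S T [h [A [ch h01 hS cA hA]]] [h' [A' [ch' h01' hT cA' hA']]].
    exists (fun y => h y + (1 - h y) * h' y), (1 *: A + (fun y => (1 - h y)%:C * A' y)); split.
    + move=> x; apply: cvgD; first exact: ch.
      by apply: cvgM; [apply: cvgB; [exact: cvg_cst | exact: ch] | exact: ch'].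
    + by move=> y; have /andP[? ?] := h01 y; have /andP[? ?] := h01' y; apply/andP; split; nra.
    + by move=> y [/hS ->|/hT ->]; ring.
    + apply: Cc_comb => //; apply: (Cc_mulf Gh) => //.
      apply: cont_on_setT; apply: cont_on_RC; apply: cont_onT => x.
      by apply: cvgB; [exact: cvg_cst | exact: ch].
    + move: hA hA'; apply: filterS2 => x hx hx' y e.
      have /andP[h0 h1] := h01 y; have H1 := hx y e; have H2 := hx' y e.
      set z := a y * _ in H1 H2 *.
      rewrite -[(_ + _ : G -> _) y]/(1 * A y + (1 - h y)%:C * A' y).
      have -> : (h y + (1 - h y) * h' y)%:C * z - (1 * A y + (1 - h y)%:C * A' y) =
         ((h y)%:C * z - A y) + (1 - h y)%:C * ((h' y)%:C * z - A' y).
        by rewrite !rmorphD !rmorphM !rmorphB /= rmorph1; ring.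
      apply: le_trans (ler_nrmD _ _) _; rewrite nrmM nrm_real ger0_norm ?subr_ge0//.
      have : (1 - h y) * N ((h' y)%:C * z - A' y) <= (1 - h y) * (d * (h' y * N (a y))).
        by rewrite ler_wpM2l ?subr_ge0.
      by move: H1; lra.
  - move=> S T ST [h [A [? ? hT ? ?]]]; exists h, A; split => // y /ST; exact: hT.
  - move=> y0 Ky0; have [V [oV Vy [beta hb]]] := conv_integrand_near a x0 y0 cb d0.
    have [g [cg g01 gV [V1 [oV1 V1y gV1]]]] := plateau R Gh Glc oV Vy.
    exists V1; split => //; exists g, (fun y => (g y)%:C * beta * a y); split => //.
    + by case: cg.
    + apply: (Cc_mulf Gh (p := fun y => (g y)%:C * beta)) => //; apply: cont_on_setT.
      apply: (@cont_onM _ R[i] setT (fun y => (g y)%:C) (fun=> beta)); last exact: cont_on_cst.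
      by apply: cont_on_RC; apply: cont_onT; case: cg.
    + apply: filterS hb => x hx y e; have /andP[g0 g1] := g01 y.
      have -> : (g y)%:C * (a y * b (gmul (ginv y) x)) - (g y)%:C * beta * a y =
        (g y)%:C * a y * (b (gmul (ginv y) x) - beta) by ring.
      rewrite !nrmM nrm_real ger0_norm//.
      have [->|/gV Vy1] := eqVneq (g y) 0; first by rewrite !mul0r mulr0.
      by rewrite mulrC ler_wpM2r ?mulr_ge0 ?nrm_ge0//; exact: hx.
move=> [h [A [ch h01 hK cA hA]]]; exists A => //; apply: filterS hA => x hx y e.
have := hx y e; have [a0|/aK Ky] := eqVneq (a y) 0.
  by rewrite a0 (@nrm0 R R[i]^o) !mulr0 mul0r mulr0.
by rewrite hK// !mul1r.
Qed.

Lemma cintegral_rfib u a : gunits G u -> Cc R G a ->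
  cintegral (haar lam u) (rfib u) a = cintegral (haar lam u) setT a.
Proof.
move=> hu ca; have [h1 h2] := Cc_cintegrable Gh lam hu measurableT ca.
by rewrite /cintegral; congr (fine _ +i* fine _)%C; apply/esym; exact: bintegral_rfib.
Qed.

Lemma conv_continuous a b : Cc R G a -> Cc R G b -> continuous (conv lam a b).
Proof.
move=> ca cb; apply: cont_on_setT; apply/cont_onC => x0 _ e e0.
have [M M0 hM] := rint_bounded Gh Gsc lam (Cc_nrm Gh ca).
(* Three errors of at most a quarter of [e] occur: at [x0], at [x], and in the variation of [J]. *)
pose d := e / (4 * (M + 1)).
have M1 : 0 < 4 * (M + 1) by lra.
have d0 : 0 < d by rewrite divr_gt0.
have dM : d * M <= e / 4.
  have -> : e / 4 = d * (M + 1) by rewrite /d; field; rewrite lt0r_neq0//; lra.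
  by rewrite ler_wpM2l ?ltW//; lra.
have [A cA hA] := conv_integrand_approx x0 ca cb d0.
pose J x : R[i]^o := cintegral (haar lam (grng x)) setT A.
have key x : (forall y, grng y = grng x ->
    N (a y * b (gmul (ginv y) x) - A y) <= d * N (a y)) -> N (conv lam a b x - J x) <= e / 4.
  move=> H; have mD := rfib_measurable Gh (grng x); have hu := grng_unit x.
  have iA := Cc_cintegrable Gh lam hu mD cA.
  have iab := conv_cintegrable Gh lam x ca cb.
  have E : conv lam a b x - J x = cintegral (haar lam (grng x)) (rfib (grng x))
     (fun y => (-1) * A y + a y * b (gmul (ginv y) x)).
    rewrite (cintegral_comb mD _ iA iab) /J -cintegral_rfib// mulN1r addrC.
    by [].
  rewrite E; apply: le_trans (cintegral_norm mD (cintegrable_comb mD (-1) iA iab)) _.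
  have ia : rintegrable (haar lam (grng x)) (rfib (grng x)) (fun y => N (a y)).
    by apply: (rintegrable_fib mD); exact: nrm_rintegrable.
  apply: le_trans (_ : _ <= rint (haar lam (grng x)) (rfib (grng x)) (fun y => d * N (a y))) _.
    apply: le_rint => //.
    - exact: cintegrable_nrm (cintegrable_comb mD (-1) iA iab).
    - exact: rintegrableZ.
    - by move=> y yx; rewrite mulN1r addrC; exact: H.
  rewrite (rintZ mD)// rint_rfib//; last exact: Cc_nrm.
  apply: le_trans dM; rewrite ler_wpM2l ?(ltW d0)//.
  by apply: le_trans (ler_norm _) _; exact: hM.
have cJ : cont_on setT J by apply: cont_onT; exact: cont_cintegral.
have e2 : 0 < e / 4 by lra.
have hJ := iffLR (@cont_onC _ _ setT J) cJ x0 I _ e2.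
have H0 : N (conv lam a b x0 - J x0) <= e / 4 by apply: key; exact: (nbhs_singleton hA).
near=> x => _.
have H1 : N (conv lam a b x - J x) <= e / 4 by apply: key; near: x.
have H2 : N (J x0 - J x) < e / 4 by have : setT x by []; near: x; exact: hJ.
have -> : conv lam a b x0 - conv lam a b x =
  (conv lam a b x0 - J x0) + (J x0 - J x) - (conv lam a b x - J x) by ring.
apply: le_lt_trans (ler_nrmD _ _) _; rewrite nrmN.
by have := ler_nrmD (conv lam a b x0 - J x0) (J x0 - J x); lra.
Unshelve. all: by end_near.
Qed.

Lemma Cc_conv a b : Cc R G a -> Cc R G b -> Cc R G (conv lam a b).
Proof.
move=> ca cb; apply/(CcP Gh); split; first exact: conv_continuous.
move: ca cb => /(CcP Gh)[_ [K cK aK]] /(CcP Gh)[_ [L cL bL]].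
pose D := [set p : G * G | gsrc p.1 = grng p.2].
exists ((fun p : G * G => gmul p.1 p.2) @` (K `*` L `&` D)).
  apply: continuous_compact.
    by apply: continuous_subspaceW (@gmul_continuous G) => p [].
  by apply: compact_closedI; [exact: compact_setX | exact: composable_closed].
move=> x /conv_neq0[y [yx /aK Ky /bL Ly]].
exists (y, gmul (ginv y) x) => /=; last exact: gmulKV.
by split => //; rewrite /D /= grng_mul ?gsrc_inv// grng_inv.
Qed.
End ConvCc.

(** * Weighted estimates for convolutions *)

Section Norms.
Context (R : realType) (G : topGroupoidType).
Hypotheses (Gh : hausdorff_space G) (Glc : locally_compact [set: G])
  (Gsc : @second_countable G).
Variable lam : haarSystem R G.
Implicit Types (u x y : G) (a b f : G -> R[i]^o).
Local Notation N k := (nrm (k : R[i]^o)).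
Local Notation RI u f := (rint (haar lam u) setT f).

Lemma int_rfib u (f : G -> R) : gunits G u -> CcR f ->
  (\int[haar lam u]_(x in (rfib u : set (borel G))) (f x)%:E = (RI u f)%:E)%E.
Proof.
move=> hu Cf; rewrite -(rint_rfib Gh Gsc lam hu Cf).
have h := rintegrable_fib (rfib_measurable Gh u) (CcR_rintegrable Gh lam hu Cf).
exact: (rintE (rfib_measurable Gh u) h).
Qed.

Lemma CcR_source (w : G -> R) a : continuous w -> Cc R G a ->
  CcR (fun x => N (a x) * w (gsrc x)).
Proof.
move=> cw ca; apply: CcR_mulf; last exact: Cc_nrm.
by move=> x; apply: continuous_comp; [exact: gsrc_continuous | exact: cw].
Qed.

Lemma conv_nrm_le a b x : Cc R G a -> Cc R G b ->
  ((N (conv lam a b x))%:E <= \int[haar lam (grng x)]_(y in (rfib (grng x) : set (borel G)))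
     (N (a y) * N (b (gmul (ginv y) x)))%:E)%E.
Proof.
move=> ca cb; have mD := rfib_measurable Gh (grng x).
have i := conv_cintegrable Gh lam x ca cb.
have := cintegral_norm mD i; rewrite -lee_fin -(rintE mD (cintegrable_nrm mD i)).
move=> /le_trans; apply; rewrite /bintegral le_eqVlt; apply/orP; left; apply/eqP.
by apply: eq_integral => y _; rewrite nrmM.
Qed.

(** The substitution [x = y z] preserves the source, which is why weights are evaluated there. *)
Lemma lquot_mass y b (w : G -> R) : Cc R G b -> continuous w -> (forall x, 0 <= w x) ->
  measurable_fun (rfib (grng y) : set (borel G))
    (fun x : borel G => (N (b (gmul (ginv y) x)) * w (gsrc x))%:E) /\
  (\int[haar lam (grng y)]_(x in (rfib (grng y) : set (borel G)))
     (N (b (gmul (ginv y) x)) * w (gsrc x))%:E =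
   (RI (gsrc y) (fun z => N (b z) * w (gsrc z)))%:E)%E.
Proof.
move=> cb cw w0.
have ms : measurable_fun (rfib (grng y) : set (borel G))
    (fun x : borel G => (N (b (gmul (ginv y) x)) * w (gsrc x))%:E).
  apply/measurable_EFinP; apply: cont_on_measurable; first exact: rfib_measurable.
  apply: (@cont_onM _ R (rfib (grng y)) (fun x => N (b (gmul (ginv y) x))) (fun x => w (gsrc x))).
    apply: cont_on_nrm; apply: (@cont_on_comp _ _ _ _ setT (gmul (ginv y)) b).
    - by have := @cont_on_ltrans _ (ginv y); rewrite gsrc_inv.
    - by apply: cont_onT; case: cb.
    - by [].
  by apply: cont_onT => x; apply: continuous_comp; [exact: gsrc_continuous | exact: cw].
split; first exact: ms.
rewrite -(int_rfib (gsrc_unit y) (CcR_source cw cb)) -(ge0_integral_ltrans Gh Glc Gsc lam ms).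
  by apply: eq_integral => z; rewrite inE => /esym zy; rewrite gmulVK// gsrc_mul.
by move=> x; rewrite lee_fin mulr_ge0// nrm_ge0.
Qed.

Lemma tonelli_rfib u (F : G * G -> R) : gunits G u ->
  measurable_fun (rfib u `*` rfib u : set (borel G * borel G)) (F : borel G * borel G -> R) ->
  (forall p, 0 <= F p) ->
  [/\ forall x, rfib u x -> measurable_fun (rfib u : set (borel G)) (fun y : borel G => F (x, y)),
      measurable_fun (rfib u : set (borel G))
        (fun x => \int[haar lam u]_(y in (rfib u : set (borel G))) (F (x, y))%:E)%E,
      measurable_fun (rfib u : set (borel G))
        (fun y => \int[haar lam u]_(x in (rfib u : set (borel G))) (F (x, y))%:E)%E &
      (\int[haar lam u]_(x in (rfib u : set (borel G)))
         \int[haar lam u]_(y in (rfib u : set (borel G))) (F (x, y))%:E =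
       \int[haar lam u]_(y in (rfib u : set (borel G)))
         \int[haar lam u]_(x in (rfib u : set (borel G))) (F (x, y))%:E)%E].
Proof.
move=> hu mF0 F0; have mD := rfib_measurable Gh u.
pose DD : set (borel G * borel G) := rfib u `*` rfib u.
have mDD : measurable DD by exact: measurableX.
pose Fp : borel G * borel G -> \bar R := (EFin \o F) \_ DD.
have mF : measurable_fun setT Fp.
  by apply/(measurable_restrict _ mDD) => //; rewrite setTI; exact/measurable_EFinP.
have Fp0 p : (0 <= Fp p)%E by rewrite /Fp patchE; case: ifP => // _; rewrite lee_fin.
have Fx x y : x \in rfib u -> Fp (x, y) = ((fun y => (F (x, y))%:E) \_ (rfib u)) y.
  move=> xu; rewrite /Fp !patchE; case: ifPn; case: ifPn => //; rewrite !inE /DD /=.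
    by move=> h [_ /mem_set]; rewrite (negPf h).
  by move=> yu /asboolPn h; exfalso; apply: h; split => //; rewrite inE in xu.
have Fy x y : y \in rfib u -> Fp (x, y) = ((fun x => (F (x, y))%:E) \_ (rfib u)) x.
  move=> xu; rewrite /Fp !patchE; case: ifPn; case: ifPn => //; rewrite !inE /DD /=.
    by move=> h [/mem_set]; rewrite (negPf h).
  by move=> yu /asboolPn h; exfalso; apply: h; split => //; rewrite inE in xu.
have sf := haar_sf Gh Glc Gsc lam hu.
have E1 : (\int[haar lam u]_x \int[haar lam u]_y Fp (x, y) =
  \int[haar lam u]_(x in (rfib u : set (borel G)))
    \int[haar lam u]_(y in (rfib u : set (borel G))) (F (x, y))%:E)%E.
  rewrite [RHS]integral_mkcond; apply: eq_integral => x _; rewrite [RHS]patchE.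
  case: ifPn => xu.
    by rewrite [RHS]integral_mkcond; apply: eq_integral => y _; exact: Fx.
  apply: integral0_eq => y _; rewrite /Fp patchE; case: ifPn => //.
  by rewrite inE => -[/mem_set]; rewrite (negPf xu).
have E2 : (\int[haar lam u]_y \int[haar lam u]_x Fp (x, y) =
  \int[haar lam u]_(y in (rfib u : set (borel G)))
    \int[haar lam u]_(x in (rfib u : set (borel G))) (F (x, y))%:E)%E.
  rewrite [RHS]integral_mkcond; apply: eq_integral => y _; rewrite [RHS]patchE.
  case: ifPn => yu.
    by rewrite [RHS]integral_mkcond; apply: eq_integral => x _; exact: Fy.
  apply: integral0_eq => x _; rewrite /Fp patchE; case: ifPn => //.
  by rewrite inE => -[_ /mem_set]; rewrite (negPf yu).
split.
- move=> x xu; apply/measurable_EFinP.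
  have : measurable_fun (rfib u : set (borel G)) (fun y : borel G => Fp (x, y)).
    by apply: measurable_funTS; apply: measurableT_comp mF _; exact: measurable_pair1.
  by apply: eq_measurable_fun => y yu; rewrite Fx ?inE// patchE yu.
- have := measurable_funTS (D := rfib u : set (borel G)) (sf_measurable sf mF Fp0).
  apply: eq_measurable_fun => x xu; rewrite [RHS]integral_mkcond.
  by apply: eq_integral => y _; exact: Fx.
- have mF' : measurable_fun setT (Fp \o (fun p : borel G * borel G => (p.2, p.1))).
    by apply: measurableT_comp mF _; exact: measurable_swap.
  have := measurable_funTS (D := rfib u : set (borel G)) (sf_measurable sf mF' (fun p => Fp0 _)).
  apply: eq_measurable_fun => y yu; rewrite [RHS]integral_mkcond.
  by apply: eq_integral => x _; exact: Fy.
- by rewrite -E1 (sf_tonelli sf sf mF Fp0) E2.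
Qed.

(** The kernel [|b|] maps the weight [w] below [w']; by Tonelli, the convolution maps [w] below the
    image of [w'] under [|a|]. Iterating this controls one weight along all powers of an element. *)
Lemma conv_weighted u a b (w w' : G -> R) : gunits G u -> Cc R G a -> Cc R G b ->
  continuous w -> continuous w' -> (forall x, 0 <= w x) ->
  (forall v, gunits G v -> RI v (fun z => N (b z) * w (gsrc z)) <= w' v) ->
  RI u (fun x => N (conv lam a b x) * w (gsrc x)) <= RI u (fun y => N (a y) * w' (gsrc y)).
Proof.
move=> hu ca cb cw cw' w0' H; have {w0'}w0 : hide (forall x, 0 <= w x) := w0'.
have cab := Cc_conv Gh Glc Gsc lam ca cb.
have mD := rfib_measurable Gh u.
rewrite -lee_fin -!int_rfib//; try exact: CcR_source.
pose F (p : G * G) : R := N (a p.2) * N (b (gmul (ginv p.2) p.1)) * w (gsrc p.1).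
pose DD : set (G * G) := rfib u `*` rfib u.
have mDD : measurable (DD : set (borel G * borel G)) by exact: measurableX.
have cF : cont_on DD (fun p => N (a p.2) * N (b (gmul (ginv p.2) p.1)) * w (gsrc p.1)).
  apply: (@cont_onM _ R DD (fun p => N (a p.2) * N (b (gmul (ginv p.2) p.1))) (fun p => w (gsrc p.1))).
    apply: (@cont_onM _ R DD (fun p => N (a p.2)) (fun p => N (b (gmul (ginv p.2) p.1)))).
      apply: cont_on_nrm; apply: (@cont_on_comp _ _ _ DD setT snd a) => //.
        by apply: cont_onT => p; exact: cvg_snd.
      by apply: cont_onT; case: ca.
    apply: cont_on_nrm; apply: (@cont_on_comp _ _ _ DD setT (fun p => gmul (ginv p.2) p.1) b) => //.
      apply: cont_on_gmul.
      - by apply: cont_on_ginv; apply: cont_onT => p; exact: cvg_snd.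
      - by apply: cont_onT => p; exact: cvg_fst.
      - by move=> [p q] [/= pu qu]; rewrite gsrc_inv pu qu.
    by apply: cont_onT; case: cb.
  apply: (@cont_on_comp _ _ _ DD setT (fun p => gsrc p.1) w) => //; last exact: cont_onT.
  apply: (@cont_on_comp _ _ _ DD setT fst (@gsrc G)) => //; apply: cont_onT => p; [exact: cvg_fst|exact: gsrc_continuous].
have F0 p : 0 <= F p.
  by apply: mulr_ge0 (w0 _); apply: mulr_ge0; exact: nrm_ge0.
have [_ mFs mGs FF] := tonelli_rfib hu (cont_on_prod_measurable Gsc mDD cF) F0.
pose I1 := (\int[haar lam u]_(x in (rfib u : set (borel G)))
    \int[haar lam u]_(y in (rfib u : set (borel G))) (F (x, y))%:E)%E.
apply: le_trans (_ : (_ <= I1)%E) _.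
  apply: ge0_le_integral; [exact: mD | | | exact: mFs |].
  - by move=> x _; rewrite lee_fin; apply: mulr_ge0; [exact: nrm_ge0 | exact: w0].
  - apply/measurable_EFinP; apply: measurable_funTS; apply: continuous_borel.
    by case: (CcR_source cw cab).
  - move=> x xu; rewrite EFinM muleC.
    have := conv_nrm_le x ca cb; rewrite xu => h.
    have wx : (0 <= (w (gsrc x))%:E)%E by rewrite lee_fin; exact: w0.
    apply: le_trans (lee_wpmul2l wx h) _.
    have cq : cont_on (rfib u) (fun y => N (a y) * N (b (gmul (ginv y) x))).
      apply: (@cont_onM _ R (rfib u) (fun y => N (a y)) (fun y => N (b (gmul (ginv y) x)))).
        by apply: cont_on_nrm; apply: cont_onT; case: ca.
      apply: cont_on_nrm; apply: (@cont_on_comp _ _ _ _ setT (fun y => gmul (ginv y) x) b).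
      + by have := cont_on_quot (x := x); rewrite xu.
      + by apply: cont_onT; case: cb.
      + by move=> ? _; exact: I.
    have q0 y : (0 <= (N (a y) * N (b (gmul (ginv y) x)))%:E)%E.
      by rewrite lee_fin; apply: mulr_ge0; exact: nrm_ge0.
    have mq : measurable_fun (rfib u : set (borel G)) (fun y : borel G => (N (a y) * N (b (gmul (ginv y) x)))%:E).
      by apply/measurable_EFinP; apply: cont_on_measurable.
    rewrite -(ge0_integralZl _ mD); [|exact: mq|by move=> y _; exact: q0|exact: wx].
    have -> : (\int[haar lam u]_(y in (rfib u : set (borel G))) (F (x, y))%:E =
       \int[haar lam u]_(y in (rfib u : set (borel G))) ((w (gsrc x))%:E * (N (a y) * N (b (gmul (ginv y) x)))%:E))%E.
      by apply: eq_integral => y yu; rewrite /F /= EFinM muleC.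
    exact: lexx.
rewrite /I1 FF.
apply: ge0_le_integral; [exact: mD | | exact: mGs | |].
- by move=> y _; apply: integral_ge0 => x _; rewrite lee_fin; exact: F0.
- apply/measurable_EFinP; apply: measurable_funTS; apply: continuous_borel.
  by case: (CcR_source cw' ca).
- move=> y yu; have [ms E] := lquot_mass y cb cw w0; rewrite yu in ms E.
  have -> : (\int[haar lam u]_(x in (rfib u : set (borel G))) (F (x, y))%:E =
      (N (a y))%:E * (RI (gsrc y) (fun z => N (b z) * w (gsrc z)))%:E)%E.
    rewrite -E -(ge0_integralZl _ mD ms).
    + by apply: eq_integral => x _; rewrite -EFinM /F /= mulrA.
    + by move=> x _; rewrite lee_fin; apply: mulr_ge0 (w0 _); exact: nrm_ge0.
    + by rewrite lee_fin nrm_ge0.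
  rewrite -EFinM lee_fin; apply: ler_wpM2l; first exact: nrm_ge0.
  by apply: H; exact: gsrc_unit.
Qed.
End Norms.

Section Inorm.
Context (R : realType) (G : topGroupoidType).
Hypotheses (Gh : hausdorff_space G) (Glc : locally_compact [set: G])
  (Gsc : @second_countable G).
Variable lam : haarSystem R G.
Implicit Types (u x y : G) (a b f : G -> R[i]^o).
Local Notation N k := (nrm (k : R[i]^o)).
Local Notation RI u f := (rint (haar lam u) setT f).

Lemma ginv_measurable : measurable_fun [set: borel G] (@ginv G : borel G -> borel G).
Proof.
apply: cont_on_borel_map => //; apply: cont_onT; exact: ginv_continuous.
Qed.

Lemma lam_inv_rint u a : Cc R G a ->
  fine (bintegral (lam_inv lam u) setT (fun x => N (a x))) = RI u (fun x => N (adj a x)).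
Proof.
move=> ca; rewrite /rint; congr fine; rewrite /bintegral /lam_inv.
rewrite (ge0_integral_pushforward ginv_measurable (haar lam u) measurableT); first last.
- by move=> y _; rewrite lee_fin nrm_ge0.
- by apply/measurable_EFinP; apply: continuous_borel; case: (Cc_nrm Gh ca).
- by rewrite preimage_setT; apply: eq_integral => x _; rewrite /= /adj nrm_conj.
Qed.

Lemma Inorm_ge a u : Cc R G a -> gunits G u ->
  RI u (fun x => N (a x)) <= Inorm lam a /\ RI u (fun x => N (adj a x)) <= Inorm lam a.
Proof.
move=> ca hu; rewrite /Inorm !le_max; split; apply/orP; [left | right].
  apply: ub_le_sup; last by exists u.
  have [M M0 hM] := rint_bounded Gh Gsc lam (Cc_nrm Gh ca).
  by exists M => _ [v hv <-]; apply: le_trans (ler_norm _) (hM _ hv).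
apply: ub_le_sup; last by exists u => //; exact: lam_inv_rint.
have [M M0 hM] := rint_bounded Gh Gsc lam (Cc_nrm Gh (Cc_adj Gh ca)).
by exists M => _ [v hv <-]; rewrite lam_inv_rint//; apply: le_trans (ler_norm _) (hM _ hv).
Qed.

Lemma Inorm_le a M : Cc R G a ->
  (forall u, gunits G u -> RI u (fun x => N (a x)) <= M) ->
  (forall u, gunits G u -> RI u (fun x => N (adj a x)) <= M) -> Inorm lam a <= M.
Proof.
move=> ca h1 h2; rewrite /Inorm ge_max; have hp := grng_unit (point : G).
apply/andP; split; apply: ge_sup.
- by exists (fine (bintegral (lam (grng point)) setT (fun x => N (a x)))), (grng point).
- by move=> _ [u hu <-]; exact: h1.
- by exists (fine (bintegral (lam_inv lam (grng point)) setT (fun x => N (a x)))), (grng point).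
- by move=> _ [u hu <-]; rewrite lam_inv_rint//; exact: h2.
Qed.

Lemma Inorm_ge0 a : Cc R G a -> 0 <= Inorm lam a.
Proof.
move=> ca; have [h _] := Inorm_ge ca (grng_unit (point : G)).
by apply: le_trans h; apply: rint_ge0 => x _; exact: nrm_ge0.
Qed.

Lemma full_norm_le_Inorm a : Cc R G a -> full_norm lam a <= Inorm lam a.
Proof.
move=> ca; rewrite /full_norm; set S := (X in sup X).
have [h|h] := pselect (S !=set0); last first.
  have -> : S = set0 by apply/seteqP; split => // t St; exfalso; apply: h; exists t.
  by rewrite sup0 Inorm_ge0.
by apply: ge_sup => // _ [H [pi [_ hpi ->]]]; exact: hpi.
Qed.

Section Schur.
Variable CG : fullCstar lam.
Local Notation inc := (cc_inc CG).

(** The kernel of [b^* b] does not increase the weight [w2], hence neither do its iterated squares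
    [e n], and their I-norms stay below [M / m]. Their C*-norms are the powers of [|b|] with
    exponent [2^(n+1)], which stay bounded only if [|b| <= 1]. *)
Lemma schur_bound b (w1 w2 : G -> R) (m M : R) : Cc R G b -> continuous w1 -> continuous w2 ->
  0 < m -> (forall x, m <= w1 x <= M) -> (forall x, m <= w2 x <= M) ->
  (forall u, gunits G u -> RI u (fun z => N (b z) * w2 (gsrc z)) <= w1 u) ->
  (forall u, gunits G u -> RI u (fun z => N (adj b z) * w1 (gsrc z)) <= w2 u) ->
  nrm (inc b) <= 1.
Proof.
move=> cb cw1 cw2 m0 b1 b2 H1 H2.
have w10 x : 0 <= w1 x by have /andP[h _] := b1 x; lra.
have w20 x : 0 <= w2 x by have /andP[h _] := b2 x; lra.
pose e := fix e n := if n is k.+1 then conv lam (e k) (e k) else conv lam (adj b) b.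
have cab := Cc_adj Gh cb.
have ce n : Cc R G (e n) by elim: n => [|n IH] /=; apply: Cc_conv.
have se n : adj (e n) = e n.
  by elim: n => [|n IH] /=; rewrite (adj_conv Gh Glc Gsc lam)// ?adjK// IH.
have we n u : gunits G u -> RI u (fun x => N (e n x) * w2 (gsrc x)) <= w2 u.
  elim: n u => [|n IH] u hu /=.
    apply: le_trans (H2 u hu); exact: (conv_weighted Gh Glc Gsc hu cab cb cw2 cw1 w20 H1).
  apply: le_trans (IH u hu); exact: (conv_weighted Gh Glc Gsc hu (ce n) (ce n) cw2 cw2 w20 IH).
(* The bounds on the weight remove it: [m |e n| <= |e n| w2], and the weighted integral is at most
   [w2 u <= M]. *)
have le n u : gunits G u -> RI u (fun x => N (e n x)) <= M / m.
  move=> hu; rewrite ler_pdivlMr//; have /andP[_ wM] := b2 u.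
  apply: le_trans (le_trans (we n u hu) wM); rewrite mulrC -(rintZ measurableT); last exact: nrm_rintegrable.
  apply: le_rint => //.
  - by apply: rintegrableZ => //; exact: nrm_rintegrable.
  - by apply: CcR_rintegrable => //; exact: CcR_source.
  - by move=> x _; rewrite mulrC ler_wpM2l ?nrm_ge0//; case/andP: (b2 (gsrc x)).
have nle n : nrm (inc (e n)) <= M / m.
  rewrite (cc_norm CG (ce n)); apply: le_trans (full_norm_le_Inorm (ce n)) _.
  by apply: Inorm_le => // u hu; rewrite ?se; exact: le.
have cn := cstar_cnorm CG.
have ne n : nrm (inc (e n)) = nrm (inc b) ^+ (2 ^ n.+1).
  elim: n => [|n IH] /=.
    by rewrite (cc_mul CG cab cb) (cc_star CG cb) (cn_star cn).
  rewrite (cc_mul CG (ce n) (ce n)) -{1}(se n) (cc_star CG (ce n)) (cn_star cn) IH.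
  by rewrite -exprM -expnSr.
rewrite leNgt; apply/negP => n1.
pose t := nrm (inc b) - 1; have t0 : 0 < t by rewrite subr_gt0.
(* Bernoulli's inequality: the powers of [1 + t] grow at least linearly, which contradicts the
   uniform bound. *)
have bern k : 1 + t *+ k <= nrm (inc b) ^+ k.
  elim: k => [|k IH]; first by rewrite mulr0n addr0 expr0.
  rewrite exprS mulrSr; have -> : nrm (inc b) = 1 + t by rewrite /t; ring.
  have tk : 0 <= t *+ k by rewrite mulrn_wge0// ltW.
  move: IH; have -> : nrm (inc b) = 1 + t by rewrite /t; ring.
  by nra.
have [k hk] : exists k : nat, M / m < t *+ k.
  have Mm : 0 <= M / m.
    by apply: le_trans (nle 0%N); exact: nrm_ge0.
  exists (Num.bound (M / m / t)).
  have := archi_boundP (divr_ge0 Mm (ltW t0)).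
  by rewrite ltr_pdivrMr// mulr_natl.
have := nle k; rewrite ne => h.
have := bern (2 ^ k.+1)%N.
have : t *+ k <= t *+ (2 ^ k.+1) by apply: ler_wpMn2l; [exact: ltW | apply: ltnW; apply: (leq_trans (ltnSn k)); apply: ltnW; exact: ltn_expl].
lra.
Qed.
End Schur.
End Inorm.

(** * The kernel of the cocycle *)

Section KernelTransfer.
Context (R : realType) (G : topGroupoidType).
Hypotheses (Gh : hausdorff_space G) (Gsc : @second_countable G).
Context (Gamma : groupType) (c : cocycle G Gamma).
Implicit Types (a b : G -> R[i]^o) (f g : kernel c -> R[i]^o).
Local Notation N k := (nrm (k : R[i]^o)).
Local Notation kv := (@kval G Gamma c).

Lemma level_open gamma : open [set x | c x = gamma].
Proof.
apply: (iffLR (@continuousP G (discrete_topology Gamma) c) (@coc_continuous _ _ c) [set gamma]).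
exact: discrete_open.
Qed.

Lemma level_closed gamma : closed [set x | c x = gamma].
Proof.
rewrite -[X in closed X]setCK closedC.
apply: (iffLR (@continuousP G (discrete_topology Gamma) c) (@coc_continuous _ _ c) (~` [set gamma])).
exact: discrete_open.
Qed.

Definition Gone : set G := [set x | c x = 1%g].

Lemma kval_one (k : kernel c) : c (kv k) = 1%g.
Proof. exact/eqP/kvalP. Qed.

(** A left inverse of the inclusion defined on all of [G], with a constant default value off the
    kernel; measures can be pushed forward along it. *)
Definition kretr (x : G) : kernel c := insubd (point : kernel c) x.

Lemma kretrK : cancel kv kretr.
Proof. by move=> k; exact: valKd. Qed.

Lemma kvalK x : c x = 1%g -> kv (kretr x) = x.
Proof. by move=> h; apply: insubdK; rewrite -topredE /= h. Qed.

Lemma ext0_kval g k : ext0 g (kv k) = g k.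
Proof. by rewrite /ext0 valK. Qed.

Lemma ext0_out g x : c x <> 1%g -> ext0 g x = 0.
Proof. by move=> h; rewrite /ext0 insubN//; exact/eqP. Qed.

Lemma ext0_restr a : (forall x, c x <> 1%g -> a x = 0) -> ext0 (c := c) (a \o kv) = a.
Proof.
move=> h; apply/funext => x; have [cx|cx] := pselect (c x = 1%g).
  by rewrite -(kvalK cx) ext0_kval.
by rewrite ext0_out// h.
Qed.

Lemma restr_ext0 g : ext0 g \o kv = g.
Proof. by apply/funext => k /=; rewrite ext0_kval. Qed.

Lemma kernel_hausdorff : hausdorff_space (kernel c).
Proof.
move=> x y xy; apply: kval_inj; apply: Gh => A B xA yB.
have [z [/= zA zB]] := xy _ _ (kval_continuous xA) (kval_continuous yB).
by exists (kv z).
Qed.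

(** The level set is closed, so it meets [K] in a compact set, and a cluster point found there is a
    point of the kernel. *)
Lemma kval_compact_preimage (K : set G) : compact K -> compact (kv @^-1` K).
Proof.
move=> cK F PF FK.
have [p [[Kp p1] clp]] : (K `&` Gone) `&` cluster (kv @ F) !=set0.
  have cK1 : compact (K `&` Gone) by apply: compact_closedI => //; exact: level_closed.
  apply: (cK1 (kv @ F)); rewrite /fmap /=.
  by apply: filterS FK => k Kk; split => //; exact: kval_one.
exists (kretr p); split; first by rewrite /= kvalK.
move=> A B FA /kernel_nbhsP[U]; rewrite kvalK// => pU UB.
have [z [[k Ak <-] Uk]] : (kv @` A) `&` U !=set0.
  by apply: clp => //; rewrite /fmap /=; apply: filterS FA => k Ak; exists k.
by exists k; split => //; exact: UB.
Qed.

(** Openness of the kernel gives continuity of the extension at its points; closedness gives it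
    elsewhere and keeps the restricted support compact. *)
Lemma Cc_ext0 g : Cc R (kernel c) g <-> Cc R G (ext0 g).
Proof.
split=> /(CcP _)[].
- exact: kernel_hausdorff.
- move=> cg [K cK gK]; apply/(CcP Gh); split; last first.
    exists (kv @` K); first by apply: continuous_compact => //; exact/continuous_subspaceT/kval_continuous.
    move=> x; have [cx|cx] := pselect (c x = 1%g); last by rewrite ext0_out// eqxx.
    by rewrite -{1}(kvalK cx) ext0_kval => /gK h; exists (kretr x) => //; exact: kvalK.
  move=> x; have [cx|cx] := pselect (c x = 1%g).
    move=> A; rewrite -{1}(kvalK cx) ext0_kval => /cg /kernel_nbhsP[U].
    rewrite kvalK// => xU UA; have nG : nbhs x Gone by apply: open_nbhs_nbhs; split => //; exact: level_open.
    rewrite /fmap /=; move: xU nG; apply: filterS2 => y Uy y1.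
    by rewrite /= -(kvalK y1) ext0_kval; apply: UA; rewrite /= kvalK.
  have nG : nbhs x (~` Gone).
    by apply: open_nbhs_nbhs; split => //; rewrite openC; exact: level_closed.
  move=> A; rewrite ext0_out// => A0; rewrite /fmap /=; apply: filterS nG => y y1.
  by rewrite /= ext0_out//; exact: nbhs_singleton.
- exact: Gh.
- move=> cg [K cK gK]; apply/(CcP kernel_hausdorff); split.
    rewrite -[g]restr_ext0 => k; apply: continuous_comp; [exact: kval_continuous | exact: cg].
  by exists (kv @^-1` K); [exact: kval_compact_preimage | move=> k gk; apply: gK; rewrite ext0_kval].
Qed.

Lemma ext0_comb (k : R[i]) f g : ext0 (k *: f + g) = k *: ext0 f + ext0 g.
Proof.
apply/funext => x; rewrite -[RHS]/(k * ext0 f x + ext0 g x).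
have [cx|cx] := pselect (c x = 1%g); last by rewrite !ext0_out// mulr0 addr0.
by rewrite -(kvalK cx) !ext0_kval.
Qed.

Lemma Gone_measurable : measurable (Gone : set (borel G)).
Proof. by apply: open_borel; exact: level_open. Qed.

Lemma kretr_measurable : measurable_fun [set: borel G] (kretr : borel G -> borel (kernel c)).
Proof.
apply: (@measurability _ _ (borel G) (borel (kernel c)) setT kretr (@open (kernel c))) => //.
move=> _ [B oB <-]; rewrite setTI.
have [U oU UB] : exists2 U : set G, open U & kv @^-1` U = B by case: oB => U oU <-; exists U.
have -> : kretr @^-1` B = (U `&` Gone) `|` (~` Gone `&` (if (point : kernel c) \in B then setT else set0)).
  apply/seteqP; split => x; have [cx|cx] := pselect (c x = 1%g).
  - by move=> h; left; split => //; rewrite -(kvalK cx); move: h; rewrite /= -UB.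
  - move=> h; right; split => //; move: h; rewrite /= /kretr /insubd insubN; last exact/eqP.
    by move=> /= /mem_set ->.
  - by move=> [[Ux _]|[]//]; rewrite /= -UB /= kvalK.
  - move=> [[_ //]|[_]]; case: ifPn => // h _; rewrite /= /kretr /insubd insubN; last exact/eqP.
    by rewrite inE in h.
apply: measurableU; apply: measurableI.
- exact: open_borel.
- exact: Gone_measurable.
- by apply: measurableC; exact: Gone_measurable.
- by case: ifP => _; [exact: measurableT | exact: measurable0].
Qed.

Section Measure.
Variable m : {measure set (borel G) -> \bar R}.
Definition kmeas (A : set (borel (kernel c))) : \bar R := m (kv @` A).

(** As a push-forward of a restricted measure the set function is countably additive, and integrals
    against it can be computed by substitution. *)
Lemma kmeasE : kmeas = pushforward (mrestr m Gone_measurable) (kretr : borel G -> borel (kernel c)).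
Proof.
apply/funext => A; rewrite /kmeas /pushforward /mrestr; congr (m _).
apply/seteqP; split => [_ [k Ak <-]|x [/= Ax x1]]; first by split; [rewrite /= kretrK | exact: kval_one].
by exists (kretr x) => //; exact: kvalK.
Qed.

Lemma kmeas_measure : exists km : {measure set (borel (kernel c)) -> \bar R},
  (km : set (borel (kernel c)) -> \bar R) = kmeas.
Proof.
pose phi : borel G -> borel (kernel c) := kretr.
unshelve refine (ex_intro _ (pushforward (mrestr m Gone_measurable) phi : {measure set (borel (kernel c)) -> \bar R}) _).
  exact: kretr_measurable.
by rewrite kmeasE.
Qed.

Lemma ge0_integral_kmeas (D : set G) (F : borel G -> \bar R) :
  measurable (D : set (borel G)) -> measurable_fun (D `&` Gone : set (borel G)) F ->
  (forall x, D x -> 0 <= F x)%E ->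
  (\int[kmeas]_(y in (kv @^-1` D : set (borel (kernel c)))) F (kv y) =
   \int[m]_(y in (D `&` Gone : set (borel G))) F y)%E.
Proof.
move=> mD mF F0; have mG := Gone_measurable; rewrite kmeasE.
pose F' : borel (kernel c) -> \bar R := fun y => F (kv y).
have mkv : measurable_fun [set: borel (kernel c)] (kv : borel (kernel c) -> borel G).
  by apply: cont_on_borel_map => //; apply: cont_onT; exact: kval_continuous.
have mD' : measurable (kv @^-1` D : set (borel (kernel c))).
  by rewrite -[X in measurable X]setTI; exact: mkv.
have mDG : measurable (D `&` Gone : set (borel G)) by exact: measurableI.
have mF' : measurable_fun (kv @^-1` D : set (borel (kernel c))) F'.
  apply: (measurable_comp mDG _ mF).
    by move=> _ [k Dk <-]; split => //; exact: kval_one.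
  exact: measurable_funTS.
rewrite (ge0_integral_pushforward kretr_measurable (mrestr m mG) mD' mF'); last first.
  by move=> y; rewrite inE => Dy; exact: F0.
have mP : measurable (kretr @^-1` (kv @^-1` D) : set (borel G)).
  by rewrite -[X in measurable X]setTI; exact: kretr_measurable.
have mc : measurable_fun (kretr @^-1` (kv @^-1` D) : set (borel G)) (F' \o kretr).
  by apply: (measurable_comp mD' _ mF'); [move=> _ [y hy <-] | exact: (measurable_funTS kretr_measurable)].
have mN : measurable (~` Gone : set (borel G)) by exact: measurableC.
have N0 : mrestr m mG (~` Gone) = 0%E by rewrite /mrestr setICl measure0.
rewrite (@ge0_negligible_integral _ _ _ (mrestr m mG) _ _ _ mN mP mc _ N0); last by move=> x /=; exact: F0.
have -> : kretr @^-1` (kv @^-1` D) `\` ~` Gone = D `&` Gone.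
  rewrite setDE setCK; apply/seteqP; split => x [/= h1 h2]; split => //; move: h1; rewrite /= kvalK//.
rewrite (@eq_measure_integral _ _ _ _ m); last first.
  move=> A mA AD; rewrite /mrestr; congr (m _).
  by apply/seteqP; split => [x []//|x Ax]; split => //; have [] := AD _ Ax.
by apply: eq_integral => x; rewrite inE => -[_ x1]; rewrite /F' /= kvalK.
Qed.

Lemma bintegral_kmeas (D : set G) (h : G -> R) :
  measurable (D : set (borel G)) -> measurable_fun (D : set (borel G)) (h : borel G -> R) ->
  (forall x, c x <> 1%g -> h x = 0) ->
  bintegral kmeas (kv @^-1` D) (h \o kv) = bintegral m D h.
Proof.
move=> mD mh h0; have [km e] := kmeas_measure.
rewrite /bintegral -e [LHS]integralE [RHS]integralE e.
have mE : measurable_fun (D : set (borel G)) (fun y : borel G => (h y)%:E) by exact/measurable_EFinP.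
have key (F : borel G -> \bar R) : measurable_fun (D : set (borel G)) F -> (forall x, 0 <= F x)%E ->
   (forall x, c x <> 1%g -> F x = 0%E) ->
   (\int[kmeas]_(y in (kv @^-1` D : set (borel (kernel c)))) F (kv y) =
    \int[m]_(y in (D : set (borel G))) F y)%E.
  move=> mF F0 Fz; rewrite ge0_integral_kmeas//; last first.
    by apply: measurable_funS mF => // x [].
  rewrite integral_mkcond [RHS]integral_mkcond; apply: eq_integral => x _.
  rewrite !patchE; case: ifPn; case: ifPn => //; rewrite ?inE.
    by move=> /negP nD [Dx _]; exfalso; apply: nD; rewrite inE.
  by move=> Dx /negP nD; rewrite Fz// => x1; apply: nD; rewrite inE.
congr (_ - _)%E.
- have := key _ (measurable_funepos mE) (fun x => funepos_ge0 _ _).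
  move=> <-; first by rewrite -e; apply: eq_integral => y _; rewrite !funeposE.
  by move=> x x1; rewrite funeposE h0// maxxx.
- have := key _ (measurable_funeneg mE) (fun x => funeneg_ge0 _ _).
  move=> <-; first by rewrite -e; apply: eq_integral => y _; rewrite !funenegE.
  by move=> x x1; rewrite funenegE h0// oppe0 maxxx.
Qed.

Lemma cintegral_kmeas (D : set G) (a : G -> R[i]^o) :
  measurable (D : set (borel G)) -> cmeasurable D a ->
  (forall x, c x <> 1%g -> a x = 0) ->
  cintegral kmeas (kv @^-1` D) (a \o kv) = cintegral m D a.
Proof.
move=> mD [m1 m2] a0; rewrite /cintegral -(bintegral_kmeas mD m1) -?(bintegral_kmeas mD m2)// => x /a0 ->//.
Qed.
End Measure.
End KernelTransfer.

Lemma eq_cintegral (R : realType) (T : ptopologicalType) (mu : {measure set (borel T) -> \bar R})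
  (D : set T) (f g : T -> R[i]^o) : (forall x, D x -> f x = g x) ->
  cintegral mu D f = cintegral mu D g.
Proof.
move=> h; rewrite /cintegral /bintegral.
by congr (fine _ +i* fine _)%C; apply: eq_integral => x; rewrite inE => Dx; rewrite h.
Qed.

Section KernelNorms.
Context (R : realType) (G : topGroupoidType).
Hypotheses (Gh : hausdorff_space G) (Glc : locally_compact [set: G]) (Gsc : @second_countable G).
Variable lam : haarSystem R G.
Context (Gamma : groupType) (c : cocycle G Gamma).
Implicit Types (a b : G -> R[i]^o) (f g : kernel c -> R[i]^o) (u x y : G).
Local Notation N k := (nrm (k : R[i]^o)).
Local Notation kv := (@kval G Gamma c).
Local Notation lamk := (kernel_haar lam c).
Local Notation Cck := (Cc R (kernel c)).
Local Notation CcG := (Cc R G).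

Definition lvl gamma a := forall x, c x <> gamma -> a x = 0.

Lemma lvl_ext0 g : lvl 1%g (ext0 g).
Proof. by move=> x; exact: ext0_out. Qed.

Lemma lvl_fsupp gamma a : lvl gamma a <-> fsupp a `<=` [set x | c x = gamma].
Proof.
split=> [h|h x cx].
  rewrite /fsupp; have /closure_id -> := @level_closed G Gamma c gamma.
  by apply: closureS => x ax; apply: contrapT => /h a0; move: ax; rewrite /= a0 eqxx.
by apply/eqP; apply: contrapT => /negP ax; apply: cx; apply: h; exact: subset_closure.
Qed.

Lemma lvl_conv beta gamma a b : lvl beta a -> lvl gamma b -> lvl (beta * gamma)%g (conv lam a b).
Proof.
move=> ha hb x; apply: contra_notP => /eqP/conv_neq0[y [yx ay by_]].
have -> : c x = (c y * c (gmul (ginv y) x))%g.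
  by rewrite -cocM ?gmulKV// grng_mul ?gsrc_inv// grng_inv.
congr (_ * _)%g.
  by apply: contrapT => /ha h; move: ay; rewrite h eqxx.
by apply: contrapT => /hb h; move: by_; rewrite h eqxx.
Qed.

Lemma lvl_adj gamma a : lvl gamma a -> lvl gamma^-1%g (adj a).
Proof.
move=> ha x cx; rewrite /adj ha ?rmorph0// coc_inv => h; apply: cx.
by rewrite -h invgK.
Qed.

Lemma ext0_adj g : ext0 (adj g) = adj (ext0 g).
Proof.
apply/funext => x; have [cx|cx] := pselect (c x = 1%g).
  by rewrite -{1}(kvalK cx) ext0_kval /adj -(ext0_kval g) /= kvalK.
have := lvl_adj (lvl_ext0 g); rewrite invg1 => h.
by rewrite h// ext0_out.
Qed.

(** Stated for a measurable integrand, so that it also covers the square-integrable vectors of the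
    regular representation. *)
Lemma conv_kernel_measurable f g k :
  cmeasurable (rfib (grng (kv k))) (fun z => ext0 f z * ext0 g (gmul (ginv z) (kv k))) ->
  conv lamk f g k = conv lam (ext0 f) (ext0 g) (kv k).
Proof.
pose a (z : G) : R[i]^o := ext0 f z * ext0 g (gmul (ginv z) (kv k)).
move=> ma; rewrite /conv /=; have mD := rfib_measurable Gh (grng (kv k)).
have a0 x : c x <> 1%g -> a x = 0 by move=> cx; rewrite /a ext0_out// mul0r.
rewrite -[RHS]/(cintegral (haar lam (grng (kv k))) (rfib (grng (kv k))) a).
rewrite -(cintegral_kmeas _ mD ma a0).
have -> : [set y | grng y = grng k] = kv @^-1` rfib (grng (kv k)).
  apply/seteqP; split => y /=; first by move=> /(congr1 kv).
  by move=> h; exact: kval_inj.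
have [km e] := kmeas_measure c (haar lam (grng (kv k))).
rewrite -[kernel_haar _ _ _]/(kmeas (haar lam (grng (kv k)))) -e.
apply: eq_cintegral => y /= yk; rewrite /a ext0_kval; congr (_ * _).
rewrite -[LHS]ext0_kval; congr (ext0 g _); rewrite [LHS]kval_mul//.
by apply: kval_inj; rewrite /= gsrc_inv.
Qed.

Lemma conv_kernel f g k : Cck f -> Cck g ->
  conv lamk f g k = conv lam (ext0 f) (ext0 g) (kv k).
Proof.
move=> /(Cc_ext0 Gh)cf /(Cc_ext0 Gh)cg; apply: conv_kernel_measurable.
apply: cont_on_cmeasurable; first exact: rfib_measurable.
apply: (@cont_onM _ R[i] _ (ext0 f) (fun z => ext0 g (gmul (ginv z) (kv k)))).
  by apply: cont_onT; case: cf.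
apply: (@cont_on_comp _ _ _ _ setT (fun y => gmul (ginv y) (kv k)) (ext0 g)) => //.
  exact: cont_on_quot.
by apply: cont_onT; case: cg.
Qed.

Lemma ext0_conv f g : Cck f -> Cck g -> ext0 (conv lamk f g) = conv lam (ext0 f) (ext0 g).
Proof.
move=> cf cg; apply/funext => x; have [cx|cx] := pselect (c x = 1%g).
  by rewrite -{1}(kvalK cx) ext0_kval conv_kernel// kvalK.
have := lvl_conv (lvl_ext0 f) (lvl_ext0 g); rewrite mulg1 => h.
by rewrite h// ext0_out.
Qed.

Lemma Cck_conv f g : Cck f -> Cck g -> Cck (conv lamk f g).
Proof.
move=> cf cg; apply/(Cc_ext0 Gh); rewrite ext0_conv//.
by apply: (Cc_conv Gh Glc Gsc); exact/(Cc_ext0 Gh).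
Qed.

Lemma Cck_adj g : Cck g -> Cck (adj g).
Proof. by move=> cg; apply/(Cc_ext0 Gh); rewrite ext0_adj; apply: (Cc_adj Gh); exact/(Cc_ext0 Gh). Qed.

Lemma lam_inv_measure u : exists m : {measure set (borel G) -> \bar R},
  (m : set (borel G) -> \bar R) = lam_inv lam u.
Proof.
unshelve refine (ex_intro _ (pushforward (haar lam u) (@ginv G : borel G -> borel G) : {measure set (borel G) -> \bar R}) _) => //.
exact: ginv_measurable.
Qed.

Lemma lam_inv_kernel k m : (m : {measure set (borel G) -> \bar R}) = lam_inv lam (kv k) :> (set (borel G) -> \bar R) ->
  lam_inv lamk k = kmeas m.
Proof.
move=> e; apply/funext => A; rewrite /kmeas e /lam_inv /pushforward /kernel_haar; congr (lam _ _).
apply/seteqP; split => [_ [y Ay <-]|x [y Ay e1]]; first by exists (ginv y).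
by exists (ginv y); [rewrite /= ginvK | rewrite -[LHS]/(ginv (kv y)) e1 ginvK].
Qed.

Lemma kunits k : gunits (kernel c) k <-> gunits G (kv k).
Proof. by split => [/(congr1 kv)//|h]; apply: kval_inj. Qed.

Lemma kval_unit u : gunits G u -> kv (kretr c u) = u.
Proof. by move=> h; apply: kvalK; rewrite -h coc_rng. Qed.

Lemma Inorm_ext0 g : Cck g -> Inorm lamk g = Inorm lam (ext0 g).
Proof.
move=> cg; have cg' : CcG (ext0 g) by exact/(Cc_ext0 Gh).
have mg : measurable_fun [set: borel G] (fun x : borel G => N (ext0 g x)).
  by apply: continuous_borel; case: (Cc_nrm Gh cg').
have g0 x : c x <> 1%g -> N (ext0 g x) = 0.
  by move=> cx; rewrite ext0_out// (@nrm0 R R[i]^o).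
have gE : (fun k : kernel c => N (g k)) = (fun x => N (ext0 g x)) \o kv.
  by apply/funext => k /=; rewrite ext0_kval.
have E1 k : bintegral (lamk k) setT (fun x : kernel c => N (g x)) = bintegral (lam (kv k)) setT (fun x => N (ext0 g x)).
  by rewrite gE -(bintegral_kmeas (haar lam (kv k)) measurableT mg g0).
have E2 k : bintegral (lam_inv lamk k) setT (fun x : kernel c => N (g x)) =
   bintegral (lam_inv lam (kv k)) setT (fun x => N (ext0 g x)).
  have [m e] := lam_inv_measure (kv k); rewrite (lam_inv_kernel e) -e gE.
  by rewrite -(bintegral_kmeas m measurableT mg g0).
rewrite /Inorm; congr (Num.max (sup _) (sup _)); apply/seteqP; split => t [u hu <-].
- by exists (kv u); [exact/kunits | rewrite E1].
- by exists (kretr c u); [apply/kunits; rewrite kval_unit | rewrite E1 kval_unit].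
- by exists (kv u); [exact/kunits | rewrite E2].
- by exists (kretr c u); [apply/kunits; rewrite kval_unit | rewrite E2 kval_unit].
Qed.

Lemma full_norm_ext0 g : Cck g -> full_norm lam (ext0 g) <= full_norm lamk g.
Proof.
move=> cg; have cE f : Cck f -> CcG (ext0 f) by move=> /(Cc_ext0 Gh).
rewrite {2}/full_norm; set S := (X in _ <= sup X).
have S0 t : S t -> 0 <= t.
  by move=> [H [pi [_ _ ->]]]; exact: opnorm_ge0.
have Sb : has_ubound S by exists (Inorm lamk g) => _ [H [pi [_ h ->]]]; exact: h.
rewrite /full_norm; set T := (X in sup X <= _).
have TS : T `<=` S.
  move=> _ [H [pi [[r1 r2 r3 r4 r5] hpi ->]]]; exists H, (fun f => pi (ext0 f)); split => //.
    split=> [a /cE/r1//|a /cE/r2//|k a b x /cE ca /cE cb|a b x ca cb|a x y ca].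
    - by rewrite ext0_comb r3.
    - by rewrite ext0_conv// r4//; exact: cE.
    - by rewrite ext0_adj r5//; exact: cE.
  by move=> b cb; rewrite Inorm_ext0//; apply: hpi; exact: cE.
have [[t Tt]|nT] := pselect (T !=set0).
  by apply: ge_sup; [exists t | move=> s /TS Ss; exact: ub_le_sup].
have -> : T = set0 by apply/seteqP; split => // t Tt; exfalso; apply: nT; exists t.
rewrite sup0; have [[t St]|nS] := pselect (S !=set0).
  by apply: le_trans (S0 _ St) _; exact: ub_le_sup.
by rewrite (_ : S = set0) ?sup0//; apply/seteqP; split => // t St; exfalso; apply: nS; exists t.
Qed.

Lemma lvl_fibre gamma a : lvl gamma (fibre_part c gamma a).
Proof. by move=> x /eqP/negPf cx; rewrite /fibre_part cx. Qed.

Lemma fibre_id gamma a : lvl gamma a -> fibre_part c gamma a = a.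
Proof. by move=> h; apply/funext => x; rewrite /fibre_part; case: eqP => // /h. Qed.

Lemma fibre_ne beta gamma a : lvl beta a -> gamma <> beta -> fibre_part c gamma a = 0.
Proof.
move=> h ne; apply/funext => x; rewrite /fibre_part; case: eqP => // e.
by apply: h => e'; apply: ne; rewrite -e -e'.
Qed.

Lemma fibre_comb gamma k a b :
  fibre_part c gamma (k *: a + b) = k *: fibre_part c gamma a + fibre_part c gamma b.
Proof.
apply/funext => x; rewrite -[RHS]/(k * fibre_part c gamma a x + fibre_part c gamma b x) /fibre_part.
by case: eqP => // _; rewrite mulr0 addr0.
Qed.

Lemma Cc_fibre gamma a : CcG a -> CcG (fibre_part c gamma a).
Proof.
move=> /(CcP Gh)[ca [K cK aK]]; apply/(CcP Gh); split; last first.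
  exists K => // x; rewrite /fibre_part; case: (c x =P gamma) => [_|_]; last by rewrite eqxx.
  exact: aK.
move=> x A; rewrite /fibre_part; case: eqP => [cx|cx].
  have nG : nbhs x [set y | c y = gamma] by apply: open_nbhs_nbhs; split => //; exact: level_open.
  move=> /ca; rewrite /fmap /=; move: nG; apply: filterS2 => y cy Ay.
  by rewrite /= cy eqxx.
move=> /nbhs_singleton A0.
have nG : nbhs x (~` [set y | c y = gamma]).
  by apply: open_nbhs_nbhs; split => //; rewrite openC; exact: level_closed.
rewrite /fmap /=; apply: filterS nG => y /eqP/negPf cy.
by rewrite /= cy.
Qed.

(** The cocycle is locally constant and hence takes finitely many values on the compact support. *)
Lemma finite_fibres a : CcG a -> finite_set [set gamma | fibre_part c gamma a != 0].
Proof.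
move=> /(CcP Gh)[ca [K cK aK]].
have fK : finite_set (c @` K).
  apply: (compact_ind (P := fun S => finite_set (c @` S)) cK).
  - by rewrite image_set0.
  - by move=> A B fA fB; rewrite image_setU finite_setU.
  - by move=> A B AB; apply: sub_finite_set; exact: image_subset.
  - move=> x Kx; exists [set y | c y = c x]; split => //; first exact: level_open.
    by apply: (sub_finite_set _ (finite_set1 (c x))) => _ [y /= -> <-].
apply: sub_finite_set fK => gamma /= h.
have [x] : exists x, fibre_part c gamma a x != 0.
  apply: contrapT => ne; move/eqP: h; apply; apply/funext => x.
  by apply/eqP; apply: contrapT => /negP h; apply: ne; exists x.
rewrite /fibre_part; case: (c x =P gamma) => [<- ax|_]; last by rewrite eqxx.
by exists x => //; exact: aK.
Qed.
End KernelNorms.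

(** * Reduced norms *)

Section FibreOperators.
Context (R : realType) (G : topGroupoidType).
Hypotheses (Gh : hausdorff_space G) (Glc : locally_compact [set: G])
  (Gsc : @second_countable G).
Variable lam : haarSystem R G.
Implicit Types (u v w x y z : G) (a b phi : G -> R[i]^o).
Local Notation N k := (nrm (k : R[i]^o)).
Local Notation RI u f := (rint (haar lam u) setT f).
Local Notation fib u := (rfib u : set (borel G)).

Definition sqi u phi : \bar R := (\int[haar lam u]_(z in fib u) (N (phi z) ^+ 2)%:E)%E.

(* Inversion turns [h |-> conv a h] on [L^2(Gu)] into the operator with kernel
   [a (w^-1 z)] on the fibre of the range map. *)
Definition slice u a phi : G -> R[i]^o := fun w =>
  cintegral (haar lam u) (rfib u) (fun z => a (gmul (ginv w) z) * phi z).

Lemma cmeasurableM (D : set G) a b : measurable (D : set (borel G)) ->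
  cmeasurable D a -> cmeasurable D b -> cmeasurable D (fun x => a x * b x).
Proof.
move=> mD [a1 a2] [b1 b2]; split.
- have : measurable_fun (D : set (borel G)) (fun x : borel G =>
    complex.Re (a x) * complex.Re (b x) - complex.Im (a x) * complex.Im (b x)).
    by apply: measurable_funB; exact: measurable_funM.
  by apply: eq_measurable_fun => x _; case: (a x) (b x) => [? ?] [? ?].
- have : measurable_fun (D : set (borel G)) (fun x : borel G =>
    complex.Re (a x) * complex.Im (b x) + complex.Im (a x) * complex.Re (b x)).
    by apply: measurable_funD; exact: measurable_funM.
  by apply: eq_measurable_fun => x _; case: (a x) (b x) => [? ?] [? ?].
Qed.

Lemma sq_measurable (D : set G) phi : cmeasurable D phi ->
  measurable_fun (D : set (borel G)) (fun z : borel G => N (phi z) ^+ 2).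
Proof. by move=> h; apply: measurable_funX; exact: nrm_measurable. Qed.

Lemma cont_on_lquot w : cont_on (rfib (grng w)) (gmul (ginv w)).
Proof. by have := @cont_on_ltrans _ (ginv w); rewrite gsrc_inv. Qed.

Lemma lquot_cont_on w a : Cc R G a -> cont_on (rfib (grng w)) (fun z => a (gmul (ginv w) z)).
Proof.
move=> ca; apply: (@cont_on_comp _ _ _ _ setT (gmul (ginv w)) a).
- exact: cont_on_lquot.
- by apply: cont_onT; case: ca.
- by [].
Qed.

Lemma lquot_measurable w a : Cc R G a -> cmeasurable (rfib (grng w)) (fun z => a (gmul (ginv w) z)).
Proof. by move=> ca; apply: cont_on_cmeasurable; [exact: rfib_measurable | exact: lquot_cont_on]. Qed.

Lemma int_lquot w a : Cc R G a ->
  (\int[haar lam (grng w)]_(z in fib (grng w)) (N (a (gmul (ginv w) z)))%:E =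
   (RI (gsrc w) (fun z => N (a z)))%:E)%E.
Proof.
move=> ca; rewrite -(int_rfib Gh Gsc lam (gsrc_unit w) (Cc_nrm Gh ca)).
have m := nrm_measurable (lquot_measurable w ca).
rewrite -(@ge0_integral_ltrans _ _ Gh Glc Gsc lam w (fun z => (N (a (gmul (ginv w) z)))%:E)).
- by apply: eq_integral => z; rewrite inE => /esym zw; rewrite gmulVK.
- exact/measurable_EFinP.
- by move=> z; rewrite lee_fin nrm_ge0.
Qed.

Lemma int_lquot_adj z a : Cc R G a ->
  measurable_fun (fib (grng z)) (fun w : borel G => (N (a (gmul (ginv w) z)))%:E) /\
  (\int[haar lam (grng z)]_(w in fib (grng z)) (N (a (gmul (ginv w) z)))%:E =
   (RI (gsrc z) (fun x => N (adj a x)))%:E)%E.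
Proof.
move=> ca; have E w : rfib (grng z) w -> N (a (gmul (ginv w) z)) = N (adj a (gmul (ginv z) w)).
  move=> wz; rewrite /adj nrm_conj; congr (N (a _)).
  by rewrite ginv_gmul ?ginvK// gsrc_inv wz.
have m := nrm_measurable (lquot_measurable z (Cc_adj Gh ca)).
split.
  have : measurable_fun (fib (grng z)) (fun w : borel G => (N (adj a (gmul (ginv z) w)))%:E).
    exact/measurable_EFinP.
  by apply: eq_measurable_fun => w; rewrite inE => /E ->.
rewrite -(int_lquot z (Cc_adj Gh ca)); apply: eq_integral => w; rewrite inE => /E ->.
by [].
Qed.

Lemma slice_cintegrable w a phi : Cc R G a -> cmeasurable (rfib (grng w)) phi ->
  (sqi (grng w) phi < +oo)%E ->
  cintegrable (haar lam (grng w)) (rfib (grng w)) (fun z => a (gmul (ginv w) z) * phi z) /\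
  rintegrable (haar lam (grng w)) (rfib (grng w)) (fun z => N (a (gmul (ginv w) z)) * N (phi z) ^+ 2).
Proof.
move=> ca mp fin; have mD := rfib_measurable Gh (grng w).
have ma := lquot_measurable w ca; have [M M0 aM] := Cc_bounded Gh ca.
have i1 : rintegrable (haar lam (grng w)) (rfib (grng w)) (fun z => N (a (gmul (ginv w) z))).
  apply/integrableP; split; first by apply/measurable_EFinP; exact: nrm_measurable.
  rewrite (eq_integral (fun z : borel G => (N (a (gmul (ginv w) z)))%:E)).
    by rewrite int_lquot// ltry.
  by move=> z _; rewrite /= ger0_norm ?nrm_ge0.
have i2 : rintegrable (haar lam (grng w)) (rfib (grng w)) (fun z => N (phi z) ^+ 2).
  apply/integrableP; split; first by apply/measurable_EFinP; exact: sq_measurable.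
  rewrite (eq_integral (fun z : borel G => (N (phi z) ^+ 2)%:E))// => z _.
  by rewrite /= ger0_norm ?sqr_ge0.
split.
  (* The majorant comes from [t <= 1 + t^2] and the boundedness of [a]. *)
  apply: (@cintegrable_le _ _ _ _ mD _ (fun z => N (a (gmul (ginv w) z)) + M * N (phi z) ^+ 2)).
  - exact: cmeasurableM.
  - by apply: rintegrableD => //; exact: rintegrableZ.
  - move=> z _; rewrite nrmM.
    have := aM (gmul (ginv w) z); have := nrm_ge0 (a (gmul (ginv w) z) : R[i]^o).
    set s := N (a _); set t := N (phi z) => s0 sM.
    have h1 : s * t ^+ 2 <= M * t ^+ 2 by rewrite ler_wpM2r ?sqr_ge0.
    have h3 : 0 <= s * t ^+ 2 - s * t + s.
      have -> : s * t ^+ 2 - s * t + s = s * ((t - 2^-1) ^+ 2 + 3 / 4) by field.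
      by rewrite mulr_ge0// addr_ge0// sqr_ge0.
    by move: h3 h1; lra.
apply: (le_integrable mD) (rintegrableZ mD M i2).
  apply/measurable_EFinP; apply: measurable_funM; [exact: nrm_measurable | exact: sq_measurable].
move=> z _; rewrite lee_fin !ger0_norm ?mulr_ge0 ?nrm_ge0 ?sqr_ge0//.
by rewrite ler_wpM2r ?sqr_ge0.
Qed.

Definition DD u : set (borel G * borel G) := fib u `*` fib u.

Lemma DD_measurable u : measurable (DD u).
Proof. by apply: measurableX; exact: rfib_measurable. Qed.

Lemma fubini_measurable u (F : G * G -> R) : gunits G u ->
  measurable_fun (DD u) (F : borel G * borel G -> R) ->
  measurable_fun (fib u) (fun w : borel G => rint (haar lam u) (rfib u) (fun z => F (w, z))).
Proof.
move=> hu mF.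
pose Fp (p : G * G) := Num.max (F p) 0; pose Fn (p : G * G) := Num.max (- F p) 0.
have mp : measurable_fun (DD u) (Fp : borel G * borel G -> R).
  by apply: measurable_maxr => //; exact: measurable_cst.
have mn : measurable_fun (DD u) (Fn : borel G * borel G -> R).
  by apply: measurable_maxr; [exact: measurable_funN | exact: measurable_cst].
have p0 p : 0 <= Fp p by rewrite /Fp le_max lexx orbT.
have n0 p : 0 <= Fn p by rewrite /Fn le_max lexx orbT.
have [_ m1 _ _] := tonelli_rfib Gh Glc Gsc lam hu mp p0.
have [_ m2 _ _] := tonelli_rfib Gh Glc Gsc lam hu mn n0.
apply: (@measurableT_comp _ _ _ _ _ _ (@fine R)); first exact: fine_measurable.
have := emeasurable_funB m1 m2; apply: eq_measurable_fun => w _.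
rewrite /bintegral [RHS]integralE; congr (_ - _)%E; apply: eq_integral => z _.
- by rewrite funeposE /Fp EFin_max.
- by rewrite funenegE /Fn EFin_max.
Qed.

Lemma prod_measurable u a : Cc R G a ->
  measurable_fun (DD u) (fun p : borel G * borel G => complex.Re (a (gmul (ginv p.1) p.2))) /\
  measurable_fun (DD u) (fun p : borel G * borel G => complex.Im (a (gmul (ginv p.1) p.2))).
Proof.
move=> ca.
have cq : cont_on (rfib u `*` rfib u) (fun p : G * G => a (gmul (ginv p.1) p.2)).
  apply: (@cont_on_comp _ _ _ _ setT (fun p : G * G => gmul (ginv p.1) p.2) a).
  - apply: cont_on_gmul.
    + by apply: cont_on_ginv; apply: cont_onT => p; exact: cvg_fst.
    + by apply: cont_onT => p; exact: cvg_snd.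
    + by move=> [p q] [/= pu qu]; rewrite gsrc_inv pu qu.
  - by apply: cont_onT; case: ca.
  - by [].
by split; apply: (cont_on_prod_measurable Gsc (DD_measurable u)); [apply: cont_on_Re | apply: cont_on_Im].
Qed.

Lemma snd_measurable u (f : G -> R) : measurable_fun (fib u) (f : borel G -> R) ->
  measurable_fun (DD u) (fun p : borel G * borel G => f p.2).
Proof.
move=> mf; apply: (measurable_comp (rfib_measurable Gh u) _ mf).
  by move=> _ [p [_ p2] <-].
by apply: measurable_funTS; exact: measurable_snd.
Qed.

Lemma slice_measurable u a phi : gunits G u -> Cc R G a -> cmeasurable (rfib u) phi ->
  cmeasurable (rfib u) (slice u a phi).
Proof.
move=> hu ca [p1 p2]; have [a1 a2] := prod_measurable u ca.
have q1 := snd_measurable p1; have q2 := snd_measurable p2.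
split.
- have := @fubini_measurable u (fun p => complex.Re (a (gmul (ginv p.1) p.2)) * complex.Re (phi p.2) -
    complex.Im (a (gmul (ginv p.1) p.2)) * complex.Im (phi p.2)) hu.
  move=> h; apply: eq_measurable_fun (h _); last by apply: measurable_funB; exact: measurable_funM.
  move=> w _; rewrite /slice cintegralE /=; congr rint; apply/funext => z /=.
  by case: (a _) (phi z) => [? ?] [? ?].
- have := @fubini_measurable u (fun p => complex.Re (a (gmul (ginv p.1) p.2)) * complex.Im (phi p.2) +
    complex.Im (a (gmul (ginv p.1) p.2)) * complex.Re (phi p.2)) hu.
  move=> h; apply: eq_measurable_fun (h _); last by apply: measurable_funD; exact: measurable_funM.
  move=> w _; rewrite /slice cintegralE /=; congr rint; apply/funext => z /=.
  by case: (a _) (phi z) => [? ?] [? ?].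
Qed.

(** The Cauchy-Schwarz inequality for the measure with density [|a (w^-1 z)|], obtained by
    integrating [2 t r <= r^2 + t^2] and then choosing [t]. *)
Lemma slice_pointwise w a phi (I0 : R) : Cc R G a -> cmeasurable (rfib (grng w)) phi ->
  (sqi (grng w) phi < +oo)%E -> 0 < I0 ->
  RI (gsrc w) (fun z => N (a z)) <= I0 ->
  ((N (slice (grng w) a phi w) ^+ 2)%:E <= I0%:E *
    \int[haar lam (grng w)]_(z in fib (grng w)) (N (a (gmul (ginv w) z)) * N (phi z) ^+ 2)%:E)%E.
Proof.
move=> ca mp fin I1 aI; have mD := rfib_measurable Gh (grng w).
have [i1 i2] := slice_cintegrable ca mp fin.
set Cq := (\int[_]_(_ in _) _)%E.
have Cr : Cq = (rint (haar lam (grng w)) (rfib (grng w)) (fun z => N (a (gmul (ginv w) z)) * N (phi z) ^+ 2))%:E.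
  by rewrite -(rintE mD i2).
rewrite Cr -EFinM lee_fin; set C1 := rint _ _ _.
have ia : rintegrable (haar lam (grng w)) (rfib (grng w)) (fun z => N (a (gmul (ginv w) z))).
  apply/integrableP; split; first by apply/measurable_EFinP; apply: nrm_measurable => //; exact: lquot_measurable.
  rewrite (eq_integral (fun z : borel G => (N (a (gmul (ginv w) z)))%:E)).
    by rewrite int_lquot// ltry.
  by move=> z _; rewrite /= ger0_norm ?nrm_ge0.
have A1 : rint (haar lam (grng w)) (rfib (grng w)) (fun z => N (a (gmul (ginv w) z))) <= I0.
  by rewrite -lee_fin -(rintE mD ia) /bintegral int_lquot// lee_fin.
have in1 := cintegrable_nrm mD i1.
pose B := rint (haar lam (grng w)) (rfib (grng w)) (fun z => N (a (gmul (ginv w) z) * phi z)).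
have nB : N (slice (grng w) a phi w) <= B by exact: cintegral_norm.
have B0 : 0 <= B by apply: rint_ge0 => z _; exact: nrm_ge0.
have key (t : R) : 2 * t * B <= C1 + t ^+ 2 * I0.
  have e1 : 2 * t * B <= rint (haar lam (grng w)) (rfib (grng w))
     (fun z => N (a (gmul (ginv w) z)) * N (phi z) ^+ 2 + t ^+ 2 * N (a (gmul (ginv w) z))).
    rewrite /B -(rintZ mD _ in1); apply: le_rint => //.
    - exact: rintegrableZ.
    - by apply: rintegrableD => //; exact: rintegrableZ.
    - move=> z _; rewrite nrmM; have := nrm_ge0 (a (gmul (ginv w) z) : R[i]^o).
      set s := N (a _); set r := N (phi z) => s0.
      have : 0 <= s * (r - t) ^+ 2 by rewrite mulr_ge0// sqr_ge0.
      by rewrite sqrrB; lra.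
  apply: le_trans e1 _; rewrite (rintD mD i2 (rintegrableZ mD _ ia)) (rintZ mD _ ia).
  by rewrite lerD2l ler_wpM2l// sqr_ge0.
(* The optimal [t]; it gives [B^2 / I0 <= C1]. *)
have h := key (B / I0).
have e2 : (B / I0) ^+ 2 * I0 = B ^+ 2 / I0 by field; rewrite lt0r_neq0.
have e3 : 2 * (B / I0) * B = 2 * (B ^+ 2 / I0) by field; rewrite lt0r_neq0.
rewrite e2 e3 in h.
have : B ^+ 2 / I0 <= C1 by lra.
rewrite ler_pdivrMr// mulrC => h2; apply: le_trans h2.
by rewrite ler_pXn2r ?nnegrE ?nrm_ge0.
Qed.

(** Schur's test with constant weights: one factor [I0] is the bound of [slice_pointwise], the other
    bounds the integral in the first variable after the order of integration is exchanged. *)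
Lemma slice_bound u a phi (I0 : R) : gunits G u -> Cc R G a -> cmeasurable (rfib u) phi ->
  (sqi u phi < +oo)%E -> 0 < I0 -> Inorm lam a <= I0 ->
  (sqi u (slice u a phi) <= (I0 ^+ 2)%:E * sqi u phi)%E.
Proof.
move=> hu ca mp fin I1 aI; have mD := rfib_measurable Gh u.
have aIl v : gunits G v -> RI v (fun z => N (a z)) <= I0.
  by move=> hv; apply: le_trans aI; case: (Inorm_ge Gh Gsc lam ca hv).
have aIr v : gunits G v -> RI v (fun z => N (adj a z)) <= I0.
  by move=> hv; apply: le_trans aI; case: (Inorm_ge Gh Gsc lam ca hv).
pose F (p : G * G) : R := N (a (gmul (ginv p.1) p.2)) * N (phi p.2) ^+ 2.
have F0 p : 0 <= F p by rewrite mulr_ge0 ?sqr_ge0 ?nrm_ge0.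
have mF : measurable_fun (DD u) (F : borel G * borel G -> R).
  apply: measurable_funM; last exact: (snd_measurable (sq_measurable mp)).
  have cq : cont_on (rfib u `*` rfib u) (fun p : G * G => a (gmul (ginv p.1) p.2)).
    apply: (@cont_on_comp _ _ _ _ setT (fun p : G * G => gmul (ginv p.1) p.2) a).
    - apply: cont_on_gmul.
      + by apply: cont_on_ginv; apply: cont_onT => p; exact: cvg_fst.
      + by apply: cont_onT => p; exact: cvg_snd.
      + by move=> [p q] [/= pu qu]; rewrite gsrc_inv pu qu.
    - by apply: cont_onT; case: ca.
    - by [].
  exact: (cont_on_prod_measurable Gsc (DD_measurable u) (cont_on_nrm cq)).
have [_ m1 m2 FF] := tonelli_rfib Gh Glc Gsc lam hu mF F0.
apply: le_trans (_ : _ <= \int[haar lam u]_(w in fib u) (I0%:E *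
    \int[haar lam u]_(z in fib u) (F (w, z))%:E))%E _.
  apply: ge0_le_integral; first exact: mD.
  - by move=> w _; rewrite lee_fin sqr_ge0.
  - apply/measurable_EFinP; apply: sq_measurable; exact: slice_measurable.
  - by apply: measurable_funeM.
  - move=> w wu; have := @slice_pointwise w a phi I0 ca; rewrite wu.
    by move=> h; apply: (h mp fin I1); apply: aIl; exact: gsrc_unit.
have I0' : (0 <= I0%:E)%E by rewrite lee_fin ltW.
rewrite (ge0_integralZl _ mD m1 _ I0'); last by move=> w _; apply: integral_ge0 => z _; rewrite lee_fin.
rewrite FF expr2 EFinM -muleA; apply: (lee_wpmul2l I0').
have sq0 z : (0 <= (N (phi z) ^+ 2)%:E)%E by rewrite lee_fin sqr_ge0.
have msq : measurable_fun (fib u) (fun z : borel G => (N (phi z) ^+ 2)%:E).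
  by apply/measurable_EFinP; exact: sq_measurable.
rewrite /sqi -(ge0_integralZl _ mD msq _ I0'); last by move=> z _; exact: sq0.
apply: ge0_le_integral; first exact: mD.
- by move=> z _; apply: integral_ge0 => w _; rewrite lee_fin.
- exact: m2.
- exact: measurable_funeM.
- move=> z zu.
  have [mz E] := int_lquot_adj z ca; rewrite zu in mz E.
  have -> : (\int[haar lam u]_(w in fib u) (F (w, z))%:E =
      (N (phi z) ^+ 2)%:E * (RI (gsrc z) (fun x => N (adj a x)))%:E)%E.
    rewrite -E -(ge0_integralZl _ mD mz).
    + by apply: eq_integral => w _; rewrite -EFinM /F /= mulrC.
    + by move=> w _; rewrite lee_fin; exact: nrm_ge0.
    + exact: sq0.
  rewrite muleC -!EFinM lee_fin; apply: ler_wpM2r; first exact: sqr_ge0.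
  by apply: aIr; exact: gsrc_unit.
Qed.

Lemma sqi_ltrans y phi : cmeasurable (rfib (grng y)) phi ->
  sqi (gsrc y) (fun w => phi (gmul y w)) = sqi (grng y) phi.
Proof.
move=> mp; rewrite /sqi.
rewrite -(@ge0_integral_ltrans _ _ Gh Glc Gsc lam y (fun z => (N (phi z) ^+ 2)%:E))//.
- by apply/measurable_EFinP; exact: sq_measurable.
- by move=> z; rewrite lee_fin sqr_ge0.
Qed.

(** The kernel [a (w^-1 z)] is unchanged when both variables are translated from the left, so
    translation intertwines the operators on the two fibres. *)
Lemma slice_ltrans y w a phi : Cc R G a -> cmeasurable (rfib (grng y)) phi -> grng w = gsrc y ->
  slice (grng y) a phi (gmul y w) = slice (gsrc y) a (fun z => phi (gmul y z)) w.
Proof.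
move=> ca mp wy; rewrite /slice.
have mf : cmeasurable (rfib (grng y)) (fun z => a (gmul (ginv (gmul y w)) z) * phi z).
  apply: cmeasurableM => //; first exact: rfib_measurable.
  by have := lquot_measurable (gmul y w) ca; rewrite grng_mul.
rewrite -(cintegral_ltrans Gh Glc Gsc lam mf).
apply: eq_cintegral => z zy; congr (a _ * _).
rewrite ginv_gmul//.
have h1 : gsrc (ginv w) = grng (ginv y) by rewrite gsrc_inv grng_inv.
have h2 : gsrc (ginv y) = grng (gmul y z) by rewrite gsrc_inv grng_mul.
by rewrite -gmulA// gmulVK.
Qed.

Lemma gfiber_measurable u : measurable (gfiber u : set (borel G)).
Proof.
rewrite (_ : gfiber u = (@ginv G : borel G -> borel G) @^-1` rfib u); last first.
  by apply/seteqP; split => x /=; rewrite /rfib /gfiber /= grng_inv.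
by rewrite -[X in measurable X]setTI; apply: ginv_measurable => //; exact: rfib_measurable.
Qed.

Lemma gfiber_inv_measurable u phi : cmeasurable (gfiber u) phi <-> cmeasurable (rfib u) (phi \o @ginv G).
Proof.
have mg := gfiber_measurable u.
have key (f : G -> R) : measurable_fun (gfiber u : set (borel G)) (f : borel G -> R) <->
    measurable_fun (fib u) (f \o @ginv G : borel G -> R).
  split=> mf.
    apply: (measurable_comp mg _ mf); last by apply: measurable_funTS; exact: ginv_measurable.
    by move=> _ [x xu <-]; rewrite /gfiber /= gsrc_inv.
  have : measurable_fun (gfiber u : set (borel G)) ((f \o @ginv G) \o (@ginv G : borel G -> borel G)).
    apply: (measurable_comp (rfib_measurable Gh u) _ mf); last by apply: measurable_funTS; exact: ginv_measurable.
    by move=> _ [x xu <-]; rewrite /rfib /= grng_inv.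
  by apply: eq_measurable_fun => x _; rewrite /= ginvK.
split=> -[h1 h2]; split.
- exact: (iffLR (key (fun x => complex.Re (phi x))) h1).
- exact: (iffLR (key (fun x => complex.Im (phi x))) h2).
- exact: (iffRL (key (fun x => complex.Re (phi x))) h1).
- exact: (iffRL (key (fun x => complex.Im (phi x))) h2).
Qed.

Lemma L2int_sqi u h : cmeasurable (gfiber u) h -> L2int lam u h = sqi u (h \o @ginv G).
Proof.
move=> mh; rewrite /L2int /bintegral /lam_inv.
have mg := gfiber_measurable u.
rewrite (ge0_integral_pushforward (@ginv_measurable G) (haar lam u) mg).
- have -> : ginv @^-1` gfiber u = rfib u.
    by apply/seteqP; split => x; rewrite /rfib /gfiber /= gsrc_inv.
  by [].
- by apply/measurable_EFinP; exact: sq_measurable.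
- by move=> z _; rewrite lee_fin sqr_ge0.
Qed.

Lemma conv_slice a h w : Cc R G a -> cmeasurable (rfib (grng w)) (h \o @ginv G) ->
  conv lam a h (ginv w) = slice (grng w) a (h \o @ginv G) w.
Proof.
move=> ca mh; rewrite /conv /slice grng_inv.
have mf : cmeasurable (rfib (grng w)) (fun z => a (gmul (ginv w) z) * (h \o @ginv G) z).
  by apply: cmeasurableM => //; [exact: rfib_measurable | exact: lquot_measurable].
rewrite -(cintegral_ltrans Gh Glc Gsc lam mf).
apply: eq_cintegral => z; rewrite /rfib /= => zw.
by rewrite gmulVK// ginv_gmul.
Qed.

Lemma conv_measurable u a h : gunits G u -> Cc R G a -> cmeasurable (gfiber u) h ->
  cmeasurable (gfiber u) (conv lam a h).
Proof.
move=> hu ca /gfiber_inv_measurable mh; apply/gfiber_inv_measurable.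
have [m1 m2] := slice_measurable hu ca mh.
have E w : rfib u w -> conv lam a h (ginv w) = slice u a (h \o @ginv G) w.
  by move=> wu; rewrite conv_slice ?wu.
split; [apply: eq_measurable_fun m1 | apply: eq_measurable_fun m2] => w; rewrite inE => /E e.
- exact: (congr1 (@complex.Re R) (esym e)).
- exact: (congr1 (@complex.Im R) (esym e)).
Qed.

Lemma eq_sqi u phi phi' : (forall z, rfib u z -> phi z = phi' z) -> sqi u phi = sqi u phi'.
Proof. by move=> h; apply: eq_integral => z; rewrite inE => zu; rewrite h. Qed.

Lemma sqi_ge0 u phi : (0 <= sqi u phi)%E.
Proof. by apply: integral_ge0 => z _; rewrite lee_fin sqr_ge0. Qed.

Lemma L2int_conv u a h : gunits G u -> Cc R G a -> cmeasurable (gfiber u) h ->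
  L2int lam u (conv lam a h) = sqi u (slice u a (h \o @ginv G)).
Proof.
move=> hu ca mh; rewrite L2int_sqi; last exact: conv_measurable.
by apply: eq_sqi => w wu; rewrite /= conv_slice ?wu//; exact/gfiber_inv_measurable.
Qed.
End FibreOperators.

(** * The reduced norm of the kernel *)

Section ReducedKernel.
Context (R : realType) (G : topGroupoidType).
Hypotheses (Gh : hausdorff_space G) (Glc : locally_compact [set: G])
  (Gsc : @second_countable G).
Variable lam : haarSystem R G.
Context (Gamma : groupType) (c : cocycle G Gamma).
Implicit Types (u v w x y z : G) (a b phi psi : G -> R[i]^o) (f g h : kernel c -> R[i]^o) (k : kernel c).
Local Notation N k := (nrm (k : R[i]^o)).
Local Notation kv := (@kval G Gamma c).
Local Notation lamk := (kernel_haar lam c).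
Local Notation Cck := (Cc R (kernel c)).
Local Notation fib u := (rfib u : set (borel G)).
Local Notation G1 := (Gone c).

Lemma kfiberE k : gfiber k = kv @^-1` gfiber (kv k) :> set (kernel c).
Proof.
apply/seteqP; split => x; rewrite /gfiber /=; first by move=> /(congr1 kv).
by move=> e; exact: kval_inj.
Qed.

Lemma kval_measurable : measurable_fun [set: borel (kernel c)] (kv : borel (kernel c) -> borel G).
Proof. by apply: cont_on_borel_map => //; apply: cont_onT; exact: kval_continuous. Qed.

Lemma kfiber_measurable k : measurable (gfiber k : set (borel (kernel c))).
Proof.
rewrite kfiberE -[X in measurable X]setTI; apply: kval_measurable => //.
exact: gfiber_measurable.
Qed.

Lemma ext0_measurable k h : cmeasurable (gfiber k) h <-> cmeasurable (gfiber (kv k)) (ext0 h).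
Proof.
have mg := gfiber_measurable Gh (kv k); have mG := Gone_measurable c.
have mk := kfiber_measurable k.
split=> -[h1 h2].
  have key (p : kernel c -> R) (q : G -> R) :
      (forall x : kernel c, p x = q (kv x)) -> (forall x, c x <> 1%g -> q x = 0) ->
      measurable_fun (gfiber k : set (borel (kernel c))) (p : borel (kernel c) -> R) ->
      measurable_fun (gfiber (kv k) : set (borel G)) (q : borel G -> R).
    move=> pq q0 mp.
    have -> : (gfiber (kv k) : set (borel G)) = (gfiber (kv k) `&` G1) `|` (gfiber (kv k) `&` ~` G1).
      by rewrite -setIUr setUCr setIT.
    apply/measurable_funU; [exact: measurableI | by apply: measurableI => //; exact: measurableC |].
    split.
      have : measurable_fun (gfiber (kv k) `&` G1 : set (borel G)) (p \o (kretr c : borel G -> borel (kernel c))).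
        apply: (measurable_comp mk _ mp); last by apply: measurable_funTS; exact: kretr_measurable.
        move=> _ [x [xk x1] <-]; rewrite kfiberE /=.
        by have := kvalK x1; rewrite /gfiber /= => ->.
      by apply: eq_measurable_fun => x; rewrite inE => -[_ x1]; rewrite /= pq kvalK.
    have : measurable_fun (gfiber (kv k) `&` ~` G1 : set (borel G)) (fun _ : borel G => 0 : R).
      exact: measurable_cst.
    by apply: eq_measurable_fun => x; rewrite inE => -[_ x1]; rewrite q0.
  split; [apply: key h1 | apply: key h2] => x; rewrite ?ext0_kval// => x1; by rewrite ext0_out.
have key (q : G -> R) (p : kernel c -> R) : (forall x : kernel c, p x = q (kv x)) ->
    measurable_fun (gfiber (kv k) : set (borel G)) (q : borel G -> R) ->
    measurable_fun (gfiber k : set (borel (kernel c))) (p : borel (kernel c) -> R).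
  move=> pq mq.
  have : measurable_fun (gfiber k : set (borel (kernel c))) (q \o (kv : borel (kernel c) -> borel G)).
    apply: (measurable_comp mg _ mq); last by apply: measurable_funTS; exact: kval_measurable.
    by move=> _ [x xk <-]; move: xk; rewrite kfiberE.
  by apply: eq_measurable_fun => x _; rewrite /= pq.
by split; [apply: key h1 | apply: key h2] => x; rewrite ext0_kval.
Qed.

Lemma L2int_ext0 k h : cmeasurable (gfiber k) h -> L2int lamk k h = L2int lam (kv k) (ext0 h).
Proof.
move=> /ext0_measurable mh; rewrite /L2int; have [m e] := lam_inv_measure lam (kv k).
rewrite (lam_inv_kernel e) -e kfiberE.
have -> : (fun x : kernel c => N (h x) ^+ 2) = (fun x => N (ext0 h x) ^+ 2) \o kv.
  by apply/funext => x /=; rewrite ext0_kval.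
apply: bintegral_kmeas; [exact: gfiber_measurable | exact: sq_measurable |].
by move=> x x1; rewrite ext0_out// (@nrm0 R R[i]^o) expr0n.
Qed.

Lemma conv_ext0 k g h : gunits (kernel c) k -> Cck g -> cmeasurable (gfiber k) h ->
  forall x, gsrc x = kv k -> ext0 (conv lamk g h) x = conv lam (ext0 g) (ext0 h) x.
Proof.
move=> hk cg /ext0_measurable mh x xk; have [x1|x1] := pselect (c x = 1%g); last first.
  rewrite ext0_out//; have := lvl_conv lam (lvl_ext0 g) (lvl_ext0 h).
  by rewrite mulg1 => ->.
rewrite -{1}(kvalK x1) ext0_kval conv_kernel_measurable// kvalK//.
have mD := rfib_measurable Gh (grng x).
have cg' : Cc R G (ext0 g) by exact/(Cc_ext0 Gh).
apply: (cmeasurableM mD).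
  by apply: cont_on_cmeasurable => //; apply: cont_onT; case: cg'.
have mq : measurable_fun (rfib (grng x) : set (borel G)) ((fun y => gmul (ginv y) x) : borel G -> borel G).
  by apply: cont_on_borel_map => //; exact: cont_on_quot.
case: mh => m1 m2; have mg := gfiber_measurable Gh (kv k).
by split; [apply: (measurable_comp mg _ m1) | apply: (measurable_comp mg _ m2)] => //;
  move=> _ [y yx <-]; rewrite /gfiber /= gsrc_mul// gsrc_inv.
Qed.

Lemma eq_cmeasurable (T : ptopologicalType) (D : set T) (f g : T -> R[i]^o) :
  (forall x : T, D x -> f x = g x) -> cmeasurable D f -> cmeasurable D g.
Proof.
move=> e [m1 m2]; split; [apply: eq_measurable_fun m1 | apply: eq_measurable_fun m2] => x;
  by rewrite inE => /e ->.
Qed.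

Lemma L2int_conv_ext0 k g h : gunits (kernel c) k -> Cck g -> cmeasurable (gfiber k) h ->
  L2int lamk k (conv lamk g h) =
  sqi lam (kv k) (slice lam (kv k) (ext0 g) (ext0 h \o @ginv G)).
Proof.
move=> hk cg mh; have cg' : Cc R G (ext0 g) by exact/(Cc_ext0 Gh).
have hv : gunits G (kv k) by exact/kunits.
have mh' := iffLR (ext0_measurable k h) mh.
have E := conv_ext0 hk cg mh.
have mc : cmeasurable (gfiber (kv k)) (ext0 (conv lamk g h)).
  apply: (@eq_cmeasurable _ _ (conv lam (ext0 g) (ext0 h))); last exact: conv_measurable.
  by move=> x xk; rewrite E.
rewrite L2int_ext0; last exact/ext0_measurable.
rewrite -(L2int_conv Gh Glc Gsc lam hv cg' mh').
by rewrite /L2int /bintegral; have [m e] := lam_inv_measure lam (kv k); rewrite -e;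
  apply: eq_integral => x; rewrite inE => xk; rewrite E.
Qed.

Lemma L2fun_sqi k h : gunits (kernel c) k -> L2fun lamk k h ->
  [/\ cmeasurable (gfiber k) h, cmeasurable (rfib (kv k)) (ext0 h \o @ginv G),
      L2int lamk k h = sqi lam (kv k) (ext0 h \o @ginv G) &
      (sqi lam (kv k) (ext0 h \o @ginv G) < +oo)%E].
Proof.
move=> hk [h1 h2 h3]; have mh : cmeasurable (gfiber k) h by split.
have mh' := iffLR (ext0_measurable k h) mh.
have E : L2int lamk k h = sqi lam (kv k) (ext0 h \o @ginv G).
  by rewrite L2int_ext0// L2int_sqi.
by split => //; [exact/gfiber_inv_measurable | rewrite -E].
Qed.

(** A crude bound that makes the suprema in the reduced norm genuine. The summand one makes the
    constant positive, as [slice_bound] requires. *)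
Lemma kernel_regular_bound k g h : gunits (kernel c) k -> Cck g -> L2fun lamk k h ->
  L2norm lamk k h <= 1 -> L2norm lamk k (conv lamk g h) <= Inorm lam (ext0 g) + 1.
Proof.
move=> hk cg Lh; have [mh mh' E fin] := L2fun_sqi hk Lh.
have hv : gunits G (kv k) by exact/kunits.
have cg' : Cc R G (ext0 g) by exact/(Cc_ext0 Gh).
have I0 := Inorm_ge0 Gh Gsc lam cg'; set I1 := Inorm _ _ + 1.
have I1p : 0 < I1 by rewrite /I1; lra.
rewrite /L2norm E L2int_conv_ext0// => h1.
have := slice_bound Gh Glc Gsc hv cg' mh' fin I1p; rewrite {1}/I1 lerDl ler01 => /(_ isT) B.
have s0 := sqi_ge0 lam (kv k) (ext0 h \o @ginv G).
have f1 : sqi lam (kv k) (ext0 h \o @ginv G) \is a fin_num by rewrite ge0_fin_numE.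
have hs : fine (sqi lam (kv k) (ext0 h \o @ginv G)) <= 1.
  rewrite -(@ler_sqrt R _ 1)// sqrtr1//.
set T := sqi _ _ _ in B *; have T0 : (0 <= T)%E by exact: sqi_ge0.
have B2 : (T <= (I1 ^+ 2)%:E)%E.
  apply: le_trans B _; rewrite -(fineK f1) -EFinM lee_fin ler_piMr// sqr_ge0//.
have T1 : T \is a fin_num by rewrite ge0_fin_numE//; apply: le_lt_trans B2 _; exact: ltry.
rewrite -[leRHS]ger0_norm ?(ltW I1p)// -sqrtr_sqr; apply: ler_wsqrtr.
by rewrite -lee_fin fineK.
Qed.

Lemma kernel_regular_le k g h : gunits (kernel c) k -> Cck g -> L2fun lamk k h ->
  L2norm lamk k h <= 1 -> L2norm lamk k (conv lamk g h) <= reduced_norm lamk g.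
Proof.
move=> hk cg Lh h1.
have reg1 k' : gunits (kernel c) k' -> has_ubound [set L2norm lamk k' (conv lamk g h) |
    h in [set h | L2fun lamk k' h /\ L2norm lamk k' h <= 1]].
  by move=> hk'; exists (Inorm lam (ext0 g) + 1) => _ [h' [L' n'] <-]; exact: kernel_regular_bound.
apply: (@le_trans _ _ (regular_norm lamk k g)).
  by apply: ub_le_sup; [exact: reg1 | exists h].
apply: ub_le_sup; last by exists k.
exists (Inorm lam (ext0 g) + 1) => _ [k' hk' <-]; rewrite /regular_norm; set S := (X in sup X).
have cg' : Cc R G (ext0 g) by exact/(Cc_ext0 Gh).
have I0 := Inorm_ge0 Gh Gsc lam cg'.
have [[t St]|nS] := pselect (S !=set0).
  apply: ge_sup; first by exists t.
  by move=> _ [h' [L' n'] <-]; exact: kernel_regular_bound.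
rewrite (_ : S = set0) ?sup0; first by lra.
by apply/seteqP; split => // t St; exfalso; apply: nS; exists t.
Qed.

Lemma sqiZ u (t : R) phi : cmeasurable (rfib u) phi ->
  sqi lam u (fun z => t%:C * phi z) = ((t ^+ 2)%:E * sqi lam u phi)%E.
Proof.
move=> mp; rewrite /sqi -ge0_integralZl//.
- by apply: eq_integral => z _; rewrite nrmM nrm_real exprMn real_normK ?num_real// EFinM.
- exact: rfib_measurable.
- by apply/measurable_EFinP; exact: sq_measurable.
- by move=> z _; rewrite lee_fin sqr_ge0.
- by rewrite lee_fin sqr_ge0.
Qed.

Lemma sliceZ u (t : R) a phi w : Cc R G a -> cmeasurable (rfib u) phi -> (sqi lam u phi < +oo)%E ->
  rfib u w -> slice lam u a (fun z => t%:C * phi z) w = t%:C * slice lam u a phi w.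
Proof.
move=> ca + + wu; rewrite -wu => mp fin.
have [i _] := slice_cintegrable Gh Glc Gsc ca mp fin.
rewrite /slice -(cintegralZ (rfib_measurable Gh (grng w)) _ i); congr cintegral.
by apply/funext => z; rewrite mulrCA.
Qed.

Lemma lvl_inv phi : lvl c 1%g phi -> lvl c 1%g (phi \o @ginv G).
Proof.
move=> h x x1; apply: h; rewrite coc_inv => e; apply: x1.
by rewrite -[c x]invgK e invg1.
Qed.

Lemma slice_kernel_le1 v g psi : gunits G v -> Cck g -> cmeasurable (rfib v) psi ->
  lvl c 1%g psi -> (sqi lam v psi <= 1)%E ->
  (sqi lam v (slice lam v (ext0 g) psi) <= (reduced_norm lamk g ^+ 2)%:E)%E.
Proof.
move=> hv cg mp lp s1; have cg' : Cc R G (ext0 g) by exact/(Cc_ext0 Gh).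
pose k := kretr c v; have kvv : kv k = v by exact: kval_unit.
have hk : gunits (kernel c) k by apply/kunits; rewrite kvv.
(* Since [psi] vanishes off the unit level, inverting it and restricting it to the kernel loses
   nothing. *)
pose h : kernel c -> R[i]^o := (psi \o @ginv G) \o kv.
have eh : ext0 h = psi \o @ginv G by apply: ext0_restr; exact: lvl_inv.
have ehi : ext0 h \o @ginv G = psi by apply/funext => z; rewrite eh /= ginvK.
have mh : cmeasurable (gfiber k) h.
  by apply/ext0_measurable; apply/gfiber_inv_measurable => //; rewrite ehi kvv.
have E : L2int lamk k h = sqi lam v psi.
  by rewrite L2int_ext0// L2int_sqi ?ehi ?kvv//; apply/gfiber_inv_measurable => //; rewrite ehi.
have fin : (sqi lam v psi < +oo)%E by apply: le_lt_trans s1 _; exact: ltry.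
have s0 := sqi_ge0 lam v psi.
have f1 : sqi lam v psi \is a fin_num by rewrite ge0_fin_numE.
have Lh : L2fun lamk k h by case: mh => m1 m2; split; rewrite ?E.
have n1 : L2norm lamk k h <= 1.
  rewrite /L2norm E -sqrtr1; apply: ler_wsqrtr; by rewrite -lee_fin fineK.
have := kernel_regular_le hk cg Lh n1.
rewrite /L2norm L2int_conv_ext0// ehi kvv.
set T := sqi _ _ _; have T0 : (0 <= T)%E by exact: sqi_ge0.
have I0 := Inorm_ge0 Gh Gsc lam cg'.
have I1p : 0 < Inorm lam (ext0 g) + 1 by lra.
have := slice_bound Gh Glc Gsc hv cg' mp fin I1p; rewrite lerDl ler01 => /(_ isT) B.
have T1 : T \is a fin_num.
  rewrite ge0_fin_numE//; apply: le_lt_trans B _; rewrite -(fineK f1) -EFinM; exact: ltry.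
move=> hT; rewrite -(fineK T1) lee_fin -(sqr_sqrtr (fine_ge0 T0)).
by rewrite ler_pXn2r ?nnegrE ?sqrtr_ge0//; apply: le_trans hT; exact: sqrtr_ge0.
Qed.

Lemma slice_kernel_le v g psi : gunits G v -> Cck g -> cmeasurable (rfib v) psi ->
  lvl c 1%g psi -> (sqi lam v psi < +oo)%E ->
  (sqi lam v (slice lam v (ext0 g) psi) <= (reduced_norm lamk g ^+ 2)%:E * sqi lam v psi)%E.
Proof.
move=> hv cg mp lp fin; have cg' : Cc R G (ext0 g) by exact/(Cc_ext0 Gh).
have s0 := sqi_ge0 lam v psi.
have f1 : sqi lam v psi \is a fin_num by rewrite ge0_fin_numE.
have I0 := Inorm_ge0 Gh Gsc lam cg'.
have I1p : 0 < Inorm lam (ext0 g) + 1 by lra.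
have := slice_bound Gh Glc Gsc hv cg' mp fin I1p; rewrite lerDl ler01 => /(_ isT) B.
have ms := slice_measurable Gh Glc Gsc lam hv cg' mp.
(* A vector of norm zero cannot be normalized; for it [slice_bound] already makes the left side
   vanish. *)
have [e0|ne0] := eqVneq (fine (sqi lam v psi)) 0.
  move: B; rewrite -(fineK f1) e0 !mule0 => B; exact: B.
pose s := fine (sqi lam v psi); have sp : 0 < s by rewrite lt0r ne0 fine_ge0.
pose t := (Num.sqrt s)^-1.
have tt : t ^+ 2 * s = 1.
  by rewrite /t exprVn sqr_sqrtr ?ltW// mulVf// lt0r_neq0.
have mt : cmeasurable (rfib v) (fun z => t%:C * psi z).
  by apply: cmeasurableM => //; exact: rfib_measurable.
have := @slice_kernel_le1 v g (fun z => t%:C * psi z) hv cg mt.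
have -> : sqi lam v (fun z => t%:C * psi z) = 1%E.
  by rewrite sqiZ// -(fineK f1) -EFinM tt.
have -> : sqi lam v (slice lam v (ext0 g) (fun z => t%:C * psi z)) =
   ((t ^+ 2)%:E * sqi lam v (slice lam v (ext0 g) psi))%E.
  by rewrite -sqiZ//; apply: eq_sqi => w wv; rewrite sliceZ.
have lt : lvl c 1%g (fun z => t%:C * psi z) by move=> x /lp ->; rewrite mulr0.
move=> /(_ lt (lexx _)) h.
set T := sqi _ _ _ in h B *.
have T0 : (0 <= T)%E by exact: sqi_ge0.
have T1 : T \is a fin_num.
  rewrite ge0_fin_numE//; apply: le_lt_trans B _; rewrite -(fineK f1) -EFinM; exact: ltry.
move: h; rewrite -(fineK T1) -(fineK f1) -!EFinM !lee_fin -/s => h.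
have -> : fine T = t ^+ 2 * fine T * s by rewrite mulrAC tt mul1r.
by rewrite ler_wpM2r// ltW.
Qed.

(** The level sets are open and disjoint, so second countability leaves countably many values even
    when [Gamma] is uncountable. Countable additivity over the levels depends on this. *)
Lemma lvl_cover : exists e : nat -> Gamma, forall x, exists n, c x = e n.
Proof.
have [b [bo bb]] := countable_base Gsc.
have /choice[e he] : forall n, exists gamma, forall x, b n x ->
    b n `<=` [set y | c y = c x] -> c x = gamma.
  move=> n; have [[x [bx bs]]|ne] := pselect (exists x, b n x /\ b n `<=` [set y | c y = c x]).
    by exists (c x) => x' bx' _; exact: bs.
  by exists 1%g => x bx bs; exfalso; apply: ne; exists x.
exists e => x; have [n [bx bs]] := bb x _ (level_open c (c x)) erefl.
by exists n; exact: he.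
Qed.

Lemma level_measurable u gamma : measurable (rfib u `&` [set w | c w = gamma] : set (borel G)).
Proof. by apply: measurableI; [exact: rfib_measurable | apply: open_borel => //; exact: level_open]. Qed.

(* Left translation by [y] identifies the part of level [c y] with the unit level. *)
Lemma slice_piece y g phi : Cck g -> cmeasurable (rfib (grng y)) phi ->
  (sqi lam (grng y) phi < +oo)%E ->
  (\int[haar lam (grng y)]_(w in (rfib (grng y) `&` [set w | c w = c y] : set (borel G)))
     (N (slice lam (grng y) (ext0 g) phi w) ^+ 2)%:E <=
   (reduced_norm lamk g ^+ 2)%:E *
   \int[haar lam (grng y)]_(w in (rfib (grng y) `&` [set w | c w = c y] : set (borel G)))
     (N (phi w) ^+ 2)%:E)%E.
Proof.
move=> cg mp fin; have cg' : Cc R G (ext0 g) by exact/(Cc_ext0 Gh).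
have hu := grng_unit y; have hv := gsrc_unit y.
have mD := rfib_measurable Gh (grng y); have mE := level_measurable (grng y) (c y).
pose psi z : R[i]^o := if c z == 1%g then phi (gmul y z) else 0.
have cyE z : grng z = gsrc y -> (c (gmul y z) = c y) <-> (c z = 1%g).
  move=> zy; rewrite cocM//; split=> [h|->]; last by rewrite mulg1.
  by apply: (mulgI (c y)); rewrite h mulg1.
have my : cmeasurable (rfib (gsrc y)) (fun z => phi (gmul y z)).
  have m : measurable_fun (rfib (gsrc y) : set (borel G)) (gmul y : borel G -> borel G).
    by apply: cont_on_borel_map; [exact: rfib_measurable | exact: cont_on_ltrans].
  case: mp => m1 m2; split; [apply: (measurable_comp mD _ m1 m) | apply: (measurable_comp mD _ m2 m)];
    by move=> _ [z zy <-]; rewrite /rfib /= grng_mul.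
have mi : cmeasurable (rfib (gsrc y)) (fun z => (if c z == 1%g then 1 else 0 : R[i]^o)).
  have m1 : measurable_fun [set: borel G] (fun z : borel G => if c z == 1%g then 1 else 0 : R).
    have : measurable_fun [set: borel G] (\1_(Gone c) : borel G -> R).
      by apply: measurable_indic; exact: Gone_measurable.
    apply: eq_measurable_fun => z _; rewrite indicE; case: eqP => h.
      by rewrite mem_set.
    by rewrite memNset.
  split; first by apply: eq_measurable_fun (measurable_funTS m1) => z _; case: eqP.
  have : measurable_fun (fib (gsrc y)) (fun _ : borel G => 0 : R) by exact: measurable_cst.
  by apply: eq_measurable_fun => z _; case: eqP.
have mpsi : cmeasurable (rfib (gsrc y)) psi.
  apply: (@eq_cmeasurable _ _ (fun z => (if c z == 1%g then 1 else 0) * phi (gmul y z))).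
    by move=> z _; rewrite /psi; case: eqP; rewrite ?mul1r ?mul0r.
  by apply: cmeasurableM => //; exact: rfib_measurable.
have lpsi : lvl c 1%g psi by move=> z /eqP/negPf; rewrite /psi => ->.
have sq0 q z : (0 <= (N (q z : R[i]^o) ^+ 2)%:E)%E by rewrite lee_fin sqr_ge0.
have key (q : G -> R[i]^o) : cmeasurable (rfib (grng y)) q ->
  (\int[haar lam (grng y)]_(w in (rfib (grng y) `&` [set w | c w = c y] : set (borel G))) (N (q w) ^+ 2)%:E =
   \int[haar lam (gsrc y)]_(z in fib (gsrc y)) (if c z == 1%g then N (q (gmul y z)) ^+ 2 else 0)%:E)%E.
  move=> mq.
  pose F (w : borel G) : \bar R := (if c w == c y then N (q w) ^+ 2 else 0)%:E.
  have F0 w : (0 <= F w)%E by rewrite /F lee_fin; case: ifP => _ //; exact: sqr_ge0.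
  have FE : (\int[haar lam (grng y)]_(w in (rfib (grng y) `&` [set w | c w = c y] : set (borel G))) (N (q w) ^+ 2)%:E =
     \int[haar lam (grng y)]_(w in fib (grng y)) F w)%E.
    rewrite integral_mkcond [RHS]integral_mkcond; apply: eq_integral => w _; rewrite !patchE /F.
    case: ifPn; case: ifPn => //; rewrite ?inE.
    - by move=> _ [_ /= ->]; rewrite eqxx.
    - by move=> /negP h [h1 _]; exfalso; apply: h; rewrite inE.
    - by move=> wy /negP h; case: eqP => // e; exfalso; apply: h; rewrite inE; split.
  have mF : measurable_fun (fib (grng y)) F.
    have : measurable_fun (fib (grng y)) ((fun w : borel G => (N (q w) ^+ 2)%:E) \_ (rfib (grng y) `&` [set w | c w = c y])).
      apply/measurable_restrict => //; apply/measurable_EFinP.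
      by apply: measurable_funS (sq_measurable mq) => // w [].
    apply: eq_measurable_fun => w wy; rewrite patchE /F; rewrite inE in wy.
    by case: ifPn => [|/negP]; rewrite inE => h; case: eqP => // e; exfalso; [apply: e; case: h | apply: h; split].
  rewrite FE -(@ge0_integral_ltrans _ _ Gh Glc Gsc lam y F mF F0).
  apply: eq_integral => z; rewrite inE => zy; rewrite /F.
  by case: eqP => [/(cyE _ zy) ->|h]; [rewrite eqxx | case: eqP => // /(cyE _ zy)].
rewrite (key _ (slice_measurable Gh Glc Gsc lam hu cg' mp)) (key _ mp).
have E2 : (\int[haar lam (gsrc y)]_(z in fib (gsrc y)) (if c z == 1%g then N (phi (gmul y z)) ^+ 2 else 0)%:E =
    sqi lam (gsrc y) psi)%E.
  apply: eq_integral => z _; rewrite /psi; case: eqP => // _.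
  by rewrite (@nrm0 R R[i]^o) expr0n.
have fpsi : (sqi lam (gsrc y) psi < +oo)%E.
  apply: le_lt_trans fin; rewrite -(sqi_ltrans Gh Glc Gsc lam mp); apply: ge0_le_integral.
  - exact: rfib_measurable.
  - by move=> z _; exact: sq0.
  - by apply/measurable_EFinP; exact: sq_measurable.
  - by apply/measurable_EFinP; exact: sq_measurable.
  - move=> z _; rewrite lee_fin /psi; case: eqP => // _.
    by rewrite (@nrm0 R R[i]^o) expr0n sqr_ge0.
rewrite E2; apply: le_trans (slice_kernel_le hv cg mpsi lpsi fpsi).
(* For [z] on the unit level [ext0 g (z^-1 t)] vanishes unless [t] is on that level too, so
   replacing the translate of [phi] by [psi] does not change the integral. *)
have SE z : rfib (gsrc y) z -> c z = 1%g ->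
    slice lam (grng y) (ext0 g) phi (gmul y z) = slice lam (gsrc y) (ext0 g) psi z.
  move=> zy z1; rewrite (slice_ltrans Gh Glc Gsc lam cg' mp zy) /slice.
  apply: eq_cintegral => t ty; rewrite /psi; case: eqP => // t1.
  rewrite (@lvl_ext0 _ _ _ c g) ?mul0r// cocM ?gsrc_inv ?zy// coc_inv z1 invg1 mul1g//.
apply: ge0_le_integral.
- exact: rfib_measurable.
- by move=> z _; rewrite lee_fin; case: ifP => // _; exact: sqr_ge0.
- have ms := slice_measurable Gh Glc Gsc lam hv cg' mpsi.
  have ms' : cmeasurable (rfib (gsrc y)) (fun z => (if c z == 1%g then 1 else 0) * slice lam (gsrc y) (ext0 g) psi z).
    by apply: cmeasurableM => //; exact: rfib_measurable.
  apply/measurable_EFinP; apply: eq_measurable_fun (sq_measurable ms') => z; rewrite inE => zy.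
  case: eqP => z1; last by rewrite mul0r (@nrm0 R R[i]^o) expr0n.
  by rewrite mul1r SE.
- by apply/measurable_EFinP; apply: sq_measurable; exact: slice_measurable.
- move=> z zy; rewrite lee_fin; case: eqP => z1; last exact: sqr_ge0.
  by rewrite SE.
Qed.

(** The operator of [ext0 g] is block diagonal for the decomposition of the fibre into levels, so
    the squared norms of the blocks add up. *)
Lemma slice_le u g phi : gunits G u -> Cck g -> cmeasurable (rfib u) phi ->
  (sqi lam u phi < +oo)%E ->
  (sqi lam u (slice lam u (ext0 g) phi) <= (reduced_norm lamk g ^+ 2)%:E * sqi lam u phi)%E.
Proof.
move=> hu cg mp fin; have cg' : Cc R G (ext0 g) by exact/(Cc_ext0 Gh).
have [e he] := lvl_cover; have mD := rfib_measurable Gh u.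
(* The enumeration [e] may repeat values; each level is attached to its first index, which makes the
   sets [E n] disjoint. *)
pose E n : set (borel G) := [set w | [/\ rfib u w, c w = e n & forall m, (m < n)%N -> e m <> e n]].
have UE : \bigcup_n E n = rfib u.
  apply/seteqP; split => [w [n _ []//]|w wu].
  have ex : exists n, c w == e n by have [n h] := he w; exists n; exact/eqP.
  case: (ex_minnP ex) => n /eqP cn nmin.
  exists n => //; split => // m mn em; have := nmin m; rewrite em cn eqxx => /(_ isT).
  by rewrite leqNgt mn.
have tE : trivIset setT E.
  apply/trivIsetP => m n _ _; wlog mn : m n / (m < n)%N.
    by move=> H; rewrite neq_ltn => /orP[mn|nm]; [apply: H | rewrite setIC; apply: H] => //;
       rewrite neq_ltn ?mn ?nm ?orbT.
  move=> _; apply/seteqP; split => // w [[_ h1 _] [_ h2 h3]].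
  by apply: (h3 m mn); rewrite -h1 -h2.
have EE n : E n = set0 \/ E n = rfib u `&` [set w | c w = e n].
  have [[m mn em]|nm] := pselect (exists2 m, (m < n)%N & e m = e n).
    by left; apply/seteqP; split => // w [_ _ h]; exact: (h m mn em).
  right; apply/seteqP; split => w [] // wu we; split => // m mn em; apply: nm; exists m => //.
have mE n : measurable (E n).
  by have [->|->] := EE n; [exact: measurable0 | exact: level_measurable].
have split_ q : cmeasurable (rfib u) q -> (sqi lam u q =
   \sum_(0 <= n <oo) \int[haar lam u]_(w in E n) (N (q w) ^+ 2)%:E)%E.
  move=> mq; rewrite /sqi -{1}UE ge0_integral_bigcup//.
  - by rewrite UE; apply/measurable_EFinP; exact: sq_measurable.
  - by move=> w _; rewrite lee_fin sqr_ge0.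
rewrite (split_ _ (slice_measurable Gh Glc Gsc lam hu cg' mp)) (split_ _ mp).
have i0 q n : (0 <= \int[haar lam u]_(w in E n) (N (q w : R[i]^o) ^+ 2)%:E)%E.
  by apply: integral_ge0 => w _; rewrite lee_fin sqr_ge0.
rewrite -nneseriesZl; last by move=> n _; exact: i0.
apply: lee_nneseries => [n _ _|n _]; first exact: i0.
have [->|En] := EE n; first by rewrite !integral_set0 mule0.
have [[y]|ne] := pselect (E n !=set0); last first.
  by rewrite (_ : E n = set0) ?integral_set0 ?mule0//; apply/seteqP; split => // w Ew; apply: ne; exists w.
rewrite En => -[yu ye]; have := @slice_piece y g phi cg.
by rewrite yu ye; apply.
Qed.

Lemma reduced_norm_ext0 g : Cck g -> reduced_norm lam (ext0 g) <= reduced_norm lamk g.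
Proof.
move=> cg; have cg' : Cc R G (ext0 g) by exact/(Cc_ext0 Gh).
(* Nonnegativity is read off at the zero vector, whose image has a norm bounded by the reduced
   norm. *)
have rho0 : 0 <= reduced_norm lamk g.
  have hk : gunits (kernel c) (grng (point : kernel c)) by exact: grng_unit.
  apply: le_trans (_ : L2norm lamk (grng point) (conv lamk g (fun=> 0)) <= _); first exact: sqrtr_ge0.
  have z0 : L2int lamk (grng (point : kernel c)) (fun=> 0) = 0%E.
    rewrite /L2int /bintegral; have [m em] := lam_inv_measure lam (kv (grng point)).
    rewrite (lam_inv_kernel em); have [km <-] := kmeas_measure c m.
    by apply: integral0_eq => x _; rewrite (@nrm0 R R[i]^o) expr0n.
  apply: kernel_regular_le => //.
    by split; [exact: measurable_cst | exact: measurable_cst | rewrite z0].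
  by rewrite /L2norm z0 sqrtr0.
apply: ge_sup; first by exists (regular_norm lam (grng point) (ext0 g)), (grng point) => //; exact: grng_unit.
move=> _ [u hu <-]; rewrite /regular_norm; set S := (X in sup X).
have [[t St]|nS] := pselect (S !=set0); last first.
  by rewrite (_ : S = set0) ?sup0//; apply/seteqP; split => // t St; exfalso; apply: nS; exists t.
apply: ge_sup; first by exists t.
move=> _ [h [[h1 h2 h3] n1] <-].
have mh : cmeasurable (gfiber u) h by split.
have mp := iffLR (gfiber_inv_measurable Gh u h) mh.
rewrite /L2norm (L2int_conv Gh Glc Gsc lam hu cg' mh).
move: h3 n1; rewrite /L2norm (L2int_sqi Gh lam mh) => fin n1.
have B := slice_le hu cg mp fin.
have s0 := sqi_ge0 lam u (h \o @ginv G).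
have f1 : sqi lam u (h \o @ginv G) \is a fin_num by rewrite ge0_fin_numE.
have hs : fine (sqi lam u (h \o @ginv G)) <= 1 by rewrite -(@ler_sqrt R _ 1)// sqrtr1.
set T := sqi _ _ _ in B *; have T0 : (0 <= T)%E by exact: sqi_ge0.
have B2 : (T <= (reduced_norm lamk g ^+ 2)%:E)%E.
  by apply: le_trans B _; rewrite -(fineK f1) -EFinM lee_fin ler_piMr// sqr_ge0.
have T1 : T \is a fin_num by rewrite ge0_fin_numE//; apply: le_lt_trans B2 _; exact: ltry.
rewrite -[leRHS]ger0_norm// -sqrtr_sqr; apply: ler_wsqrtr.
by rewrite -lee_fin fineK.
Qed.
End ReducedKernel.

(** * Hilbert modules *)

Section DenseExtension.
Context (R : realType) (V : lmodType R[i]) (A : normedModType R[i]) (B : completeNormedModType R[i]).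
Variables (D : set V) (i : V -> A) (j : V -> B).
Hypotheses (Dc : forall k x y, D x -> D y -> D (k *: x + y))
  (il : linear_on D i) (jl : linear_on D j)
  (iD : closure (i @` D) = setT) (ij : forall v, D v -> nrm (j v) = nrm (i v)).

Lemma linear_onB (W : lmodType R[i]) (f : V -> W) : linear_on D f -> forall x y, D x -> D y -> f (x - y) = f x - f y.
Proof. by move=> fl x y Dx Dy; rewrite -scaleN1r addrC fl// addrC scaleN1r. Qed.

(** The closure of the graph of [i v |-> j v], a relation because different [v] may have the same
    image under [i]. [Q_norm] shows that it is single-valued. *)
Let Q x y := forall e : R, 0 < e -> exists v, [/\ D v, nrm (x - i v) < e & nrm (y - j v) < e].

Let Q_ex x : exists y, Q x y.
Proof.
have ap (n : nat) : exists v, D v /\ nrm (x - i v) < n.+1%:R^-1.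
  have : closure (i @` D) x by rewrite iD.
  have n0 : 0 < n.+1%:R^-1 :> R by rewrite invr_gt0.
  by move/closureP => /(_ _ n0)[_ [v Dv <-] h]; exists v.
have [v hv] := choice ap.
have conv0 e : 0 < e -> exists n0, forall n, (n0 <= n)%N -> nrm (x - i (v n)) < e.
  move=> e0; exists (Num.bound e^-1) => n nn; have [_ h] := hv n.
  apply: lt_le_trans h _; rewrite invf_ple ?posrE//.
  apply: ltW; apply: lt_le_trans (archi_boundP _) _; first by rewrite invr_ge0 ltW.
  by rewrite ler_nat (leq_trans nn).
have [e e0|y hy] := @nrm_complete R B (fun n => j (v n)).
  have e2 : 0 < e / 2 by rewrite divr_gt0.
  have [n0 H] := conv0 _ e2; exists n0 => p q /H hp /H hq.
  have [Dp _] := hv p; have [Dq _] := hv q.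
  rewrite -(linear_onB jl)// ij; last by rewrite addrC -scaleN1r; apply: Dc.
  rewrite (linear_onB il)//.
  have -> : i (v p) - i (v q) = (x - i (v q)) - (x - i (v p)) by lin.
  by apply: le_lt_trans (ler_nrmD _ _) _; rewrite nrmN; move: hp hq; lra.
exists y => e e0; have [n1 H1] := conv0 _ e0; have [n2 H2] := hy _ e0.
exists (v (n1 + n2)%N); have [Dv _] := hv (n1 + n2)%N; split => //.
  by apply: H1; exact: leq_addr.
by rewrite -nrmN opprB; apply: H2; exact: leq_addl.
Qed.

Let Q_lin k x y x' y' : Q x y -> Q x' y' -> Q (k *: x + x') (k *: y + y').
Proof.
move=> h h' e e0; pose K := nrm (k : R[i]^o) + 1.
have K0 : 0 < K by rewrite ltr_wpDl// nrm_ge0.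
have e1 : 0 < e / 2 / K by rewrite !divr_gt0.
have e2 : 0 < e / 2 by rewrite divr_gt0.
have [v [Dv h1 h2]] := h _ e1; have [v' [Dv' h1' h2']] := h' _ e2.
exists (k *: v + v'); split; first exact: Dc.
  rewrite il//; have -> : k *: x + x' - (k *: i v + i v') = k *: (x - i v) + (x' - i v') by lin.
  apply: le_lt_trans (ler_nrmD _ _) _; rewrite nrmZ.
  have : nrm (k : R[i]^o) * nrm (x - i v) <= K * nrm (x - i v).
    by rewrite ler_wpM2r ?nrm_ge0// /K lerDl.
  have : K * nrm (x - i v) < e / 2 by rewrite mulrC -ltr_pdivlMr.
  by move: h1'; lra.
rewrite jl//; have -> : k *: y + y' - (k *: j v + j v') = k *: (y - j v) + (y' - j v') by lin.
apply: le_lt_trans (ler_nrmD _ _) _; rewrite nrmZ.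
have : nrm (k : R[i]^o) * nrm (y - j v) <= K * nrm (y - j v).
  by rewrite ler_wpM2r ?nrm_ge0// /K lerDl.
have : K * nrm (y - j v) < e / 2 by rewrite mulrC -ltr_pdivlMr.
by move: h2'; lra.
Qed.

Let Q_norm x y : Q x y -> nrm y = nrm x.
Proof.
move=> h; apply/le_anti/andP; split; apply/ler_addgt0Pr => e e0; have e2 : 0 < e / 2 by rewrite divr_gt0.
- have [v [Dv h1 h2]] := h _ e2.
  have := ler_nrmD (y - j v) (j v); rewrite subrK ij//.
  have := ler_nrmD (i v - x) x; rewrite subrK -(nrmN (i v - x)) opprB.
  by move: h1 h2; lra.
- have [v [Dv h1 h2]] := h _ e2.
  have := ler_nrmD (x - i v) (i v); rewrite subrK -ij//.
  have := ler_nrmD (j v - y) y; rewrite subrK -(nrmN (j v - y)) opprB.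
  by move: h1 h2; lra.
Qed.

Lemma dense_extension : exists f : A -> B,
  [/\ linear f, forall v, D v -> f (i v) = j v & forall x, nrm (f x) = nrm x].
Proof.
have [f hf] := choice Q_ex; exists f.
have uniq x y : Q x y -> f x = y.
  move=> h; have := Q_lin (-1) h (hf x); rewrite scaleN1r addNr => /Q_norm.
  rewrite nrm0 => /nrm0_eq0 /eqP; rewrite addrC scaleN1r subr_eq0 => /eqP.
  by [].
split=> [k x y|v Dv|x].
- by apply: uniq; exact: Q_lin.
- by apply: uniq => e e0; exists v; rewrite !subrr !nrm0.
- exact: Q_norm.
Qed.
End DenseExtension.

Section Closure.
Context (R : realType).

Lemma closure_comb (V : normedModType R[i]) (S : set V) : (forall k x y, S x -> S y -> S (k *: x + y)) ->
  forall k x y, closure S x -> closure S y -> closure S (k *: x + y).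
Proof.
move=> Sc k x y /closureP hx /closureP hy; apply/closureP => e e0.
pose K := nrm (k : R[i]^o) + 1; have K0 : 0 < K by rewrite ltr_wpDl// nrm_ge0.
have e1 : 0 < e / 2 / K by rewrite !divr_gt0.
have e2 : 0 < e / 2 by rewrite divr_gt0.
have [a Sa xa] := hx _ e1; have [b Sb yb] := hy _ e2.
exists (k *: a + b); first exact: Sc.
have -> : k *: x + y - (k *: a + b) = k *: (x - a) + (y - b) by lin.
apply: le_lt_trans (ler_nrmD _ _) _; rewrite nrmZ.
have : nrm (k : R[i]^o) * nrm (x - a) <= K * nrm (x - a).
  by rewrite ler_wpM2r ?nrm_ge0// /K lerDl.
have : K * nrm (x - a) < e / 2 by rewrite mulrC -ltr_pdivlMr.
by move: yb; lra.
Qed.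

Lemma closure_mul (A : cstarAlgType R) (S1 S2 S3 : set A) :
  (forall x y, S1 x -> S2 y -> S3 (x ** y)) ->
  forall x y, closure S1 x -> closure S2 y -> closure S3 (x ** y).
Proof.
move=> SM x y /closureP hx /closureP hy; apply/closureP => e e0; have cn := cstar_cnorm A.
pose K := nrm x + nrm y + 1; have x0 := nrm_ge0 x; have y0 := nrm_ge0 y.
have K0 : 0 < K by rewrite /K; lra.
pose d := Num.min 1 (e / 2 / K).
have d0 : 0 < d by rewrite lt_min ltr01 /= !divr_gt0.
have d1 : d <= 1 by rewrite ge_min lexx.
have dK : d * K <= e / 2 by rewrite -ler_pdivlMr// ge_min lexx orbT.
have [a Sa xa] := hx _ d0; have [b Sb yb] := hy _ d0.
exists (a ** b); first exact: SM.
have -> : x ** y - a ** b = x ** (y - b) + (x - a) ** b by alg.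
apply: le_lt_trans (ler_nrmD _ _) _.
have h1 := cn_M cn x (y - b); have h2 := cn_M cn (x - a) b.
have nb : nrm b <= nrm y + 1.
  have := ler_nrmD (b - y) y; rewrite subrK -(nrmN (b - y)) opprB; move: yb d1; lra.
have h3 : nrm x * nrm (y - b) <= nrm x * d by rewrite ler_wpM2l// ltW.
have h4 : nrm (x - a) * nrm b <= d * (nrm y + 1).
  by apply: ler_pM => //; [exact: nrm_ge0 | exact: nrm_ge0 | exact: ltW].
have : nrm x * d + d * (nrm y + 1) = d * K by rewrite /K; ring.
by move: h1 h2 h3 h4 dK; lra.
Qed.

Lemma closure_star (A : cstarAlgType R) (S S' : set A) : (forall x, S x -> S' (sstar x)) ->
  forall x, closure S x -> closure S' (sstar x).
Proof.
move=> SS x /closureP hx; apply/closureP => e e0; have [a Sa xa] := hx e e0.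
exists (sstar a); first exact: SS.
by rewrite -sstarB (cn_V (cstar_cnorm A)).
Qed.
End Closure.

Section HilbertModules.
Context (R : realType) (M : cstarAlgType R) (B : set M) (E : hilbertModule B).
Implicit Types x y z : E.

Lemma nrm_hip x : nrm x ^+ 2 = nrm (hip x x).
Proof.
have := hip_norm x; rewrite !nrmE -rmorphXn => /(congr1 (@complex.Re R)).
by [].
Qed.

Lemma hipDl x y z : hip (x + y) z = hip x z + hip y z.
Proof. by have := hip_comb_l z x y 1; rewrite conjc1 !scale1r. Qed.

Lemma hipZl (k : R[i]) x z : hip (k *: x) z = conjc k *: hip x z.
Proof.
have := hip_comb_l z x 0 k; rewrite !addr0 => ->.
by rewrite -[hip 0 z]hip_star hip0r sstar0 addr0.
Qed.

Lemma hip_polar x y : (4%:R : R[i]) *: hip x y =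
  hip (x + y) (x + y) - hip (y - x) (y - x)
  - 'i *: hip (x + 'i *: y) (x + 'i *: y) + 'i *: hip (x - 'i *: y) (x - 'i *: y).
Proof.
have Nl (u v : E) : hip (- u) v = - hip u v by rewrite -scaleN1r hipZl rmorphN1 scaleN1r.
have Nr (u v : E) : hip u (- v) = - hip u v by rewrite -scaleN1r hipZr scaleN1r.
have ci : conjc 'i = - 'i :> R[i] by apply/eqP; rewrite eq_complex /= oppr0 !eqxx.
have i2 : 'i * 'i = -1 :> R[i] by rewrite -expr2 sqr_i.
rewrite !hipDl !hipDr !Nl !Nr !hipZl !hipZr ci !scalerDr !scalerN !scaleNr !scalerA.
have i3 : 'i * - 'i = 1 :> R[i] by rewrite mulrN i2 opprK.
rewrite ?scalerN ?scaleNr ?scalerA ?i2 ?i3.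
have -> : (4%:R : R[i]) *: hip x y = hip x y + hip x y + hip x y + hip x y.
  by rewrite scaler_nat !mulrSr mulr0n add0r.
lin.
Qed.

(** For vectors of the unit ball polarization expresses four times the inner product by four terms
    of norm at most four; scaling does the rest. The constant serves for continuity of the inner
    product. *)
Lemma hip_bound x y : nrm (hip x y) <= 4 * nrm x * nrm y.
Proof.
have one (u v : E) : nrm u <= 1 -> nrm v <= 1 -> nrm (hip u v) <= 4.
  move=> u1 v1.
  have sq (w : E) : nrm w <= 2 -> nrm (hip w w) <= 4.
    move=> w2; rewrite -nrm_hip; have -> : (4 : R) = 2 ^+ 2 by ring.
    by rewrite ler_pXn2r ?nnegrE ?nrm_ge0.
  have ni : nrm ('i *: v) <= 1 by rewrite nrmZ nrm_i mul1r.
  have h1 : nrm (hip (u + v) (u + v)) <= 4.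
    by apply: sq; apply: le_trans (ler_nrmD _ _) _; lra.
  have h2 : nrm (hip (v - u) (v - u)) <= 4.
    by apply: sq; apply: le_trans (ler_nrmD _ _) _; rewrite nrmN; lra.
  have h3 : nrm (hip (u + 'i *: v) (u + 'i *: v)) <= 4.
    by apply: sq; apply: le_trans (ler_nrmD _ _) _; move: ni; lra.
  have h4 : nrm (hip (u - 'i *: v) (u - 'i *: v)) <= 4.
    by apply: sq; apply: le_trans (ler_nrmD _ _) _; rewrite nrmN; move: ni; lra.
  have : nrm ((4%:R : R[i]) *: hip u v) <= 16.
    rewrite hip_polar; apply: le_trans (ler_nrmD _ _) _; rewrite nrmZ nrm_i mul1r.
    have := ler_nrmD (hip (u + v) (u + v) - hip (v - u) (v - u)) (- ('i *: hip (u + 'i *: v) (u + 'i *: v))).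
    rewrite nrmN nrmZ nrm_i mul1r.
    have := ler_nrmD (hip (u + v) (u + v)) (- hip (v - u) (v - u)); rewrite nrmN.
    move: h1 h2 h3 h4; lra.
  have -> : (4%:R : R[i]) = (4%:R : R)%:C by rewrite rmorph_nat.
  by rewrite nrmZ nrm_real ger0_norm//; lra.
have [x0|x0] := eqVneq (nrm x) 0.
  by rewrite (nrm0_eq0 x0) -hip_star hip0r sstar0 !nrm0 mulr0 mul0r.
have [y0|y0] := eqVneq (nrm y) 0.
  by rewrite (nrm0_eq0 y0) hip0r !nrm0 mulr0.
have xp : 0 < nrm x by rewrite lt_neqAle eq_sym x0 nrm_ge0.
have yp : 0 < nrm y by rewrite lt_neqAle eq_sym y0 nrm_ge0.
have := one ((nrm x)^-1%:C *: x) ((nrm y)^-1%:C *: y).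
rewrite !nrmZ !nrm_real !ger0_norm ?invr_ge0 ?nrm_ge0// !mulVf// lexx => /(_ isT isT).
rewrite hipZl hipZr conjc_real scalerA nrmZ -rmorphM nrm_real ger0_norm ?mulr_ge0 ?invr_ge0 ?nrm_ge0//.
rewrite -invfM mulrC ler_pdivrMr ?mulr_gt0//; by rewrite mulrA.
Qed.

Lemma adjop_action (A : cstarAlgType R) (f : A -> adjop E) : star_hom f ->
  star_action [set: A] (fun a x => aop (f a) x) (@hip R M B E) (@nrm R M) (@nrm R E).
Proof.
move=> [fl fm fs]; split.
- exact: nrm_ge0.
- exact: ler_nrmD.
- exact: nrmZ.
- exact: nrm_hip.
- exact: hipDl.
- exact: hipDr.
- by move=> k a b u _ _; rewrite fl.
- by move=> a u w _; have := adjop_linear (f a) 1 u w; rewrite !scale1r.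
- by move=> a b u _ _; rewrite fm.
- by move=> a u w _; rewrite fs; exact: adjop_starP.
Qed.

Lemma adjop_selfadj_bound (A : cstarAlgType R) (f : A -> adjop E) a x : star_hom f -> selfadj a ->
  nrm (aop (f a) x) <= nrm a * nrm x.
Proof.
move=> hf ha; have := selfadj_act (adjop_action hf) (@star_subalgebraT R A) (cstar_cnorm A).
by apply => //; exact: sclosedT.
Qed.

(** Self-adjoint elements act with norm at most their own; the factor two comes from the real and
    imaginary parts of [a]. *)
Lemma adjop_bound (A : cstarAlgType R) (f : A -> adjop E) a x : star_hom f ->
  nrm (aop (f a) x) <= 2 * nrm a * nrm x.
Proof.
move=> hf; have cn := cstar_cnorm A.
have i2 : 'i * 'i = -1 :> R[i] by rewrite -expr2 sqr_i.
have ci : conjc 'i = - 'i :> R[i] by apply/eqP; rewrite eq_complex /= oppr0 !eqxx.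
pose b := 2^-1%:C *: (a + sstar a); pose d := (2^-1%:C * 'i) *: (sstar a - a).
have e : a = b + 'i *: d.
  rewrite /b /d scalerA mulrCA i2 mulrN1 -[LHS]scale1r -(half2C R); lin.
have hb : selfadj b.
  by rewrite /selfadj /b sstarZ conjc_real sstarD sstarK addrC.
have hd : selfadj d.
  rewrite /selfadj /d sstarZ conjcM conjc_real ci sstarB sstarK mulrN scaleNr -scalerN.
  by rewrite opprB.
have nb : nrm b <= nrm a.
  rewrite /b nrmZ nrm_real ger0_norm ?invr_ge0//.
  by have := ler_nrmD a (sstar a); rewrite (cn_V cn); lra.
have nd : nrm d <= nrm a.
  rewrite /d nrmZ nrmM nrm_i mulr1 nrm_real ger0_norm ?invr_ge0//.
  by have := ler_nrmD (sstar a) (- a); rewrite nrmN (cn_V cn); lra.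
have [fl _ _] := hf.
have -> : aop (f a) x = aop (f b) x + 'i *: aop (f d) x.
  by rewrite {1}e addrC fl /= addrC.
apply: le_trans (ler_nrmD _ _) _; rewrite nrmZ nrm_i mul1r.
have h1 := adjop_selfadj_bound x hf hb; have h2 := adjop_selfadj_bound x hf hd.
have h3 : nrm b * nrm x <= nrm a * nrm x by rewrite ler_wpM2r ?nrm_ge0.
have h4 : nrm d * nrm x <= nrm a * nrm x by rewrite ler_wpM2r ?nrm_ge0.
by lra.
Qed.
End HilbertModules.

(** * Transport of operators along a unitary *)

Section ModuleIsomorphism.
Context (R : realType) (M1 M2 : cstarAlgType R) (B1 : set M1) (B2 : set M2)
  (E1 : hilbertModule B1) (E2 : hilbertModule B2).
Variables (U : E1 -> E2) (V : E2 -> E1) (rho : M1 -> M2).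
Hypotheses (UV : cancel V U) (VU : cancel U V) (rhoI : injective rho)
  (Ul : linear U) (UP : forall x y, hip (U x) (U y) = rho (hip x y)).

Lemma conj_adjoint (T S : E2 -> E2) : is_adjoint T S -> is_adjoint (V \o T \o U) (V \o S \o U).
Proof. by move=> h x y; apply: rhoI; rewrite -!UP /= !UV h. Qed.

Lemma conj_adjointable (T : adjop E2) : (V \o aop T \o U) \in adjointable (E := E1).
Proof.
have [S hS] := adjointableP T.
by apply/asboolP; exists (V \o S \o U); exact: conj_adjoint.
Qed.

Definition conjop (T : adjop E2) : adjop E1 := Adjop (conj_adjointable T).

Lemma V_linear : linear V.
Proof. by move=> k x y; apply: (can_inj VU); rewrite UV Ul !UV. Qed.

Lemma conjop_hom : star_hom conjop.
Proof.
split.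
- by move=> k T S; apply: aop_inj; apply/funext => x /=; rewrite V_linear.
- by move=> T S; apply: aop_inj; apply/funext => x /=; rewrite UV.
- move=> T; apply: aop_inj; apply: is_adjoint_inj (adjop_starP _).
  by apply: conj_adjoint; exact: adjop_starP.
Qed.

Lemma conjop_inj : injective conjop.
Proof.
move=> T S /(congr1 (@aop _ _ _ _)) /= e; apply: aop_inj; apply/funext => x.
have := congr1 (fun h => U (h (V x))) e; rewrite /= !UV.
by [].
Qed.

(** Conjugation by the unitary sends [Lambda a] to [L (phi a)] and is injective on operators;
    surjectivity of [phi] makes it onto the range of [L]. *)
Lemma ranges_isomorphic (A1 A2 : cstarAlgType R) (L : A1 -> adjop E1) (Lambda : A2 -> adjop E2)
  (phi : A2 -> A1) : (forall b, exists a, phi a = b) ->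
  (forall a x, aop (Lambda a) (U x) = U (aop (L (phi a)) x)) ->
  star_isomorphic (range Lambda) (range L).
Proof.
move=> phis H; have [cl cm cs] := conjop_hom.
have key a : conjop (Lambda a) = L (phi a).
  by apply: aop_inj; apply/funext => x /=; rewrite H VU.
exists conjop; split.
- split.
  + by move=> _ [a _ <-]; exists (phi a) => //; rewrite key.
  + by move=> T S _ _; exact: conjop_inj.
  + by move=> _ [b _ <-]; have [a <-] := phis b; exists (Lambda a); [exists a | exact: key].
- by move=> k T S _ _; exact: cl.
- by move=> T S _ _; exact: cm.
- by move=> T _; exact: cs.
Qed.
End ModuleIsomorphism.

(** * The bundle of a cocycle *)

Lemma dense_eq (R : realType) (A B : normedModType R[i]) (S : set A) (f g : A -> B) (K : R) :
  closure S = setT ->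
  (forall x x', nrm (f x - f x') <= K * nrm (x - x')) ->
  (forall x x', nrm (g x - g x') <= K * nrm (x - x')) ->
  (forall x, S x -> f x = g x) -> f =1 g.
Proof.
move=> dS hf hg e x; apply/eqP; rewrite -subr_eq0; apply/eqP/nrm0_eq0.
apply/le_anti; rewrite nrm_ge0 andbT; apply/ler_addgt0Pr => d d0; rewrite add0r.
pose K' := `|K| + 1; have K0 : 0 < K' by rewrite ltr_wpDl.
have d1 : 0 < d / 2 / K' by rewrite !divr_gt0.
have : closure S x by rewrite dS.
move/closureP => /(_ _ d1)[y Sy xy].
have -> : f x - g x = (f x - f y) - (g x - g y) by rewrite (e _ Sy); lin.
apply: le_trans (ler_nrmD _ _) _; rewrite nrmN.
have KK : K * nrm (x - y) <= K' * nrm (x - y).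
  by rewrite ler_wpM2r ?nrm_ge0// /K'; have := ler_norm K; lra.
have : K' * nrm (x - y) < d / 2 by rewrite mulrC -ltr_pdivlMr.
by have := hf x y; have := hg x y; move: KK; lra.
Qed.

Lemma linear_isometry_lip (R : realType) (A B : normedModType R[i]) (f : A -> B) : linear f ->
  (forall x, nrm (f x) = nrm x) -> forall x x', nrm (f x - f x') = nrm (x - x').
Proof.
move=> fl fi x x'; rewrite -fi; congr nrm.
by have h := fl (-1) x' x; rewrite !scaleN1r in h; rewrite [x - x']addrC h addrC.
Qed.

Lemma isometry_inverse (R : realType) (A B : completeNormedModType R[i]) (U : A -> B) : linear U ->
  (forall x, nrm (U x) = nrm x) -> closure (range U) = setT ->
  exists V : B -> A, cancel U V /\ cancel V U.
Proof.
move=> Ul Ui Ud.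
have [V [Vl VU Vi]] : exists V : B -> A,
    [/\ linear V, forall v, setT v -> V (U v) = v & forall x, nrm (V x) = nrm x].
  by apply: dense_extension => // k x y _ _; exact: Ul.
exists V; split; first by move=> x; exact: VU.
apply: (@dense_eq R B B (range U) (U \o V) id 1 Ud).
- move=> x x'; rewrite mul1r /= (linear_isometry_lip Ul Ui).
  by rewrite (linear_isometry_lip Vl Vi).
- by move=> x x'; rewrite mul1r.
- by move=> _ [a _ <-] /=; rewrite VU.
Qed.

Lemma fsum_seq (T : choiceType) (V : nmodType) (f : T -> V) (s : seq T) : uniq s ->
  (forall t, t \notin s -> f t = 0) -> \sum_(t \in [set: T]) f t = \sum_(t <- s) f t.
Proof.
move=> us h; rewrite (@fsbigE _ _ _ _ _ s)//; last by move=> t _; exact: h.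
by rewrite big_mkcond; apply: eq_bigr => t _; rewrite in_setT.
Qed.

Section Bundle.
Context (R : realType) (G : topGroupoidType).
Hypotheses (Gh : hausdorff_space G) (Glc : locally_compact [set: G])
  (Gsc : @second_countable G).
Variable lam : haarSystem R G.
Context (Gamma : groupType) (c : cocycle G Gamma) (NG : (G -> R[i]^o) -> R).
Variable CG : cstarCompletion (Cc R G) (conv lam) (@adj R G) NG.
Local Notation inc := (cc_inc CG).
Local Notation CcG := (Cc R G).
Local Notation Cck := (Cc R (kernel c)).
Local Notation F := (cocycle_bundle c CG).
Local Notation lamk := (kernel_haar lam c).
Local Notation lvl := (lvl c).
Implicit Types (a b f : G -> R[i]^o) (gamma beta : Gamma).

Lemma inc0 : inc 0 = 0.
Proof.
have := cc_linear CG (-1) (Cc0 R Gh) (Cc0 R Gh); rewrite scaler0 addr0 scaleN1r addNr.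
by [].
Qed.

Lemma incD a b : CcG a -> CcG b -> inc (a + b) = inc a + inc b.
Proof. by move=> ca cb; have := cc_linear CG 1 ca cb; rewrite !scale1r. Qed.

Lemma inc_sum (T : Type) (s : seq T) (f : T -> G -> R[i]^o) : (forall t, CcG (f t)) ->
  CcG (\sum_(t <- s) f t) /\ inc (\sum_(t <- s) f t) = \sum_(t <- s) inc (f t).
Proof.
move=> cf; elim: s => [|t s [h1 h2]]; first by rewrite !big_nil; split; [exact: Cc0 | exact: inc0].
by rewrite !big_cons; split; [exact: CcD | rewrite incD// h2].
Qed.

Lemma bundle_inc gamma a : CcG a -> lvl gamma a -> F gamma (inc a).
Proof. by move=> ca la; apply: subset_closure; exists a => //; split => //; exact/lvl_fsupp. Qed.

Lemma bundleP gamma x : F gamma x <-> forall e, 0 < e -> exists a, [/\ CcG a, lvl gamma a & nrm (x - inc a) < e].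
Proof.
split=> [/closureP h e e0|h].
  by have [_ [a [ca /lvl_fsupp la] <-] xa] := h e e0; exists a.
apply/closureP => e e0; have [a [ca la xa]] := h e e0.
by exists (inc a) => //; exists a => //; split => //; exact/lvl_fsupp.
Qed.

Lemma bundle_comb gamma k x y : F gamma x -> F gamma y -> F gamma (k *: x + y).
Proof.
apply: closure_comb => {}k _ _ [a [ca /lvl_fsupp la] <-] [b [cb /lvl_fsupp lb] <-].
exists (k *: a + b); last by rewrite (cc_linear CG).
split; first exact: Cc_comb.
by apply/lvl_fsupp => z cz; rewrite -[LHS]/(k * a z + b z) la// lb// mulr0 addr0.
Qed.

Lemma bundle0 gamma : F gamma 0.
Proof. by rewrite -inc0; apply: bundle_inc => //; exact: Cc0. Qed.

Lemma bundle_closed gamma : closed (F gamma).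
Proof. exact: closed_closure. Qed.

Lemma bundle_mul beta gamma x y : F beta x -> F gamma y -> F (beta * gamma)%g (x ** y).
Proof.
apply: closure_mul => _ _ [a [ca /lvl_fsupp la] <-] [b [cb /lvl_fsupp lb] <-].
exists (conv lam a b); last by rewrite (cc_mul CG).
by split; [exact: Cc_conv | apply/lvl_fsupp; exact: lvl_conv].
Qed.

Lemma bundle_star gamma x : F gamma x -> F gamma^-1%g (sstar x).
Proof.
apply: closure_star => _ [a [ca /lvl_fsupp la] <-].
exists (adj a); last by rewrite (cc_star CG).
by split; [exact: Cc_adj | apply/lvl_fsupp; exact: lvl_adj].
Qed.

(** A function of [C_c(G)] is the finite sum of its parts on the levels; the induction removes one
    level at a time from a list covering the support. *)
Lemma homogeneous_ind (P : (G -> R[i]^o) -> Prop) : P 0 ->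
  (forall a b, CcG a -> CcG b -> P a -> P b -> P (a + b)) ->
  (forall gamma a, CcG a -> lvl gamma a -> P a) -> forall a, CcG a -> P a.
Proof.
move=> P0 PD Ph a ca; have /finite_seqP[s hs] := finite_fibres Gh c ca.
have {hs} : forall gamma, gamma \notin s -> fibre_part c gamma a = 0.
  move=> gamma h; apply/eqP; apply: contrapT => /negP h'.
  have : [set` s] gamma by rewrite -hs.
  by move=> /= h''; rewrite h'' in h.
elim: s a ca => [|gamma s IH] a ca h.
  have -> : a = 0.
    by apply/funext => x; have := congr1 (fun f => f x) (h (c x) isT); rewrite /fibre_part eqxx.
  exact: P0.
pose a' := (-1) *: fibre_part c gamma a + a.
have cf := Cc_fibre Gh c gamma ca.
have ca' : CcG a' by exact: Cc_comb.
have -> : a = fibre_part c gamma a + a' by rewrite /a' scaleN1r addNKr.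
apply: PD => //; first by apply: Ph cf _; exact: lvl_fibre.
apply: IH => // beta bs; rewrite /a' fibre_comb.
have [->|bg] := eqVneq beta gamma.
  by rewrite (fibre_id (@lvl_fibre _ _ _ c gamma a)) scaleN1r addNr.
rewrite (h beta) ?inE ?negb_or ?bg// addr0 (fibre_ne (@lvl_fibre _ _ _ c gamma a)) ?scaler0//.
exact/eqP.
Qed.

Definition sec a : Gamma -> CG := fun gamma => inc (fibre_part c gamma a).

Lemma sec_finite a : CcG a -> finite_sections F (sec a).
Proof.
move=> ca; split.
  by move=> gamma; apply: bundle_inc; [exact: Cc_fibre | exact: lvl_fibre].
apply: sub_finite_set (finite_fibres Gh c ca) => gamma /=.
by apply: contraNneq; rewrite /sec => ->; rewrite inc0.
Qed.

Lemma sec_homogeneous gamma a : lvl gamma a -> sec a = section_delta gamma (inc a).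
Proof.
move=> la; apply/funext => beta; rewrite /sec /section_delta.
have [->|/eqP ne] := eqVneq beta gamma; first by rewrite fibre_id.
by rewrite (fibre_ne la) ?inc0.
Qed.

Lemma sec_comb k a b : CcG a -> CcG b -> sec (k *: a + b) = k *: sec a + sec b.
Proof.
move=> ca cb; apply/funext => gamma; rewrite -[RHS]/(k *: sec a gamma + sec b gamma) /sec.
by rewrite fibre_comb (cc_linear CG)//; exact: Cc_fibre.
Qed.

Lemma delta_comb gamma k (x y : CG) :
  section_delta gamma (k *: x + y) = k *: section_delta gamma x + section_delta gamma y.
Proof.
apply/funext => beta; rewrite -[RHS]/(k *: section_delta gamma x beta + section_delta gamma y beta).
by rewrite /section_delta; case: eqP => //; rewrite scaler0 addr0.
Qed.

Lemma delta_finite gamma x : F gamma x -> finite_sections F (section_delta gamma x).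
Proof.
move=> Fx; split.
  by move=> beta; rewrite /section_delta; case: eqP => [->//|_]; exact: bundle0.
apply: sub_finite_set (finite_set1 gamma) => beta /=.
by rewrite /section_delta; case: (beta =P gamma) => // _; rewrite eqxx.
Qed.

Lemma section_ip_inc a b : CcG a -> CcG b ->
  Cck (@Cc_ip R G lam Gamma c a b) /\ section_ip (sec a) (sec b) = inc (ext0 (@Cc_ip R G lam Gamma c a b)).
Proof.
move=> ca cb; have /finite_seqP[s0 hs0] := finite_fibres Gh c ca.
pose s := undup s0; have us : uniq s by exact: undup_uniq.
have hs gamma : gamma \notin s -> fibre_part c gamma a = 0.
  rewrite mem_undup => h; apply/eqP; apply: contrapT => /negP h'.
  have : [set` s0] gamma by rewrite -hs0.
  by move=> /= h''; rewrite h'' in h.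
pose f gamma := conv lam (adj (fibre_part c gamma a)) (fibre_part c gamma b).
have cf gamma : CcG (f gamma).
  by apply: Cc_conv => //; [apply: Cc_adj => //|]; exact: Cc_fibre.
have lf gamma : lvl 1%g (f gamma).
  rewrite -(mulVg gamma); apply: lvl_conv; last exact: lvl_fibre.
  by apply: lvl_adj; exact: lvl_fibre.
have adj0 : adj (0 : G -> R[i]^o) = 0 by apply/funext => x; rewrite /adj -[X in conjc X]/(0 : R[i]) rmorph0.
have f0 gamma : gamma \notin s -> f gamma = 0.
  move=> gs; rewrite /f (hs _ gs) adj0.
  have := conv_comb_l Gh lam (-1) (Cc0 R Gh) (Cc0 R Gh) (Cc_fibre Gh c gamma cb).
  by rewrite scaler0 addr0 scaleN1r addNr.
have E : ext0 (@Cc_ip R G lam Gamma c a b) = \sum_(gamma <- s) f gamma.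
  apply/funext => x; have -> : (\sum_(gamma <- s) f gamma) x = \sum_(gamma <- s) f gamma x.
    by elim: (s) => [|t r IH]; rewrite ?big_nil// !big_cons -IH.
  have [x1|x1] := pselect (c x = 1%g); last first.
    by rewrite ext0_out// big1// => gamma _; exact: lf.
  rewrite -{1}(kvalK x1) ext0_kval /Cc_ip kvalK//.
  by apply: fsum_seq => // gamma /f0 e; rewrite -[LHS]/(f gamma x) e.
have [h1 h2] := inc_sum s cf.
split; first by apply/(Cc_ext0 Gh); rewrite E.
rewrite E h2 /section_ip (fsum_seq us).
  by apply: eq_bigr => gamma _; rewrite /f (cc_mul CG) ?(cc_star CG)//; [exact: Cc_fibre|apply: Cc_adj => //; exact: Cc_fibre|exact: Cc_fibre].
by move=> gamma gs; rewrite /sec (hs _ gs) inc0 sstar0 smul0l.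
Qed.

Lemma section_ip_delta gamma (x : CG) :
  section_ip (section_delta gamma x) (section_delta gamma x) = sstar x ** x.
Proof.
rewrite /section_ip (@fsum_seq _ _ _ [:: gamma])//.
  by rewrite big_seq1 /section_delta eqxx.
by move=> beta; rewrite inE /section_delta => /negPf ->; rewrite sstar0 smul0l.
Qed.
End Bundle.

(** * The unitary from the cocycle module onto the sections *)

Section RangeIsomorphism.
Context (R : realType) (G : topGroupoidType).
Hypotheses (Gh : hausdorff_space G) (Glc : locally_compact [set: G])
  (Gsc : @second_countable G).
Variable lam : haarSystem R G.
Context (Gamma : groupType) (c : cocycle G Gamma).
Context (NG : (G -> R[i]^o) -> R) (Ne : (kernel c -> R[i]^o) -> R).
Variable CG : cstarCompletion (Cc R G) (conv lam) (@adj R G) NG.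
Variable CGe : cstarCompletion (Cc R (kernel c)) (conv (kernel_haar lam c)) (@adj R (kernel c)) Ne.
(** The comparison of norms is proved separately in the full and the reduced case; with it as a
    hypothesis the section covers both. *)
Hypothesis Nle : forall g, Cc R (kernel c) g -> NG (ext0 g) <= Ne g.
Variables (X : cocycleModule CGe) (L : CG -> adjop X) (HL : left_mult_hom L).
Variables (CF : fellCstar (cocycle_bundle c CG)) (E : ell2 (cocycle_bundle c CG))
  (Lambda : CF -> adjop E) (HLambda : regular_representation Lambda).
Local Notation inc := (cc_inc CG).
Local Notation ince := (cc_inc CGe).
Local Notation CcG := (Cc R G).
Local Notation Cck := (Cc R (kernel c)).
Local Notation F := (cocycle_bundle c CG).
Local Notation lamk := (kernel_haar lam c).
Local Notation lvl := (lvl c).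
Local Notation mX := (mc_inc X).
Local Notation mE := (mc_inc E).
Local Notation sec := (sec c CG).
Implicit Types (a b f : G -> R[i]^o) (g : kernel c -> R[i]^o) (gamma beta : Gamma).

Let Lh : star_hom L. Proof. by case: HL. Qed.
Let Lc a b : CcG a -> CcG b -> aop (L (inc a)) (mX b) = mX (conv lam a b).
Proof. by case: HL => _; apply. Qed.
Let cnG := cstar_cnorm CG.
Let cnE := cstar_cnorm CGe.

Lemma Cc_ip_ext0 g : Cck g -> @Cc_ip R G lam Gamma c (ext0 g) (ext0 g) = conv lamk (adj g) g.
Proof.
move=> cg; have cg' : CcG (ext0 g) by exact/(Cc_ext0 Gh).
apply/funext => k; rewrite /Cc_ip (@fsum_seq _ _ _ [:: 1%g])//.
  rewrite big_seq1 !fibre_id; try exact: lvl_ext0.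
  rewrite conv_kernel//; last by apply: Cck_adj.
  by rewrite ext0_adj.
move=> gamma; rewrite inE => /eqP ne; rewrite (fibre_ne (@lvl_ext0 R G Gamma c g) ne).
have := conv_comb_r Gh lam (-1) (Cc_adj Gh (Cc0 R Gh)) (Cc0 R Gh) (Cc0 R Gh).
by rewrite scaler0 addr0 scaleN1r addNr => ->.
Qed.

(** For [a = ext0 g] and [q = g^* g] let [a^* a] act on the vector [q] of the module. The bound for
    self-adjoint elements reads [|q|^2 <= |a|^2 |q|], and [|q| = |g|^2] gives the inequality
    opposite to [Nle]. *)
Lemma ince_norm g : Cck g -> nrm (ince g) = nrm (inc (ext0 g)).
Proof.
move=> cg; have cg' : CcG (ext0 g) by exact/(Cc_ext0 Gh).
apply/le_anti/andP; split; last by rewrite !cc_norm//; exact: Nle.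
pose q := conv lamk (adj g) g; pose a := ext0 g.
have ca : CcG (adj a) by exact: Cc_adj.
have cgs : Cck (adj g) by exact: Cck_adj.
have cq : Cck q by exact: Cck_conv.
have cq' : CcG (ext0 q) by exact/(Cc_ext0 Gh).
have qs : adj q = q.
  rewrite /q -[LHS]restr_ext0 ext0_adj ext0_conv// ext0_adj (adj_conv Gh Glc Gsc)// adjK.
  by rewrite -ext0_adj -ext0_conv// restr_ext0.
(* On functions supported in the kernel the module norm is the norm of [CGe]. *)
have mn h : Cck h -> nrm (mX (ext0 h)) = nrm (ince h).
  move=> ch; have ch' : CcG (ext0 h) by exact/(Cc_ext0 Gh).
  have e : nrm (mX (ext0 h)) ^+ 2 = nrm (ince h) ^+ 2.
    rewrite nrm_hip (mc_ip X ch' ch') Cc_ip_ext0// (cc_mul CGe) ?(cc_star CGe)//; last exact: Cck_adj.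
    exact: (cn_star cnE).
  by apply/eqP; rewrite -(@eqrXn2 _ 2) ?nrm_ge0//; exact/eqP.
have ea : inc (ext0 q) = sstar (inc a) ** inc a.
  by rewrite /q ext0_conv// ext0_adj (cc_mul CG)// (cc_star CG).
have key : nrm (ince (conv lamk q q)) <= nrm (inc a) ^+ 2 * nrm (ince q).
  have := adjop_selfadj_bound (mX (ext0 q)) Lh (selfadj_mulV (inc a)).
  rewrite -ea Lc// -ext0_conv// !mn//; last exact: Cck_conv.
  by rewrite ea (cn_star cnG).
have eq2 : nrm (ince (conv lamk q q)) = nrm (ince q) ^+ 2.
  by rewrite (cc_mul CGe)// -{1}qs (cc_star CGe)// (cn_star cnE).
have eq1 : nrm (ince q) = nrm (ince g) ^+ 2.
  by rewrite /q (cc_mul CGe)// (cc_star CGe)// (cn_star cnE).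
move: key; rewrite eq2 expr2 => key.
have [z|z] := eqVneq (nrm (ince q)) 0.
  have : nrm (ince g) ^+ 2 = 0 by rewrite -eq1.
  by move/eqP; rewrite sqrf_eq0 => /eqP ->; exact: nrm_ge0.
have zp : 0 < nrm (ince q) by rewrite lt_neqAle eq_sym z nrm_ge0.
move: key; rewrite ler_pM2r// eq1.
by rewrite ler_pXn2r ?nnegrE ?nrm_ge0.
Qed.

Let Cc0G : CcG 0 := Cc0 R Gh.

(** The modules [X] and [E] take inner products in different algebras; [rho] carries those of [X]
    into the algebra of [E]. *)
Lemma rho_exists : exists rho : CGe -> CG,
  [/\ linear rho, forall g, Cck g -> rho (ince g) = inc (ext0 g) & forall x, nrm (rho x) = nrm x].
Proof.
apply: (@dense_extension R _ CGe CG Cck ince (fun g => inc (ext0 g))).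
- by move=> k x y cx cy; apply: Cc_comb => //; exact: kernel_hausdorff.
- exact: cc_linear.
- move=> k x y cx cy; rewrite ext0_comb (cc_linear CG)//; exact/(Cc_ext0 Gh).
- exact: cc_dense.
- by move=> v cv; rewrite ince_norm.
Qed.

Lemma U_exists : exists U : X -> E,
  [/\ linear U, forall a, CcG a -> U (mX a) = mE (sec a) & forall x, nrm (U x) = nrm x].
Proof.
apply: (@dense_extension R _ X E CcG mX (fun a => mE (sec a))) => //.
- by move=> k x y; exact: Cc_comb.
- exact: mc_linear.
- move=> k a b ca cb; rewrite sec_comb// (mc_linear E)//; exact: sec_finite.
- exact: mc_dense.
- move=> a ca; have [h1 h2] := section_ip_inc Gh Glc Gsc c CG ca ca.
  have e : nrm (mE (sec a)) ^+ 2 = nrm (mX a) ^+ 2.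
    rewrite !nrm_hip (mc_ip E) ?(mc_ip X)//; try exact: sec_finite.
    by rewrite h2 -ince_norm.
  by apply/eqP; rewrite -(@eqrXn2 _ 2) ?nrm_ge0//; exact/eqP.
Qed.

Lemma nrm_delta gamma (x : CG) : F gamma x -> nrm (mE (section_delta gamma x)) = nrm x.
Proof.
move=> Fx; have hf := delta_finite Gh Fx.
have e : nrm (mE (section_delta gamma x)) ^+ 2 = nrm x ^+ 2.
  by rewrite nrm_hip (mc_ip E)// section_ip_delta (cn_star cnG).
by apply/eqP; rewrite -(@eqrXn2 _ 2) ?nrm_ge0//; exact/eqP.
Qed.

Lemma mE_deltaB gamma (x y : CG) : F gamma x -> F gamma y ->
  mE (section_delta gamma x) - mE (section_delta gamma y) = mE (section_delta gamma (x - y)).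
Proof.
move=> Fx Fy; have -> : x - y = (-1) *: y + x by lin.
rewrite delta_comb (mc_linear E); first by lin.
- exact: delta_finite.
- exact: delta_finite.
Qed.

Section Intertwining.
Variables (U : X -> E) (rho : CGe -> CG).
Hypotheses (Ul : linear U) (Uc : forall a, CcG a -> U (mX a) = mE (sec a))
  (Ui : forall x, nrm (U x) = nrm x).
Hypotheses (rl : linear rho) (rc : forall g, Cck g -> rho (ince g) = inc (ext0 g))
  (ri : forall x, nrm (rho x) = nrm x).

Let Ulip := linear_isometry_lip Ul Ui.
Let rlip := linear_isometry_lip rl ri.
Let UB x y : U (x - y) = U x - U y.
Proof. by have h := Ul (-1) y x; rewrite !scaleN1r in h; rewrite addrC h addrC. Qed.

Let hip_lip_l (M : cstarAlgType R) (B : set M) (H : hilbertModule B) (y x x' : H) :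
  nrm (hip x y - hip x' y) <= 4 * nrm y * nrm (x - x').
Proof.
have -> : hip x y - hip x' y = hip (x - x') y.
  have -> : x - x' = (-1) *: x' + x by lin.
  by rewrite hip_comb_l rmorphN1 scaleN1r addrC.
by rewrite mulrAC; exact: hip_bound.
Qed.

Let hip_lip_r (M : cstarAlgType R) (B : set M) (H : hilbertModule B) (x y y' : H) :
  nrm (hip x y - hip x y') <= 4 * nrm x * nrm (y - y').
Proof. by rewrite -hipBr; exact: hip_bound. Qed.

Lemma U_hip x y : hip (U x) (U y) = rho (hip x y).
Proof.
have h1 a b : CcG a -> CcG b -> hip (U (mX a)) (U (mX b)) = rho (hip (mX a) (mX b)).
  move=> ca cb; have [k1 k2] := section_ip_inc Gh Glc Gsc c CG ca cb.
  rewrite !Uc// (mc_ip X)// (mc_ip E) ?rc//; exact: sec_finite.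
have h2 b x' : CcG b -> hip (U x') (U (mX b)) = rho (hip x' (mX b)).
  move=> cb; move: x'; apply: (@dense_eq R X CG _ _ _ (4 * nrm (mX b)) (mc_dense X)).
  - by move=> u u'; apply: le_trans (hip_lip_l _ _ _) _; rewrite Ui Ulip.
  - by move=> u u'; rewrite rlip; exact: hip_lip_l.
  - by move=> _ [a ca <-]; exact: h1.
move: y; apply: (@dense_eq R X CG _ _ _ (4 * nrm x) (mc_dense X)).
- by move=> u u'; apply: le_trans (hip_lip_r _ _ _) _; rewrite Ui Ulip.
- by move=> u u'; rewrite rlip; exact: hip_lip_r.
- by move=> _ [b cb <-]; exact: h2.
Qed.

Lemma U_delta gamma a : CcG a -> lvl gamma a -> U (mX a) = mE (section_delta gamma (inc a)).
Proof. by move=> ca la; rewrite Uc// (sec_homogeneous Gh _ la). Qed.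

Let clU := closure (range U).

Let clU_comb k x y : clU x -> clU y -> clU (k *: x + y).
Proof.
by apply: closure_comb => {}k _ _ [a _ <-] [b _ <-]; exists (k *: a + b) => //; exact: Ul.
Qed.

Let clU_delta gamma x : F gamma x -> clU (mE (section_delta gamma x)).
Proof.
move=> Fx; apply/closureP => e e0; have [a [ca la xa]] := iffLR (bundleP _ _ _) Fx e e0.
exists (U (mX a)); first by exists (mX a).
have Fa : F gamma (inc a) := bundle_inc ca la.
rewrite (U_delta ca la) mE_deltaB// nrm_delta//.
have -> : x - inc a = (-1) *: inc a + x by lin.
exact: bundle_comb.
Qed.

Let clU_section (s : seq Gamma) : forall xi, finite_sections F xi ->
  (forall gamma, gamma \notin s -> xi gamma = 0) -> clU (mE xi).
Proof.
elim: s => [|gamma s IH] xi fxi hs.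
  have -> : xi = section_delta 1%g 0.
    by apply/funext => beta; rewrite hs// /section_delta; case: eqP.
  by apply: clU_delta; exact: bundle0.
pose xi' beta := if beta == gamma then 0 else xi beta.
have fxi' : finite_sections F xi'.
  case: fxi => h1 h2; split.
    by move=> beta; rewrite /xi'; case: eqP => // _; exact: bundle0.
  apply: sub_finite_set h2 => beta /=; rewrite /xi'.
  by case: (beta =P gamma) => // _; rewrite eqxx.
have Fg : F gamma (xi gamma) by case: fxi.
have -> : xi = 1 *: section_delta gamma (xi gamma) + xi'.
  rewrite scale1r; apply/funext => beta; rewrite -[RHS]/(section_delta gamma (xi gamma) beta + xi' beta).
  by rewrite /section_delta /xi'; case: eqP => [->|_]; rewrite ?addr0 ?add0r.
rewrite (mc_linear E)//; last exact: delta_finite.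
apply: clU_comb; first exact: clU_delta.
apply: IH => // beta bs; rewrite /xi'; case: eqP => // /eqP bg.
by apply: hs; rewrite inE negb_or bg.
Qed.

Lemma U_dense : closure (range U) = setT.
Proof.
apply/seteqP; split => // y _.
have : closure (mE @` finite_sections F) y by rewrite (mc_dense E).
have sub : mE @` finite_sections F `<=` clU.
  move=> _ [xi fxi <-]; have [_ /finite_seqP[s hs]] := fxi.
  apply: (clU_section (s := s)) => // gamma gs; apply/eqP; apply: contrapT => /negP h.
  have : [set` s] gamma by rewrite -hs.
  by move=> /= h'; rewrite h' in gs.
move=> /(closureS sub); have /closure_id <- // : closed clU by exact: closed_closure.
Qed.

Variable phi : CF -> CG.
Hypotheses (ph : star_hom phi) (pc : forall gamma x, F gamma x -> phi (fc_inc CF gamma x) = x).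

Let Lmh : star_hom Lambda. Proof. by case: HLambda. Qed.

Lemma intertwine_homogeneous beta gamma (x : CG) a : F beta x -> CcG a -> lvl gamma a ->
  aop (Lambda (fc_inc CF beta x)) (U (mX a)) = U (aop (L x) (mX a)).
Proof.
move=> Fx ca la; have Fa : F gamma (inc a) := bundle_inc ca la.
rewrite (U_delta ca la) (HLambda.2 _ _ _ _ Fx Fa).
apply/eqP; rewrite -subr_eq0; apply/eqP/nrm0_eq0/le_anti; rewrite nrm_ge0 andbT.
apply/ler_addgt0Pr => e e0; rewrite add0r.
(* Both sides are continuous in [x], with constants [|inc a|] and [2 |mX a|], and they agree at the
   approximant [inc f]. *)
pose K := nrm (inc a) + 2 * nrm (mX a) + 1.
have K0 : 0 < K by rewrite /K; have := nrm_ge0 (inc a); have := nrm_ge0 (mX a); lra.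
have e1 : 0 < e / K by rewrite divr_gt0.
have [f [cf lf xf]] := iffLR (bundleP _ _ _) Fx _ e1.
have Ff : F beta (inc f) := bundle_inc cf lf.
have E1 : U (aop (L (inc f)) (mX a)) = mE (section_delta (beta * gamma)%g (inc f ** inc a)).
  by rewrite Lc// (@U_delta (beta * gamma)%g) ?(cc_mul CG)//; [exact: Cc_conv | exact: lvl_conv].
have -> : mE (section_delta (beta * gamma)%g (x ** inc a)) - U (aop (L x) (mX a)) =
  (mE (section_delta (beta * gamma)%g (x ** inc a)) - mE (section_delta (beta * gamma)%g (inc f ** inc a)))
  - (U (aop (L x) (mX a)) - U (aop (L (inc f)) (mX a))) by rewrite E1; lin.
have Fm1 := bundle_mul Gh Glc Gsc Fx Fa; have Fm2 := bundle_mul Gh Glc Gsc Ff Fa.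
apply: le_trans (ler_nrmD _ _) _; rewrite nrmN mE_deltaB// nrm_delta; last first.
  have -> : x ** inc a - inc f ** inc a = (-1) *: (inc f ** inc a) + x ** inc a by lin.
  exact: bundle_comb.
rewrite -UB Ui -smulNl -smulDl.
have -> : aop (L x) (mX a) - aop (L (inc f)) (mX a) = aop (L (x - inc f)) (mX a).
  have [Ll _ _] := Lh; have -> : x - inc f = (-1) *: inc f + x by lin.
  by rewrite Ll /=; lin.
have h1 := cn_M cnG (x - inc f) (inc a).
have h2 := adjop_bound (x - inc f) (mX a) Lh.
have h3 : nrm (x - inc f) * K <= e by rewrite -ler_pdivlMr// ltW.
have h4 := nrm_ge0 (x - inc f); move: h3; rewrite /K; lra.
Qed.

Lemma intertwine_bundle beta (x : CG) y : F beta x ->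
  aop (Lambda (fc_inc CF beta x)) (U y) = U (aop (L x) y).
Proof.
move=> Fx.
have h a : CcG a -> aop (Lambda (fc_inc CF beta x)) (U (mX a)) = U (aop (L x) (mX a)).
  move: a; apply: (homogeneous_ind (c := c) Gh).
  - have -> : mX 0 = 0.
      by have := mc_linear X (-1) Cc0G Cc0G; rewrite scaler0 addr0 scaleN1r addNr.
    have U0 : U 0 = 0 by have := UB 0 0; rewrite !subrr.
    have A0 (M : cstarAlgType R) (B : set M) (H : hilbertModule B) (T : adjop H) : aop T 0 = 0.
      by have := adjop_linear T (-1) 0 0; rewrite scaler0 addr0 scaleN1r addNr.
    by rewrite A0 !U0 A0.
  - move=> a b ca cb ha hb.
    have -> : mX (a + b) = 1 *: mX a + mX b by rewrite -(mc_linear X)// scale1r.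
    by rewrite Ul !adjop_linear ha hb Ul.
  - by move=> gamma a ca la; exact: (intertwine_homogeneous Fx ca la).
pose K := 2 * nrm (fc_inc CF beta x) + 2 * nrm x.
have K1 : 0 <= 2 * nrm (fc_inc CF beta x) by rewrite mulr_ge0 ?nrm_ge0.
have K2 : 0 <= 2 * nrm x by rewrite mulr_ge0 ?nrm_ge0.
have lip (M : cstarAlgType R) (B : set M) (H : hilbertModule B) (T : adjop H) u u' :
    aop T u - aop T u' = aop T (u - u').
  by have h' := adjop_linear T (-1) u' u; rewrite !scaleN1r in h'; rewrite addrC -h' addrC.
move: y; apply: (@dense_eq R X E _ _ _ K (mc_dense X)).
- move=> u u'; rewrite lip -UB; apply: le_trans (adjop_bound _ _ Lmh) _.
  by rewrite Ui ler_wpM2r ?nrm_ge0// /K; lra.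
- move=> u u'; rewrite -UB lip Ui; apply: le_trans (adjop_bound _ _ Lh) _.
  by rewrite ler_wpM2r ?nrm_ge0// /K; lra.
- by move=> _ [a ca <-]; exact: h.
Qed.

(** The elements for which the identity holds form a closed star-subalgebra containing the fibres,
    hence everything. *)
Lemma intertwine (Us : forall z, exists y, U y = z) (T : CF) y :
  aop (Lambda T) (U y) = U (aop (L (phi T)) y).
Proof.
have [Ll Lm Ls] := Lh; have [ll lm ls] := Lmh; have [pl pm ps] := ph.
pose S : set CF := [set T | forall y, aop (Lambda T) (U y) = U (aop (L (phi T)) y)].
suff : S = setT.
  move=> ST; have h : S T by rewrite ST.
  exact: h.
apply: (fc_generated (f := CF)).
- split.
  + move=> z; rewrite (star_hom0 ph) (star_hom0 Lh) (star_hom0 Lmh) /=.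
    by have := UB 0 0; rewrite !subrr.
  + move=> k T1 T2 h1 h2 z; rewrite ll pl Ll /=.
    rewrite -[LHS]/(k *: aop (Lambda T1) (U z) + aop (Lambda T2) (U z)) h1 h2.
    by rewrite -Ul.
  + by move=> T1 T2 h1 h2 z; rewrite lm pm Lm /= h2 h1.
  (* Surjectivity of [U] allows testing against vectors [U w'] only, and the adjoint is moved onto
     them. *)
  + move=> T1 h1 z; apply: hip_eq => w; have [w' <-] := Us w.
    rewrite ls ps Ls -(adjop_starP (Lambda T1)) h1 !U_hip.
    by rewrite (adjop_starP (L (phi T1))).
- move=> T' /closureP cT' z; apply/eqP; rewrite -subr_eq0; apply/eqP/nrm0_eq0/le_anti.
  rewrite nrm_ge0 andbT; apply/ler_addgt0Pr => e e0; rewrite add0r.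
  pose K := 4 * nrm z + 1; have K0 : 0 < K by rewrite /K; have := nrm_ge0 z; lra.
  have e1 : 0 < e / K by rewrite divr_gt0.
  have [T1 ST1 dT] := cT' _ e1.
  have -> : aop (Lambda T') (U z) - U (aop (L (phi T')) z) =
     aop (Lambda (T' - T1)) (U z) - U (aop (L (phi (T' - T1))) z).
    rewrite (star_homB ph) (star_homB Lh) (star_homB Lmh).
    rewrite -[aop (_ - _) (U z)]/(aop (Lambda T') (U z) - aop (Lambda T1) (U z)).
    rewrite -[aop (_ - _) z]/(aop (L (phi T')) z - aop (L (phi T1)) z) UB ST1; lin.
  apply: le_trans (ler_nrmD _ _) _; rewrite nrmN Ui.
  have h1 := adjop_bound (T' - T1) (U z) Lmh; rewrite Ui in h1.
  have h2 := adjop_bound (phi (T' - T1)) z Lh.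
  have h3 := star_hom_contractive (cstar_cnorm CF) cnG ph (T' - T1).
  have h4 : nrm (phi (T' - T1)) * nrm z <= nrm (T' - T1) * nrm z by rewrite ler_wpM2r ?nrm_ge0.
  have h5 : nrm (T' - T1) * K <= e by rewrite -ler_pdivlMr// ltW.
  have h6 := nrm_ge0 (T' - T1); move: h5; rewrite /K; lra.
- by move=> gamma x Fx z; rewrite intertwine_bundle// pc.
Qed.
End Intertwining.

Lemma bundle_phi : exists phi : CF -> CG, star_hom phi /\
  forall gamma x, F gamma x -> phi (fc_inc CF gamma x) = x.
Proof.
have hr : fell_rep F (fun (_ : Gamma) (x : CG) => x) by split.
by have [phi h1 h2] := fc_universal CF hr; exists phi.
Qed.

Lemma phi_surjective (phi : CF -> CG) : star_hom phi ->
  (forall gamma x, F gamma x -> phi (fc_inc CF gamma x) = x) -> forall y, exists T, phi T = y.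
Proof.
move=> ph pc y; apply: (star_hom_closed_range (cstar_cnorm CF) cnG ph) => e e0.
have : closure (inc @` CcG) y by rewrite (cc_dense CG).
move=> /closureP/(_ e e0)[_ [a ca <-] ya].
suff [T hT] : exists T, phi T = inc a by exists T; rewrite hT.
move: a ca {ya}; apply: (homogeneous_ind (c := c) Gh).
- by exists 0; rewrite (star_hom0 ph) inc0.
- by move=> a b ca cb [T1 h1] [T2 h2]; exists (T1 + T2); rewrite (star_homD ph) h1 h2 (incD CG ca cb).
- move=> gamma a ca la; exists (fc_inc CF gamma (inc a)).
  by apply: pc; exact: bundle_inc.
Qed.

Theorem reduced_range_isomorphic : star_isomorphic (range Lambda) (range L).
Proof.
have [rho [rl rc ri]] := rho_exists; have [U [Ul Uc Ui]] := U_exists.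
have [V [VU UV]] := isometry_inverse Ul Ui (U_dense Ul Uc).
have [phi [ph pc]] := bundle_phi.
have rI : injective rho.
  move=> x y e; apply/eqP; rewrite -subr_eq0; apply/eqP/nrm0_eq0.
  by rewrite -(linear_isometry_lip rl ri) e subrr nrm0.
apply: (ranges_isomorphic UV VU rI Ul (U_hip Ul Uc Ui rl rc ri)) (phi_surjective ph pc) _.
move=> T x; apply: (intertwine Ul Uc Ui rl rc ri ph pc) => z.
by exists (V z).
Qed.
End RangeIsomorphism.

(** * Full norms *)

Section Weights.
Context (R : realType) (G : topGroupoidType).
Hypotheses (Gh : hausdorff_space G) (Glc : locally_compact [set: G])
  (Gsc : @second_countable G).
Variable lam : haarSystem R G.
Implicit Types (u x y : G) (a b h : G -> R[i]^o) (w p q : G -> R).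
Local Notation N k := (nrm (k : R[i]^o)).
Local Notation RI u f := (rint (haar lam u) setT f).
Local Notation CcG := (Cc R G).

(** Functions of the range and of the source act as left and right multipliers of the convolution
    algebra without belonging to it. *)
Definition lmul w a : G -> R[i]^o := fun x => (w (grng x))%:C * a x.
Definition rmul a w : G -> R[i]^o := fun x => (w (gsrc x))%:C * a x.

Lemma Cc_lmul w a : continuous w -> CcG a -> CcG (lmul w a).
Proof.
move=> cw ca; apply: (Cc_mulf Gh (p := fun x => (w (grng x))%:C)) => //.
apply: cont_on_setT; apply: cont_on_RC; apply: cont_onT => x.
by apply: continuous_comp; [exact: grng_continuous | exact: cw].
Qed.

Lemma Cc_rmul w a : continuous w -> CcG a -> CcG (rmul a w).
Proof.
move=> cw ca; apply: (Cc_mulf Gh (p := fun x => (w (gsrc x))%:C)) => //.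
apply: cont_on_setT; apply: cont_on_RC; apply: cont_onT => x.
by apply: continuous_comp; [exact: gsrc_continuous | exact: cw].
Qed.

Lemma adj_lmul w a : adj (lmul w a) = rmul (adj a) w.
Proof. by apply/funext => x; rewrite /adj /lmul /rmul grng_inv conjcM conjc_real. Qed.

Lemma adj_rmul w a : adj (rmul a w) = lmul w (adj a).
Proof. by apply/funext => x; rewrite /adj /lmul /rmul gsrc_inv conjcM conjc_real. Qed.

Lemma conv_lmul w a b : CcG a -> CcG b -> conv lam (lmul w a) b = lmul w (conv lam a b).
Proof.
move=> ca cb; apply/funext => x; have mD := rfib_measurable Gh (grng x).
rewrite /conv /lmul -(cintegralZ mD _ (conv_cintegrable Gh lam x ca cb)).
by apply: eq_cintegral => y /= yx; rewrite yx mulrA.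
Qed.

(** The weight passes from one factor to the other because the source of [y] is the range of
    [y^-1 x]. *)
Lemma conv_rmul w a b : conv lam (rmul a w) b = conv lam a (lmul w b).
Proof.
apply/funext => x; rewrite /conv /lmul /rmul; apply: (eq_cintegral (haar lam (grng x))) => y /= yx.
by rewrite grng_mul ?gsrc_inv// grng_inv mulrCA mulrA.
Qed.

Lemma lmul_comp w w' a : lmul w (lmul w' a) = lmul (fun x => w x * w' x) a.
Proof. by apply/funext => x; rewrite /lmul rmorphM mulrA. Qed.

Lemma lmul_add w w' a : lmul (fun x => w x + w' x) a = lmul w a + lmul w' a.
Proof.
by apply/funext => x; rewrite -[RHS]/(lmul w a x + lmul w' a x) /lmul rmorphD mulrDl.
Qed.

Lemma lmul_cst (t : R) a : lmul (fun=> t) a = t%:C *: a.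
Proof. by []. Qed.

Lemma eq_rint_rfib u (f g : G -> R) : gunits G u -> CcR f -> CcR g ->
  (forall x, grng x = u -> f x = g x) -> RI u f = RI u g.
Proof.
move=> hu cf cg e; rewrite -!(rint_rfib Gh Gsc lam hu)// /rint; congr fine.
by apply: eq_integral => x; rewrite inE => xu; rewrite e.
Qed.

Lemma rint_sum (T : Type) (s : seq T) (f : T -> G -> R) u : gunits G u -> (forall t, CcR (f t)) ->
  rintegrable (haar lam u) setT (fun x => \sum_(t <- s) f t x) /\
  \sum_(t <- s) RI u (f t) = RI u (fun x => \sum_(t <- s) f t x).
Proof.
move=> hu cf; elim: s => [|t s [IH1 IH2]].
  have e : (fun x : G => \sum_(t <- [::]) f t x) = fun=> 0 by apply/funext => x; rewrite big_nil.
  rewrite e big_nil; have i0 := CcR_rintegrable Gh lam hu (CcR0 R G).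
  split; first exact: i0.
  by rewrite /rint /bintegral (eq_integral (fun=> 0%E))// integral0.
have it := CcR_rintegrable Gh lam hu (cf t).
have -> : (fun x => \sum_(j <- t :: s) f j x) = (fun x => f t x + \sum_(j <- s) f j x).
  by apply/funext => x; rewrite big_cons.
by split; [exact: rintegrableD | rewrite big_cons IH2 rintD].
Qed.

(* Schur's test for [p^-1 a q^-1] with the weights [p] and [q]. *)
Lemma balanced_bound (CG : fullCstar lam) a p q (m M : R) : CcG a -> continuous p -> continuous q ->
  0 < m -> (forall x, m <= p x <= M) -> (forall x, m <= q x <= M) ->
  (forall u, gunits G u -> RI u (fun z => N (a z)) <= p u ^+ 2) ->
  (forall u, gunits G u -> RI u (fun z => N (adj a z)) <= q u ^+ 2) ->
  nrm (cc_inc CG (lmul (fun x => (p x)^-1) (rmul a (fun x => (q x)^-1)))) <= 1.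
Proof.
move=> ca cp cq m0 bp bq hp hq.
have inv_cont w : continuous w -> (forall x, m <= w x <= M) -> continuous (fun x => (w x)^-1).
  move=> cw bw x; apply: cvgV; last exact: cw.
  by have /andP[h _] := bw x; rewrite gt_eqF//; apply: lt_le_trans h.
(* One half of Schur's test, used for [a] and, with [p] and [q] exchanged, for [adj a]. The weight
   [q'] cancels its inverse, and [p'^-1] times the integral of [|a'|] is at most [p']. *)
have key p' q' a' : CcG a' -> continuous p' -> continuous q' ->
    (forall x, m <= p' x <= M) -> (forall x, m <= q' x <= M) ->
    (forall u, gunits G u -> RI u (fun z => N (a' z)) <= p' u ^+ 2) ->
    forall u, gunits G u ->
    RI u (fun z => N (lmul (fun x => (p' x)^-1) (rmul a' (fun x => (q' x)^-1)) z) * q' (gsrc z)) <= p' u.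
  move=> ca' cp' cq' bp' bq' hp' u hu.
  have pos x : 0 < p' x by have /andP[h _] := bp' x; exact: lt_le_trans h.
  have posq x : 0 < q' x by have /andP[h _] := bq' x; exact: lt_le_trans h.
  have ci := nrm_rintegrable Gh lam hu ca'.
  rewrite (@eq_rint_rfib u _ (fun z => (p' u)^-1 * N (a' z))) //.
  - rewrite (rintZ measurableT)// ler_pdivrMl//.
    by apply: le_trans (hp' u hu) _; rewrite expr2.
  - apply: CcR_source => //; apply: Cc_lmul; first exact: inv_cont.
    by apply: Cc_rmul => //; exact: inv_cont.
  - have := @CcR_mulf R G (fun=> (p' u)^-1) _ _ (Cc_nrm Gh ca').
    rewrite (_ : (fun x => _ * _) = fun z => (p' u)^-1 * N (a' z)); last by apply/funext => x; rewrite mulrC.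
    by apply; move=> x; exact: cvg_cst.
  - move=> x xu; rewrite /lmul /rmul !nrmM !nrm_real !ger0_norm ?invr_ge0 ?ltW// xu.
    by rewrite -!mulrA; congr (_ * _); rewrite mulrCA mulVf ?mulr1// gt_eqF.
have cb : CcG (lmul (fun x => (p x)^-1) (rmul a (fun x => (q x)^-1))).
  by apply: Cc_lmul; [exact: inv_cont | apply: Cc_rmul => //; exact: inv_cont].
apply: (@schur_bound R G Gh Glc Gsc lam CG _ p q m M cb cp cq m0 bp bq).
  by move=> u hu; exact: key.
move=> u hu; have -> : adj (lmul (fun x => (p x)^-1) (rmul a (fun x => (q x)^-1))) =
    lmul (fun x => (q x)^-1) (rmul (adj a) (fun x => (p x)^-1)).
  rewrite adj_lmul adj_rmul; apply/funext => x; rewrite /lmul /rmul; ring.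
by apply: key => //; exact: Cc_adj.
Qed.
End Weights.

Section HilbertInequality.
Context (R : realType) (H : hilbertSpace R).
Implicit Types x y : H.
Local Notation ip x y := (complex.Re (hs_ip x y : R[i])).

Lemma re_ipDr x y z : ip x (y + z) = ip x y + ip x z.
Proof. by have := hs_ip_linear x 1 y z; rewrite !scale1r => ->; case: (hs_ip x y) (hs_ip x z) => [? ?] [? ?]. Qed.

Lemma re_ipZr (t : R) x y : ip x (t%:C *: y) = t * ip x y.
Proof.
have h0 : hs_ip x 0 = 0.
  by have := hs_ip_linear x (-1) 0 0; rewrite scaler0 addr0 scaleN1r addNr.
have := hs_ip_linear x t%:C y 0; rewrite addr0 h0 addr0 => ->.
by case: (hs_ip x y) => a b; rewrite /= mul0r subr0.
Qed.

Lemma re_ipC x y : ip x y = ip y x.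
Proof. by rewrite -(hs_ip_conj y x); case: (hs_ip y x). Qed.

Lemma ip_nrm x : nrm x ^+ 2 = ip x x.
Proof.
by have := hs_ip_norm x; rewrite nrmE -rmorphXn => <-.
Qed.

(** The square of [t x - y] is nonnegative. The parameter [t] stays free until the inequalities have
    been summed over the fibres. *)
Lemma ip_am_gm (t : R) x y : 2 * t * ip x y <= t ^+ 2 * nrm x ^+ 2 + nrm y ^+ 2.
Proof.
have h : 0 <= ip (t%:C *: x + (-1)%:C *: y) (t%:C *: x + (-1)%:C *: y) by rewrite -ip_nrm sqr_ge0.
move: h; rewrite !re_ipDr !re_ipZr !(re_ipC (_ + _)) !re_ipDr !re_ipZr (re_ipC y x) -!ip_nrm => h.
rewrite -subr_ge0; apply: le_trans h _; rewrite le_eqVlt; apply/orP; left; apply/eqP; ring.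
Qed.
End HilbertInequality.

(** * The full C*-algebra of the bundle *)

Section FullBundle.
Context (R : realType) (G : topGroupoidType).
Hypotheses (Gh : hausdorff_space G) (Glc : locally_compact [set: G])
  (Gsc : @second_countable G).
Variable lam : haarSystem R G.
Context (Gamma : groupType) (c : cocycle G Gamma).
Variable CG : fullCstar lam.
Variable CB : fellCstar (cocycle_bundle c CG).
Local Notation inc := (cc_inc CG).
Local Notation CcG := (Cc R G).
Local Notation F := (cocycle_bundle c CG).
Local Notation lvl := (lvl c).
Local Notation fc := (fc_inc CB).
Local Notation N k := (nrm (k : R[i]^o)).
Local Notation RI u f := (rint (haar lam u) setT f).
Implicit Types (a b f h k : G -> R[i]^o) (gamma beta : Gamma) (w q : G -> R).

Let cnG := cstar_cnorm CG.
Let cnB := cstar_cnorm CB.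
Let fcl gamma : linear_on (F gamma) (fc gamma). Proof. by case: (fc_rep CB) => h _ _; exact: h. Qed.
Let fcM beta gamma x y : F beta x -> F gamma y -> fc (beta * gamma)%g (x ** y) = fc beta x ** fc gamma y.
Proof. by move=> Fx Fy; case: (fc_rep CB) => _ m _; rewrite m. Qed.
Let fcS gamma x : F gamma x -> fc gamma^-1%g (sstar x) = sstar (fc gamma x).
Proof. by move=> Fx; case: (fc_rep CB) => _ _ s; rewrite s. Qed.

Lemma fc0 gamma : fc gamma 0 = 0.
Proof.
have F0 := bundle0 Gh c (CG := CG) gamma.
by have := fcl (-1) F0 F0; rewrite scaler0 addr0 scaleN1r addNr.
Qed.

(** The unit fibre is a closed star-subalgebra on which [fc] is multiplicative, so [hom_contractive]
    applies. In the other fibres the C*-identity passes to [x^* x], which lies in the unit fibre. *)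
Lemma fc_contractive gamma x : F gamma x -> nrm (fc gamma x) <= nrm x.
Proof.
have one y : F 1%g y -> nrm (fc 1%g y) <= nrm y.
  apply: (hom_contractive cnG cnB (S := F 1%g)).
  - split.
    + exact: bundle0.
    + by move=> k a b; exact: bundle_comb.
    + by move=> a b Fa Fb; have := bundle_mul Gh Glc Gsc Fa Fb; rewrite mulg1.
    + by move=> a Fa; have := bundle_star Gh Fa; rewrite invg1.
  - move=> u l Fu ul; have /closure_id -> : closed (F 1%g) by exact: bundle_closed.
    apply/closureP => e e0; have [n0 H] := ul e e0; exists (u n0); first exact: Fu.
    by rewrite -nrmN opprB; exact: H.
  - exact: fcl.
  - by move=> a b Fa Fb; rewrite -fcM// mulg1.
  - by move=> a Fa; rewrite -fcS// invg1.
move=> Fx; have Fs := bundle_star Gh Fx.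
have e : nrm (fc gamma x) ^+ 2 <= nrm x ^+ 2.
  rewrite -(cn_star cnB) -fcS// -fcM// mulVg -(cn_star cnG); apply: one.
  by rewrite -(mulVg gamma); exact: bundle_mul.
by rewrite -(@ler_pXn2r _ 2) ?nnegrE ?nrm_ge0.
Qed.

Definition bundle_map a : CB := \sum_(gamma \in [set: Gamma]) fc gamma (inc (fibre_part c gamma a)).

Definition covers (s : seq Gamma) a := forall gamma, gamma \notin s -> fibre_part c gamma a = 0.

Lemma cover_exists a : CcG a -> exists2 s, uniq s & covers s a.
Proof.
move=> ca; have /finite_seqP[s0 hs0] := finite_fibres Gh c ca.
exists (undup s0); first exact: undup_uniq.
move=> gamma; rewrite mem_undup => h; apply/eqP; apply: contrapT => /negP h'.
have : [set` s0] gamma by rewrite -hs0.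
by move=> /= h''; rewrite h'' in h.
Qed.

Lemma bundle_map_seq s a : uniq s -> covers s a -> bundle_map a = \sum_(gamma <- s) fc gamma (inc (fibre_part c gamma a)).
Proof.
by move=> us cs; apply: fsum_seq => // gamma /cs ->; rewrite (inc0 Gh) fc0.
Qed.

Lemma bundle_map_lin (k : R[i]) a b : CcG a -> CcG b -> bundle_map (k *: a + b) = k *: bundle_map a + bundle_map b.
Proof.
move=> ca cb; have [s1 _ c1] := cover_exists ca; have [s2 _ c2] := cover_exists cb.
pose s := undup (s1 ++ s2); have us : uniq s by exact: undup_uniq.
have ca' : covers s a by move=> g; rewrite mem_undup mem_cat negb_or => /andP[/c1].
have cb' : covers s b by move=> g; rewrite mem_undup mem_cat negb_or => /andP[_ /c2].
have cc' : covers s (k *: a + b).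
  by move=> g gs; rewrite fibre_comb ca'// cb'// scaler0 addr0.
rewrite !(bundle_map_seq us)// scaler_sumr -big_split; apply: eq_bigr => g _.
rewrite fibre_comb (cc_linear CG) ?fcl//; try exact: Cc_fibre.
all: by apply: bundle_inc; [exact: Cc_fibre | exact: lvl_fibre].
Qed.

Lemma bundle_map_homogeneous gamma a : CcG a -> lvl gamma a -> bundle_map a = fc gamma (inc a).
Proof.
move=> ca la; rewrite (@bundle_map_seq [:: gamma])//; first by rewrite big_seq1 fibre_id.
by move=> beta; rewrite inE => /eqP ne; exact: fibre_ne la ne.
Qed.

Lemma bundle_map0 : bundle_map 0 = 0.
Proof. by have := bundle_map_lin (-1) (Cc0 R Gh) (Cc0 R Gh); rewrite scaler0 addr0 scaleN1r addNr. Qed.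

Lemma bundle_mapD a b : CcG a -> CcG b -> bundle_map (a + b) = bundle_map a + bundle_map b.
Proof. by move=> ca cb; have := bundle_map_lin 1 ca cb; rewrite !scale1r. Qed.

Lemma bundle_map_conv a b : CcG a -> CcG b -> bundle_map (conv lam a b) = bundle_map a ** bundle_map b.
Proof.
move=> ca cb; move: a ca; apply: (homogeneous_ind (c := c) Gh).
- have -> : conv lam 0 b = 0.
    have := conv_comb_l Gh lam (-1) (Cc0 R Gh) (Cc0 R Gh) cb.
    by rewrite scaler0 addr0 scaleN1r addNr.
  by rewrite bundle_map0 smul0l.
- move=> a a' ca ca' h h'.
  have -> : conv lam (a + a') b = conv lam a b + conv lam a' b.
    by have := conv_comb_l Gh lam 1 ca ca' cb; rewrite !scale1r.
  by rewrite !bundle_mapD//; [rewrite h h' smulDl | exact: Cc_conv | exact: Cc_conv].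
move=> beta a ca la; move: b cb; apply: (homogeneous_ind (c := c) Gh).
- have -> : conv lam a 0 = 0.
    have := conv_comb_r Gh lam (-1) ca (Cc0 R Gh) (Cc0 R Gh).
    by rewrite scaler0 addr0 scaleN1r addNr.
  by rewrite bundle_map0 smul0r.
- move=> b b' cb cb' h h'.
  have -> : conv lam a (b + b') = conv lam a b + conv lam a b'.
    by have := conv_comb_r Gh lam 1 ca cb cb'; rewrite !scale1r.
  by rewrite !bundle_mapD//; [rewrite h h' smulDr | exact: Cc_conv | exact: Cc_conv].
move=> gamma b cb lb.
rewrite (@bundle_map_homogeneous (beta * gamma)%g); [|exact: Cc_conv|exact: lvl_conv].
rewrite (bundle_map_homogeneous ca la) (bundle_map_homogeneous cb lb) (cc_mul CG)// fcM//; exact: bundle_inc.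
Qed.

Lemma bundle_map_adj a : CcG a -> bundle_map (adj a) = sstar (bundle_map a).
Proof.
move: a; apply: (homogeneous_ind (c := c) Gh).
- have -> : adj (0 : G -> R[i]^o) = 0.
    by apply/funext => x; rewrite /adj -[X in conjc X]/(0 : R[i]) rmorph0.
  by rewrite bundle_map0 sstar0.
- move=> a b ca cb ha hb; have -> : adj (a + b) = adj a + adj b.
    by apply/funext => x; rewrite -[RHS]/(adj a x + adj b x) /adj -[X in conjc X]/(a (ginv x) + b (ginv x)) conjcD.
  by rewrite !bundle_mapD//; [rewrite ha hb sstarD | exact: Cc_adj | exact: Cc_adj].
move=> gamma a ca la.
rewrite (@bundle_map_homogeneous gamma^-1%g); [|exact: Cc_adj|exact: lvl_adj].
by rewrite (bundle_map_homogeneous ca la) (cc_star CG)// fcS//; exact: bundle_inc.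
Qed.

(** Multiplication by the real weight [w] is self-adjoint, in a form that involves no operator for
    [w] itself. *)
Lemma bundle_map_lmul_star w a b : continuous w -> CcG a -> CcG b ->
  sstar (bundle_map (lmul w a)) ** bundle_map b = sstar (bundle_map a) ** bundle_map (lmul w b).
Proof.
move=> cw ca cb; have clw := Cc_lmul Gh cw ca; have clb := Cc_lmul Gh cw cb.
rewrite -!bundle_map_adj// -!bundle_map_conv//; try exact: Cc_adj.
by rewrite adj_lmul conv_rmul.
Qed.

Section Representation.
Context (H : hilbertSpace R) (pi : CB -> H -> H) (hpi : cstar_rep pi).
Variable xi : H.
Local Notation ip x y := (complex.Re (hs_ip x y : R[i])).
Local Notation v a := (pi (bundle_map a) xi).

Lemma ip_rep (x y : CB) (u z : H) : ip (pi x u) (pi y z) = ip u (pi (sstar x ** y) z).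
Proof. by rewrite (cr_adj hpi) (cr_mul hpi). Qed.

Lemma pi_0 u : pi 0 u = 0.
Proof. by have := cr_comb hpi (-1) 0 0 u; rewrite scaler0 addr0 scaleN1r addNr. Qed.

Lemma ip_lmul w a b : continuous w -> CcG a -> CcG b -> ip (v (lmul w a)) (v b) = ip (v a) (v (lmul w b)).
Proof. by move=> cw ca cb; rewrite !ip_rep bundle_map_lmul_star. Qed.

Lemma vD a b : CcG a -> CcG b -> v (a + b) = v a + v b.
Proof. by move=> ca cb; rewrite bundle_mapD//; have := cr_comb hpi 1 (bundle_map a) (bundle_map b) xi; rewrite !scale1r. Qed.

Lemma vZ (t : R) a : CcG a -> v (t%:C *: a) = t%:C *: v a.
Proof.
move=> ca; have := bundle_map_lin t%:C ca (Cc0 R Gh); rewrite addr0 bundle_map0 addr0 => ->.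
by have := cr_comb hpi t%:C (bundle_map a) 0 xi; rewrite addr0 pi_0 addr0.
Qed.

Lemma v0 : v 0 = 0.
Proof. by rewrite bundle_map0 pi_0. Qed.

Lemma continuous_sqrt w : continuous w -> continuous (fun x => Num.sqrt (w x)).
Proof. by move=> cw x; apply: continuous_comp; [exact: cw | exact: sqrt_continuous]. Qed.

Lemma v_sqrt w a : continuous w -> (forall x, 0 <= w x) -> CcG a ->
  nrm (v (lmul (fun x => Num.sqrt (w x)) a)) ^+ 2 = ip (v a) (v (lmul w a)).
Proof.
move=> cw w0 ca; have cs := continuous_sqrt cw.
rewrite ip_nrm ip_lmul//; last exact: Cc_lmul.
rewrite lmul_comp; congr (complex.Re (hs_ip _ (v (lmul _ a)))).
by apply/funext => x; rewrite -expr2 sqr_sqrtr.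
Qed.

Lemma continuous_sum (U : Type) (s : seq U) (w : U -> G -> R) : (forall t, continuous (w t)) ->
  continuous (fun x => \sum_(t <- s) w t x).
Proof.
move=> cw; elim: s => [|t s IH].
  by rewrite (_ : (fun x => _) = fun=> 0); [move=> x; exact: cvg_cst | apply/funext => x; rewrite big_nil].
rewrite (_ : (fun x => _) = fun x => w t x + \sum_(t <- s) w t x); last by apply/funext => x; rewrite big_cons.
by move=> x; apply: cvgD; [exact: cw | exact: IH].
Qed.

(* The difference of the two sides is the square for the weight [C - sum_t w_t]. *)
Lemma v_sum_le (U : Type) (s : seq U) (w : U -> G -> R) (C : R) a : (forall t, continuous (w t)) ->
  (forall t x, 0 <= w t x) -> (forall x, \sum_(t <- s) w t x <= C) -> CcG a ->
  \sum_(t <- s) nrm (v (lmul (fun x => Num.sqrt (w t x)) a)) ^+ 2 <= C * nrm (v a) ^+ 2.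
Proof.
move=> cw w0 sC ca.
have E : \sum_(t <- s) nrm (v (lmul (fun x => Num.sqrt (w t x)) a)) ^+ 2 =
    ip (v a) (v (lmul (fun x => \sum_(t <- s) w t x) a)).
  elim: s {sC} => [|t s IH].
    rewrite big_nil (_ : lmul _ a = 0).
      by rewrite v0; have := re_ipZr 0 (v a) 0; rewrite scaler0 mul0r => ->.
    by apply/funext => x; rewrite /lmul big_nil mul0r.
  rewrite big_cons IH v_sqrt// (_ : (fun x => \sum_(j <- t :: s) w j x) = fun x => w t x + \sum_(j <- s) w j x).
    by rewrite lmul_add vD ?re_ipDr//; apply: Cc_lmul => //; exact: continuous_sum.
  by apply/funext => x; rewrite big_cons.
have cs : continuous (fun x => \sum_(t <- s) w t x) by exact: continuous_sum.
have cr : continuous (fun x => C - \sum_(t <- s) w t x).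
  by move=> x; apply: cvgB; [exact: cvg_cst | exact: cs].
have r0 x : 0 <= C - \sum_(t <- s) w t x by rewrite subr_ge0.
have h := v_sqrt cr r0 ca.
have e : ip (v a) (v (lmul (fun x => \sum_(t <- s) w t x) a)) +
   ip (v a) (v (lmul (fun x => C - \sum_(t <- s) w t x) a)) = C * nrm (v a) ^+ 2.
  rewrite -re_ipDr -vD; [|exact: Cc_lmul|exact: Cc_lmul].
  rewrite -lmul_add (_ : (fun x => _ + _) = fun=> C); last by apply/funext => x; ring.
  by rewrite lmul_cst vZ// re_ipZr ip_nrm.
rewrite E -e lerDl -h; exact: sqr_ge0.
Qed.
End Representation.

Lemma fibre_sum_le s b x : uniq s -> \sum_(gamma <- s) N (fibre_part c gamma b x) <= N (b x).
Proof.
move=> us; have [cs|cs] := boolP (c x \in s); last first.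
  rewrite big1_seq ?nrm_ge0// => gamma /andP[_ gs]; rewrite /fibre_part.
  by case: eqP => [e|_]; [rewrite e gs in cs | rewrite (@nrm0 R R[i]^o)].
rewrite (bigD1_seq (c x))//= /fibre_part eqxx big1 ?addr0// => gamma.
by rewrite eq_sym => /negPf ->; rewrite (@nrm0 R R[i]^o).
Qed.

(** At each point at most one fibre part is nonzero. The map [d] is the identity for the sums of [P]
    and inversion for those of [Q], as [adj] evaluates a fibre part at the inverse. *)
Lemma fibre_mass_le s (d : G -> G) b b' u : uniq s -> gunits G u -> CcG b' ->
  (forall gamma, CcR (fun z => N (fibre_part c gamma b (d z)))) ->
  (forall z, N (b (d z)) = N (b' z)) ->
  \sum_(gamma <- s) RI u (fun z => N (fibre_part c gamma b (d z))) <= RI u (fun z => N (b' z)).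
Proof.
move=> us hu cb cf e.
have [i1 ->] := rint_sum Gh lam s hu cf.
apply: le_rint => //; first exact: nrm_rintegrable.
by move=> z _; rewrite -e; exact: fibre_sum_le.
Qed.

Lemma nrm_pi_sum (H : hilbertSpace R) (pi : CB -> H -> H) (hpi : cstar_rep pi) (U : Type) (s : seq U)
  (f : U -> CB) u : pi (\sum_(t <- s) f t) u = \sum_(t <- s) pi (f t) u.
Proof.
elim: s => [|t s IH]; first by rewrite !big_nil (pi_0 hpi).
by rewrite !big_cons -IH; have := cr_comb hpi 1 (f t) (\sum_(t <- s) f t) u; rewrite !scale1r.
Qed.

(** The factor [bundle_map h] is there because weights act on functions: they can be applied to
    [pi (bundle_map h) xi] but not to an arbitrary vector. The [eps] term pays for keeping the
    weights away from zero, and [.+1] keeps the constant positive when [s] is empty. *)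
Lemma bundle_map_mul_bound b h s (eps : R) : CcG b -> CcG h -> uniq s -> covers s b -> 0 < eps ->
  nrm (bundle_map b ** bundle_map h) <= (Inorm lam b + (size s).+1%:R * eps) * nrm (bundle_map h).
Proof.
move=> cb ch us cs e0; set C := Inorm lam b + _.
have I0 := Inorm_ge0 Gh Gsc lam cb.
have C0 : 0 < C by rewrite /C ltr_wpDl// mulr_gt0.
have [H [pi [hpi [xi xi1 hxi]]]] := gelfand_naimark (bundle_map b ** bundle_map h).
rewrite -hxi; pose bg gamma := fibre_part c gamma b.
have cbg gamma : CcG (bg gamma) by exact: Cc_fibre.
(* Adding [eps] bounds the weights from below, so that their inverse square roots are continuous and
   Schur's test applies. *)
pose P gamma x := RI (grng x) (fun z => N (bg gamma z)) + eps.
pose Q gamma x := RI (grng x) (fun z => N (adj (bg gamma) z)) + eps.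
have cP gamma : continuous (P gamma).
  have hc : continuous (fun x => RI (grng x) (fun z => N (bg gamma z))).
    by apply: cont_rint => //; exact: (Cc_nrm Gh (cbg gamma)).
  apply: cont_on_setT; apply: (@cont_onD _ R setT (fun x => RI (grng x) (fun z => N (bg gamma z))) (fun=> eps)).
    exact: (cont_onT hc).
  exact: cont_on_cst.
have cQ gamma : continuous (Q gamma).
  have hc : continuous (fun x => RI (grng x) (fun z => N (adj (bg gamma) z))).
    by apply: cont_rint => //; exact: (Cc_nrm Gh (Cc_adj Gh (cbg gamma))).
  apply: cont_on_setT; apply: (@cont_onD _ R setT (fun x => RI (grng x) (fun z => N (adj (bg gamma) z))) (fun=> eps)).
    exact: (cont_onT hc).
  exact: cont_on_cst.
have r0 f u : 0 <= RI u (fun z => N (f z)) by apply: rint_ge0 => z _; exact: nrm_ge0.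
have bP gamma x : eps <= P gamma x <= Inorm lam (bg gamma) + eps.
  rewrite /P lerDr r0 /= lerD2r.
  by have [] := Inorm_ge Gh Gsc lam (cbg gamma) (grng_unit x).
have bQ gamma x : eps <= Q gamma x <= Inorm lam (bg gamma) + eps.
  rewrite /Q lerDr r0 /= lerD2r.
  by have [] := Inorm_ge Gh Gsc lam (cbg gamma) (grng_unit x).
have P0 gamma x : 0 <= P gamma x by have /andP[hh _] := bP gamma x; exact: le_trans (ltW e0) hh.
have Q0 gamma x : 0 <= Q gamma x by have /andP[hh _] := bQ gamma x; exact: le_trans (ltW e0) hh.
pose p gamma x := Num.sqrt (P gamma x); pose q gamma x := Num.sqrt (Q gamma x).
have cp gamma : continuous (p gamma) by exact: continuous_sqrt.
have cq gamma : continuous (q gamma) by exact: continuous_sqrt.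
have se : 0 < Num.sqrt eps by rewrite sqrtr_gt0.
have sb t M : eps <= t <= M -> Num.sqrt eps <= Num.sqrt t <= Num.sqrt M.
  by move=> /andP[h1 h2]; rewrite !ler_wsqrtr.
pose b2 gamma := lmul (fun x => (p gamma x)^-1) (rmul (bg gamma) (fun x => (q gamma x)^-1)).
have inv_cont w : continuous w -> (forall x, 0 < w x) -> continuous (fun x => (w x)^-1).
  by move=> cw w0 x; apply: cvgV; [rewrite gt_eqF | exact: cw].
have p0 gamma x : 0 < p gamma x by have /andP[hh _] := sb _ _ (bP gamma x); exact: lt_le_trans hh.
have q0 gamma x : 0 < q gamma x by have /andP[hh _] := sb _ _ (bQ gamma x); exact: lt_le_trans hh.
have cb2 gamma : CcG (b2 gamma).
  by apply: (Cc_lmul Gh); [exact: inv_cont | apply: (Cc_rmul Gh) => //; exact: inv_cont].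
have n2 gamma : nrm (bundle_map (b2 gamma)) <= 1.
  have l2 : lvl gamma (b2 gamma).
    by move=> x cx; rewrite /b2 /lmul /rmul /bg (@lvl_fibre _ _ _ c gamma b x cx) !mulr0.
  rewrite (bundle_map_homogeneous (cb2 gamma) l2).
  apply: le_trans (fc_contractive (bundle_inc (cb2 gamma) l2)) _.
  apply: (balanced_bound Gh Glc Gsc CG (cbg gamma) (cp gamma) (cq gamma) se).
  - by move=> x; exact: sb (bP gamma x).
  - by move=> x; exact: sb (bQ gamma x).
  - by move=> u hu; rewrite sqr_sqrtr// /P hu lerDl ltW.
  - by move=> u hu; rewrite sqr_sqrtr// /Q hu lerDl ltW.
have bE gamma : bg gamma = lmul (p gamma) (rmul (b2 gamma) (q gamma)).
  apply/funext => x; rewrite /b2 /lmul /rmul.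
  have -> : (p gamma (grng x))%:C * ((q gamma (gsrc x))%:C *
      ((p gamma (grng x))^-1%:C * ((q gamma (gsrc x))^-1%:C * bg gamma x))) =
    (p gamma (grng x) * (p gamma (grng x))^-1)%:C * ((q gamma (gsrc x) * (q gamma (gsrc x))^-1)%:C * bg gamma x).
    by rewrite !rmorphM; ring.
  by rewrite !mulfV ?gt_eqF// !rmorph1 !mul1r.
have size_eps (w : Gamma -> R) : \sum_(gamma <- s) (w gamma + eps) <= \sum_(gamma <- s) w gamma + (size s).+1%:R * eps.
  rewrite big_split lerD2l /= big_const_seq count_predT iter_addr addr0 -[eps *+ _]mulr_natl ler_pM2r//.
  by rewrite ler_nat.
have sP x : \sum_(gamma <- s) P gamma x <= C.
  apply: le_trans (size_eps _) _; rewrite lerD2r.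
  apply: le_trans (_ : _ <= RI (grng x) (fun z => N (b z))) _.
    apply: (@fibre_mass_le s id b b) => //; first exact: grng_unit.
    by move=> gamma; exact: (Cc_nrm Gh (cbg gamma)).
  by have [] := Inorm_ge Gh Gsc lam cb (grng_unit x).
have sQ x : \sum_(gamma <- s) Q gamma x <= C.
  apply: le_trans (size_eps _) _; rewrite lerD2r.
  apply: le_trans (_ : _ <= RI (grng x) (fun z => N (adj b z))) _.
    have aE gamma : (fun z => N (adj (bg gamma) z)) = fun z => N (bg gamma (ginv z)).
      by apply/funext => z; rewrite /adj nrm_conj.
    under eq_bigr => gamma _ do rewrite aE.
    apply: (@fibre_mass_le s (@ginv G) b (adj b)) => //; first exact: grng_unit.
    - exact: Cc_adj.
    - by move=> gamma; rewrite -[fun z => _]aE; exact: (Cc_nrm Gh (Cc_adj Gh (cbg gamma))).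
    - by move=> z; rewrite /adj nrm_conj.
  by have [] := Inorm_ge Gh Gsc lam cb (grng_unit x).
pose k := conv lam b h; have ck : CcG k by exact: Cc_conv.
pose v a := pi (bundle_map a) xi.
have vk : v k = pi (bundle_map b ** bundle_map h) xi by rewrite /v bundle_map_conv.
have hK := v_sum_le hpi xi cP P0 sP ck.
have hH := v_sum_le hpi xi cQ Q0 sQ ch.
(* The weight [p] stays outside, ready to be moved to the other side of an inner product, while [q]
   passes through the convolution onto [h]. *)
have kE : v k = \sum_(gamma <- s) v (lmul (p gamma) (conv lam (b2 gamma) (lmul (q gamma) h))).
  rewrite vk (cr_mul hpi) (bundle_map_seq us cs) (nrm_pi_sum hpi); apply: eq_bigr => gamma _.
  rewrite -(bundle_map_homogeneous (cbg gamma) (@lvl_fibre _ _ _ c gamma b)) -(cr_mul hpi) -bundle_map_conv//.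
  rewrite {1}bE (conv_lmul Gh lam (p gamma) (Cc_rmul Gh (cq gamma) (cb2 gamma)) ch).
  by rewrite conv_rmul.
have cqh gamma : CcG (lmul (q gamma) h) by exact: Cc_lmul.
have term gamma (t : R) : 2 * t * complex.Re (hs_ip (v k) (v (lmul (p gamma) (conv lam (b2 gamma) (lmul (q gamma) h)))) : R[i]) <=
    t ^+ 2 * nrm (v (lmul (p gamma) k)) ^+ 2 + nrm (v (lmul (q gamma) h)) ^+ 2.
  rewrite -(ip_lmul hpi xi (cp gamma) ck); last exact: Cc_conv.
  apply: le_trans (ip_am_gm _ _ _) _; rewrite lerD2l.
  rewrite ler_pXn2r ?nnegrE ?nrm_ge0// bundle_map_conv// (cr_mul hpi).
  apply: le_trans (cr_bound hpi _ _) _; apply: ler_piMl; [exact: nrm_ge0 | exact: n2].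
(* After summation over the levels, [v_sum_le] bounds the two sums of squares through [sP] and
   [sQ]. *)
have key (t : R) : 2 * t * nrm (v k) ^+ 2 <= t ^+ 2 * (C * nrm (v k) ^+ 2) + C * nrm (v h) ^+ 2.
  have e1 : nrm (v k) ^+ 2 = \sum_(gamma <- s) complex.Re (hs_ip (v k) (v (lmul (p gamma) (conv lam (b2 gamma) (lmul (q gamma) h)))) : R[i]).
    rewrite ip_nrm {2}kE; elim: (s) => [|g r IH].
      by rewrite !big_nil; have := re_ipZr 0 (v k) 0; rewrite scaler0 mul0r.
    by rewrite !big_cons re_ipDr IH.
  rewrite {1}e1 mulr_sumr.
  apply: le_trans (_ : _ <= \sum_(gamma <- s) (t ^+ 2 * nrm (v (lmul (p gamma) k)) ^+ 2 + nrm (v (lmul (q gamma) h)) ^+ 2)) _.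
    by apply: ler_sum => gamma _; exact: term.
  rewrite big_split -mulr_sumr; apply: lerD; last exact: hH.
  by rewrite ler_wpM2l ?sqr_ge0//; exact: hK.
have vh : nrm (v h) <= nrm (bundle_map h).
  by apply: le_trans (cr_bound hpi _ _) _; rewrite ler_piMr ?nrm_ge0.
rewrite -vk; apply: le_trans (_ : C * nrm (v h) <= _); last by rewrite ler_pM2l.
rewrite -(@ler_pXn2r _ 2) ?nnegrE ?nrm_ge0 ?mulr_ge0 ?nrm_ge0 ?(ltW C0)// exprMn.
(* With this [t] the term in [v k] on the right is half of the left side, which leaves
   [|v k| <= C |v h|]. *)
have := key C^-1.
have -> : C^-1 ^+ 2 * (C * nrm (v k) ^+ 2) = C^-1 * nrm (v k) ^+ 2 by field; rewrite gt_eqF.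
rewrite -mulrA => hk.
have : C^-1 * nrm (v k) ^+ 2 <= C * nrm (v h) ^+ 2 by lra.
by rewrite ler_pdivrMl// mulrA -expr2.
Qed.

(** Taking [h = adj b] turns the product bound into [|T b|^2 <= (|b|_I + e) |T b|], with [e] divided
    by one more than the number of levels as the [eps] there. *)
Lemma bundle_map_le_Inorm b : CcG b -> nrm (bundle_map b) <= Inorm lam b.
Proof.
move=> cb; have [s us cs] := cover_exists cb.
apply/ler_addgt0Pr => e e0; pose eps := e / (size s).+1%:R.
have eps0 : 0 < eps by rewrite divr_gt0.
have := bundle_map_mul_bound cb (Cc_adj Gh cb) us cs eps0.
have -> : (size s).+1%:R * eps = e by rewrite /eps mulrC divfK.
rewrite bundle_map_adj// (cn_V cnB) -{1}(sstarK (bundle_map b)) (cn_star cnB) (cn_V cnB) expr2.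
have [->|z] := eqVneq (nrm (bundle_map b)) 0.
  by move=> _; rewrite addr_ge0 ?(ltW e0)//; exact: Inorm_ge0.
by rewrite ler_pM2r// lt_neqAle eq_sym z nrm_ge0.
Qed.

Lemma bundle_map_le_full a : CcG a -> nrm (bundle_map a) <= full_norm lam a.
Proof.
move=> ca; have [H [pi [hpi [xi xi1 hxi]]]] := gelfand_naimark (bundle_map a).
have bnd b x : CcG b -> nrm (pi (bundle_map b) x) <= Inorm lam b * nrm x.
  move=> cb; apply: le_trans (cr_bound hpi _ _) _.
  by rewrite ler_wpM2r ?nrm_ge0//; exact: bundle_map_le_Inorm.
have rep : star_rep lam (fun a => pi (bundle_map a)).
  split.
  - by move=> b cb; exact: (cr_linear hpi).
  - move=> b cb x; apply/cvgrPdist_lt => e e0.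
    have [r r0 re] := posC_real e0.
    pose K := Inorm lam b + 1; have K0 : 0 < K by rewrite /K ltr_wpDl//; exact: Inorm_ge0.
    have rK : 0 < r / K by rewrite divr_gt0.
    have : \forall y \near x, `|x - y| < (r / K)%:C.
      by apply: (@cvgr_dist_lt _ _ _ _ _ (fun y => y)) => //; rewrite ltcR.
    apply: filterS => y; rewrite re !nrm_lt => xy.
    have -> : pi (bundle_map b) x - pi (bundle_map b) y = pi (bundle_map b) (x - y).
      have h := cr_linear hpi (bundle_map b) (-1) y x; rewrite !scaleN1r in h.
      by rewrite addrC -h addrC.
    apply: le_lt_trans (bnd b _ cb) _.
    apply: le_lt_trans (_ : K * nrm (x - y) < _); first by rewrite ler_wpM2r ?nrm_ge0// /K lerDl.
    by rewrite mulrC -ltr_pdivlMr.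
  - by move=> k a1 a2 x c1 c2; rewrite bundle_map_lin// (cr_comb hpi).
  - by move=> a1 a2 x c1 c2; rewrite bundle_map_conv// (cr_mul hpi).
  - by move=> a1 x y c1; rewrite bundle_map_adj// (cr_adj hpi).
have op b : CcG b -> opnorm (pi (bundle_map b)) <= Inorm lam b.
  move=> cb; apply: opnorm_le; first exact: Inorm_ge0.
  by move=> x; exact: bnd.
apply: le_trans (_ : opnorm (pi (bundle_map a)) <= _).
  rewrite -hxi; apply: le_trans (le_opnorm xi _ _) _.
  - move=> k x; have h := cr_linear hpi (bundle_map a) k x 0.
    have z0 : pi (bundle_map a) 0 = 0.
      by have := cr_linear hpi (bundle_map a) (-1) 0 0; rewrite scaler0 addr0 scaleN1r addNr.
    by rewrite z0 !addr0 in h.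
  - by exists (Inorm lam a) => x; exact: bnd.
  - by rewrite ler_piMr//; exact: opnorm_ge0.
rewrite /full_norm; apply: ub_le_sup.
  by exists (Inorm lam a) => _ [H' [pi' [_ h' ->]]]; exact: h'.
by exists H, (fun a => pi (bundle_map a)).
Qed.

(** The closure of the image is a closed star-subalgebra, and it contains the fibres because [fc] is
    contractive on each of them. *)
Lemma bundle_map_dense : closure (bundle_map @` CcG) = setT.
Proof.
apply: (fc_generated (f := CB)).
- split.
  + by apply: subset_closure; exists 0; [exact: Cc0 | exact: bundle_map0].
  + apply: closure_comb => k _ _ [a ca <-] [b cb <-].
    by exists (k *: a + b); [exact: Cc_comb | exact: bundle_map_lin].
  + apply: closure_mul => _ _ [a ca <-] [b cb <-].
    by exists (conv lam a b); [exact: Cc_conv | exact: bundle_map_conv].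
  + apply: closure_star => _ [a ca <-].
    by exists (adj a); [exact: Cc_adj | exact: bundle_map_adj].
- exact: closed_closure.
- move=> gamma x Fx; apply/closureP => e e0.
  have [a [ca la xa]] := iffLR (bundleP _ _ _) Fx e e0.
  exists (bundle_map a); first by exists a.
  rewrite (bundle_map_homogeneous ca la); have Fa : F gamma (inc a) := bundle_inc ca la.
  have -> : fc gamma x - fc gamma (inc a) = fc gamma (x - inc a).
    have -> : x - inc a = (-1) *: inc a + x by lin.
    by rewrite fcl//; lin.
  apply: le_lt_trans (fc_contractive _) xa.
  have -> : x - inc a = (-1) *: inc a + x by lin.
  exact: bundle_comb.
Qed.

Theorem full_bundle_isomorphic : star_isomorphic [set: CB] [set: CG].
Proof.
have [phi [ph pc]] := bundle_phi CB.
have phT a : CcG a -> phi (bundle_map a) = inc a.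
  move: a; apply: (homogeneous_ind (c := c) Gh).
  - by rewrite bundle_map0 (star_hom0 ph) (inc0 Gh).
  - by move=> a b ca cb ha hb; rewrite bundle_mapD// (star_homD ph) ha hb (incD CG ca cb).
  - by move=> gamma a ca la; rewrite (bundle_map_homogeneous ca la) pc//; exact: bundle_inc.
have phc := star_hom_contractive cnB cnG ph.
have iso x : nrm x <= nrm (phi x).
  apply/ler_addgt0Pr => e e0; have e2 : 0 < e / 2 by rewrite divr_gt0.
  have : closure (bundle_map @` CcG) x by rewrite bundle_map_dense.
  move=> /closureP/(_ _ e2)[_ [a ca <-] xa].
  have h1 : nrm (bundle_map a) <= nrm (phi (bundle_map a)) by rewrite phT// (cc_norm CG ca); exact: bundle_map_le_full.
  have h2 := ler_nrmD (x - bundle_map a) (bundle_map a); rewrite subrK in h2.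
  have h3 := ler_nrmD (phi (bundle_map a - x)) (phi x).
  rewrite -(star_homD ph) subrK in h3.
  have h4 := phc (bundle_map a - x); rewrite -(nrmN (bundle_map a - x)) opprB in h4.
  by move: xa h1 h2 h3 h4; lra.
have [pl pm ps] := ph; exists phi; split.
- split.
  + by [].
  + move=> x y _ _ e; apply/eqP; rewrite -subr_eq0; apply/eqP/nrm0_eq0/le_anti.
    by rewrite nrm_ge0 andbT; apply: le_trans (iso _) _; rewrite (star_homB ph) e subrr nrm0.
  + by move=> y _; have [x hx] := phi_surjective Gh ph pc y; exists x.
- by move=> k x y _ _; exact: pl.
- by move=> x y _ _; exact: pm.
- by move=> x _; exact: ps.
Qed.
End FullBundle.

Theorem proposition3p6 (R : realType) (G : topGroupoidType)
  (G_hausdorff : hausdorff_space G)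
  (G_locally_compact : locally_compact [set: G])
  (G_second_countable : @second_countable G)
  (lam : haarSystem R G)
  (Gamma : groupType) (c : cocycle G Gamma)
  (CG : fullCstar lam) (CrG : reducedCstar lam)
  (CGe : fullCstar (kernel_haar lam c))
  (CrGe : reducedCstar (kernel_haar lam c))
  (X : cocycleModule CGe) (Y : cocycleModule CrGe)
  (L : CG -> adjop X) (HL : left_mult_hom L)
  (Lt : CrG -> adjop Y) (HLt : left_mult_hom Lt)
  (CA : fellCstar (cocycle_bundle c CrG)) (l2A : ell2 (cocycle_bundle c CrG))
  (LambdaA : CA -> adjop l2A) (HLambdaA : regular_representation LambdaA)
  (CB : fellCstar (cocycle_bundle c CG)) (l2B : ell2 (cocycle_bundle c CG))
  (LambdaB : CB -> adjop l2B) (HLambdaB : regular_representation LambdaB) :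
  [/\ star_isomorphic (range LambdaA) (range Lt),
      star_isomorphic (range LambdaB) (range L) &
      star_isomorphic [set: CB] [set: CG]].
Proof.
split.
- apply: (reduced_range_isomorphic G_hausdorff G_locally_compact G_second_countable _ HLt HLambdaA).
  by move=> g cg; exact: reduced_norm_ext0.
- apply: (reduced_range_isomorphic G_hausdorff G_locally_compact G_second_countable _ HL HLambdaB).
  by move=> g cg; exact: full_norm_ext0.
- exact: full_bundle_isomorphic.
Qed.
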